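(* Let $m\ge2$ and let $G(\Omega)=\dfrac{T(\Omega)\Lambda(\Omega)}{P(\Omega)^{\frac{m}{m-1}}}$. Let $\gamma\in(0,1)$. There exist $\delta>0$ and a positive constant $C=C(m,\delta)$ such that for every $B_h\in S_{\delta,\gamma}$ with $h\not\equiv 0$, $$G(B_1)-G(B_h)>C\,\|h\|_{H^1(\partial B_1)}^2 .$$
   Context: $B_1$ is the unit ball of $\mathbb{R}^m$ centred at the origin. For $h\in C^0(\partial B_1)$ with $\|h\|_{L^\infty(\partial B_1)}<\frac12$, $B_h$ is the open set (star-shaped with respect to the origin) with boundary $\partial B_h=\{(1+h(y))y:\ y\in\partial B_1\}$. For $\delta,\gamma>0$, the class of nearly spherical sets is $$S_{\delta,\gamma}=\Big\{B_h:\ h\in C^{2,\gamma}(\partial B_1),\ \|h\|_{L^\infty(\partial B_1)}<\tfrac12,\ \int_{\partial B_1}h\,d\mathcal{H}^{m-1}=0,\ \int_{\partial B_1}h\,x\,d\mathcal{H}^{m-1}=0,\ \|h\|_{C^{2,\gamma}}\le\delta\Big\}.$$ $P(\Omega)$ is the (De Giorgi) perimeter of $\Omega$. The torsional rigidity is $T(\Omega)=\max_{\varphi\in H_0^1(\Omega)\setminus\{0\}}\frac{(\int_\Omega\varphi\,dx)^2}{\int_\Omega|\nabla\varphi|^2dx}$. The first Dirichlet eigenvalue is $\Lambda(\Omega)=\min_{\varphi\in H_0^1(\Omega)\setminus\{0\}}\frac{\int_\Omega|\nabla\varphi|^2dx}{\int_\Omega\varphi^2dx}$. *)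

(* Defs.v *)
From HB Require Import structures.
From mathcomp Require Import all_boot all_order all_algebra.
From mathcomp Require Import all_classical all_reals all_analysis.

Set Implicit Arguments.
Unset Strict Implicit.
Unset Printing Implicit Defensive.

Import Order.TTheory GRing.Theory Num.Theory.
Import numFieldNormedType.Exports.

Local Open Scope classical_set_scope.
Local Open Scope ring_scope.

(* R^n carries the sigma-algebra generated by its coordinate functions, that
   is, the Borel sigma-algebra. *)
Section measurable_rV.
Context {R : realType} {n : nat}.

Let coord (i : 'I_n) (x : 'rV[R]_n) : R := x 0 i.

Let rV_set0 : g_sigma_preimage coord set0.
Proof. exact: sigma_algebra0. Qed.

Let rV_setC A : g_sigma_preimage coord A -> g_sigma_preimage coord (~` A).
Proof. exact: sigma_algebraC. Qed.

Let rV_bigcup (F : _^nat) : (forall i, g_sigma_preimage coord (F i)) ->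
  g_sigma_preimage coord (\bigcup_i (F i)).
Proof. exact: sigma_algebra_bigcup. Qed.

HB.instance Definition _ := @isMeasurable.Build default_measure_display
  'rV[R]_n (g_sigma_preimage coord) rV_set0 rV_setC rV_bigcup.

Lemma measurable_coord (i : 'I_n) :
  measurable_fun [set: 'rV[R]_n] (fun x : 'rV[R]_n => x 0 i).
Proof.
move=> _ Y mY; rewrite setTI; apply: sub_sigma_algebra => /=.
rewrite -bigcup_seq/=; exists i => /=; first by rewrite mem_index_enum.
by exists Y => //; rewrite setTI.
Qed.

Lemma measurable_fun_rV d (T : measurableType d) (f : T -> 'rV[R]_n) :
  (forall i, measurable_fun setT (fun t => f t 0 i)) -> measurable_fun setT f.
Proof.
move=> mf; apply: (@measurability _ _ _ _ _ f _ erefl) => _ [A + <-].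
rewrite -bigcup_seq => -[i _ [Y mY <-]].
have := mf i measurableT Y mY; rewrite !setTI.
exact.
Qed.

End measurable_rV.

Section lebesgue_rV.
Context {R : realType}.

Definition rV_cons n (p : R * 'rV[R]_n) : 'rV[R]_n.+1 :=
  \row_(i < n.+1) if unlift ord0 i is Some j then p.2 0 j else p.1.

Lemma measurable_rV_cons n : measurable_fun setT (@rV_cons n).
Proof.
apply: measurable_fun_rV => i; rewrite /rV_cons.
under eq_fun do rewrite mxE.
case: (unlift ord0 i) => [j|]; last exact: measurable_fst.
apply: (@measurableT_comp _ _ _ _ _ _ (fun x : 'rV[R]_n => x 0 j)) => //.
exact: measurable_coord.
Qed.

Definition rV_uncons n (x : 'rV[R]_n.+1) : R * 'rV[R]_n :=
  (x 0 ord0, \row_(j < n) x 0 (lift ord0 j)).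

Lemma measurable_rV_uncons n : measurable_fun setT (@rV_uncons n).
Proof.
apply: measurable_fun_pair; first exact: measurable_coord.
apply: measurable_fun_rV => j; under eq_fun do rewrite mxE.
exact: measurable_coord.
Qed.

Lemma rV_consK n : cancel (@rV_cons n) (@rV_uncons n).
Proof.
case=> a v; rewrite /rV_uncons /rV_cons mxE unlift_none/=; congr pair.
by apply/rowP => j; rewrite !mxE liftK.
Qed.

Section step.
Local Open Scope ereal_scope.
Variables (n : nat) (mu : {sigma_finite_measure set 'rV[R]_n -> \bar R}).

Definition lebesgue_rV_step : set 'rV[R]_n.+1 -> \bar R :=
  pushforward (lebesgue_measure \x mu) (@rV_cons n).

Let measure_step : {measure set 'rV[R]_n.+1 -> \bar R} :=
  measure_function_pushforward__canonical__measure_function_Measure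
    (lebesgue_measure \x mu) (@measurable_rV_cons n).

HB.instance Definition _ := Measure.copy lebesgue_rV_step measure_step.

Let step_sigma_finite : sigma_finite setT lebesgue_rV_step.
Proof.
have /sigma_finiteP[F [TF ndF Foo]] := sigma_finiteT (@lebesgue_measure R).
have /sigma_finiteP[G [TG ndG Goo]] := sigma_finiteT mu.
exists (fun k => @rV_uncons n @^-1` (F k `*` G k)).
  rewrite -preimage_bigcup (_ : \bigcup_k _ = setT) ?preimage_setT//.
  rewrite -setXTT TF TG predeqE => -[x y]; split.
    by move=> [k _ [/= Fkx Gky]]; split; exists k.
  move=> [/= [i _ Fix] [j _ Gjy]]; exists (maxn i j) => //; split.
    by move: x Fix; exact/subsetPset/ndF/leq_maxl.
  by move: y Gjy; exact/subsetPset/ndG/leq_maxr.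
move=> k; have [mF Fy] := Foo k; have [mG Gy] := Goo k; split.
  by rewrite -[X in measurable X]setTI; apply: measurable_rV_uncons => //;
     exact: measurableX.
rewrite /lebesgue_rV_step /pushforward -comp_preimage.
rewrite (_ : @rV_uncons n \o @rV_cons n = id); last first.
  by apply/funext => p /=; rewrite rV_consK.
by rewrite preimage_id product_measure1E// lte_mul_pinfty// ge0_fin_numE.
Qed.

HB.instance Definition _ := @Measure_isSigmaFinite.Build _ _ _
  lebesgue_rV_step step_sigma_finite.

End step.

Fixpoint lebesgue_rV n : {sigma_finite_measure set 'rV[R]_n -> \bar R} :=
  if n is n'.+1 then lebesgue_rV_step (lebesgue_rV n') else \d_(0 : 'rV[R]_0).

End lebesgue_rV.

Section euclidean.
Context {R : realType} {n : nat}.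

(* The library norm on row vectors is the maximum norm. *)
Definition enorm (x : 'rV[R]_n) : R := Num.sqrt (\sum_i x 0 i ^+ 2).

Definition unit_ball : set 'rV[R]_n := [set x | enorm x < 1].

Definition unit_sphere : set 'rV[R]_n := [set x | enorm x = 1].

Definition ediam (U : set 'rV[R]_n) : \bar R :=
  ereal_sup [set (enorm (x - y))%:E | x in U & y in U].

End euclidean.

Section hausdorff.
Context {R : realType}.
Variables (n k : nat).

(* omega_k (diam U / 2)^k if diam U <= d, where omega_k is the volume of the
   unit ball of R^k; sets of larger diameter are not allowed in covers. *)
Definition hausdorff_gauge (d : R) (U : set 'rV[R]_n) : \bar R :=
  if U == set0 then 0%E
  else if (ediam U <= d%:E)%E then
    (lebesgue_rV k (@unit_ball R k) *
     ((fine (ediam U) / 2%:R) ^+ k)%:E)%E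
  else +oo%E.

(* mu_ext takes the infimum over countable covers by Borel sets; this loses
   nothing as a set and its closure have the same diameter. *)
Definition hausdorff_content (d : R) : set 'rV[R]_n -> \bar R :=
  mu_ext (hausdorff_gauge d).

Definition hausdorff (A : set 'rV[R]_n) : \bar R :=
  ereal_sup [set hausdorff_content d A | d in [set d : R | 0 < d]].

Let gauge0 d : hausdorff_gauge d set0 = 0%E.
Proof. by rewrite /hausdorff_gauge eqxx. Qed.

Let gauge_ge0 d U : (0 <= hausdorff_gauge d U)%E.
Proof.
rewrite /hausdorff_gauge; case: eqP => // /eqP/set0P[x Ux].
have dU : (0 <= ediam U)%E.
  apply: ereal_sup_ubound; exists x => //; exists x => //.
  by rewrite subrr /enorm big1 ?sqrtr0// => i _; rewrite mxE expr0n.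
case: ifPn => // _; apply: mule_ge0 => //.
by rewrite lee_fin exprn_ge0// divr_ge0// fine_ge0.
Qed.

Let hausdorff_content_ge0 d A : (0 <= hausdorff_content d A)%E.
Proof. exact/mu_ext_ge0/gauge_ge0. Qed.

Let hausdorff_ge0 A : (0 <= hausdorff A)%E.
Proof.
apply: (le_trans (hausdorff_content_ge0 1 A)).
by apply: ereal_sup_ubound; exists 1 => //=; exact: ltr01.
Qed.

Let hausdorff0 : hausdorff set0 = 0%E.
Proof.
apply/eqP; rewrite eq_le hausdorff_ge0 andbT.
by apply: ge_ereal_sup => _ [d _ <-]; rewrite /hausdorff_content mu_ext0.
Qed.

Let le_hausdorff : {homo hausdorff : A B / A `<=` B >-> (A <= B)%E}.
Proof.
move=> A B AB; apply: ge_ereal_sup => _ [d d0 <-].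
apply: (@le_trans _ _ (hausdorff_content d B)); first exact: le_mu_ext.
by apply: ereal_sup_ubound; exists d.
Qed.

Let hausdorff_sigma_subadditive : sigma_subadditive hausdorff.
Proof.
move=> F; apply: ge_ereal_sup => _ [d d0 <-].
have gd := gauge_ge0 d.
apply: (le_trans (mu_ext_sigma_subadditive gd F)).
apply: lee_nneseries => [i _ _|i _]; first exact: hausdorff_content_ge0.
by apply: ereal_sup_ubound; exists d.
Qed.

HB.instance Definition _ := isOuterMeasure.Build R 'rV[R]_n hausdorff
  hausdorff0 hausdorff_ge0 le_hausdorff hausdorff_sigma_subadditive.

Definition hausdorff_outer : {outer_measure set 'rV[R]_n -> \bar R} :=
  hausdorff.

Definition hausdorff_measure :
    {measure set (caratheodory_type hausdorff_outer) -> \bar R} :=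
  (hausdorff_outer : set (caratheodory_type hausdorff_outer) -> \bar R).

End hausdorff.

Section functionals.
Context {R : realType} {m : nat}.
Implicit Types (Om : set 'rV[R]_m) (f phi psi : 'rV[R]_m -> R).
Implicit Types (X g : 'rV[R]_m -> 'rV[R]_m).

Local Notation leb := (@lebesgue_rV R m).

Definition partial (i : 'I_m) f : 'rV[R]_m -> R := 'D_(delta_mx 0 i) f.

Definition grad f (x : 'rV[R]_m) : 'rV[R]_m := \row_i partial i f x.

Definition C1 f := forall i : 'I_m,
  (forall x, derivable f x (delta_mx 0 i)) /\ continuous (partial i f).

Definition smooth f := forall s : seq 'I_m, C1 (foldr partial f s).

Definition compact_support Om f :=
  compact (closure [set x | f x != 0]) /\ closure [set x | f x != 0] `<=` Om.

Definition test_function Om psi := smooth psi /\ compact_support Om psi.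

Definition divergence X (x : 'rV[R]_m) : R :=
  \sum_i partial i (fun y => X y 0 i) x.

Definition perimeter Om : \bar R :=
  ereal_sup [set (\int[leb]_(x in Om) divergence X x)%:E | X in
    [set X : 'rV[R]_m -> 'rV[R]_m |
             (forall i, C1 (fun y => X y 0 i) /\
                        compact_support setT (fun y => X y 0 i)) /\
             (forall x, enorm (X x) <= 1)]].

Definition L2 Om f :=
  measurable_fun Om f /\ (\int[leb]_(x in Om) (f x ^+ 2)%:E < +oo)%E.

Definition weak_gradient Om phi g := forall (psi : 'rV[R]_m -> R) (i : 'I_m),
  test_function Om psi ->
  \int[leb]_(x in Om) (phi x * partial i psi x) =
  - \int[leb]_(x in Om) (g x 0 i * psi x).

Definition H1 Om phi g :=
  [/\ L2 Om phi, forall i, L2 Om (fun x => g x 0 i) & weak_gradient Om phi g].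

(* An element of H^1 or H^1_0 comes with its weak gradient g, which is unique
   almost everywhere; H^1_0(Om) is the closure of C_c^oo(Om) in H^1(Om). *)
Definition H10 Om phi g := H1 Om phi g /\
  forall e : R, 0 < e -> exists2 psi, test_function Om psi &
    (\int[leb]_(x in Om)
      ((phi x - psi x) ^+ 2 + enorm (g x - grad psi x) ^+ 2)%:E < e%:E)%E.

Definition H10_nonzero Om phi g :=
  H10 Om phi g /\ \int[leb]_(x in Om) (phi x ^+ 2) != 0.

(* The supremum and the infimum below are attained when Om is bounded, open and
   nonempty, by compactness of the embedding of H^1_0(Om) into L^2(Om). *)
Definition torsion Om : R :=
  sup [set t | exists phi g, H10_nonzero Om phi g /\
    t = (\int[leb]_(x in Om) phi x) ^+ 2 /
        \int[leb]_(x in Om) (enorm (g x) ^+ 2)].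

Definition eigenvalue1 Om : R :=
  inf [set t | exists phi g, H10_nonzero Om phi g /\
    t = \int[leb]_(x in Om) (enorm (g x) ^+ 2) /
        \int[leb]_(x in Om) (phi x ^+ 2)].

Definition Gfun Om : R :=
  torsion Om * eigenvalue1 Om /
  (fine (perimeter Om) `^ (m%:R / (m%:R - 1))).

End functionals.

(* Functions on the sphere are represented by functions on R^m of which only
   the restriction to the sphere is relevant. *)
Section sphere.
Context {R : realType} {m : nat}.
Implicit Types h f : 'rV[R]_m -> R.

Local Notation S := (@unit_sphere R m).

Definition sphere_integral f : R :=
  \int[@hausdorff_measure R m m.-1]_(y in S) f y.

Definition hextend h (x : 'rV[R]_m) : R := h ((enorm x)^-1 *: x).

(* On the sphere, the gradient of the 0-homogeneous extension of h is the
   tangential gradient of h. *)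
Definition tpartial (i : 'I_m) h : 'rV[R]_m -> R := partial i (hextend h).

Definition tgrad h (y : 'rV[R]_m) : 'rV[R]_m := \row_i tpartial i h y.

Definition sphere_C1 h := {within S, continuous h} /\
  forall i, (forall y, S y -> derivable (hextend h) y (delta_mx 0 i)) /\
            {within S, continuous (tpartial i h)}.

Definition sphere_C2 h := sphere_C1 h /\ forall i, sphere_C1 (tpartial i h).

Definition sphere_sup f : \bar R := ereal_sup [set `|f y|%:E | y in S].

Definition sphere_holder (gamma : R) f : \bar R :=
  ereal_sup [set t | exists y z, [/\ S y, S z, y != z &
    t = (`|f y - f z| / enorm (y - z) `^ gamma)%:E]].

(* The C^{2,gamma} norm is taken over iterated tangential derivatives; other
   usual choices (local charts, covariant derivatives) are equivalent to it. *)
Definition C2gamma_norm (gamma : R) h : \bar R :=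
  (sphere_sup h + \sum_i sphere_sup (tpartial i h) +
   \sum_i \sum_j (sphere_sup (tpartial i (tpartial j h)) +
                  sphere_holder gamma (tpartial i (tpartial j h))))%E.

Definition C2gamma (gamma : R) h :=
  sphere_C2 h /\ (C2gamma_norm gamma h < +oo)%E.

Definition H1_norm h : R :=
  Num.sqrt (sphere_integral (fun y => h y ^+ 2 + enorm (tgrad h y) ^+ 2)).

(* For h continuous with sup |h| < 1, this is the open set, star-shaped with
   respect to the origin, with boundary { (1 + h y) y | y in S }. *)
Definition starball h : set 'rV[R]_m :=
  [set x | exists t y, [/\ 0 <= t < 1, S y & x = (t * (1 + h y)) *: y]].

(* The class S_{delta,gamma} consists of the sets starball h for these h. *)
Definition nearly_spherical (delta gamma : R) h :=
  [/\ C2gamma gamma h,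
      (sphere_sup h < (2^-1)%:E)%E,
      sphere_integral h = 0,
      (forall i, sphere_integral (fun y => h y * y 0 i) = 0) &
      (C2gamma_norm gamma h <= delta%:E)%E].

End sphere.

(* Main.v *)
(* Second-order expansion at the ball. The eigenvalue is bounded above by testing with
   the radial eigenfunction corrected to vanish on the boundary, the torsion through the
   Steklov inequality on an inner ball and radial variation outside it, the perimeter
   through the divergence of an extension of the normal. The linear terms cancel by the
   constraints on h; the remaining quadratic form is negative by the Poincare inequality
   on the sphere and Barta's bound m^2/4 + 2m <= Lambda(B_1). *)
Require Import Defs.
From HB Require Import structures.
From mathcomp Require Import all_boot all_order all_algebra.
From mathcomp Require Import all_classical all_reals all_analysis measurable_realfun.
From mathcomp Require Import ring lra zify.

Set Implicit Arguments.
Unset Strict Implicit.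
Unset Printing Implicit Defensive.

Import Order.TTheory GRing.Theory Num.Theory.
Import numFieldNormedType.Exports.

Local Open Scope classical_set_scope.
Local Open Scope ring_scope.

(** Every estimate is one-sided: upper bounds for torsion and eigenvalue and a lower bound for the
    perimeter of the perturbed ball, the opposite bounds for the unit ball. For the torsion, an
    arbitrary test function is traded for a function with prescribed boundary values, about
    [- h / n]. As [h] has no component of degree 0 or 1, Steklov's inequality bounds its energy
    below by 2n times its boundary mass. The eigenvalue of the ball is represented by the first zero
    l of a Bessel series; the coefficient of the L2 mass of [h] decreases in l, so a lower bound on
    l decides its sign. Surface integrals shape the development. They are carried by [sA], the
    integral of the 0-homogeneous extension over the punctured unit ball, for which polar
    coordinates follow from Tonelli's theorem and scaling. The Hausdorff measure is compared with
    [sA] through its invariance under reflections, up to a positive factor that is absorbed in the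
    final constant. *)

Lemma eq_ler (R : numDomainType) (x y : R) : x = y -> x <= y. Proof. by move->. Qed.

Lemma ler_sqr_norm (R : realDomainType) (x y : R) : `|x| <= y -> x ^+ 2 <= y ^+ 2.
Proof.
by move=> xy; rewrite -real_normK ?num_real// lerXn2r ?nnegrE//; exact: le_trans xy.
Qed.

Local Notation leb := (@lebesgue_rV _ _).

(** * Euclidean inner product, norm and Borel sets of R^n *)

Section euclid.
Context {R : realType} {n : nat}.
Implicit Types (x y z : 'rV[R]_n) (c : R).

Definition dot x y : R := \sum_i x 0 i * y 0 i.

Lemma dotC x y : dot x y = dot y x.
Proof. by apply: eq_bigr => i _; rewrite mulrC. Qed.

Lemma dotDl x y z : dot (x + y) z = dot x z + dot y z.
Proof. by rewrite -big_split; apply: eq_bigr => i _; rewrite mxE mulrDl. Qed.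

Lemma dotZl c x y : dot (c *: x) y = c * dot x y.
Proof. by rewrite mulr_sumr; apply: eq_bigr => i _; rewrite mxE mulrA. Qed.

Lemma dotDr x y z : dot x (y + z) = dot x y + dot x z.
Proof. by rewrite dotC dotDl !(dotC x). Qed.

Lemma dotZr c x y : dot x (c *: y) = c * dot x y.
Proof. by rewrite dotC dotZl dotC. Qed.

Lemma dotNl x y : dot (- x) y = - dot x y.
Proof. by rewrite -scaleN1r dotZl mulN1r. Qed.

Lemma dotNr x y : dot x (- y) = - dot x y.
Proof. by rewrite dotC dotNl dotC. Qed.

Lemma dotBl x y z : dot (x - y) z = dot x z - dot y z.
Proof. by rewrite dotDl dotNl. Qed.

Lemma dotBr x y z : dot x (y - z) = dot x y - dot x z.
Proof. by rewrite dotDr dotNr. Qed.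

Lemma dot0l x : dot 0 x = 0.
Proof. by rewrite -(scale0r 0) dotZl mul0r. Qed.

Lemma dot0r x : dot x 0 = 0.
Proof. by rewrite dotC dot0l. Qed.

Lemma dot_delta x i : dot x (delta_mx 0 i) = x 0 i.
Proof.
rewrite /dot (bigD1 i)//= mxE !eqxx mulr1 big1 ?addr0// => j /negbTE ji.
by rewrite mxE ji andbF mulr0.
Qed.

Lemma row_eq x : x = \row_i x 0 i.
Proof. by apply/rowP => i; rewrite mxE. Qed.

Lemma dotxx_ge0 x : 0 <= dot x x.
Proof. by apply: sumr_ge0 => i _; rewrite -expr2 sqr_ge0. Qed.

Lemma enorm_sqr x : enorm x ^+ 2 = dot x x.
Proof.
rewrite /enorm sqr_sqrtr; first by apply: eq_bigr => i _; rewrite expr2.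
by apply: sumr_ge0 => i _; exact: sqr_ge0.
Qed.

Lemma enorm_ge0 x : 0 <= enorm x. Proof. exact: sqrtr_ge0. Qed.

Lemma enormE x : enorm x = Num.sqrt (dot x x).
Proof. by rewrite -enorm_sqr sqrtr_sqr ger0_norm// enorm_ge0. Qed.

Lemma enormZ c x : enorm (c *: x) = `|c| * enorm x.
Proof.
by rewrite !enormE dotZl dotZr mulrA -expr2 sqrtrM ?sqr_ge0// sqrtr_sqr.
Qed.

Lemma enormN x : enorm (- x) = enorm x.
Proof. by rewrite -scaleN1r enormZ normrN1 mul1r. Qed.

Lemma enorm0 : enorm (0 : 'rV[R]_n) = 0.
Proof. by rewrite enormE dot0l sqrtr0. Qed.

Lemma coord_le_enorm x i : `|x 0 i| <= enorm x.
Proof.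
rewrite -sqrtr_sqr /enorm ler_wsqrtr// (bigD1 i)//= lerDl.
by apply: sumr_ge0 => j _; exact: sqr_ge0.
Qed.

Lemma enorm_eq0 x : (enorm x == 0) = (x == 0).
Proof.
apply/eqP/eqP => [x0|->]; last exact: enorm0.
apply/rowP => i; apply/eqP; rewrite mxE -normr_le0.
by rewrite (le_trans (coord_le_enorm x i))// x0.
Qed.

Lemma enorm_gt0 x : (0 < enorm x) = (x != 0).
Proof. by rewrite lt0r enorm_ge0 andbT enorm_eq0. Qed.

Lemma cauchy_schwarz x y : `|dot x y| <= enorm x * enorm y.
Proof.
have [->|y0] := eqVneq y 0; first by rewrite dot0r normr0 enorm0 mulr0.
rewrite -ler_sqr ?nnegrE ?mulr_ge0 ?enorm_ge0// -normrX ger0_norm ?sqr_ge0//.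
rewrite exprMn !enorm_sqr.
have yy : 0 < dot y y by rewrite -enorm_sqr exprn_gt0// enorm_gt0.
have := dotxx_ge0 (dot y y *: x - dot x y *: y).
rewrite dotBl !dotBr !dotZl !dotZr (dotC y x).
rewrite (_ : _ - _ = dot y y * (dot x x * dot y y - dot x y ^+ 2)); last by ring.
by rewrite pmulr_rge0// subr_ge0.
Qed.

Lemma dot_le x y : dot x y <= enorm x * enorm y.
Proof. exact: le_trans (ler_norm _) (cauchy_schwarz x y). Qed.

Lemma enormD x y : enorm (x + y) <= enorm x + enorm y.
Proof.
rewrite -ler_sqr ?nnegrE ?addr_ge0 ?enorm_ge0// sqrrD !enorm_sqr dotDl !dotDr.
by have := dot_le x y; rewrite (dotC y x); lra.
Qed.

Lemma enormB x y : enorm x - enorm y <= enorm (x - y).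
Proof. by rewrite lerBlDr -{1}(subrK y x) enormD. Qed.

Lemma enorm_sum I (r : seq I) (F : I -> 'rV[R]_n) :
  enorm (\sum_(i <- r) F i) <= \sum_(i <- r) enorm (F i).
Proof.
elim/big_rec2: _ => [|i a v _ h]; first by rewrite enorm0.
by rewrite (le_trans (enormD _ _))// lerD2l.
Qed.

Lemma enorm_delta (i : 'I_n) : enorm (delta_mx 0 i : 'rV[R]_n) = 1.
Proof. by rewrite enormE dot_delta mxE !eqxx sqrtr1. Qed.

Lemma row_sum_delta' x : x = \sum_i x 0 i *: delta_mx 0 i.
Proof. by rewrite {1}[x]row_sum_delta. Qed.

Lemma enorm_le_sum x : enorm x <= \sum_i `|x 0 i|.
Proof.
rewrite {1}[x]row_sum_delta' (le_trans (enorm_sum _ _))// ler_sum// => i _.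
by rewrite enormZ enorm_delta mulr1.
Qed.

Lemma norm_coord_le x i : `|x 0 i| <= `|x|.
Proof.
rewrite /Num.norm/= mx_normrE.
exact: (@le_bigmax _ _ _ 0 (fun ij : 'I_1 * 'I_n => `|x ij.1 ij.2|) (0, i)).
Qed.

Lemma norm_le_enorm x : `|x| <= enorm x.
Proof.
rewrite /Num.norm/= mx_normrE; apply/bigmax_leP; split=> [|[i j] _].
  exact: enorm_ge0.
by rewrite ord1; exact: coord_le_enorm.
Qed.

Lemma enorm_le_norm x : enorm x <= n%:R * `|x|.
Proof.
rewrite (le_trans (enorm_le_sum x))// (le_trans (ler_sum _ (fun i _ => norm_coord_le x i)))//.
by rewrite sumr_const card_ord mulr_natl.
Qed.

Lemma continuous_coord (i : 'I_n) : continuous (fun x : 'rV[R]_n => x 0 i).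
Proof. exact: coord_continuous. Qed.

Lemma continuous_sum (T : topologicalType) (I : Type) (r : seq I)
    (F : I -> T -> R) (t : T) : (forall i, {for t, continuous (F i)}) ->
  {for t, continuous (fun u : T => \sum_(i <- r) F i u)}.
Proof.
move=> cF; elim: r => [|i r IH].
  rewrite (_ : (fun _ => _) = cst 0); first exact: cst_continuous.
  by apply/funext => u; rewrite big_nil.
rewrite (_ : (fun _ => _) = F i \+ (fun u : T => \sum_(j <- r) F j u)).
  exact: continuousD (cF i) IH.
by apply/funext => u; rewrite big_cons.
Qed.

Lemma continuous_dot (T : topologicalType) (f g : T -> 'rV[R]_n) (t : T) :
  {for t, continuous f} -> {for t, continuous g} ->
  {for t, continuous (fun u => dot (f u) (g u))}.
Proof.
move=> cf cg; apply: continuous_sum => i; apply: continuousM.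
  exact: (continuous_comp cf (@continuous_coord i _)).
exact: (continuous_comp cg (@continuous_coord i _)).
Qed.

Lemma continuous_enorm : continuous (@enorm R n).
Proof.
move=> x; rewrite (_ : @enorm R n = (Num.sqrt \o (fun z => dot z z))).
  apply: continuous_comp; last exact: sqrt_continuous.
  by apply: continuous_dot; exact: cvg_id.
by apply/funext => z; rewrite enormE.
Qed.

Lemma open_unit_ball : open (@unit_ball R n).
Proof.
have -> : @unit_ball R n = (@enorm R n) @^-1` [set t | t < 1] by [].
by apply: open_comp => [x _|]; [exact: continuous_enorm|exact: open_lt].
Qed.

Lemma closed_unit_sphere : closed (@unit_sphere R n).
Proof.
have -> : @unit_sphere R n = (@enorm R n) @^-1` [set 1] by [].
by apply: closed_comp => [x _|]; [exact: continuous_enorm|exact: closed_eq].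
Qed.

Lemma compact_closed_enorm_ball (r : R) : compact [set x : 'rV[R]_n | enorm x <= r].
Proof.
apply: bounded_closed_compact; last first.
  have -> : [set x : 'rV[R]_n | enorm x <= r] = (@enorm R n) @^-1` [set t | t <= r] by [].
  by apply: closed_comp => [x _|]; [exact: continuous_enorm|exact: closed_le].
exists r; split=> [|s rs x /= xr]; first exact: num_real.
by rewrite (le_trans (norm_le_enorm x))// (le_trans xr)// ltW.
Qed.

Lemma ball_bounded (f : 'rV[R]_n -> R) (r : R) : continuous f ->
  exists2 M : R, 0 <= M & forall x, enorm x <= r -> `|f x| <= M.
Proof.
move=> cf; have ck : compact (f @` [set x | enorm x <= r]).
  by apply: continuous_compact; [exact: continuous_subspaceT|exact: compact_closed_enorm_ball].
have [M [_ H]] := compact_bounded ck; exists (`|M| + 1) => [|x xr]; first exact: addr_ge0.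
by apply: H; [rewrite (le_lt_trans (ler_norm M))// ltrDl|exists x].
Qed.

Lemma closure_enorm_le (A : set 'rV[R]_n) (r : R) x : (forall z, A z -> enorm z <= r) ->
  closure A x -> enorm x <= r.
Proof.
move=> Ar; rewrite closureE => /(_ [set x | enorm x <= r]); apply; split; last exact: Ar.
rewrite (_ : [set x | _] = (@enorm R n) @^-1` [set t | t <= r])//.
by apply: closed_comp => [z _|]; [exact: continuous_enorm|exact: closed_le].
Qed.

Lemma compact_unit_sphere : compact (@unit_sphere R n).
Proof.
apply: (subclosed_compact closed_unit_sphere (@compact_closed_enorm_ball 1)).
by move=> x /= ->.
Qed.

(** The sigma-algebra is generated by the coordinates, so an open set has to be written as a
    countable union of boxes: rational centres, sides given by [1 / (k + 1)], enumerated through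
    [pickle]. *)
Lemma open_measurable_rV (U : set 'rV[R]_n) : open U -> measurable U.
Proof.
move=> oU.
pose q (p : 'rV[rat]_n) : 'rV[R]_n := \row_i ratr (p 0 i).
pose b (pk : 'rV[rat]_n * nat) := [set x : 'rV[R]_n | forall i, `|x 0 i - q pk.1 0 i| < (pk.2.+1%:R^-1 : R)].
have mb pk : measurable (b pk).
  have -> : b pk = \big[setI/setT]_i
      ((fun x : 'rV[R]_n => x 0 i) @^-1` [set t | `|t - q pk.1 0 i| < pk.2.+1%:R^-1]).
    apply/seteqP; split=> [x bx|x]; first by rewrite -bigcap_seq => i _; exact: bx.
    by rewrite -bigcap_seq => bx i; apply: bx => /=; rewrite mem_index_enum.
  apply: bigsetI_measurable => i _; rewrite -[X in measurable X]setTI.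
  apply: measurable_coord => //; apply: open_measurable.
  have -> : [set t | `|t - q pk.1 0 i| < pk.2.+1%:R^-1] = ball (q pk.1 0 i) (pk.2.+1%:R^-1 : R).
    by apply/funext => t; rewrite /ball/= distrC.
  exact: ball_open.
have -> : U = \bigcup_k (if unpickle k is Some pk then
    (if `[< b pk `<=` U >] then b pk else set0) else set0).
  apply/seteqP; split=> [x Ux|x [k _]]; last first.
    by case: unpickle => // pk; case: ifPn => // /asboolP; exact.
  have /nbhs_ballP[e /= e0 eU] := open_nbhs_nbhs (conj oU Ux).
  have [k] := ltr_add_invr (divr_gt0 e0 (ltr0n R 2)); rewrite add0r => ke.
  have k0 : (0 : R) < k.+1%:R^-1 by rewrite invr_gt0.
  have pP i : {r : rat | `|x 0 i - ratr r| < k.+1%:R^-1}.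
    apply/cid; move: (k.+1%:R^-1 : R) k0 => d d0.
    have [|r] := @rat_in_itvoo R (x 0 i - d) (x 0 i + d); first lra.
    by rewrite in_itv/= => /andP[r1 r2]; exists r; rewrite ltr_distlC; apply/andP; split; lra.
  pose p := \row_i sval (pP i).
  exists (pickle (p, k)) => //; rewrite pickleK.
  have -> : `[< b (p, k) `<=` U >].
    apply/asboolP => y by'; apply: eU; rewrite -ball_normE/=.
    apply: (@le_lt_trans _ _ (k.+1%:R^-1 + k.+1%:R^-1)); last by rewrite [ltRHS]splitr ltrD.
    rewrite {1}/Num.norm/= mx_normrE; apply/bigmax_leP; split; first by rewrite addr_ge0// ltW.
    move=> [i0 i] _ /=; rewrite ord1 !mxE.
    have := by' i; rewrite !mxE => yi; have xi := svalP (pP i).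
    by rewrite (le_trans (ler_distD (ratr (sval (pP i))) _ _))// lerD ?ltW// distrC.
  by move=> i /=; rewrite !mxE; exact: (svalP (pP i)).
by apply: bigcup_measurable => k _; case: unpickle => // pk; case: ifP.
Qed.

Lemma measurable_open_continuous (U : set 'rV[R]_n) (f : 'rV[R]_n -> R) :
  open U -> (forall x, U x -> {for x, continuous f}) -> measurable_fun U f.
Proof.
move=> oU cf; apply: (measurability _ (RGenOpens.measurableE R)).
move=> _ [_ [a [b ->] <-]]; apply: open_measurable_rV.
rewrite openE => x [Ux fx]; apply: filterI; first exact: open_nbhs_nbhs.
by apply: cf => //; apply: open_nbhs_nbhs; split => //; exact: interval_open.
Qed.

Lemma measurable_continuous (f : 'rV[R]_n -> R) :
  continuous f -> measurable_fun setT f.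
Proof. by move=> cf; apply: (measurable_open_continuous openT) => x _; exact: cf. Qed.

Lemma measurable_unit_ball : measurable (@unit_ball R n).
Proof. by apply: open_measurable_rV; exact: open_unit_ball. Qed.

Lemma measurable_enorm : measurable_fun setT (@enorm R n).
Proof. by apply: measurable_continuous; exact: continuous_enorm. Qed.

Lemma measurable_lt_set (a b : 'rV[R]_n -> R) : measurable_fun setT a -> measurable_fun setT b ->
  measurable [set x | a x < b x].
Proof.
move=> ma mb; have := measurable_fun_ltr ma mb measurableT.
by move=> /(_ [set true]); rewrite setTI; apply.
Qed.

Lemma measurable_le_set (a b : 'rV[R]_n -> R) : measurable_fun setT a -> measurable_fun setT b ->
  measurable [set x | a x <= b x].
Proof.
move=> ma mb; have := measurable_fun_ler ma mb measurableT.
by move=> /(_ [set true]); rewrite setTI; apply.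
Qed.

Lemma open_neq0 : open [set x : 'rV[R]_n | x != 0].
Proof.
have -> : [set x : 'rV[R]_n | x != 0] = (@enorm R n) @^-1` [set t | t != 0].
  by apply/seteqP; split=> x /=; rewrite enorm_eq0.
by apply: open_comp => [x _|]; [exact: continuous_enorm|exact: open_neq].
Qed.

Lemma measurable_neq0 : measurable [set x : 'rV[R]_n | x != 0].
Proof. exact: open_measurable_rV open_neq0. Qed.

Lemma measurable_zero : measurable [set (0 : 'rV[R]_n)].
Proof.
rewrite (_ : [set _] = ~` [set x : 'rV[R]_n | x != 0]); first exact: measurableC measurable_neq0.
by apply/seteqP; split=> x /= => [->|/negP/negPn/eqP]; [rewrite eqxx|].
Qed.

Lemma measurable_away0 (f : 'rV[R]_n -> R) :
  (forall x, x != 0 -> {for x, continuous f}) -> measurable_fun setT f.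
Proof.
move=> cf; have -> : [set: 'rV[R]_n] = [set 0] `|` [set x | x != 0].
  by apply/seteqP; split=> // x _; have [->|] := eqVneq x 0; [left|right].
apply/measurable_funU; [exact: measurable_zero|exact: measurable_neq0|].
split; first exact: measurable_fun_set1.
exact: measurable_open_continuous open_neq0 _.
Qed.

End euclid.

(** * Derivatives of functions of one variable *)

Section derive1.
Context {R : realType}.

Lemma is_deriveXn (t : R) k : is_derive t 1 (fun s : R => s ^+ k) (k%:R * t ^+ k.-1).
Proof.
split; first exact: exprn_derivable.
by rewrite exp_derive /GRing.scale/= mulr1.
Qed.

Lemma is_deriveVn (t : R) : t != 0 -> is_derive t 1 (fun s : R => s^-1) (- t ^- 2).
Proof.
move=> t0; split; first exact: derivableV.
by rewrite deriveV// derive_id /GRing.scale/= mulr1.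
Qed.

Lemma is_deriveVX (r : R) k : r != 0 -> is_derive r 1 (fun s : R => s ^- k) (- k%:R * r ^- k.+1).
Proof.
move=> r0; have rk : r ^+ k != 0 by rewrite expf_neq0.
have H := @is_derive1_comp R (fun r => r^-1) (fun r => r ^+ k) r _ _ (is_deriveVn rk) (is_deriveXn r k).
apply: (is_derive_eq H); case: k rk {H} => [|k] rk; first by rewrite !mul0r oppr0 mulr0 mul0r.
by rewrite /= !exprS; field; rewrite ?r0 ?expf_neq0.
Qed.

Lemma is_derive_continuous (f : R -> R) (t d : R) : is_derive t 1 f d -> {for t, continuous f}.
Proof. by case=> df _; apply: differentiable_continuous; exact/derivable1_diffP. Qed.

Lemma is_derive_mull (c t : R) : is_derive t 1 (fun s : R => c * s) c.
Proof. by apply: (is_derive_eq (is_deriveZ c (is_derive_id t 1))); rewrite /GRing.scale/= mulr1. Qed.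

Lemma is_derive_mulr (c t : R) : is_derive t 1 (fun s : R => s * c) c.
Proof. by under eq_fun do rewrite mulrC; exact: is_derive_mull. Qed.

(** Serves at the junction point of functions defined by cases, such as [pos2] and [flat], where no
    differentiation rule applies. *)
Lemma is_derive0_quadratic (g : R -> R) C : 0 <= C -> (forall h, `|g h| <= C * h ^+ 2) -> is_derive (0 : R) 1 g 0.
Proof.
move=> C0 gC; have C1 : 0 < C + 1 by lra.
have g0 : g 0 = 0.
  by apply/eqP; rewrite -normr_le0 (le_trans (gC 0))// expr0n mulr0.
have L : (fun h : R => h^-1 *: ((g \o shift 0) (h *: 1) - g 0)) @ 0^' --> (0 : R).
  apply/cvgrPdist_lt => d d0; near=> h.
  have h0 : h != 0 by near: h; exact: nbhs_dnbhs_neq.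
  rewrite sub0r normrN /= addr0 [h *: 1]mulr1 g0 subr0 normrM.
  rewrite (le_lt_trans (ler_wpM2l _ (gC h)))//.
  have -> : `|h^-1| * (C * h ^+ 2) = C * `|h|.
    by rewrite -(real_normK (num_real h)) normfV; field; rewrite normr_eq0.
  apply: (@le_lt_trans _ _ ((C + 1) * `|h|)); first by rewrite ler_wpM2r//; lra.
  rewrite mulrC -ltr_pdivlMr//.
  by near: h; apply: dnbhs0_lt; rewrite divr_gt0//.
by split; [apply/cvg_ex; exists 0|exact: cvg_lim L].
Unshelve. all: by end_near. Qed.

Lemma is_derive_line (V : normedModType R) (f : V -> R) (a v : V) (t l : R) :
  is_derive (a + t *: v) v f l -> is_derive t 1 (fun s => f (a + s *: v)) l.
Proof.
have E : (fun h : R => h^-1 *: (((fun s => f (a + s *: v)) \o shift t) (h *: 1) - f (a + t *: v))) =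
    (fun h : R => h^-1 *: ((f \o shift (a + t *: v)) (h *: v) - f (a + t *: v))).
  apply/funext => h /=; congr (_ *: (f _ - _)).
  by rewrite [h *: 1]mulr1 scalerDl addrCA.
by move=> [df <-]; split; rewrite /derivable /derive E.
Qed.

Lemma is_derive_ray (V : normedModType R) (f : V -> R) (v : V) (t l : R) :
  is_derive (t *: v) v f l -> is_derive t 1 (fun s => f (s *: v)) l.
Proof.
have := @is_derive_line V f 0 v t l; rewrite add0r (_ : (fun s => f (0 + _)) = (fun s => f (s *: v)))//.
by apply/funext => s; rewrite add0r.
Qed.

Lemma MVT01 (f df : R -> R) : (forall t : R, 0 <= t <= 1 -> is_derive t 1 f (df t)) ->
  exists2 c, 0 <= c <= 1 & f 1 - f 0 = df c.
Proof.
move=> h; have [t||c] := @MVT_segment R f df 0 1 ler01.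
- by rewrite in_itv/= => /andP[t0 t1]; apply: h; rewrite !ltW.
- apply: continuous_in_subspaceT => t; rewrite inE/= in_itv/= => t01.
  by have := h t t01; exact: is_derive_continuous.
- by rewrite in_itv/= => c01 ->; exists c => //; rewrite subr0 mulr1.
Qed.

End derive1.

Lemma is_diff_row (R : realType) (V : normedModType R) k (Phi : V -> 'rV[R]_k)
    (dPhi : 'I_k -> V -> R) x :
  (forall j, is_diff x (fun z => Phi z 0 j) (dPhi j)) ->
  is_diff x Phi (fun v => \row_j dPhi j v).
Proof.
move=> h.
have E (F : 'I_k -> V -> R) : (fun z => \row_j F j z) =
    \sum_(j < k) (fun z => F j z *: delta_mx 0 j : 'rV[R]_k).
  apply/funext => z; rewrite fct_sumE; apply/rowP => j; rewrite mxE summxE.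
  rewrite (bigD1 j)//= !mxE !eqxx mulr1 big1 ?addr0// => l /negbTE jl.
  by rewrite !mxE eq_sym jl andbF mulr0.
have hj j : is_diff x (fun z => Phi z 0 j *: delta_mx 0 j : 'rV[R]_k)
    (fun v => dPhi j v *: delta_mx 0 j).
  have [dj djE] := h j; apply: DiffDef; first exact: differentiableZl.
  by rewrite diffZl// djE.
have S (r : seq 'I_k) : is_diff x (\sum_(j <- r) (fun z => Phi z 0 j *: delta_mx 0 j : 'rV[R]_k))
    (\sum_(j <- r) (fun v => dPhi j v *: delta_mx 0 j)).
  elim: r => [|j r IH]; first by rewrite !big_nil; exact: is_diff_cst.
  by rewrite !big_cons; exact: is_diffD.
rewrite E (_ : Phi = (fun z => \row_j Phi z 0 j)); first by rewrite E; exact: S.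
by apply/funext => z; rewrite -row_eq.
Qed.

(** * Gradients of functions on R^n *)

Section gradient.
Context {R : realType} {n : nat}.
Implicit Types (f : 'rV[R]_n -> R) (x g v : 'rV[R]_n).

Lemma gradE i f : (fun x => grad f x 0 i) = partial i f.
Proof. by apply/funext => x; rewrite mxE. Qed.

Definition isgrad f x g := is_diff x f (dot g).

Lemma isgrad_derive f x g v : isgrad f x g -> is_derive x v f (dot g v).
Proof.
by move=> [df dE]; split; [exact: diff_derivable|rewrite deriveE// dE].
Qed.

Lemma isgrad_partial f x g i : isgrad f x g -> partial i f x = g 0 i.
Proof. by move=> fg; have [_ ] := isgrad_derive (delta_mx 0 i) fg; rewrite dot_delta. Qed.

Lemma isgrad_derivable f x g v : isgrad f x g -> derivable f x v.
Proof. by move=> /(isgrad_derive v)[]. Qed.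

Lemma isgrad_grad f x g : isgrad f x g -> grad f x = g.
Proof. by move=> fg; apply/rowP => i; rewrite mxE (isgrad_partial _ fg). Qed.

Lemma isgrad_continuous f x g : isgrad f x g -> {for x, continuous f}.
Proof. by move=> [fg _]; exact: differentiable_continuous. Qed.

Lemma isgrad_eq f x g g' : isgrad f x g -> g = g' -> isgrad f x g'.
Proof. by move=> ? <-. Qed.

Lemma isgrad_cst (c : R) x : isgrad (cst c) x 0.
Proof.
by apply: (is_diff_eq (is_diff_cst _ _)); apply/funext => v; rewrite dot0l.
Qed.

Lemma isgradP f x g : isgrad f x g <-> forall e : R, 0 < e ->
  \forall h \near (0 : 'rV[R]_n), `|f (h + x) - f x - dot g h| <= e * `|h|.
Proof.
split=> [[df dE] e e0|H].
  have /diff_locally/eqaddoP/(_ e e0) := df; apply: filterS => h /=.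
  by rewrite dE /= !fctE /= opprD addrA.
have @L : {linear 'rV[R]_n -> R}.
  exists (dot g); do 2![eexists]; do ?[constructor] => //.
  - by rewrite dot0r.
  - by move=> u v; rewrite dotDr.
  - by move=> c v; rewrite dotZr.
have cL : continuous L.
  by move=> v; apply: continuous_dot; [exact: cst_continuous|exact: cvg_id].
have E : f \o shift x = cst (f x) + (L : 'rV[R]_n -> R) +o_ (0 : 'rV[R]_n) id.
  apply/(@eqaddoP _ _ _ 'rV[R]_n) => e e0; apply: filterS (H e e0) => h /=.
  by rewrite !fctE /= opprD addrA.
have dE := diff_unique cL E.
apply: DiffDef; last by rewrite dE.
by apply/diff_locallyP; rewrite dE.
Qed.

Lemma isgrad_coord i x : isgrad (fun z => z 0 i) x (delta_mx 0 i).
Proof.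
apply/isgradP => e e0; near=> h.
by rewrite mxE addrK dotC dot_delta subrr normr0 mulr_ge0// ltW.
Unshelve. all: by end_near. Qed.

Lemma isgradD f1 f2 x g1 g2 : isgrad f1 x g1 -> isgrad f2 x g2 ->
  isgrad (fun z => f1 z + f2 z) x (g1 + g2).
Proof.
move=> h1 h2; apply: (is_diff_eq (is_diffD h1 h2)).
by apply/funext => v; rewrite dotDl.
Qed.

Lemma isgradN f x g : isgrad f x g -> isgrad (fun z => - f z) x (- g).
Proof.
by move=> h; apply: (is_diff_eq (is_diffN h)); apply/funext => v; rewrite dotNl.
Qed.

Lemma isgradB f1 f2 x g1 g2 : isgrad f1 x g1 -> isgrad f2 x g2 ->
  isgrad (fun z => f1 z - f2 z) x (g1 - g2).
Proof. by move=> h1 h2; exact: isgradD h1 (isgradN h2). Qed.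

Lemma isgradM f1 f2 x g1 g2 : isgrad f1 x g1 -> isgrad f2 x g2 ->
  isgrad (fun z => f1 z * f2 z) x (f1 x *: g2 + f2 x *: g1).
Proof.
move=> h1 h2; apply: (is_diff_eq (is_diffM h1 h2)).
by apply/funext => v; rewrite dotDl !dotZl.
Qed.

Lemma isgradZ (c : R) f x g : isgrad f x g -> isgrad (fun z => c * f z) x (c *: g).
Proof.
by move=> h; apply: (isgrad_eq (isgradM (isgrad_cst c x) h)); rewrite scaler0 addr0.
Qed.

Lemma isgrad_sum (I : Type) (r : seq I) (F : I -> 'rV[R]_n -> R) G x :
  (forall i, isgrad (F i) x (G i)) ->
  isgrad (fun z => \sum_(i <- r) F i z) x (\sum_(i <- r) G i).
Proof.
move=> h; elim: r => [|i r IH].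
  by rewrite big_nil; under eq_fun do rewrite big_nil; exact: isgrad_cst.
by rewrite big_cons; under eq_fun do rewrite big_cons; exact: isgradD.
Qed.

Lemma isgrad_comp1 (h : R -> R) (d : R) f x g :
  isgrad f x g -> is_derive (f x) 1 h d -> isgrad (h \o f) x (d *: g).
Proof.
move=> fg hd.
have hd' : is_diff (f x) h (fun t => d * t).
  have dh : differentiable h (f x) by apply/derivable1_diffP; case: hd.
  apply: DiffDef => //; rewrite diff1E//; apply/funext => t.
  by rewrite derive1E (@derive_val _ _ _ _ _ _ _ hd) /= mulrC.
apply: (is_diff_eq (is_diff_comp fg hd')).
by apply/funext => v /=; rewrite dotZl.
Qed.

Lemma isgradX f x g k : isgrad f x g ->
  isgrad (fun z => f z ^+ k) x ((k%:R * f x ^+ k.-1) *: g).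
Proof.
move=> h; apply: (@isgrad_comp1 (fun t => t ^+ k)) => //.
exact: is_deriveXn.
Qed.

Lemma isgradV f x g : f x != 0 -> isgrad f x g ->
  isgrad (fun z => (f z)^-1) x (- (f x ^- 2) *: g).
Proof.
move=> f0 h; apply: (@isgrad_comp1 (fun t => t^-1)) => //.
exact: is_deriveVn.
Qed.

Lemma isgrad_near f f' x g : (\forall z \near x, f z = f' z) ->
  isgrad f x g -> isgrad f' x g.
Proof.
move=> ff' /isgradP fg; apply/isgradP => e e0.
have fx := nbhs_singleton ff'.
have : \forall h \near (0 : 'rV[R]_n), f (h + x) = f' (h + x).
  by move: ff'; rewrite (near_shift 0); apply: filterS => h /=; rewrite subr0.
by move=> /filterI/(_ (fg e e0)); apply: filterS => h [<-]; rewrite -fx.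
Qed.

(** The increment of [f] telescopes over the coordinates, changed one at a time. The mean value
    theorem handles each change, and continuity at [x] replaces the intermediate slopes by those at
    [x]. *)
Lemma isgrad_C1_at f x : (\forall z \near x, forall i, derivable f z (delta_mx 0 i)) ->
  (forall i, {for x, continuous (partial i f)}) -> isgrad f x (grad f x).
Proof.
move=> df cf; apply/isgradP => e e0.
(* Each of the [n] coordinate changes may cost at most this; the successor keeps the quotient
   meaningful for [n = 0]. *)
pose e' := e / n.+1%:R; have e'0 : 0 < e' by rewrite divr_gt0.
have : \forall z \near x, forall i, derivable f z (delta_mx 0 i) /\
    `|partial i f x - partial i f z| < e'.
  have : \forall z \near x, forall i, `|partial i f x - partial i f z| < e'.
    apply: (@filter_forall _ _ (fun i z => `|partial i f x - partial i f z| < e') (nbhs x) _ _) => i.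
    by have /cvgrPdist_lt/(_ _ e'0) := cf i; exact.
  move=> /(filterI df); apply: filterS => z [h1 h2] i; split; [exact: h1|exact: h2].
move=> /nbhs_ballP[d /= d0 D]; near=> h.
have hd : `|h| < d by near: h; apply/nbhs_ballP; exists d => // y; rewrite -ball_normE/= sub0r normrN.
(* The point where the first [k] coordinates have already moved from [x] to [h + x]. *)
pose p k : 'rV[R]_n := \row_i (x 0 i + if (i < k)%N then h 0 i else 0).
have p0 : p 0 = x by apply/rowP => i; rewrite mxE addr0.
have pn : p n = h + x by apply/rowP => i; rewrite !mxE ltn_ord addrC.
have pS (k : 'I_n) : p k.+1 = p k + h 0 k *: delta_mx 0 k.
  apply/rowP => i; rewrite !mxE/= ltnS leq_eqVlt; have [->|ik] := eqVneq i k.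
    by rewrite eqxx/= ltnn addr0 mulr1.
  by rewrite (negbTE (_ : (i : nat) != k))//= mulr0 addr0.
have step (k : 'I_n) : `|f (p k.+1) - f (p k) - grad f x 0 k * h 0 k| <= e' * `|h|.
  have D1 t : 0 <= t <= 1 -> ball x d (p k + (t * h 0 k) *: delta_mx 0 k).
    move=> /andP[t0 t1]; rewrite -ball_normE/=; apply: le_lt_trans hd.
    rewrite {1}/Num.norm/= mx_normrE; apply/bigmax_leP; split => // -[i0 i] _ /=.
    rewrite ord1 !mxE !eqxx/=; apply: le_trans (norm_coord_le h i).
    rewrite opprD addrA opprD addrA subrr add0r.
    have [->|ik] := eqVneq i k; last by rewrite mulr0 subr0 normrN; case: ifP => // _; rewrite normr0.
    by rewrite ltnn oppr0 add0r mulr1 normrN normrM ger0_norm// ler_piMl.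
  have [t t01|c c01] := @MVT01 R (fun t => f (p k + (t * h 0 k) *: delta_mx 0 k))
      (fun t => h 0 k * partial k f (p k + (t * h 0 k) *: delta_mx 0 k)).
    have [/(_ _) dk _] := D _ (D1 t t01) k.
    have H := is_derive_line (derivableP dk).
    have M := is_derive_mulr (h 0 k) t.
    by have := @is_derive1_comp R (fun s => f (p k + s *: delta_mx 0 k)) (fun s => s * h 0 k) t _ _ H M; rewrite mulrC.
  rewrite mul1r mul0r scale0r addr0 -pS => ->.
  rewrite mxE [partial k f x * _]mulrC -mulrBr normrM mulrC ler_pM//; last exact: norm_coord_le.
  by rewrite distrC ltW//; have [] := D _ (D1 c c01) k.
have -> : f (h + x) - f x - dot (grad f x) h =
    \sum_(k < n) (f (p k.+1) - f (p k) - grad f x 0 k * h 0 k).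
  rewrite sumrB; congr (_ - _).
  by rewrite -(big_mkord xpredT (fun k => f (p k.+1) - f (p k))) telescope_sumr// pn p0.
rewrite (le_trans (ler_norm_sum _ _ _))// (le_trans (ler_sum _ (fun k _ => step k)))//.
rewrite sumr_const card_ord -mulr_natl mulrA ler_wpM2r// /e' mulrCA.
apply: ler_piMr; first exact: ltW.
by rewrite ler_pdivrMr// mul1r ler_nat.
Unshelve. all: by end_near. Qed.

Lemma C1_isgrad f x : C1 f -> isgrad f x (grad f x).
Proof.
move=> cf; apply: isgrad_C1_at => [|i]; last by have [_] := cf i; exact.
by near=> z => i; have [] := cf i.
Unshelve. all: by end_near. Qed.

End gradient.

Lemma isgrad_compv (R : realType) n k (f : 'rV[R]_k -> R) (Phi : 'rV[R]_n -> 'rV[R]_k)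
    (G : 'I_k -> 'rV[R]_n) x g :
  (forall j, isgrad (fun z => Phi z 0 j) x (G j)) -> isgrad f (Phi x) g ->
  isgrad (f \o Phi) x (\sum_j g 0 j *: G j).
Proof.
move=> h fg; apply: (is_diff_eq (is_diff_comp (is_diff_row h) fg)).
apply/funext => v /=; rewrite /dot; under [RHS]eq_bigr do rewrite summxE mulr_suml.
rewrite exchange_big; apply: eq_bigr => j _ /=; rewrite mxE mulr_sumr.
by apply: eq_bigr => i _; rewrite !mxE mulrA.
Qed.

(** * Functions on the sphere and their 0-homogeneous extensions *)

Section radial_projection.
Context {R : realType} {n : nat}.
Implicit Types (f h : 'rV[R]_n -> R) (x y g : 'rV[R]_n).

Definition nx x : 'rV[R]_n := (enorm x)^-1 *: x.

Lemma enorm_nx x : x != 0 -> enorm (nx x) = 1.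
Proof.
by rewrite -enorm_gt0 => x0; rewrite enormZ gtr0_norm ?invr_gt0// mulVf ?gt_eqF.
Qed.

Lemma nx_id y : unit_sphere y -> nx y = y.
Proof. by move=> y1; rewrite /nx y1 invr1 scale1r. Qed.

Lemma enorm_ray c y : unit_sphere y -> 0 < c -> enorm (c *: y) = c.
Proof. by move=> y1 c0; rewrite enormZ (y1 : enorm y = 1) mulr1 gtr0_norm. Qed.

Lemma nxZ c x : 0 < c -> nx (c *: x) = nx x.
Proof.
move=> c0; rewrite /nx enormZ gtr0_norm// scalerA.
have [->|x0] := eqVneq x 0; first by rewrite !scaler0.
by rewrite invfM mulrAC mulVf ?mul1r// gt_eqF.
Qed.

Lemma enorm_nxE x : enorm x *: nx x = x.
Proof.
have [->|x0] := eqVneq x 0; first by rewrite /nx !scaler0.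
by rewrite scalerA divff ?scale1r// enorm_eq0.
Qed.

Lemma unit_sphere_neq0 y : unit_sphere y -> y != 0.
Proof. by rewrite -enorm_gt0 => ->. Qed.

Lemma hextendE h x : hextend h x = h (nx x). Proof. by []. Qed.

Lemma hextend_sphere h y : unit_sphere y -> hextend h y = h y.
Proof. by move=> y1; rewrite hextendE nx_id. Qed.

Lemma hextendZ h c x : 0 < c -> hextend h (c *: x) = hextend h x.
Proof. by move=> c0; rewrite !hextendE nxZ. Qed.

Lemma isgrad_dotxx x : isgrad (fun z => dot z z) x (2 *: x).
Proof.
apply: isgrad_eq; first by apply: isgrad_sum => i; apply: isgradM; exact: isgrad_coord.
under eq_bigr do rewrite -scalerDl -mulr2n -mulr_natl -scalerA.
by rewrite -scaler_sumr -row_sum_delta'.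
Qed.

Lemma isgrad_enorm x : x != 0 -> isgrad (@enorm R n) x (nx x).
Proof.
move=> x0; have xx : 0 < dot x x by rewrite -enorm_sqr exprn_gt0// enorm_gt0.
rewrite (_ : @enorm R n = Num.sqrt \o (fun z => dot z z)); last first.
  by apply/funext => z; rewrite enormE.
apply: (isgrad_eq (isgrad_comp1 (isgrad_dotxx x) (is_derive1_sqrt xx))).
by rewrite scalerA -enormE invfM mulrAC mulVf// mul1r.
Qed.

Lemma near_neq0 x : x != 0 -> \forall z \near x, z != 0.
Proof.
move=> x0; have /cvgrPdist_lt/(_ _ (_ : 0 < enorm x)) := @continuous_enorm R n x.
rewrite enorm_gt0 => /(_ x0); apply: filterS => z; apply: contraTneq => ->.
by rewrite enorm0 subr0 ger0_norm ?enorm_ge0// ltxx.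
Qed.

Lemma continuous_nx x : x != 0 -> {for x, continuous nx}.
Proof.
move=> x0; apply: continuousZ; last exact: cvg_id.
by apply: continuousV; [rewrite enorm_eq0|exact: continuous_enorm].
Qed.

(** Continuity on the sphere, phrased for the extension away from the origin, so that measurability
    and differentiation in the ambient space apply directly. *)
Definition scont h := forall x, x != 0 -> {for x, continuous (hextend h)}.

Lemma within_scont h : {within unit_sphere, continuous h} -> scont h.
Proof.
move=> /subspace_continuousP ch x x0.
have Sx : unit_sphere (nx x) by exact: enorm_nx.
suff : h \o nx @ x --> h (nx x) by [].
apply: (cvg_comp nx h _ (ch _ Sx)) => P /= /(continuous_nx x0) nP.
by apply: filterS2 (near_neq0 x0) nP => z z0; apply; exact: enorm_nx.
Qed.

Lemma scont_continuous f : continuous f -> scont f.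
Proof. by move=> cf x x0; apply: (continuous_comp (continuous_nx x0)); exact: cf. Qed.

Lemma scont_hextend h : (forall x, x != 0 -> {for x, continuous h}) -> scont h.
Proof.
move=> cf x x0; apply: (continuous_comp (continuous_nx x0)).
by apply: cf; rewrite unit_sphere_neq0//; exact: enorm_nx.
Qed.

Lemma scont_cst (c : R) : scont (fun=> c).
Proof. by apply: scont_continuous => x; exact: cst_continuous. Qed.

Lemma scont_coord i : scont (fun x => x 0 i).
Proof. by apply: scont_continuous => x; exact: continuous_coord. Qed.

Lemma scontD f h : scont f -> scont h -> scont (fun x => f x + h x).
Proof. by move=> cf ch x x0; exact: continuousD (cf x x0) (ch x x0). Qed.

Lemma scontM f h : scont f -> scont h -> scont (fun x => f x * h x).
Proof. by move=> cf ch x x0; exact: continuousM (cf x x0) (ch x x0). Qed.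

Lemma scontN h : scont h -> scont (fun x => - h x).
Proof. by move=> ch x x0; exact: continuousN (ch x x0). Qed.

Lemma scontB f h : scont f -> scont h -> scont (fun x => f x - h x).
Proof. by move=> cf ch; apply: scontD => //; exact: scontN. Qed.

Lemma scontX f k : scont f -> scont (fun x => f x ^+ k).
Proof.
move=> cf; elim: k => [|k IH]; first by under eq_fun do rewrite expr0; exact: scont_cst.
by under eq_fun do rewrite exprS; exact: scontM.
Qed.

Lemma scont_sum (I : Type) (r : seq I) (F : I -> 'rV[R]_n -> R) :
  (forall i, scont (F i)) -> scont (fun x => \sum_(i <- r) F i x).
Proof. by move=> cF x x0; apply: continuous_sum => i; exact: cF. Qed.

Lemma scont_dot (F G : 'rV[R]_n -> 'rV[R]_n) : (forall i, scont (fun x => F x 0 i)) ->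
  (forall i, scont (fun x => G x 0 i)) -> scont (fun x => dot (F x) (G x)).
Proof. by move=> cF cG; apply: scont_sum => i; exact: scontM. Qed.

Lemma scont_comp (u : R -> R) h : (forall y, unit_sphere y -> {for h y, continuous u}) ->
  scont h -> scont (fun x => u (h x)).
Proof.
move=> cu ch x x0; apply: (continuous_comp (ch x x0)).
by apply: cu; exact: enorm_nx.
Qed.

Lemma scont_bounded h : scont h -> exists2 M : R, 0 <= M & forall y, unit_sphere y -> `|h y| <= M.
Proof.
move=> ch; have chS : {within @unit_sphere R n, continuous (hextend h)}.
  apply: continuous_in_subspaceT => y; rewrite inE => y1.
  by apply: ch; exact: unit_sphere_neq0.
have /compact_bounded[M [_ HM]] := continuous_compact chS compact_unit_sphere.
exists (`|M| + 1) => [|y y1]; first by rewrite addr_ge0.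
rewrite -(hextend_sphere h y1); apply: (HM (`|M| + 1)); last by exists y.
by rewrite (le_lt_trans (ler_norm _))// ltrDl.
Qed.

(* [sgrad h G]: the 0-homogeneous extension of [h] is continuously differentiable
   away from the origin, with gradient [G] on the sphere. *)
Definition sgrad h (G : 'rV[R]_n -> 'rV[R]_n) :=
  (forall x, x != 0 -> isgrad (hextend h) x ((enorm x)^-1 *: G (nx x))) /\
  (forall i, scont (fun x => G x 0 i)).

Lemma derivable_scale f c x v (l : R) : 0 < c -> is_derive (c *: x) v f l ->
  is_derive x v (fun z => f (c *: z)) (c * l).
Proof.
move=> c0 H.
have E : (fun t => f (c *: (x + t *: v))) = (fun s => f (c *: x + s *: v)) \o (fun t => t * c).
  by apply/funext => t /=; rewrite scalerDr scalerA mulrC.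
have D0 : is_derive (0 : R) 1 (fun t => f (c *: (x + t *: v))) (c * l).
  have H1 : is_derive (c *: x + 0 *: v) v f l by rewrite scale0r addr0.
  have H' := is_derive_line H1; rewrite E mulrC.
  have M := is_derive_mulr c (0 : R).
  have H0 : is_derive (0 * c : R) 1 (fun s => f (c *: x + s *: v)) l by rewrite mul0r.
  exact: (@is_derive1_comp R (fun s => f (c *: x + s *: v)) (fun t => t * c) 0 _ _ H0 M).
have E2 : (fun t : R => t^-1 *: (((fun z => f (c *: z)) \o shift x) (t *: v) - f (c *: x))) =
    (fun t : R => t^-1 *: (((fun t => f (c *: (x + t *: v))) \o shift (0 : R)) (t *: 1) - f (c *: (x + 0 *: v)))).
  by apply/funext => t /=; rewrite scale0r !addr0 [t *: 1]mulr1 [t *: v + x]addrC.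
by case: D0 => D1 D2; split; rewrite /derivable /derive E2.
Qed.

(** The hypothesis gives partial derivatives at points of the sphere only. Homogeneity carries them
    to the whole punctured space with a factor [1 / |x|]; there they are continuous, and the C^1
    criterion yields a gradient. *)
Lemma sphere_C1_sgrad h : sphere_C1 h -> sgrad h (tgrad h).
Proof.
move=> [ch dh].
have ct i : scont (tpartial i h) by apply: within_scont; have [] := dh i.
split; last first.
  by move=> i; under eq_fun do rewrite mxE; exact: ct.
have D i x : x != 0 -> is_derive x (delta_mx 0 i) (hextend h) ((enorm x)^-1 * hextend (tpartial i h) x).
  move=> x0; have Sx : unit_sphere (nx x) by exact: enorm_nx.
  have ex : 0 < (enorm x)^-1 by rewrite invr_gt0 enorm_gt0.
  have [/(_ _ Sx) /derivableP dx _] := dh i.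
  have := derivable_scale ex dx.
  by under eq_fun do rewrite hextendZ//.
have P i x : x != 0 -> partial i (hextend h) x = (enorm x)^-1 * hextend (tpartial i h) x.
  by move=> x0; have [_] := D i x x0.
move=> x x0; rewrite (_ : _ *: _ = grad (hextend h) x); last first.
  by apply/rowP => i; rewrite !mxE P.
apply: isgrad_C1_at => [|i].
  by apply: filterS (near_neq0 x0) => z z0 i; have [] := D i z z0.
rewrite /prop_for /continuous_at P//.
have E : {near x, (fun z => (enorm z)^-1 * hextend (tpartial i h) z) =1 partial i (hextend h)}.
  by near=> z; rewrite P//; near: z; exact: near_neq0.
apply: cvg_trans; first exact: near_eq_cvg E.
apply: cvgM; last exact: ct.
by apply: cvgV; [rewrite enorm_eq0|exact: continuous_enorm].
Unshelve. all: by end_near. Qed.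

Lemma sgrad_scont h G : sgrad h G -> scont h.
Proof. by move=> [hG _] x x0; have := hG x x0; exact: isgrad_continuous. Qed.

Lemma sgrad_isgrad h G y : sgrad h G -> unit_sphere y -> isgrad (hextend h) y (G y).
Proof.
move=> [hG _] y1; have := hG y (unit_sphere_neq0 y1).
by rewrite nx_id// y1 invr1 scale1r.
Qed.

(** The extension is constant along rays, so its radial derivative vanishes. *)
Lemma sgrad_tangent h G y : sgrad h G -> unit_sphere y -> dot (G y) y = 0.
Proof.
move=> hG y1; have H := isgrad_derive y (sgrad_isgrad hG y1).
have [|_ <-] := @is_derive_ray _ _ (hextend h) y 1 (dot (G y) y); first by rewrite scale1r.
rewrite (@near_eq_derive _ _ _ _ (cst (h y))); first exact: derive_cst.
near=> s; rewrite hextendZ ?hextend_sphere//.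
by near: s; exact: lt_nbhsr.
Unshelve. all: by end_near. Qed.

End radial_projection.

Ltac scont := cbv beta; first [match goal with H : scont ?f |- scont ?f => exact: H end | lazymatch goal with
  | |- scont (fun _ => ?c) => exact: scont_cst
  | |- scont (fun y => _ + - _) => apply: scontB; scont
  | |- scont (fun y => _ + _) => apply: scontD; scont
  | |- scont (fun y => - _) => apply: scontN; scont
  | |- scont (fun y => _ * _) => apply: scontM; scont
  | |- scont (fun y => _ ^+ _) => apply: scontX; scont
  | |- scont (fun y => \sum_(i <- _ | _) _) => apply: scont_sum => ?; scont
  | |- _ => first [done | exact: scont_coord | apply: scont_dot => ?; scont]
  end].

(** * Lebesgue measure under affine maps and isometries *)

Section lebesgue_1d.
Context {R : realType}.
Local Open Scope ereal_scope.

Variables c a : R.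
Hypothesis c0 : c != 0%R.

Let phi : measurableTypeR R -> measurableTypeR R := fun t => (c * t + a)%R.

Let mphi : measurable_fun setT phi.
Proof.
have : measurable_fun setT (fun t : R => (c * t + a)%R).
  by apply: measurable_funD => //; exact: measurable_funM.
exact.
Qed.

Let m1 := measure_function_pushforward__canonical__measure_function_Measure
  (@lebesgue_measure R) mphi.

Let c1 : (0 <= `|c|)%R. Proof. by []. Qed.

(** Uniqueness of Lebesgue measure reduces this to half-open intervals. A negative [c] exchanges the
    included endpoint, without effect on the length. *)
Let lebesgue_affine (A : set R) : measurable A -> lebesgue_measure A = mscale (NngNum c1) m1 A.
Proof.
move=> mA; apply: (@lebesgue_measure_unique R (mscale (NngNum c1) m1)) => // _ [[x y] _ <-] /=.
rewrite /mscale /= /pushforward.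
have [cpos|cneg|/eqP] := ltrgtP c 0%R; last by rewrite (negbTE c0).
- have -> : phi @^-1` `]x, y] = `[((y - a) / c)%R, ((x - a) / c)%R[%classic.
    apply/seteqP; split=> t; rewrite /= !in_itv/= /phi.
      move=> /andP[h1 h2]; rewrite ler_ndivrMr// ltr_ndivlMr// mulrC lerBrDr h2 /= ltrBlDr//.
    by move=> /andP[]; rewrite ler_ndivrMr// ltr_ndivlMr// mulrC lerBrDr ltrBlDr => -> ->.
  rewrite !lebesgue_measure_itv/= !lte_fin ltr_ndivrMr// mulrVK ?unitfE// ltrD2r.
  case: ifPn; rewrite ?mule0// => xy; rewrite -!EFinD -EFinM ltr0_norm//.
  by congr _%:E; field.
- have -> : phi @^-1` `]x, y] = `]((x - a) / c)%R, ((y - a) / c)%R]%classic.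
    apply/seteqP; split=> t; rewrite /= !in_itv/= /phi.
      by move=> /andP[h1 h2]; rewrite ler_pdivlMr// ltr_pdivrMr// mulrC lerBrDr h2 /= ltrBlDr h1.
    by move=> /andP[]; rewrite ler_pdivlMr// ltr_pdivrMr// mulrC lerBrDr ltrBlDr => -> ->.
  rewrite !lebesgue_measure_itv/= !lte_fin ltr_pdivrMr// mulrVK ?unitfE// ltrD2r.
  case: ifPn; rewrite ?mule0// => xy; rewrite -!EFinD -EFinM gtr0_norm//.
  by congr _%:E; field.
Qed.

Lemma ge0_integral_affine (f : R -> \bar R) : measurable_fun setT f -> (forall t, 0 <= f t) ->
  \int[lebesgue_measure]_t f t = `|c|%:E * \int[lebesgue_measure]_t f (c * t + a)%R.
Proof.
move=> mf f0; transitivity (\int[mscale (NngNum c1) m1]_t f t).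
  by apply: eq_measure_integral => A mA _; exact: lebesgue_affine.
rewrite ge0_integral_mscale//=; congr (_ * _).
exact: (@ge0_integral_pushforward _ _ _ _ R phi mphi lebesgue_measure setT f measurableT mf (fun y _ => f0 y)).
Qed.

End lebesgue_1d.

Section lebesgue_rV_theory.
Context {R : realType}.
Local Open Scope ereal_scope.

Lemma ge0_integral_rV_cons n (f : 'rV[R]_n.+1 -> \bar R) :
  measurable_fun setT f -> (forall x, 0 <= f x) ->
  \int[lebesgue_rV n.+1]_x f x =
  \int[lebesgue_measure]_t \int[lebesgue_rV n]_v f (rV_cons (t, v)).
Proof.
move=> mf f0.
pose rc : measurableTypeR R * 'rV[R]_n -> 'rV[R]_n.+1 := @rV_cons R n.
have mc : measurable_fun setT rc := @measurable_rV_cons R n.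
transitivity (\int[lebesgue_measure \x lebesgue_rV n]_p f (rc p)).
  exact: (@ge0_integral_pushforward _ _ _ _ R rc mc
    (lebesgue_measure \x lebesgue_rV n) setT f measurableT mf (fun y _ => f0 y)).
rewrite (fubini_tonelli1 (f \o rc)) => [//||p]; last exact: f0.
exact: (measurableT_comp mf mc).
Qed.

Lemma measurable_affine n (c : R) (a : 'rV[R]_n) :
  measurable_fun setT (fun x : 'rV[R]_n => c *: x + a)%R.
Proof.
apply: measurable_fun_rV => i; under eq_fun do rewrite !mxE.
by apply: measurable_funD => //; apply: measurable_funM => //; exact: measurable_coord.
Qed.

Lemma rV_cons_affine n (c t : R) (v : 'rV[R]_n) (a : 'rV[R]_n.+1) :
  (c *: rV_cons (t, v) + a)%R =
  rV_cons ((c * t + a 0%R ord0)%R, (c *: v + (rV_uncons a).2)%R).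
Proof. by apply/rowP => i; rewrite !mxE /=; case: unliftP => [j ->|->]; rewrite ?mxE. Qed.

(** Lebesgue measure on R^n is built by adding a first coordinate, so the induction peels it off and
    uses the one-dimensional case; every coordinate contributes one factor [|c|]. *)
Lemma ge0_integral_rV_affine n (c : R) (a : 'rV[R]_n) (f : 'rV[R]_n -> \bar R) :
  c != 0%R -> measurable_fun setT f -> (forall x, 0 <= f x) ->
  \int[lebesgue_rV n]_x f x =
  (`|c| ^+ n)%:E * \int[lebesgue_rV n]_x f (c *: x + a)%R.
Proof.
move=> c0; elim: n a f => [|n IH] a f mf f0.
  rewrite expr0 mul1e; congr integral; apply/funext => x; congr f.
  by apply/rowP => -[].
rewrite !ge0_integral_rV_cons//; last exact: (measurableT_comp mf (measurable_affine c a)).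
have mfc : measurable_fun setT (fun p => f (@rV_cons R n p)).
  exact: (measurableT_comp mf (@measurable_rV_cons R n)).
have mg : measurable_fun setT (fun t : R => \int[lebesgue_rV n]_v f (rV_cons (t, v))).
  exact: (measurable_fun_fubini_tonelli_F (m2 := lebesgue_rV n) _ mfc).
rewrite (@ge0_integral_affine _ _ (a 0%R ord0) c0 _ mg); last by move=> t; exact: integral_ge0.
rewrite exprS EFinM -muleA; congr (_ * _).
rewrite -ge0_integralZl//; last 2 first.
- have mh : measurable_fun setT (fun p => f (c *: @rV_cons R n p + a)%R).
    exact: (measurableT_comp (measurableT_comp mf (measurable_affine c a)) (@measurable_rV_cons R n)).
  exact: (measurable_fun_fubini_tonelli_F (m2 := lebesgue_rV n) _ mh (fun p => f0 _)).
- by move=> t _; exact: integral_ge0.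
apply: eq_integral => t _; rewrite (IH (rV_uncons a).2 (fun v => f (rV_cons ((c * t + a 0%R ord0)%R, v))))//.
  by congr (_ * _); apply: eq_integral => v _; rewrite rV_cons_affine.
exact: (measurableT_comp mfc (@measurable_pair1 _ _ _ _ _)).
Qed.

Lemma measurable_mem d (T : measurableType d) (D : set T) : measurable D -> measurable_fun setT (fun x => x \in D).
Proof. by move=> mD; apply: (measurable_fun_bool true); rewrite setTI preimage_mem_true. Qed.

End lebesgue_rV_theory.

Section lebesgue_rV_invariance.
Context {R : realType}.
Local Open Scope ereal_scope.
Local Notation leb n := (@lebesgue_rV R n).

Definition cube n (r : R) := [set x : 'rV[R]_n | forall i, (`|x 0%R i| <= r)%R].

Arguments cube : clear implicits.

Lemma measurable_cube n r : measurable (cube n r).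
Proof.
have -> : cube n r = \big[setI/setT]_i
    ((fun x : 'rV[R]_n => x 0%R i) @^-1` [set t | (`|t| <= r)%R]).
  apply/seteqP; split=> [x bx|x]; first by rewrite -bigcap_seq => i _; exact: bx.
  by rewrite -bigcap_seq => bx i; apply: bx => /=; rewrite mem_index_enum.
apply: bigsetI_measurable => i _; rewrite -[X in measurable X]setTI.
apply: measurable_coord => //.
rewrite (_ : [set t | _] = `[(- r)%R, r]%classic)//.
by apply/seteqP; split=> t /=; rewrite in_itv/= ler_norml.
Qed.

(** Cubes are products, hence have an explicit measure. They serve to bound the measure of balls
    from above and from below. *)
Lemma lebesgue_cube n (r : R) : (0 <= r)%R -> leb n (cube n r) = ((r *+ 2) ^+ n)%:E.
Proof.
move=> r0; elim: n => [|n IH].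
  by rewrite expr0 /= diracE mem_set// => -[].
have mi k : measurable_fun setT (fun x : 'rV[R]_k => (\1_(cube k r) x)%:E).
  by apply/measurable_EFinP; apply: measurable_indic; exact: measurable_cube.
have IHi : \int[leb n]_x (\1_(cube n r) x)%:E = ((r *+ 2) ^+ n)%:E.
  by rewrite integral_indic ?setIT//; exact: measurable_cube.
transitivity (\int[leb n.+1]_x (\1_(cube n.+1 r) x)%:E).
  by rewrite integral_indic ?setIT//; exact: measurable_cube.
rewrite ge0_integral_rV_cons//.
under eq_integral => t _.
  rewrite (_ : (fun v => _) = (fun v => (\1_`[(- r)%R, r] t)%:E * (\1_(cube n r) v)%:E)); last first.
    apply/funext => v; rewrite -EFinM !indicE.
    have -> : (rV_cons (t, v) \in cube n.+1 r) = (t \in `[(- r)%R, r]%classic) && (v \in cube n r).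
      apply/idP/andP; rewrite !inE /cube/= in_itv/= -ler_norml.
        move=> h; split; first by have := h ord0; rewrite mxE unlift_none.
        by move=> i; have := h (lift ord0 i); rewrite mxE liftK.
      by move=> [h1 h2] i; rewrite mxE; case: unliftP => [j _|_].
    by rewrite -natrM mulnb.
  rewrite ge0_integralZl//; last exact: mi.
  rewrite IHi; over.

rewrite ge0_integralZr//; last 2 first.
- by apply/measurable_EFinP; exact: measurable_indic.
- by rewrite lee_fin exprn_ge0// mulrn_wge0.
rewrite exprS EFinM; congr (_ * _).
transitivity (lebesgue_measure `[(- r)%R, r]%classic).
  by rewrite [LHS]integral_indic// setIT.
rewrite lebesgue_measure_itv/= lte_fin.
case: ifPn => [_|]; first by rewrite -EFinD opprK mulr2n.
rewrite -leNgt => h; have -> : r = 0%R by apply/eqP; rewrite eq_le r0 andbT; lra.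
by rewrite mul0rn.
Qed.

Lemma lebesgue_bounded n (A : set 'rV[R]_n) (r : R) :
  measurable A -> (forall x, A x -> (enorm x <= r)%R) -> leb n A < +oo.
Proof.
move=> mA Ar; have mC := @measurable_cube n (`|r|)%R.
apply: (@le_lt_trans _ _ (leb n (cube n `|r|))).
  apply: le_measure; rewrite ?inE// => x /Ar xr i.
  by rewrite (le_trans (coord_le_enorm x i))// (le_trans xr)// ler_norm.
by rewrite lebesgue_cube// ltry.
Qed.

Lemma lebesgue_unit_ball_fin n : leb n (@unit_ball R n) < +oo.
Proof.
apply: (@lebesgue_bounded _ _ 1); first exact: measurable_unit_ball.
by move=> x /ltW.
Qed.

Lemma lebesgue_unit_ball_gt0 n : 0 < leb n (@unit_ball R n).
Proof.
pose r : R := (n.+1%:R^-1)%R; have r0 : (0 < r)%R by rewrite invr_gt0.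
have mC := @measurable_cube n r.
apply: (@lt_le_trans _ _ (leb n (cube n r))).
  by rewrite lebesgue_cube ?ltW// lte_fin exprn_gt0// mulrn_wgt0.
apply: le_measure; rewrite ?inE//; first exact: measurable_unit_ball.
move=> x /= xr; rewrite /unit_ball/= (le_lt_trans (enorm_le_sum x))//.
rewrite (le_lt_trans (ler_sum _ (fun i _ => xr i)))//.
by rewrite sumr_const card_ord -mulr_natl /r ltr_pdivrMr// mul1r ltr_nat.
Qed.

Definition ballvol n : R := fine (leb n (@unit_ball R n)).

Lemma ballvolE n : leb n (@unit_ball R n) = (ballvol n)%:E.
Proof.
by rewrite fineK// ge0_fin_numE ?lebesgue_unit_ball_fin// ltW ?lebesgue_unit_ball_gt0.
Qed.

Lemma ballvol_gt0 n : (0 < ballvol n)%R.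
Proof. by rewrite -lte_fin -ballvolE lebesgue_unit_ball_gt0. Qed.

(* Both Lebesgue measure and its image under [s] are translation invariant, and
   they agree on the unit ball: Tonelli's theorem, applied to
   [f (s x) * 1_B (y - s x)], shows that they are equal. *)
Lemma ge0_integral_isometry n (s : 'rV[R]_n -> 'rV[R]_n) (f : 'rV[R]_n -> \bar R) :
  measurable_fun setT s -> (forall x y, s (x - y) = s x - s y)%R ->
  involutive s -> (forall x, enorm (s x) = enorm x) ->
  measurable_fun setT f -> (forall x, 0 <= f x) ->
  \int[leb n]_x f (s x) = \int[leb n]_x f x.
Proof.
move=> ms sB ss es mf f0.
have V0 := ballvol_gt0 n.
pose b x : \bar R := (\1_(@unit_ball R n) x)%:E.
have b0 x : 0 <= b x by rewrite lee_fin.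
have mb : measurable_fun setT b.
  by apply/measurable_EFinP; apply: measurable_indic; exact: measurable_unit_ball.
have bE x y : enorm x = enorm y -> b x = b y.
  move=> xy; rewrite /b !indicE (_ : (x \in _) = (y \in @unit_ball R n))//.
  by apply/idP/idP; rewrite !inE /unit_ball/= xy.
have intb : \int[leb n]_x b x = (ballvol n)%:E.
  rewrite integral_indic//; first by rewrite setIT; exact: ballvolE.
  exact: measurable_unit_ball.
have mfs : measurable_fun setT (f \o s) by exact: measurableT_comp.
have mbs : measurable_fun setT (b \o s) by exact: measurableT_comp.
have msub : measurable_fun setT (fun p : 'rV[R]_n * 'rV[R]_n => p.2 - s p.1)%R.
  apply: measurable_fun_rV => i; under eq_fun do rewrite !mxE.
  apply: measurable_funB; first exact: (measurableT_comp (measurable_coord i) measurable_snd).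
  exact: (measurableT_comp (measurable_coord i) (measurableT_comp ms measurable_fst)).
have m1 : measurable_fun setT (fun p : 'rV[R]_n * 'rV[R]_n => f (s p.1) * b (p.2 - s p.1)%R).
  apply: emeasurable_funM; first exact: (measurableT_comp mfs measurable_fst).
  exact: (measurableT_comp mb msub).
have m2 : measurable_fun setT (fun p : 'rV[R]_n * 'rV[R]_n => f (p.2 - s p.1)%R * b p.1).
  apply: emeasurable_funM; first exact: (measurableT_comp mf msub).
  exact: (measurableT_comp mb measurable_fst).
have sh (a : 'rV[R]_n) (g : 'rV[R]_n -> \bar R) : measurable_fun setT g -> (forall x, 0 <= g x) ->
    \int[leb n]_x g (x - a)%R = \int[leb n]_x g x.
  move=> mg g0; rewrite [RHS](ge0_integral_rV_affine (c := 1) (- a)%R)//.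
  by rewrite normr1 expr1n mul1e; under [RHS]eq_integral do rewrite scale1r.
have rf (a : 'rV[R]_n) (g : 'rV[R]_n -> \bar R) : measurable_fun setT g -> (forall x, 0 <= g x) ->
    \int[leb n]_x g (a - x)%R = \int[leb n]_x g x.
  move=> mg g0; rewrite [RHS](ge0_integral_rV_affine (c := -1) a)//.
  rewrite normrN1 expr1n mul1e; under [RHS]eq_integral do rewrite scaleN1r addrC.
  by [].
have E : (\int[leb n]_x f (s x)) * (ballvol n)%:E = (\int[leb n]_x f x) * (ballvol n)%:E.
  rewrite -intb; transitivity (\int[leb n]_x \int[leb n]_y (f (s x) * b (y - s x)%R)).
    rewrite -ge0_integralZr//; last exact: integral_ge0.
    apply: eq_integral => x _; rewrite -(sh (s x) b)// -ge0_integralZl//.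
    by apply: (measurableT_comp mb); exact: (measurableT_comp msub (@measurable_pair1 _ _ _ _ _)).
  rewrite (fubini_tonelli (m1 := leb n) (m2 := leb n) (fun p => f (s p.1) * b (p.2 - s p.1)%R))//=; last first.
    by move=> p; exact: mule_ge0.
  transitivity (\int[leb n]_y \int[leb n]_x (f (y - s x)%R * b x)).
    (* The substitution of [s y - x] for [x] turns [s x] into [y - s x], and the argument of the
       ball indicator into [s x], of the same length as [x]. *)
    apply: eq_integral => y _; rewrite -(rf (s y) (fun x => f (s x) * b (y - s x)%R)).
    - apply: eq_integral => x _; rewrite sB ss; congr (_ * _).
      by apply: bE; rewrite opprB addrCA subrr addr0 es.
    - exact: (measurableT_comp m1 (@measurable_pair2 _ _ _ _ _)).
    - by move=> x; exact: mule_ge0.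
  rewrite -(fubini_tonelli (m1 := leb n) (m2 := leb n) (fun p => f (p.2 - s p.1)%R * b p.1))//=; last first.
    by move=> p; exact: mule_ge0.
  rewrite -ge0_integralZl//; last exact: integral_ge0.
  apply: eq_integral => x _; rewrite ge0_integralZr//; last first.
    by apply: (measurableT_comp mf); exact: (measurableT_comp msub (@measurable_pair1 _ _ _ _ _)).
  by rewrite (sh (s x) f).
by apply/eqP; rewrite eq_le -(@lee_pmul2r _ (ballvol n)%:E)// E lexx/= -(@lee_pmul2r _ (ballvol n)%:E)// E.
Qed.

End lebesgue_rV_invariance.
Arguments cube {R} n r.
Arguments ballvol {R} n.

(** * Polar coordinates *)

Section polar.
Context {R : realType} {n : nat}.
Implicit Types (f h : 'rV[R]_n -> R) (x y : 'rV[R]_n).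

Definition pball : set 'rV[R]_n := [set x | x != 0 /\ enorm x < 1].

Lemma measurable_pball : measurable pball.
Proof. by apply: measurableI; [exact: measurable_neq0|exact: measurable_unit_ball]. Qed.

Lemma integrable_bounded (D : set 'rV[R]_n) f (r M : R) : measurable D ->
  (forall x, D x -> enorm x <= r) -> measurable_fun D f ->
  (forall x, D x -> `|f x| <= M) -> leb.-integrable D (EFin \o f).
Proof.
move=> mD Dr mf fM; apply: measurable_bounded_integrable => //.
  exact: lebesgue_bounded Dr.
exists M; split; first exact: num_real.
by move=> K MK x Dx /=; exact: le_trans (fM x Dx) (ltW MK).
Qed.

Lemma measurable_hextend h : scont h -> measurable_fun setT (hextend h).
Proof. by move=> ch; apply: measurable_away0. Qed.

Lemma integrable_hextend h : scont h -> leb.-integrable pball (EFin \o hextend h).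
Proof.
move=> ch; have [M _ HM] := scont_bounded ch.
apply: (@integrable_bounded _ _ 1 M).
- exact: measurable_pball.
- by move=> x [_ /ltW].
- by apply: measurable_funTS; exact: measurable_hextend.
- by move=> x [x0 _]; apply: HM; exact: enorm_nx.
Qed.

(** Plays the role of the surface integral divided by [n], the factor coming from the integral of
    [r^(n-1)] over (0,1). *)
Definition sA h : R := \int[leb]_(x in pball) hextend h x.

Lemma eq_sA f h : (forall y, unit_sphere y -> f y = h y) -> sA f = sA h.
Proof.
move=> fh; apply: eq_Rintegral => x; rewrite inE => -[x0 _].
by rewrite !hextendE fh//; exact: enorm_nx.
Qed.

Lemma sAD f h : scont f -> scont h -> sA (fun y => f y + h y) = sA f + sA h.
Proof.
by move=> cf ch; rewrite /sA RintegralD//; [exact: measurable_pball|exact: integrable_hextend..].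
Qed.

Lemma sAZ c h : scont h -> sA (fun y => c * h y) = c * sA h.
Proof.
by move=> ch; rewrite /sA RintegralZl//; [exact: measurable_pball|exact: integrable_hextend].
Qed.

Lemma sAB f h : scont f -> scont h -> sA (fun y => f y - h y) = sA f - sA h.
Proof.
by move=> cf ch; rewrite /sA RintegralB//; [exact: measurable_pball|exact: integrable_hextend..].
Qed.

Lemma sA_cst c : sA (fun=> c) = c * sA (fun=> 1).
Proof.
rewrite -(sAZ c (@scont_cst _ _ 1)); congr sA; apply/funext => y; by rewrite mulr1.
Qed.

Lemma sA0 : sA (fun=> 0) = 0.
Proof. by rewrite sA_cst mul0r. Qed.

Lemma sA_sum (I : Type) (r : seq I) (F : I -> 'rV[R]_n -> R) :
  (forall i, scont (F i)) -> sA (fun x => \sum_(i <- r) F i x) = \sum_(i <- r) sA (F i).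
Proof.
move=> cF; elim: r => [|i r IH].
  by rewrite big_nil -[RHS]sA0; under eq_fun do rewrite big_nil.
by rewrite big_cons -IH -sAD//; [under eq_fun do rewrite big_cons|exact: scont_sum].
Qed.

Lemma le_sA f h : scont f -> scont h -> (forall y, unit_sphere y -> f y <= h y) -> sA f <= sA h.
Proof.
move=> cf ch fh; apply: le_Rintegral.
- exact: measurable_pball.
- exact: integrable_hextend.
- exact: integrable_hextend.
- by move=> x [x0 _]; apply: fh; exact: enorm_nx.
Qed.

Lemma sA_ge0 h : (forall y, unit_sphere y -> 0 <= h y) -> 0 <= sA h.
Proof. by move=> h0; apply: Rintegral_ge0 => x [x0 _]; apply: h0; exact: enorm_nx. Qed.

Lemma norm_sA_le h M : scont h -> (forall y, unit_sphere y -> `|h y| <= M) ->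
  `|sA h| <= M * sA (fun=> 1).
Proof.
move=> ch hM; rewrite ler_norml -mulNr -!sA_cst; apply/andP; split; apply: le_sA => //.
- exact: scont_cst.
- by move=> y /hM; rewrite ler_norml => /andP[].
- exact: scont_cst.
- by move=> y /hM; rewrite ler_norml => /andP[].
Qed.

Hypothesis n0 : (0 < n)%N.

Lemma lebesgue_set0 : leb [set 0 : 'rV[R]_n] = 0%E.
Proof.
apply/eqP; rewrite eq_le measure_ge0 andbT; apply/lee_addgt0Pr => e e0; rewrite add0e.
pose r := Num.min 1 e / 2; have r0 : 0 < r by rewrite divr_gt0// lt_min ltr01.
apply: (@le_trans _ _ (leb (cube n r))).
  apply: le_measure; rewrite ?inE; [exact: measurable_zero|exact: measurable_cube|].
  by move=> x -> i; rewrite mxE normr0 ltW.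
rewrite (lebesgue_cube _ (ltW r0)) lee_fin.
have -> : r *+ 2 = Num.min 1 e by rewrite -mulr_natr /r mulfVK.
rewrite -(prednK n0) exprS; apply: (@le_trans _ _ (Num.min 1 e * 1)).
  have m0' : 0 <= Num.min 1 e by rewrite le_min ler01 ltW.
  by apply: ler_wpM2l => //; apply: exprn_ile1 => //; rewrite ge_min lexx.
by rewrite mulr1 ge_min lexx orbT.
Qed.

Lemma inv_measurable : measurable_fun setT (@GRing.inv R).
Proof.
have -> : [set: R] = [set 0] `|` [set r | r != 0].
  by apply/seteqP; split=> // r _; have [->|] := eqVneq r 0; [left|right].
have o0 : open [set r : R | r != 0] by exact: open_neq.
apply/measurable_funU => //; first exact: open_measurable.
split; first exact: measurable_fun_set1.
apply: open_continuous_measurable_fun => // r; rewrite inE/= => r0.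
exact: inv_continuous.
Qed.

Lemma measurable_exprV k : measurable_fun setT (fun r : R => r ^- k).
Proof.
have -> : (fun r : R => r ^- k) = (fun r => (r^-1) ^+ k) by apply/funext => r; rewrite exprVn.
by apply: (measurableT_comp (@exprn_measurable _ _ k)); exact: inv_measurable.
Qed.

(** Normalises the density along rays that the proof of the polar formula inserts as an additional
    integral. *)
Lemma integral_ray_tail (a : R) : 0 < a ->
  (\int[lebesgue_measure]_(r in `]a, +oo[) (n%:R * r ^- n.+1)%:E = (a ^- n)%:E)%E.
Proof.
move=> a0.
have dF (x : R) : x != 0 -> is_derive x 1 (fun r : R => - r ^- n) (n%:R * x ^- n.+1).
  by move=> x0; apply: (is_derive_eq (is_deriveN (is_deriveVX n x0))); rewrite mulNr opprK.
rewrite integral_itv_obnd_cbnd; last first.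
  by apply/measurable_EFinP; apply: measurable_funM => //; apply: measurable_funTS; exact: measurable_exprV.
rewrite (@ge0_continuous_FTC2y R (fun r => n%:R * r ^- n.+1) (fun r => - r ^- n) a 0).
- by rewrite -EFinB sub0r opprK.
- by move=> x ax; rewrite mulr_ge0// invr_ge0 exprn_ge0// (le_trans _ ax) ?ltW.
- apply: continuous_in_subspaceT => x; rewrite inE/= in_itv/= andbT => ax.
  have x0 : 0 < x by apply: lt_le_trans ax.
  apply: cvgM; first exact: cvg_cst.
  apply: cvgV; first by rewrite expf_neq0// gt_eqF.
  exact: exprn_continuous.
- apply/cvgrPdist_lt => e e0; near=> r.
  have r1 : 1 < r by near: r; apply: nbhs_pinfty_gt; exact: num_real.
  have re : e^-1 < r by near: r; apply: nbhs_pinfty_gt; exact: num_real.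
  rewrite sub0r opprK ger0_norm ?invr_ge0 ?exprn_ge0 ?(le_trans ler01 (ltW r1))//.
  apply: (@le_lt_trans _ _ r^-1); last by rewrite invf_plt// posrE (lt_trans _ r1).
  by rewrite lef_pV2 ?posrE ?exprn_gt0 ?(lt_trans _ r1)// -[leLHS]expr1 ler_eXn2l.
- by move=> x ax; have [] := dF x (lt0r_neq0 (lt_trans a0 ax)).
- apply: cvg_at_right_filter; have := dF a (lt0r_neq0 a0); exact: is_derive_continuous.
- move=> x; rewrite in_itv/= andbT => ax.
  by rewrite derive1E; have [_ ] := dF x (lt0r_neq0 (lt_trans a0 ax)).
Unshelve. all: by end_near. Qed.

(** The value [f x] is spread over the radii [r > |x|] with the density [n |x|^n r^(-n-1)] of total
    mass 1 (function [H']). Exchanging the integrals and scaling [x] by [r] moves the inner domain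
    to the unit ball (function [H]). After exchanging back, the substitution [s = r |x|] leaves an
    integral along each ray. *)
Lemma ge0_polar (f : 'rV[R]_n -> R) : measurable_fun setT f -> (forall x, 0 <= f x) ->
  (\int[leb]_(x in [set x | x != 0%R]) (f x)%:E =
   \int[leb]_(x in pball) \int[lebesgue_measure]_(s in `]0%R, +oo[)
      (n%:R * s ^+ n.-1 * f (s *: nx x))%:E)%E.
Proof.
move=> mf f0.
pose G x s := if [&& x != 0, enorm x < 1 & 0 < s] then n%:R * s ^+ n.-1 * f (s *: nx x) else 0.
pose H x r := if [&& x != 0, enorm x < 1 & 0 < r] then n%:R * r ^+ n.-1 * enorm x ^+ n * f (r *: x) else 0.
pose H' x r := if (x != 0) && (enorm x < r) then n%:R * r ^- n.+1 * enorm x ^+ n * f x else 0.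
have mneq : measurable_fun setT (fun x : 'rV[R]_n => x != 0).
  have -> : (fun x : 'rV[R]_n => x != 0) = (fun x => 0 < enorm x).
    by apply/funext => x; rewrite enorm_gt0.
  by apply: measurable_fun_ltr => //; exact: measurable_enorm.
have mfst (g : 'rV[R]_n -> R) : measurable_fun setT g ->
    measurable_fun setT (fun p : 'rV[R]_n * R => g p.1).
  by move=> mg; exact: (measurableT_comp mg measurable_fst).
have msnd (g : R -> R) : measurable_fun setT g ->
    measurable_fun setT (fun p : 'rV[R]_n * R => g p.2).
  by move=> mg; exact: (measurableT_comp mg measurable_snd).
have mexp k : measurable_fun setT (fun r : R => r ^+ k) by exact: exprn_measurable.
have mH : measurable_fun setT (fun p => (H p.1 p.2)%:E).
  apply/measurable_EFinP; apply: measurable_fun_ifT => //.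
    apply: measurable_and; first exact: (measurableT_comp mneq measurable_fst).
    apply: measurable_and.
      by apply: measurable_fun_ltr => //; apply: mfst; exact: measurable_enorm.
    by apply: measurable_fun_ltr => //; exact: measurable_snd.
  apply: measurable_funM; first apply: measurable_funM; first apply: measurable_funM => //.
  - exact: (msnd (fun r => r ^+ n.-1)).
  - by apply: (mfst (fun x => enorm x ^+ n)); apply: (measurableT_comp (mexp n)); exact: measurable_enorm.
  - apply: (measurableT_comp mf); apply: measurable_fun_rV => i; under eq_fun do rewrite mxE.
    by apply: measurable_funM; [exact: measurable_snd|apply: (mfst (fun x => x 0 i)); exact: measurable_coord].
have mH' : measurable_fun setT (fun p => (H' p.1 p.2)%:E).
  apply/measurable_EFinP; apply: measurable_fun_ifT => //.
    apply: measurable_and; first exact: (measurableT_comp mneq measurable_fst).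
    by apply: measurable_fun_ltr; [apply: mfst; exact: measurable_enorm|exact: measurable_snd].
  apply: measurable_funM; last exact: mfst.
  apply: measurable_funM; last first.
    by apply: (mfst (fun x => enorm x ^+ n)); apply: (measurableT_comp (mexp n)); exact: measurable_enorm.
  apply: (msnd (fun r => n%:R * r ^- n.+1)); apply: measurable_funM => //.
  exact: measurable_exprV.
have nn k (a : R) : 0 < a -> 0 <= n%:R * a ^+ k by move=> a0; rewrite mulr_ge0// exprn_ge0// ltW.
have H0 p : (0%:E <= (H p.1 p.2)%:E)%E.
  rewrite lee_fin /H; case: ifPn => // /and3P[_ _ r0].
  by rewrite !mulr_ge0// exprn_ge0// ?enorm_ge0 ?ltW.
have H'0 p : (0%:E <= (H' p.1 p.2)%:E)%E.
  rewrite lee_fin /H'; case: ifPn => // /andP[_ r0].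
  by rewrite !mulr_ge0// ?invr_ge0 exprn_ge0 ?enorm_ge0// (le_trans _ (ltW r0))// enorm_ge0.
transitivity (\int[leb]_x \int[lebesgue_measure]_r (H' x r)%:E)%E.
  rewrite integral_mkcond; apply: eq_integral => x _; rewrite patchE.
  case: ifPn; rewrite ?inE/=; last first.
    move=> /negP; rewrite inE/= => /negP/negPn x0.
    by rewrite integral0_eq// => r _; rewrite /H' x0.
  move=> x0; have ex : 0 < enorm x by rewrite enorm_gt0.
  have <- : (\int[lebesgue_measure]_(r in `]enorm x, +oo[)
      ((enorm x ^+ n * f x)%:E * (n%:R * r ^- n.+1)%:E) = (f x)%:E)%E.
    rewrite ge0_integralZl//.
    - rewrite integral_ray_tail// -EFinM mulrAC mulfV ?mul1r// expf_neq0// gt_eqF//.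
    - by apply/measurable_EFinP; apply: measurable_funM => //; apply: measurable_funTS; exact: measurable_exprV.
    - move=> r /=; rewrite in_itv/= andbT => xr.
      by rewrite lee_fin mulr_ge0// invr_ge0 exprn_ge0// ltW// (lt_trans ex).
    - by rewrite lee_fin mulr_ge0// exprn_ge0// enorm_ge0.
  rewrite integral_mkcond; apply: eq_integral => r _; rewrite patchE /H' x0/=.
  have -> : (r \in `]enorm x, +oo[%classic) = (enorm x < r) by apply/idP/idP; rewrite inE/= in_itv/= andbT.
  by case: ifP => // _; rewrite -EFinM mulrC mulrA.
rewrite (fubini_tonelli (m1 := leb) (m2 := lebesgue_measure) (fun p => (H' p.1 p.2)%:E))//=.
transitivity (\int[lebesgue_measure]_r \int[leb]_x (H x r)%:E)%E.
  apply: eq_integral => r _; have [r0|r0] := ltP 0 r; last first.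
    rewrite !integral0_eq// => x _.
      by rewrite /H (ltNge 0) r0 !andbF.
    by rewrite /H' [enorm x < r]ltNge (le_trans r0 (enorm_ge0 x)) andbF.
  rewrite [LHS](ge0_integral_rV_affine (c := r) 0).
  - rewrite -ge0_integralZl//.
    + apply: eq_integral => x _; rewrite addr0 -EFinM; congr EFin.
      rewrite /H /H' r0 andbT scaler_eq0 gt_eqF//= enormZ gtr0_norm// gtr_pMr//.
      case: ifP => // _; rewrite ?mulr0//.
      have rn : r ^+ n = r * r ^+ n.-1 by rewrite -exprS prednK.
      rewrite exprMn exprS rn; field.
      by rewrite expf_neq0 gt_eqF.
    + by apply: (measurableT_comp (measurableT_comp mH' (measurable_pair2 r))); exact: measurable_affine.
    + by move=> x _; exact: (H'0 (_, r)).
  - by rewrite gt_eqF.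
  - exact: (measurableT_comp mH' (measurable_pair2 r)).
  - by move=> x; have := H'0 (x, r).
rewrite -[LHS](fubini_tonelli (m1 := leb) (m2 := lebesgue_measure) (fun p => (H p.1 p.2)%:E)); [rewrite /=|by []|by []].
rewrite [RHS]integral_mkcond; apply: eq_integral => x _; rewrite patchE.
have -> : (x \in pball) = (x != 0) && (enorm x < 1).
  by apply/idP/andP; rewrite inE => -[].
case: ifPn => [/andP[x0 x1]|xN]; last first.
  by rewrite integral0_eq// => r _; rewrite /H andbA (negbTE xN).
have ex : 0 < enorm x by rewrite enorm_gt0.
rewrite [RHS]integral_mkcond.
have -> : (fun s => (n%:R * s ^+ n.-1 * f (s *: nx x))%:E) \_ `]0, +oo[ = (fun s => (G x s)%:E).
  apply/funext => s; rewrite patchE /G x0 x1/=.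
  have -> : (s \in `]0, +oo[%classic) = (0 < s) by apply/idP/idP; rewrite inE/= in_itv/= andbT.
  by case: ifP.
have mG : measurable_fun setT (fun s => (G x s)%:E).
  apply/measurable_EFinP; rewrite /G x0 x1/=; apply: measurable_fun_ifT => //.
    exact: measurable_fun_ltr.
  apply: measurable_funM; first by apply: measurable_funM.
  apply: (measurableT_comp mf); apply: measurable_fun_rV => i; under eq_fun do rewrite mxE.
  exact: measurable_funM.
have G0 s : (0%:E <= (G x s)%:E)%E.
  rewrite lee_fin /G; case: ifPn => // /and3P[_ _ r0].
  by rewrite !mulr_ge0// exprn_ge0// ltW.
rewrite (@ge0_integral_affine _ (enorm x) 0 _ _ mG G0); last by rewrite gt_eqF.
rewrite -ge0_integralZl//.
  apply: eq_integral => r _; rewrite addr0 -EFinM; congr EFin.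
  rewrite /H /G x0 x1/= pmulr_rgt0//; case: ifP => // r0; rewrite ?mulr0//.
  rewrite gtr0_norm// (mulrC (enorm x) r) -scalerA enorm_nxE exprMn.
  have -> : enorm x ^+ n = enorm x * enorm x ^+ n.-1 by rewrite -exprS prednK.
  ring.
by apply: (measurableT_comp mG); apply: measurable_funD => //; exact: measurable_funM.
Qed.

End polar.

(** * Integrals of partial derivatives *)

Section integral_partial.
Context {R : realType} {n : nat}.
Implicit Types (f h : 'rV[R]_n -> R) (x y : 'rV[R]_n).

Lemma compact_uniform_continuous f (K : set 'rV[R]_n) (e : R) : continuous f -> compact K -> 0 < e ->
  exists2 d : R, 0 < d & forall x z, K x -> `|z - x| < d -> `|f z - f x| < e.
Proof.
move=> cf /compact_near_coveringP cK e0.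
pose P (d : R) x := forall z, `|z - x| < d -> `|f z - f x| < e.
suff H : \forall d \near (0 : R)^'+, 0 < d /\ K `<=` P d.
  by have [d [d0 KP]] := filter_ex H; exists d => // x z Kx; exact: KP.
have KP : \forall d \near (0 : R)^'+, K `<=` P d.
    apply: cK => x _.
    have /cvgrPdist_lt/(_ _ (divr_gt0 e0 (ltr0n _ 2))) := cf x => /nbhs_ballP[r /= r0 xr].
    have r2 : 0 < r / 2 by rewrite divr_gt0.
    exists (ball x (r / 2), [set d | d < r / 2]) => /=.
      by split; [exact: nbhsx_ballx|exact: nbhs_right_lt].
    move=> [x' d] [/= xx' dr] z zx'.
    have h1 : `|f x - f x'| < e / 2.
      by apply: xr; apply: le_ball xx'; rewrite ler_pdivrMr// ler_peMr// ?ler1n// ltW.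
    have h2 : `|f x - f z| < e / 2.
      apply: xr; rewrite -ball_normE/= in xx' *; rewrite distrC.
      apply: (le_lt_trans (ler_distD x' _ _)); rewrite (splitr r).
      by apply: ltrD; [exact: lt_trans zx' dr|rewrite distrC].
    by apply: (le_lt_trans (ler_distD (f x) _ _)); rewrite (splitr e) ltrD// distrC.
near=> d; split; last by near: d.
by near: d; exact: nbhs_right_gt.
Unshelve. all: by end_near. Qed.

Lemma integrable_support f (r M : R) : measurable_fun setT f ->
  (forall x, `|f x| <= M) -> (forall x, r < enorm x -> f x = 0) -> leb.-integrable setT (EFin \o f).
Proof.
move=> mf fM f0.
have mD : measurable [set x : 'rV[R]_n | enorm x <= r] by apply: measurable_le_set => //; exact: measurable_enorm.
have -> : EFin \o f = (EFin \o f) \_ [set x : 'rV[R]_n | enorm x <= r].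
  apply/funext => x; rewrite patchE; case: ifPn => //; rewrite notin_setE/= => /negP.
  by rewrite -ltNge => /f0 ->.
apply: (proj1 (integrable_mkcond _ _)) => //.
by apply: (@integrable_bounded _ _ _ _ r M) => //; exact: measurable_funTS.
Qed.

Lemma Rintegral_affine f (c : R) a : `|c| = 1 -> measurable_fun setT f ->
  \int[leb]_x f x = \int[leb]_x f (c *: x + a).
Proof.
move=> c1 mf; have c0 : c != 0 by rewrite -normr_eq0 c1 oner_neq0.
rewrite /Rintegral [in LHS]integralE [in RHS]integralE.
have sh (g : 'rV[R]_n -> \bar R) : measurable_fun setT g -> (forall x, 0 <= g x)%E ->
    (\int[leb]_x g x = \int[leb]_x g (c *: x + a)%R)%E.
  by move=> mg g0; rewrite (ge0_integral_rV_affine a c0 mg g0) c1 expr1n mul1e.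
have mE : measurable_fun setT (EFin \o f) by exact/measurable_EFinP.
congr (fine (_ - _)%E).
  rewrite [LHS](sh _ (measurable_funepos mE) (funepos_ge0 _)).
  by apply: eq_integral => x _; rewrite !funeposE.
rewrite [LHS](sh _ (measurable_funeneg mE) (funeneg_ge0 _)).
by apply: eq_integral => x _; rewrite !funenegE.
Qed.

Lemma C1_support_partial f (M : R) i : (forall x, M < enorm x -> f x = 0) ->
  forall x, M < enorm x -> partial i f x = 0.
Proof.
move=> f0 x Mx.
have : isgrad f x 0.
  apply: (isgrad_near (f := cst 0)); last exact: isgrad_cst.
  have /cvgrPdist_lt/(_ (enorm x - M)) := @continuous_enorm R n x.
  rewrite subr_gt0 => /(_ Mx); apply: filterS => z; rewrite ltr_norml => /andP[_ h].
  by rewrite f0//; lra.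
by move=> /isgrad_partial ->; rewrite mxE.
Qed.

Lemma bounded_support f (M : R) : continuous f -> (forall x, M < enorm x -> f x = 0) ->
  exists B, forall x, `|f x| <= B.
Proof.
move=> cf f0.
have [B B0 HB] := ball_bounded M cf; exists B => x.
by have [/HB//|/f0 ->] := leP (enorm x) M; rewrite normr0.
Qed.

(** By translation invariance, [f (x + t e_i) - f x] has integral zero. It differs from [t] times
    the derivative by at most [t e] on a fixed ball, by uniform continuity of the derivative; divide
    by [t] and let [e] tend to 0. *)
Lemma Rintegral_partial f (M : R) i : C1 f -> (forall x, M < enorm x -> f x = 0) ->
  \int[leb]_x partial i f x = 0.
Proof.
move=> cf f0; set g := partial i f; pose e_i : 'rV[R]_n := delta_mx 0 i.
have fgrad x := C1_isgrad x cf.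
have fc : continuous f by move=> x; exact: isgrad_continuous (fgrad x).
have gc : continuous g by have [] := cf i.
have g0 := C1_support_partial i f0.
have [Bf fB] := bounded_support fc f0.
have [Bg gB] := bounded_support gc g0.
have mf := measurable_continuous fc; have mg := measurable_continuous gc.
pose K := [set x : 'rV[R]_n | enorm x <= M + 1].
have mK : measurable K by apply: measurable_le_set => //; exact: measurable_enorm.
have Kfin : (leb K < +oo)%E by exact: (@lebesgue_bounded _ _ _ (M + 1) mK).
have if_ : leb.-integrable setT (EFin \o f) by exact: integrable_support f0.
have ig : leb.-integrable setT (EFin \o g) by exact: integrable_support g0.
suff H e : 0 < e -> `|\int[leb]_x g x| <= e * fine (leb K).
  apply/eqP; rewrite -normr_le0; apply/ler_addgt0Pr => e e0; rewrite add0r.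
  have k0 : 0 <= fine (leb K) by exact: fine_ge0.
  apply: (le_trans (H (e / (fine (leb K) + 1)) _)); first by rewrite divr_gt0// ltr_wpDl.
  rewrite mulrAC ler_pdivrMr ?ltr_wpDl// ler_wpM2l ?ltW//.
  by rewrite ltrDl.
move=> e0.
have [d d0 dP] := compact_uniform_continuous gc (@compact_closed_enorm_ball _ _ (M + 1)) e0.
(* Shifts of length at most 1 keep all supports within radius [M + 1]; shifts below [d] change the
   derivative by less than [e] there. *)
pose t := Num.min 1 (d / 2); have t0 : 0 < t by rewrite lt_min ltr01 divr_gt0.
have t1 : t <= 1 by rewrite ge_min lexx.
have td : t < d by rewrite gt_min ltr_pdivrMr// ltr_pMr// ltr1n orbT.
have far x : M + 1 < enorm x -> f (x + t *: e_i) = 0.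
  move=> Mx; apply: f0; have := enormB x (- (t *: e_i)).
  rewrite opprK enormN enormZ enorm_delta mulr1 gtr0_norm//; lra.
pose r x := f (x + t *: e_i) - f x - t * g x.
have rK x : ~ K x -> r x = 0.
  move=> /negP; rewrite -ltNge => Mx; have Mx' : M < enorm x by apply: lt_trans Mx; rewrite ltrDl.
  by rewrite /r (_ : g x = 0) ?far ?f0 ?mulr0 ?subr0//; exact: g0.
have rb x : `|r x| <= t * e.
  have [Kx|/rK ->] := pselect (K x); last by rewrite normr0 mulr_ge0// ltW.
  have [s _|c /andP[c0 c1]] := @MVT01 R (fun s => f (x + (s * t) *: e_i)) (fun s => t * g (x + (s * t) *: e_i)).
    have H := is_derive_line (isgrad_derive e_i (fgrad (x + (s * t) *: e_i))).
    have := @is_derive1_comp R (fun s => f (x + s *: e_i)) (fun s => s * t) s _ _ H (is_derive_mulr t s).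
    by rewrite dot_delta mxE mulrC.
  rewrite mul1r mul0r scale0r addr0 /r => ->; rewrite -mulrBr normrM gtr0_norm// ler_wpM2l ?(ltW t0)//.
  apply/ltW/dP => //; rewrite addrC addKr normrZ.
  apply: le_lt_trans td; rewrite normrM (ger0_norm c0) (gtr0_norm t0) mulrAC.
  apply: ler_piMl; first exact: ltW.
  by apply: mulr_ile1 => //; rewrite (le_trans (norm_le_enorm _))// enorm_delta.
have mfs : measurable_fun setT (fun x => f (x + t *: e_i)).
  have := measurableT_comp mf (@measurable_affine R n 1 (t *: e_i)).
  by under eq_fun do rewrite scale1r.
have ifs : leb.-integrable setT (EFin \o (fun x => f (x + t *: e_i))).
  exact: (@integrable_support _ (M + 1) Bf).
have itg : leb.-integrable setT (EFin \o (fun x => t * g x)).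
  by apply: (integrableZl measurableT t ig).
have ifd : leb.-integrable setT (EFin \o (fun x => f (x + t *: e_i) - f x)).
  exact: (integrableB measurableT ifs if_).
have intr : \int[leb]_x r x = - (t * \int[leb]_x g x).
  rewrite /r RintegralB// RintegralB// [X in _ - X - _](Rintegral_affine (t *: e_i) (normr1 R) mf).
  by under [X in _ - X - _]eq_Rintegral do rewrite scale1r; rewrite subrr sub0r RintegralZl.
have : `|\int[leb]_x r x| <= t * e * fine (leb K).
  rewrite (_ : \int[leb]_x r x = \int[leb]_(x in K) r x); last first.
    rewrite [RHS]Rintegral_mkcond; apply: eq_Rintegral => x _; rewrite patchE.
    by case: ifPn => //; rewrite notin_setE => /rK.
  have mr : measurable_fun setT r.
    apply: measurable_funB; first exact: measurable_funB.
    exact: measurable_funM.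
  have ir : leb.-integrable K (EFin \o r).
    apply: (@integrable_bounded _ _ _ _ (M + 1) (t * e)) => //.
    exact: measurable_funTS.
  rewrite (le_trans (le_normr_Rintegral mK ir))// -Rintegral_cst//.
  apply: le_Rintegral => //.
  - by move/integrable_abse: ir.
  - apply: (@integrable_bounded _ _ _ _ (M + 1) `|t * e|) => //.
rewrite intr normrN normrM gtr0_norm// -mulrA ler_pM2l//.
Qed.

End integral_partial.

(** * Integrals between two graphs over the sphere *)

Section polar_primitive.
Context {R : realType} {n : nat}.
Implicit Types (f h : 'rV[R]_n -> R) (x y : 'rV[R]_n).

Definition region (r0 r1 : 'rV[R]_n -> R) : set 'rV[R]_n :=
  [set x | [/\ x != 0, hextend r0 x < enorm x & enorm x < hextend r1 x]].

Lemma measurable_region r0 r1 : scont r0 -> scont r1 -> measurable (region r0 r1).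
Proof.
move=> c0 c1.
rewrite (_ : region r0 r1 = [set x | x != 0] `&` [set x | hextend r0 x < enorm x] `&`
    [set x | enorm x < hextend r1 x]); last first.
  by apply/seteqP; split=> x; [case|move=> [[]]].
apply: measurableI; first apply: measurableI; first exact: measurable_neq0.
  by apply: measurable_lt_set; [exact: measurable_hextend|exact: measurable_enorm].
by apply: measurable_lt_set; [exact: measurable_enorm|exact: measurable_hextend].
Qed.

Lemma region_ray r0 r1 y (s : R) : unit_sphere y -> 0 < s ->
  region r0 r1 (s *: y) <-> r0 y < s < r1 y.
Proof.
move=> y1 s0; rewrite /region/= !hextendZ// !hextend_sphere// enormZ gtr0_norm// y1 mulr1.
split=> [[_ -> ->//]|/andP[-> ->]]; split => //.
by rewrite scaler_eq0 negb_or gt_eqF//= unit_sphere_neq0.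
Qed.

Hypothesis n0 : (0 < n)%N.

(** On each ray the integral is evaluated by the fundamental theorem of calculus, so an integral
    over a region bounded by two graphs costs one primitive [K y] per direction. *)
Lemma ge0_polar_primitive r0 r1 f (K : 'rV[R]_n -> R -> R) :
  scont r0 -> scont r1 -> (forall y, unit_sphere y -> 0 <= r0 y <= r1 y) ->
  measurable_fun setT f -> (forall x, region r0 r1 x -> 0 <= f x) ->
  (forall y (r : R), unit_sphere y -> r0 y <= r <= r1 y ->
     is_derive r 1 (K y) (r ^+ n.-1 * f (r *: y)) /\
     {for r, continuous (fun s : R => s ^+ n.-1 * f (s *: y))}) ->
  (\int[leb]_(x in region r0 r1) (f x)%:E =
   \int[leb]_(x in pball) (n%:R * (K (nx x) (r1 (nx x)) - K (nx x) (r0 (nx x))))%:E)%E.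
Proof.
move=> c0 c1 r01 mf f0 dK.
have mreg := measurable_region c0 c1.
transitivity (\int[leb]_(x in [set x | x != 0%R]) ((f \_ (region r0 r1)) x)%:E)%E.
  rewrite [LHS]integral_mkcond [RHS]integral_mkcond; apply: eq_integral => x _.
  rewrite !patchE; case: ifPn; rewrite ?inE => xr; last by case: ifP.
  by case: (xr) => x0 _ _; rewrite mem_set.
rewrite ge0_polar//; last 2 first.
- exact: (proj1 (measurable_restrict _ mreg measurableT) (measurable_funTS mf)).
- by move=> x; rewrite patchE; case: ifPn => //; rewrite inE => /f0.
apply: eq_integral => x; rewrite inE => -[x0 _].
have y1 : unit_sphere (nx x) by exact: enorm_nx.
move: (nx x) y1 => y y1; have /andP[a0 ab] := r01 y y1.
transitivity (\int[lebesgue_measure]_(s in `]r0 y, r1 y[) (n%:R * s ^+ n.-1 * f (s *: y))%:E)%E.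
  rewrite [LHS]integral_mkcond [RHS]integral_mkcond; apply: eq_integral => s _.
  rewrite !patchE !mem_setE !in_itv/= andbT; case: ifPn => s0; last first.
    by case: ifPn => // /andP[/(le_lt_trans a0)]; rewrite (negbTE s0).
  have -> : (s *: y \in region r0 r1) = (r0 y < s < r1 y).
    by apply/idP/idP; rewrite inE => /(region_ray r0 r1 y1 s0).
  by case: ifP; rewrite ?mulr0.
move: ab; rewrite le_eqVlt => /predU1P[->|ab].
  by rewrite set_itvoo0 integral_set0 subrr mulr0.
have cc : {within `[r0 y, r1 y], continuous (fun s : R => n%:R * s ^+ n.-1 * f (s *: y))}.
  apply: continuous_in_subspaceT => s; rewrite inE/= in_itv/= => sr.
  have [_ cs] := dK y s y1 sr.
  rewrite (_ : (fun s => _) = (fun s => n%:R * (s ^+ n.-1 * f (s *: y)))); last first.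
    by apply/funext => t; rewrite mulrA.
  by apply: cvgM; [exact: cvg_cst|exact: cs].
have dnK (s : R) : r0 y <= s <= r1 y ->
    is_derive s 1 (fun s => n%:R * K y s) (n%:R * s ^+ n.-1 * f (s *: y)).
  by move=> sr; have [ds _] := dK y s y1 sr; rewrite -mulrA; exact: is_deriveZ.
have mi : measurable_fun `]r0 y, r1 y[ (fun s : R => (n%:R * s ^+ n.-1 * f (s *: y))%:E).
  apply/measurable_EFinP; apply: (@measurable_funS _ _ _ _ `[r0 y, r1 y]) => //.
    exact: subset_itv_oo_cc.
  exact: subspace_continuous_measurable_fun.
rewrite -(integral_itv_bndoo true false mi).
rewrite (@continuous_FTC2 R _ (fun s => n%:R * K y s))//.
- by rewrite -EFinB -mulrBr.
- split=> [s /[!in_itv]/= /andP[h1 h2]||].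
  + have sr : r0 y <= s <= r1 y by rewrite !ltW.
    by have [] := dnK s sr.
  + apply: cvg_at_right_filter; apply: is_derive_continuous (dnK _ _); by rewrite lexx ltW.
  + apply: cvg_at_left_filter; apply: is_derive_continuous (dnK _ _); by rewrite lexx ltW.
- move=> s /[!in_itv]/= /andP[h1 h2].
  have sr : r0 y <= s <= r1 y by rewrite !ltW.
  by rewrite derive1E; have [_ ->] := dnK s sr.
Qed.

Lemma region_bounded r0 r1 : scont r1 -> exists r, forall x, region r0 r1 x -> enorm x <= r.
Proof.
move=> /scont_bounded[M M0 HM]; exists M => x [x0 _ /ltW xr].
by rewrite (le_trans xr)// (le_trans (ler_norm _))// HM//; exact: enorm_nx.
Qed.

(** The bound [M] is added to [f] to make it nonnegative, with primitive [M r^n / n], and its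
    contribution is subtracted afterwards. *)
Lemma polar_primitive r0 r1 f (K : 'rV[R]_n -> R -> R) (M : R) :
  scont r0 -> scont r1 -> (forall y, unit_sphere y -> 0 <= r0 y <= r1 y) ->
  measurable_fun setT f -> (forall x, region r0 r1 x -> `|f x| <= M) ->
  (forall y (r : R), unit_sphere y -> r0 y <= r <= r1 y ->
     is_derive r 1 (K y) (r ^+ n.-1 * f (r *: y)) /\
     {for r, continuous (fun s : R => s ^+ n.-1 * f (s *: y))}) ->
  scont (fun y => K y (r1 y) - K y (r0 y)) ->
  \int[leb]_(x in region r0 r1) f x = n%:R * sA (fun y => K y (r1 y) - K y (r0 y)).
Proof.
move=> c0 c1 r01 mf fM1 dK ck.
move: (normr_ge0 M) (fun x xr => le_trans (fM1 x xr) (ler_norm M)).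
move: `|M| => {fM1}M M0 fM.
have mreg := measurable_region c0 c1.
have [r rr] := region_bounded r0 c1.
have intf : leb.-integrable (region r0 r1) (EFin \o f).
  by apply: (integrable_bounded mreg rr _ fM); exact: measurable_funTS.
have intM : leb.-integrable (region r0 r1) (EFin \o (fun=> M)).
  by apply: (@integrable_bounded _ _ _ _ r M mreg rr) => // x _; rewrite ger0_norm.
have dM (s : R) : is_derive s 1 (fun s : R => M / n%:R * s ^+ n) (s ^+ n.-1 * M).
  apply: (is_derive_eq (is_deriveZ (M / n%:R) (is_deriveXn s n))).
  by rewrite /GRing.scale/= mulrA mulfVK ?pnatr_eq0 -?lt0n// mulrC.
have nn0 : n%:R != 0 :> R by rewrite pnatr_eq0 -lt0n.
pose k y := K y (r1 y) - K y (r0 y).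
pose kM y := M / n%:R * r1 y ^+ n - M / n%:R * r0 y ^+ n.
have ckM : scont kM.
  by apply: scontB; apply: scontM; [exact: scont_cst|exact: scontX|exact: scont_cst|exact: scontX].
have fin2 h : scont h -> (\int[leb]_(x in pball) (n%:R * h (nx x))%:E)%E = (n%:R * sA h)%:E.
  move=> ch; rewrite -sAZ// /sA /Rintegral fineK//.
  apply: integrable_fin_num; first exact: measurable_pball.
  by apply: (@integrable_hextend _ _ (fun y => n%:R * h y)); apply: scontM => //; exact: scont_cst.
have E1 : \int[leb]_(x in region r0 r1) (f x + M) = n%:R * sA (fun y => k y + kM y).
  rewrite /Rintegral (@ge0_polar_primitive r0 r1 (fun x => f x + M)
     (fun y s => K y s + M / n%:R * s ^+ n))//.
  - transitivity (fine (\int[leb]_(x in pball) (n%:R * (k (nx x) + kM (nx x)))%:E)%E).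
      congr fine; apply: eq_integral => x _; congr (_ * _)%:E.
      by rewrite /k /kM opprD addrACA.
    by rewrite (fin2 (fun y => k y + kM y))//; exact: scontD.
  - exact: measurable_funD.
  - by move=> x /fM; rewrite ler_norml => /andP[h _]; lra.
  - move=> y s y1 sr; have [d1 s1] := dK y s y1 sr; split.
      by rewrite mulrDr; exact: is_deriveD.
    rewrite (_ : (fun s => _) = (fun s => s ^+ n.-1 * f (s *: y) + s ^+ n.-1 * M)).
      apply: cvgD; first exact: s1.
      by apply: cvgM; [exact: exprn_continuous|exact: cvg_cst].
    by apply/funext => t; rewrite mulrDr.
have E2 : \int[leb]_(x in region r0 r1) M = n%:R * sA kM.
  rewrite /Rintegral (@ge0_polar_primitive r0 r1 (fun x => M) (fun y s => M / n%:R * s ^+ n))//.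
  - by rewrite (fin2 kM).
  - move=> y s y1 sr; split => //.
    by apply: cvgM; [exact: exprn_continuous|exact: cvg_cst].
have := RintegralD mreg intf intM; rewrite E1 E2 sAD// mulrDr => h.
by apply: (@addIr _ (n%:R * sA kM)); rewrite h.
Qed.

End polar_primitive.

Section continuous_arith.
Context {R : realType} {T : topologicalType}.
Implicit Types (f g : T -> R) (t : T).

Lemma continuous_add f g t : {for t, continuous f} -> {for t, continuous g} ->
  {for t, continuous (fun u => f u + g u)}.
Proof. exact: continuousD. Qed.

Lemma continuous_sub f g t : {for t, continuous f} -> {for t, continuous g} ->
  {for t, continuous (fun u => f u - g u)}.
Proof. exact: continuousB. Qed.

Lemma continuous_mul f g t : {for t, continuous f} -> {for t, continuous g} ->
  {for t, continuous (fun u => f u * g u)}.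
Proof. exact: continuousM. Qed.

Lemma continuous_sqr f : continuous f -> continuous (fun u => f u ^+ 2).
Proof. by move=> cf u; exact: (continuous_mul (cf u) (cf u)). Qed.

Lemma continuous_cst_at (c : R) t : {for t, continuous (fun=> c)}.
Proof. exact: cst_continuous. Qed.

End continuous_arith.

(** * Divergence theorem on the sphere *)

Section bump.
Context {R : realType}.

Definition pos2 (t : R) : R := Num.max 0 t ^+ 2.

Lemma is_derive_pos2 (t : R) : is_derive t 1 pos2 (2 * Num.max 0 t).
Proof.
have [t0|t0|t0] := ltgtP t 0.
- rewrite mulr0; have H : is_derive t 1 (cst 0 : R -> R) 0 by exact: is_derive_cst.
  apply: near_eq_is_derive H; near=> s; rewrite /pos2 max_l ?expr0n//=; apply: ltW.
  by near: s; exact: lt_nbhsl.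
- have H := is_deriveXn t 2; rewrite expr1 in H.
  apply: near_eq_is_derive H; near=> s; rewrite /pos2 max_r//; apply: ltW.
  by near: s; exact: lt_nbhsr.
- rewrite t0 mulr0; apply: (is_derive0_quadratic ler01) => h.
  by rewrite mul1r /pos2 ger0_norm ?sqr_ge0//; have [_|_] := leP h 0; rewrite ?expr0n ?sqr_ge0.
Unshelve. all: by end_near. Qed.

(** The factor 30 normalises the integral over [1,2] to 1, since [u^2 (1 - u)^2] has integral 1/30
    over [0,1]. *)
Definition bump (r : R) : R := 30 * pos2 ((r - 1) * (2 - r)).
Definition dbump (r : R) : R := 60 * Num.max 0 ((r - 1) * (2 - r)) * (3 - 2 * r).

Lemma is_derive_bump (r : R) : is_derive r 1 bump (dbump r).
Proof.
have H1 : is_derive r 1 (fun s : R => (s - 1) * (2 - s)) (3 - 2 * r).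
  have -> : (fun s : R => (s - 1) * (2 - s)) = (fun s => 3 * s - s ^+ 2 - 2).
    by apply/funext => s; ring.
  have A := is_deriveB (is_deriveB (is_deriveZ 3 (is_derive_id r (1:R))) (is_deriveXn r 2)) (is_derive_cst (2 : R) r 1).
  by apply: (is_derive_eq A); rewrite /GRing.scale/= mulr1 subr0 expr1.
have H2 := @is_derive1_comp R pos2 _ r _ _ (is_derive_pos2 _) H1.
apply: (is_derive_eq (is_deriveZ 30 H2)); rewrite /GRing.scale/= /dbump; ring.
Qed.

Lemma bump_out r : ~~ (1 < r < 2) -> bump r = 0 /\ dbump r = 0.
Proof.
move=> r12; have h : (r - 1) * (2 - r) <= 0.
  move: r12; rewrite negb_and -!leNgt => /orP[h|h]; first by rewrite mulr_le0_ge0//; lra.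
  by rewrite mulr_ge0_le0//; lra.
by rewrite /bump /dbump /pos2 max_l// expr0n/= !mulr0 mul0r.
Qed.

(** The primitive of [bump] on [1,2] that vanishes at 1; by the normalisation it equals 1 at 2. *)
Definition step5 (r : R) : R := 10 * (r - 1) ^+ 3 - 15 * (r - 1) ^+ 4 + 6 * (r - 1) ^+ 5.

Lemma is_derive_step5 (r : R) : 1 <= r <= 2 -> is_derive r 1 step5 (bump r).
Proof.
move=> /andP[r1 r2].
have X k : is_derive r 1 (fun s : R => (s - 1) ^+ k) (k%:R * (r - 1) ^+ k.-1).
  have H1 := is_deriveB (is_derive_id r (1:R)) (is_derive_cst (1 : R) r 1).
  have := @is_derive1_comp R (fun s => s ^+ k) _ r _ _ (is_deriveXn _ k) H1.
  by rewrite subr0 mulr1.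
have A := is_deriveD (is_deriveB (is_deriveZ 10 (X 3)) (is_deriveZ 15 (X 4))) (is_deriveZ 6 (X 5)).
apply: (is_derive_eq A); rewrite /bump /pos2 max_r; last by rewrite mulr_ge0//; lra.
by rewrite /GRing.scale/=; ring.
Qed.

End bump.

Section sphere_divergence.
Context {R : realType} {n : nat}.
Implicit Types (f h : 'rV[R]_n -> R) (x y : 'rV[R]_n).

Lemma C1_away0 f (g : 'rV[R]_n -> 'rV[R]_n) : (forall x, x != 0 -> isgrad f x (g x)) ->
  (forall i x, x != 0 -> {for x, continuous (fun z => g z 0 i)}) ->
  (forall x, enorm x < 1 -> f x = 0) -> C1 f.
Proof.
move=> fg cg f0 i.
have near1 x : enorm x < 1 -> \forall z \near x, enorm z < 1.
  move=> x1; apply: (open_nbhs_nbhs (conj (@open_unit_ball R n) x1)).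
have g0 x : enorm x < 1 -> isgrad f x 0.
  move=> /near1 x1; apply: (isgrad_near (f := cst 0)); last exact: isgrad_cst.
  by apply: filterS x1 => z z1; rewrite f0.
split=> x.
  have [->|x0] := eqVneq x 0; last exact: isgrad_derivable (fg x x0).
  by apply: isgrad_derivable (g0 0 _); rewrite enorm0.
have [->|x0] := eqVneq x 0.
  have h0 : enorm (0 : 'rV[R]_n) < 1 by rewrite enorm0.
  rewrite /continuous_at (isgrad_partial _ (g0 0 h0)) mxE.
  have E : {near (0 : 'rV[R]_n), (fun _ => 0 : R) =1 partial i f}.
    by near=> z; rewrite (isgrad_partial (g := 0)) ?mxE//; apply: g0; near: z; exact: near1.
  by apply: cvg_trans; [exact: near_eq_cvg E|exact: cvg_cst].
rewrite /continuous_at (isgrad_partial _ (fg x x0)).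
have E : {near x, (fun z => g z 0 i) =1 partial i f}.
  by near=> z; rewrite (isgrad_partial (g := g z))//; apply: fg; near: z; exact: near_neq0.
by apply: cvg_trans; [exact: near_eq_cvg E|exact: cg i x x0].
Unshelve. all: by end_near. Qed.

Lemma continuous_away_comp (u : R -> R) x : x != 0 -> {for enorm x, continuous u} ->
  {for x, continuous (fun z : 'rV[R]_n => u (enorm z))}.
Proof.
by move=> x0 cu; apply: (continuous_comp (@continuous_enorm R n x)).
Qed.

Lemma continuous_max0 : continuous (Num.max 0 : R -> R).
Proof.
move=> t; have -> : (Num.max 0 : R -> R) = (fun t => Num.max (cst 0 t) (id t)) by [].
by apply: continuous_max; [exact: cst_continuous|exact: cvg_id].
Qed.

Hypothesis n1 : (1 < n)%N.

(** The field, extended with degree 0 and multiplied by a radial cutoff supported in an annulus, has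
    a divergence of integral zero. Evaluated in polar coordinates, this integral is a combination of
    the tangential divergence and of the normal component. *)
Lemma sphere_divergence (X : 'rV[R]_n -> 'rV[R]_n) (G : 'I_n -> 'rV[R]_n -> 'rV[R]_n) :
  (forall i, sgrad (fun y => X y 0 i) (G i)) ->
  sA (fun y => \sum_i G i y 0 i) = n.-1%:R * sA (fun y => dot (X y) y).
Proof.
move=> sX.
pose k := n.-2.
(* The power [r^(2-n)] turns the weight [r^(n-2) psi r] of the tangential divergence into [bump r],
   of integral 1. The weight [r^(n-1)] of [psi'] then gives [-(n-1)] by parts. *)
pose psi (r : R) := bump r * r ^- k.
pose dpsi (r : R) := bump r * (- k%:R * r ^- k.+1) + r ^- k * dbump r.
have psiD (r : R) : r != 0 -> is_derive r 1 psi (dpsi r).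
  by move=> r0; apply: (is_derive_eq (is_deriveM (is_derive_bump r) (is_deriveVX k r0))).
have psi0 r : ~~ (1 < r < 2) -> psi r = 0 /\ dpsi r = 0.
  by move=> /bump_out[h1 h2]; rewrite /psi /dpsi h1 h2 !mul0r mulr0 addr0.
pose F i z := psi (enorm z) * hextend (fun y => X y 0 i) z.
pose g i z := psi (enorm z) *: ((enorm z)^-1 *: G i (nx z)) +
              hextend (fun y => X y 0 i) z *: (dpsi (enorm z) *: nx z).
have Fg i x : x != 0 -> isgrad (F i) x (g i x).
  move=> x0; apply: isgradM; last by have [+ _] := sX i; exact.
  by apply: (isgrad_comp1 (isgrad_enorm x0)); apply: psiD; rewrite enorm_eq0.
have cdbump (r : R) : {for r, continuous (@dbump R)}.
  rewrite /dbump; apply: continuous_mul; last first.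
    by apply: continuous_sub; [exact: continuous_cst_at|apply: continuous_mul; [exact: continuous_cst_at|exact: cvg_id]].
  apply: continuous_mul; first exact: continuous_cst_at.
  apply: (@continuous_comp _ _ _ (fun r : R => (r - 1) * (2 - r)) (Num.max 0)); last exact: continuous_max0.
  by apply: continuous_mul; apply: continuous_sub; (try exact: cvg_id); exact: continuous_cst_at.
have cVX j (r : R) : r != 0 -> {for r, continuous (fun r : R => r ^- j)}.
  by move=> r0; exact: is_derive_continuous (is_deriveVX j r0).
have cbump : continuous (@bump R) by move=> r; exact: is_derive_continuous (is_derive_bump r).
have cpsi (r : R) : r != 0 -> {for r, continuous psi}.
  by move=> r0; exact: is_derive_continuous (psiD r r0).
have cdpsi (r : R) : r != 0 -> {for r, continuous dpsi}.
  move=> r0; rewrite /dpsi; apply: continuous_add.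
    apply: continuous_mul; first exact: cbump.
    by apply: continuous_mul; [exact: continuous_cst_at|exact: cVX].
  by apply: continuous_mul; [exact: cVX|exact: cdbump].
have cX i := sgrad_scont (sX i).
have cg i j x : x != 0 -> {for x, continuous (fun z => g i z 0 j)}.
  move=> x0; have ex0 : enorm x != 0 by rewrite enorm_eq0.
  rewrite (_ : (fun z => _) = (fun z => psi (enorm z) * ((enorm z)^-1 * hextend (fun y => G i y 0 j) z) +
     hextend (fun y => X y 0 i) z * (dpsi (enorm z) * hextend (fun y => y 0 j) z))); last first.
    by apply/funext => z; rewrite /g !mxE /hextend /= ?mxE.
  apply: continuous_add; apply: continuous_mul.
  - exact: (continuous_away_comp x0 (cpsi _ ex0)).
  - apply: continuous_mul; last by have [_ +] := sX i; apply.
    by apply: continuousV => //; exact: continuous_enorm.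
  - exact: cX.
  - apply: continuous_mul; first exact: (continuous_away_comp x0 (cdpsi _ ex0)).
    exact: scont_coord.
have F0 i x : enorm x < 1 -> F i x = 0.
  move=> x1; rewrite /F (psi0 _ _).1 ?mul0r//.
  by apply/negP => /andP[h _]; lra.
have F2 i x : 2 < enorm x -> F i x = 0.
  move=> x1; rewrite /F (psi0 _ _).1 ?mul0r//.
  by apply/negP => /andP[_ h]; lra.
have CF i : C1 (F i) by exact: (C1_away0 (Fg i) (cg i) (F0 i)).
pose f x := \sum_i partial i (F i) x.
have cpF i : continuous (partial i (F i)) by have [] := CF i i.
have cf : continuous f by move=> x; apply: continuous_sum => i; exact: cpF.
have intF i : leb.-integrable setT (EFin \o partial i (F i)).
  have [B HB] := bounded_support (cpF i) (C1_support_partial i (F2 i)).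
  by apply: (integrable_support (measurable_continuous (cpF i)) HB (C1_support_partial i (F2 i))).
have If : \int[leb]_x f x = 0.
  have S (s : seq 'I_n) : let fs := fun x => \sum_(i <- s) partial i (F i) x in
      leb.-integrable setT (EFin \o fs) /\ \int[leb]_x fs x = 0.
    elim: s => [|i s [IH1 IH2]] /=.
      rewrite (_ : (fun x => _) = cst 0); last by apply/funext => x; rewrite big_nil.
      by split; [exact: integrable0|rewrite Rintegral_cst// mul0r].
    rewrite (_ : (fun x => _) = (fun x => partial i (F i) x + \sum_(j <- s) partial j (F j) x)); last first.
      by apply/funext => x; rewrite big_cons.
    split; first exact: (integrableD measurableT (intF i) IH1).
    by rewrite RintegralD// IH2 addr0; apply: Rintegral_partial (CF i) (F2 i).
  exact: (S _).2.
have fE x : x != 0 -> f x = dpsi (enorm x) * dot (X (nx x)) (nx x) +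
    psi (enorm x) * ((enorm x)^-1 * \sum_i G i (nx x) 0 i).
  move=> x0; rewrite /f (eq_bigr (fun i => g i x 0 i)); last by move=> i _; rewrite (isgrad_partial _ (Fg i x x0)).
  rewrite addrC /g /dot !mulr_sumr -big_split; apply: eq_bigr => i _; rewrite !mxE /hextend -/(nx x) /=.
  ring.
have f0 x : ~~ (1 < enorm x < 2) -> f x = 0.
  move=> xN; have [->|x0] := eqVneq x 0.
    rewrite /f big1// => i _; rewrite (isgrad_partial (g := 0)) ?mxE//.
    apply: (isgrad_near (f := cst 0)); last exact: isgrad_cst.
    have h0 : enorm (0 : 'rV[R]_n) < 1 by rewrite enorm0.
    by apply: filterS (open_nbhs_nbhs (conj (@open_unit_ball R n) h0)) => z z1; rewrite F0.
  by rewrite fE// (psi0 _ xN).1 (psi0 _ xN).2 !mul0r addr0.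
have [B HB] : exists B, forall x, `|f x| <= B.
  apply: (bounded_support (M := 2) cf) => x x2; apply: f0.
  by apply/negP => /andP[_ h]; lra.
pose D y := \sum_i G i y 0 i.
have cD : scont D by apply: scont_sum => i; have [_ +] := sX i; exact.
have cXy : scont (fun y => dot (X y) y) by apply: scont_dot => i; [exact: cX|exact: scont_coord].
(* A primitive of [r^(n-1) f (r y)] along the ray. As [psi] vanishes at 1 and 2, only the increment
   1 of [step5] survives. *)
pose K y r := r ^+ n.-1 * psi r * dot (X y) y - step5 r * (n.-1%:R * dot (X y) y - D y).
have s1 : step5 (1 : R) = 0 by rewrite /step5 subrr !expr0n/=; ring.
have s2 : step5 (2 : R) = 1 by rewrite /step5; ring.
have p1 : psi 1 = 0 by apply: (psi0 _ _).1; rewrite ltxx.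
have p2 : psi 2 = 0 by apply: (psi0 _ _).1; rewrite ltxx andbF.
have E : (fun y => K y 2 - K y 1) = (fun y => D y - n.-1%:R * dot (X y) y).
  by apply/funext => y; rewrite /K s1 s2 p1 p2; ring.
have c3 : scont (fun y => n.-1%:R * dot (X y) y) by scont.
have H : \int[leb]_(x in region (fun=> 1) (fun=> 2)) f x = n%:R * sA (fun y => K y 2 - K y 1).
  apply: (@polar_primitive R n (ltnW n1) (fun=> 1) (fun=> 2) f K B).
  - exact: scont_cst.
  - exact: scont_cst.
  - by move=> y _; rewrite ler01 ler1n.
  - exact: measurable_continuous.
  - by move=> x _; exact: HB.
  - move=> y r y1 /andP[r1 r2]; have r0 : 0 < r by rewrite (lt_le_trans ltr01).
    split; last first.
      apply: continuous_mul; first exact: exprn_continuous.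
      apply: (continuous_comp (f := fun s : R => s *: y)); last exact: cf.
      by apply: cvgZr_tmp; exact: cvg_id.
    have H1 := is_deriveM (is_deriveM (is_deriveXn r n.-1) (psiD r (lt0r_neq0 r0))) (is_derive_cst (dot (X y) y) r (1 : R)).
    have H2 := is_deriveM (@is_derive_step5 _ r (introT andP (conj r1 r2))) (is_derive_cst (n.-1%:R * dot (X y) y - D y) r (1:R)).
    apply: (is_derive_eq (is_deriveB H1 H2)).
    have ry0 : r *: y != 0 by rewrite scaler_eq0 negb_or gt_eqF//= unit_sphere_neq0.
    rewrite fE// nxZ// (nx_id y1) enormZ gtr0_norm// y1 mulr1 -/(D y).
    rewrite /GRing.scale/= /cst !mulr0 !add0r.
    rewrite /psi -/k (_ : n.-1 = k.+1); last by rewrite /k prednK // -subn1 subn_gt0.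
    by rewrite /= !exprS; field; rewrite expf_neq0 gt_eqF.
  - by rewrite E; exact: scontB.
have I0 : \int[leb]_(x in region (fun=> 1) (fun=> 2)) f x = 0.
  rewrite -[RHS]If [LHS]Rintegral_mkcond; apply: eq_Rintegral => x _; rewrite patchE.
  case: ifPn => //; rewrite notin_setE => xN; rewrite f0//; apply/negP => /andP[x1 x2]; apply: xN.
  by split => //; rewrite -enorm_gt0 (lt_trans _ x1).
move: H; rewrite E I0 => /esym/eqP; rewrite mulf_eq0 pnatr_eq0 gtn_eqF ?(ltnW n1)//=.
by rewrite sAB// sAZ// subr_eq0 => /eqP.
Qed.

End sphere_divergence.

(** * Divergence theorem on balls *)

Section ball_divergence.
Context {R : realType} {n : nat}.
Local Notation leb := (@lebesgue_rV R n).
Implicit Types (f h : 'rV[R]_n -> R) (x y : 'rV[R]_n).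

Lemma measurable_nx : measurable_fun setT (@nx R n).
Proof.
apply: measurable_fun_rV => i.
have := @measurable_hextend R n _ (@scont_coord R n i).
by under eq_fun do rewrite /hextend.
Qed.

Lemma le0_small (c C : R) : 0 <= C -> (exists2 d : R, 0 < d & forall a, 0 < a < d -> c <= C * a) -> c <= 0.
Proof.
move=> C0 [d d0 H]; apply/ler_addgt0Pr => e e0; rewrite add0r.
pose a := Num.min (d / 2) (e / (C + 1)).
have C1 : 0 < C + 1 by rewrite ltr_wpDl.
have a0 : 0 < a by rewrite lt_min !divr_gt0.
have ad : a < d by rewrite gt_min ltr_pdivrMr// ltr_pMr// ltr1n.
rewrite (le_trans (H a _)) ?a0//.
apply: (@le_trans _ _ ((C + 1) * a)); first by rewrite ler_wpM2r ?(ltW a0)// lerDl ler01.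
by rewrite mulrC -ler_pdivlMr// ge_min lexx orbT.
Qed.

Hypothesis n1 : (1 < n)%N.
Let n0 : (0 < n)%N := ltnW n1.

(** Slicing by spheres instead of rays allows an identity between integrals over concentric spheres
    to be integrated in the radius. *)
Lemma ge0_polar_swap (f : 'rV[R]_n -> R) : measurable_fun setT f -> (forall x, 0 <= f x) ->
  (\int[leb]_(x in [set x | x != 0%R]) (f x)%:E =
   \int[lebesgue_measure]_(s in `]0%R, +oo[) \int[leb]_(x in pball)
      (n%:R * s ^+ n.-1 * f (s *: nx x))%:E)%E.
Proof.
move=> mf f0; rewrite ge0_polar//.
pose H x s := if (x \in pball) && (0 < s) then n%:R * s ^+ n.-1 * f (s *: nx x) else 0.
have mH : measurable_fun setT (fun p : 'rV[R]_n * R => (H p.1 p.2)%:E).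
  apply/measurable_EFinP; apply: measurable_fun_ifT => //.
    apply: measurable_and; last by apply: measurable_fun_ltr => //; exact: measurable_snd.
    exact: (measurableT_comp (measurable_mem (@measurable_pball R n)) measurable_fst).
  apply: measurable_funM; first apply: measurable_funM => //.
    exact: (measurableT_comp (@exprn_measurable _ _ n.-1) measurable_snd).
  apply: (measurableT_comp mf); apply: measurable_fun_rV => i; under eq_fun do rewrite mxE.
  apply: measurable_funM; first exact: measurable_snd.
  exact: (measurableT_comp (measurableT_comp (measurable_coord i) measurable_nx) measurable_fst).
have H0 p : (0%:E <= (H p.1 p.2)%:E)%E.
  rewrite lee_fin /H; case: ifPn => // /andP[_ r0].
  by rewrite !mulr_ge0// exprn_ge0// ltW.
transitivity (\int[leb]_x \int[lebesgue_measure]_s (H x s)%:E)%E.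
  rewrite [LHS]integral_mkcond; apply: eq_integral => x _; rewrite patchE.
  case: ifPn => xb; last by rewrite integral0_eq// => s _; rewrite /H (negbTE xb).
  rewrite [LHS]integral_mkcond; apply: eq_integral => s _; rewrite patchE /H xb/=.
  by rewrite mem_setE in_itv/= andbT; case: ifP.
rewrite [LHS](fubini_tonelli (m1 := leb) (m2 := lebesgue_measure) (fun p => (H p.1 p.2)%:E)); [rewrite /=|by []|by []].
rewrite [RHS]integral_mkcond; apply: eq_integral => s _; rewrite patchE mem_setE in_itv/= andbT.
case: ifPn => s0; last by rewrite integral0_eq// => x _; rewrite /H (negbTE s0) andbF.
rewrite [RHS]integral_mkcond; apply: eq_integral => x _; rewrite patchE /H s0 andbT.
by case: ifP.
Qed.

Local Notation annulus a b := (region (fun=> a) (fun=> b)).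

Let measurable_annulus a b : measurable (annulus a b : set 'rV[R]_n).
Proof. by apply: measurable_region; exact: scont_cst. Qed.

Lemma eq_annulus_ge0 (a b M : R) f : 0 < a -> measurable_fun setT f ->
  (forall s : R, 0 < s -> scont (fun y => f (s *: y))) ->
  (forall x, annulus a b x -> - M <= f x) ->
  (\int[leb]_(x in annulus a b) (f x + M)%:E =
   \int[lebesgue_measure]_(s in `]a, b[) (n%:R * s ^+ n.-1 * (sA (fun y => f (s *: y)) + M * sA (fun _ : 'rV[R]_n => 1)))%:E)%E.
Proof.
move=> a0 mf cf fM.
have mreg := measurable_annulus a b.
transitivity (\int[leb]_(x in [set x | x != 0%R]) (((fun x => f x + M) \_ (annulus a b)) x)%:E)%E.
  rewrite [LHS]integral_mkcond [RHS]integral_mkcond; apply: eq_integral => x _.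
  rewrite !patchE; case: ifPn; rewrite ?inE => xr; last by case: ifP.
  by case: (xr) => x0 _ _; rewrite mem_set.
rewrite ge0_polar_swap; last 2 first.
- by apply: (proj1 (measurable_restrict _ mreg measurableT)); apply: measurable_funTS; exact: measurable_funD.
- by move=> x; rewrite patchE; case: ifPn => //; rewrite inE => /fM; lra.
rewrite [LHS]integral_mkcond [RHS]integral_mkcond; apply: eq_integral => s _.
rewrite !patchE !mem_setE !in_itv/= andbT; case: ifPn => s0; last first.
  by case: ifPn => // /andP[/(lt_trans a0)]; rewrite (negbTE s0).
have E x : x \in pball -> (s *: nx x \in annulus a b) = (a < s < b).
  rewrite inE => -[x0 _].
  by apply/idP/idP; rewrite inE => /(region_ray (fun=> a) (fun=> b) (enorm_nx x0) s0).
case: ifPn => sab; last first.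
  by rewrite integral0_eq// => x xb; rewrite patchE E ?inE// (negbTE sab) mulr0.
transitivity (\int[leb]_(x in pball) (hextend (fun y => n%:R * s ^+ n.-1 * (f (s *: y) + M)) x)%:E)%E.
  by apply: eq_integral => x xb; rewrite patchE E// sab.
have c1 : scont (fun y => f (s *: y) + M) by apply: scontD; [exact: cf|exact: scont_cst].
have c2 : scont (fun y => n%:R * s ^+ n.-1 * (f (s *: y) + M)) by scont.
rewrite -(sA_cst M) -sAD//; [|exact: cf|exact: scont_cst].
rewrite -sAZ// /sA /Rintegral fineK//.
by apply: integrable_fin_num; [exact: measurable_pball|exact: integrable_hextend].
Qed.

(** Permits replacing a divergence, sphere by sphere, by an expression that has a primitive along
    every ray. Since [a > 0], the singularity of polar coordinates stays outside. *)
Lemma eq_annulus (a b M : R) f1 f2 : 0 < a -> measurable_fun setT f1 -> measurable_fun setT f2 ->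
  (forall s : R, 0 < s -> scont (fun y => f1 (s *: y))) ->
  (forall s : R, 0 < s -> scont (fun y => f2 (s *: y))) ->
  (forall x, annulus a b x -> `|f1 x| <= M) ->
  (forall x, annulus a b x -> `|f2 x| <= M) ->
  (forall s : R, 0 < s -> sA (fun y => f1 (s *: y)) = sA (fun y => f2 (s *: y))) ->
  \int[leb]_(x in annulus a b) f1 x = \int[leb]_(x in annulus a b) f2 x.
Proof.
move=> a0 m1 m2 c1 c2 M1 M2 f12.
have cb : scont (fun _ : 'rV[R]_n => b) by exact: scont_cst.
have mreg := measurable_annulus a b.
have [r rr] := region_bounded (fun=> a) cb.
have i1 : leb.-integrable (annulus a b) (EFin \o f1).
  by apply: (integrable_bounded mreg rr _ M1); exact: measurable_funTS.
have i2 : leb.-integrable (annulus a b) (EFin \o f2).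
  by apply: (integrable_bounded mreg rr _ M2); exact: measurable_funTS.
have iM : leb.-integrable (annulus a b) (EFin \o (fun=> M)).
  by apply: (@integrable_bounded _ _ _ _ r `|M| mreg rr).
apply: (@addIr _ (\int[leb]_(x in annulus a b) M)).
rewrite -(RintegralD mreg i1 iM) -(RintegralD mreg i2 iM); congr fine.
rewrite (eq_annulus_ge0 a0 m1 c1) 1?(eq_annulus_ge0 a0 m2 c2).
- apply: eq_integral => s; rewrite mem_setE in_itv/= => /andP[s0 _].
  by rewrite f12// (lt_trans a0).
- by move=> x /M2; rewrite ler_norml => /andP[].
- by move=> x /M1; rewrite ler_norml => /andP[].
Qed.

Lemma sgrad_scale f (s : R) : 0 < s -> C1 f ->
  sgrad (fun y => f (s *: y)) (fun y => s *: (grad f (s *: y) - dot (grad f (s *: y)) y *: y)).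
Proof.
move=> s0 cf; have cg i : continuous (fun x => grad f x 0 i).
  by rewrite gradE; have [] := cf i.
have csc (u : 'rV[R]_n -> R) : continuous u -> continuous (fun y => u (s *: y)).
  by move=> cu x; exact: (continuous_comp (@scaler_continuous _ _ s x) (cu _)).
have cd : continuous (fun y => dot (grad f (s *: y)) y).
  by move=> x; apply: continuous_sum => i; apply: continuous_mul; [exact: csc (cg i) x|exact: continuous_coord].
split; last first.
  move=> i; apply: scont_continuous => x.
  rewrite (_ : (fun _ => _) = (fun y => s * (grad f (s *: y) 0 i - dot (grad f (s *: y)) y * y 0 i))); last first.
    by apply/funext => y; rewrite !mxE.
  suff : {for x, continuous (fun y => s * (grad f (s *: y) 0 i - dot (grad f (s *: y)) y * y 0 i))} by [].
  apply: continuous_mul; first exact: continuous_cst_at.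
  apply: continuous_sub; first exact: csc (cg i) x.
  by apply: continuous_mul; [exact: cd|exact: continuous_coord].
move=> x x0; have ex : enorm x != 0 by rewrite enorm_eq0.
pose Phi z : 'rV[R]_n := s *: nx z.
pose G (j : 'I_n) : 'rV[R]_n := s *: ((enorm x)^-1 *: delta_mx 0 j + (x 0 j) *: (- (enorm x ^- 2) *: nx x)).
have PG j : isgrad (fun z => Phi z 0 j) x (G j).
  rewrite (_ : (fun z => _) = (fun z => s * ((enorm z)^-1 * z 0 j))); last by apply/funext => z; rewrite !mxE.
  apply: isgradZ; apply: isgradM; last exact: isgrad_coord.
  by apply: isgradV => //; exact: isgrad_enorm.
apply: (isgrad_eq (isgrad_compv PG (C1_isgrad (Phi x) cf))).
rewrite /Phi; set g := grad f _.
have -> : \sum_j g 0 j *: G j = s *: ((enorm x)^-1 *: g - (dot g x * enorm x ^- 2) *: nx x).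
  under eq_bigr do rewrite /G scalerA mulrC -scalerA scalerDr !scalerA.
  rewrite -scaler_sumr big_split/=; congr (_ *: (_ + _)).
    by under eq_bigr do rewrite mulrC -scalerA; rewrite -scaler_sumr -row_sum_delta'.
  rewrite -scaler_suml -scaleNr /nx scalerA; congr (_ *: _).
  by rewrite -mulNr /dot -sumrN !mulr_suml; apply: eq_bigr => j _; ring.
rewrite [RHS]scalerA (mulrC _ s) -[RHS]scalerA; congr (_ *: _).
rewrite scalerBr; congr (_ - _); rewrite [RHS]scalerA; congr (_ *: _).
have -> : dot g x = enorm x * dot g (nx x) by rewrite -dotZr enorm_nxE.
by field.
Qed.

(** On each sphere [sphere_divergence] exchanges the tangential part of the divergence for
    [(n-1) / r] times the normal component. What results, times [r^(n-1)], is the radial derivative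
    of [r^(n-1)] times the normal component. A ball of radius [a] around the origin is cut out, and
    its contributions are of order [a]. *)
Lemma ball_divergence (X : 'rV[R]_n -> 'rV[R]_n) (rho : R) : 0 < rho ->
  (forall i, C1 (fun x => X x 0 i)) ->
  \int[leb]_(x in [set x | enorm x < rho]) divergence X x =
  n%:R * rho ^+ n.-1 * sA (fun y => dot (X (rho *: y)) y).
Proof.
move=> rho0 cX.
pose g i x := grad (fun z => X z 0 i) x.
have gX i x : isgrad (fun z => X z 0 i) x (g i x) by exact: C1_isgrad.
have cXi i : continuous (fun z => X z 0 i) by move=> x; exact: isgrad_continuous (gX i x).
have cg i j : continuous (fun x => g i x 0 j).
  by rewrite gradE; have [] := cX i j.
pose f1 := divergence X.
have f1E x : f1 x = \sum_i g i x 0 i by apply: eq_bigr => i _; rewrite mxE.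
have cf1 : continuous f1.
  move=> x; rewrite (_ : f1 = (fun x => \sum_i g i x 0 i)); last exact/funext.
  by apply: continuous_sum => i; exact: cg.
(* Normal component times [(n-1) / |x|], plus its radial derivative. *)
pose f2 x := (enorm x)^-1 * (n.-1%:R * dot (X x) (nx x)) + \sum_i dot (g i x) (nx x) * nx x 0 i.
have cnx i x : x != 0 -> {for x, continuous (fun z : 'rV[R]_n => nx z 0 i)}.
  by move=> x0; exact: (@scont_coord R n i x x0).
have cf2 x : x != 0 -> {for x, continuous f2}.
  move=> x0; rewrite /f2; apply: continuous_add.
    apply: continuous_mul; first by apply: continuousV; [rewrite enorm_eq0|exact: continuous_enorm].
    apply: continuous_mul; first exact: continuous_cst_at.
    by apply: continuous_sum => i; apply: continuous_mul; [exact: cXi|exact: cnx].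
  apply: continuous_sum => i; apply: continuous_mul; last exact: cnx.
  by apply: continuous_sum => j; apply: continuous_mul; [exact: cg|exact: cnx].
have sc (u : 'rV[R]_n -> R) : (forall x, x != 0 -> {for x, continuous u}) ->
    forall s : R, 0 < s -> scont (fun y => u (s *: y)).
  move=> cu s s0; apply: scont_hextend => x x0; apply: (continuous_comp (@scaler_continuous _ _ s x)).
  by apply: cu; rewrite scaler_eq0 negb_or gt_eqF.
have f12 s : 0 < s -> sA (fun y => f1 (s *: y)) = sA (fun y => f2 (s *: y)).
  move=> s0; have := sphere_divergence n1 (fun i => sgrad_scale s0 (cX i)).
  pose A y := \sum_i dot (g i (s *: y)) y * y 0 i.
  have cgs i j : continuous (fun y => g i (s *: y) 0 j).
    by move=> x; exact: (continuous_comp (@scaler_continuous _ _ s x) (cg i j _)).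
  have cA : scont A.
    apply: scont_continuous => x; apply: continuous_sum => i; apply: continuous_mul; last exact: continuous_coord.
    by apply: continuous_sum => j; apply: continuous_mul; [exact: cgs|exact: continuous_coord].
  have c1 : scont (fun y => f1 (s *: y)) by apply: sc => // x _; exact: cf1.
  rewrite (_ : sA (fun y => \sum_i _) = sA (fun y => s * (f1 (s *: y) - A y))); last first.
    congr sA; apply/funext => y; rewrite f1E /A mulrBr !mulr_sumr -sumrB; apply: eq_bigr => i _.
    by rewrite !mxE mulrBr.
  have cB : scont (fun y => dot (X (s *: y)) y).
    apply: scont_dot => i; last exact: scont_coord.
    by apply: (sc (fun x => X x 0 i)) => // x _; exact: cXi.
  rewrite sAZ ?sAB//; last exact: scontB.
  move=> h.
  have -> : sA (fun y => f2 (s *: y)) = sA (fun y => s^-1 * (n.-1%:R * dot (X (s *: y)) y) + A y).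
    apply: eq_sA => y y1; rewrite /f2 nxZ// nx_id// enormZ gtr0_norm// y1 mulr1//.
  have cB' : scont (fun y => n.-1%:R * dot (X (s *: y)) y) by scont.
  rewrite sAD//; last by scont.
  rewrite sAZ// sAZ// -h mulrA mulVf ?gt_eqF// mul1r subrK//.
pose K y (r : R) := r ^+ n.-1 * dot (X (r *: y)) y.
have dK y (r : R) : unit_sphere y -> 0 < r -> is_derive r 1 (K y) (r ^+ n.-1 * f2 (r *: y)).
  move=> y1 r0.
  have H i : is_derive r 1 (fun s => X (s *: y) 0 i * y 0 i) (dot (g i (r *: y)) y * y 0 i).
    have h := is_derive_ray (isgrad_derive y (gX i (r *: y))).
    by apply: (is_derive_eq (is_deriveM h (is_derive_cst (y 0 i) r (1:R)))); rewrite scaler0 add0r /GRing.scale/= mulrC.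
  have HS : is_derive r 1 (fun s => dot (X (s *: y)) y) (\sum_i dot (g i (r *: y)) y * y 0 i).
    have := @is_derive_sum R R R n (fun i (s : R) => X (s *: y) 0 i * y 0 i) r 1 _ H.
    by rewrite (_ : \sum_i _ = (fun s => dot (X (s *: y)) y))//; apply/funext => s; rewrite fct_sumE.
  apply: (is_derive_eq (is_deriveM (is_deriveXn r n.-1) HS)).
  rewrite /GRing.scale/= /f2 nxZ// nx_id// enormZ gtr0_norm// y1 mulr1.
  rewrite (_ : r ^+ n.-1 = r * r ^+ n.-2); last by rewrite -exprS prednK// -subn1 subn_gt0.
  by field; rewrite gt_eqF.
have [B1 B10 HB1] := ball_bounded rho cf1.
have cN : continuous (fun x => \sum_i `|X x 0 i|).
  move=> x; apply: continuous_sum => i.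
  by apply: (continuous_comp (cXi i x)); exact: norm_continuous.
have [B2 B20 HB2] := ball_bounded rho cN.
have XB y (r : R) : unit_sphere y -> 0 <= r <= rho -> `|dot (X (r *: y)) y| <= B2.
  move=> y1 /andP[r0 rr]; have := HB2 (r *: y); rewrite enormZ y1 mulr1 ger0_norm// => /(_ rr).
  rewrite ger0_norm; last by apply: sumr_ge0.
  apply: le_trans; apply: (le_trans (ler_norm_sum _ _ _)); apply: ler_sum => i _.
  by rewrite normrM ler_piMr// -y1 coord_le_enorm.
have cKr (r : R) : 0 < r -> scont (fun y => K y r).
  move=> r0; apply: scontM; first exact: scont_cst.
  apply: scont_dot => i; last exact: scont_coord.
  by apply: (sc (fun x => X x 0 i)) => // x _; exact: cXi.
have mball : measurable [set x : 'rV[R]_n | enorm x < rho].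
  by apply: measurable_lt_set => //; exact: measurable_enorm.
have mcball (a : R) : measurable [set x : 'rV[R]_n | enorm x <= a].
  by apply: measurable_le_set => //; exact: measurable_enorm.
have mf1 := measurable_continuous cf1.
have if1 (D : set 'rV[R]_n) : measurable D -> (forall x, D x -> enorm x <= rho) ->
    leb.-integrable D (EFin \o f1).
  move=> mD Dr; apply: (integrable_bounded mD Dr (M := B1)); first exact: measurable_funTS.
  by move=> x /Dr; exact: HB1.
pose V : R := sA (fun _ : 'rV[R]_n => 1).
have V0 : 0 <= V by exact: sA_ge0.
apply/eqP; rewrite -subr_eq0 -normr_le0.
apply: (@le0_small _ (B1 * 2 ^+ n + n%:R * (B2 * V))).
  by rewrite addr_ge0// !mulr_ge0.
exists (Num.min 1 rho) => [|a /andP[a0]]; first by rewrite lt_min ltr01.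
rewrite lt_min => /andP[a1 ar].
have splitE : [set x : 'rV[R]_n | enorm x < rho] =
    annulus a rho `|` [set x | enorm x <= a].
  apply/seteqP; split=> [x /= xr|x /= [[_ _ //]|/le_lt_trans]]; last exact.
  have [xa|ax] := leP (enorm x) a; [by right|left].
  by split => //; rewrite -enorm_gt0 (lt_trans a0).
have mreg := measurable_annulus a rho.
have mf2 : measurable_fun setT f2 by exact: measurable_away0.
have [M2 HM2] : exists M2, forall x, annulus a rho x -> `|f2 x| <= M2.
  pose KK := [set x : 'rV[R]_n | a <= enorm x <= rho].
  have cKK : compact KK.
    apply: (subclosed_compact _ (@compact_closed_enorm_ball _ _ rho)); last by move=> x /andP[].
    have -> : KK = (@enorm R n) @^-1` `[a, rho] by apply/seteqP; split=> x; rewrite /KK/= in_itv.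
    by apply: closed_comp => [x _|]; [exact: continuous_enorm|exact: itv_closed].
  have cuK : {within KK, continuous f2}.
    apply: continuous_in_subspaceT => x; rewrite inE => /andP[ax _]; apply: cf2.
    by rewrite -enorm_gt0 (lt_le_trans a0).
  have /compact_bounded[B [_ HB]] := continuous_compact cuK cKK.
  exists (`|B| + 1) => x [x0 h1 h2]; apply: (HB (`|B| + 1)); last by exists x; rewrite // /KK/= !ltW.
  by rewrite (le_lt_trans (ler_norm _))// ltrDl.
have I1 : \int[leb]_(x in annulus a rho) f1 x = n%:R * sA (fun y => K y rho - K y a).
  rewrite (@eq_annulus a rho (`|B1| + `|M2|) f1 f2)//.
  - apply: (@polar_primitive R n n0 (fun=> a) (fun=> rho) f2 K M2) => //.
    + exact: scont_cst.
    + exact: scont_cst.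
    + by move=> y _; rewrite !ltW.
    + move=> y r y1 /andP[ra rr]; have r0 : 0 < r by exact: lt_le_trans ra.
      split; first exact: dK.
      apply: continuous_mul; first exact: exprn_continuous.
      apply: (continuous_comp (f := fun s : R => s *: y)); first by apply: cvgZr_tmp; exact: cvg_id.
      by apply: cf2; rewrite scaler_eq0 negb_or gt_eqF//= unit_sphere_neq0.
    + by apply: scontB; exact: cKr.
  - by apply: sc => x _; exact: cf1.
  - by apply: sc => x; exact: cf2.
  - move=> x [_ _ /ltW xr]; rewrite (le_trans (HB1 x xr))// (le_trans (ler_norm _))// lerDl//.
  - by move=> x /HM2 h; rewrite (le_trans h)// (le_trans (ler_norm _))// lerDr.
rewrite -/f1 splitE Rintegral_setU//; last 2 first.
- by apply: if1; rewrite -?splitE => // x /ltW.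
- by apply/disj_set2P/seteqP; split=> x //= [[_ h _]]; rewrite leNgt h.
rewrite I1 sAB; [|exact: cKr..].
have K1 : sA (fun y => K y rho) = rho ^+ n.-1 * sA (fun y => dot (X (rho *: y)) y).
  rewrite sAZ//; apply: scont_dot => i; last exact: scont_coord.
  by apply: (sc (fun x => X x 0 i)) => // x _; exact: cXi.
have K2 : `|sA (fun y => K y a)| <= a * (B2 * V).
  rewrite mulrA; apply: norm_sA_le; first exact: cKr.
  move=> y y1; rewrite normrM ler_pM//; last by apply: XB => //; rewrite !ltW.
  rewrite ger0_norm ?exprn_ge0 ?(ltW a0)//.
  rewrite (_ : a ^+ n.-1 = a * a ^+ n.-2); last by rewrite -exprS prednK// -subn1 subn_gt0.
  by apply: ler_piMr; [exact: ltW|apply: exprn_ile1; exact: ltW].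
have I2 : `|\int[leb]_(x in [set x | enorm x <= a]) f1 x| <= a * (B1 * 2 ^+ n).
  have ia : leb.-integrable [set x : 'rV[R]_n | enorm x <= a] (EFin \o f1).
    by apply: if1 => // x /le_trans; apply; exact: ltW.
  rewrite (le_trans (le_normr_Rintegral (mcball a) ia))//.
  apply: (@le_trans _ _ (\int[leb]_(x in [set x | enorm x <= a]) B1)).
    apply: le_Rintegral => //.
    - by move/integrable_abse : ia.
    - apply: (@integrable_bounded _ _ _ _ a `|B1|) => //.
    - by move=> x /= xa; apply: HB1; rewrite (le_trans xa)// ltW.
  rewrite Rintegral_cst// mulrCA ler_wpM2l//.
  rewrite -lee_fin fineK; last first.
    by rewrite ge0_fin_numE//; exact: (@lebesgue_bounded _ _ _ a).
  apply: (@le_trans _ _ (leb (cube n a))).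
    apply: le_measure; rewrite ?inE//; first exact: measurable_cube.
    by move=> x /= xa i; exact: le_trans (coord_le_enorm x i) xa.
  rewrite lebesgue_cube ?(ltW a0)// lee_fin.
  rewrite (_ : (a *+ 2) ^+ n = a ^+ n * 2 ^+ n); last by rewrite -[a *+ 2]mulr_natr exprMn.
  rewrite ler_wpM2r//.
  rewrite (_ : a ^+ n = a * a ^+ n.-1); last by rewrite -exprS prednK.
  by apply: ler_piMr; [exact: ltW|apply: exprn_ile1; exact: ltW].
rewrite K1 mulrBr mulrA [X in X - _]addrC addrA addrAC.
rewrite (_ : _ + _ - _ = \int[leb]_(x in [set x | enorm x <= a]) f1 x - n%:R * sA (fun y => K y a)); last by ring.
rewrite (le_trans (ler_normB _ _))// mulrDl lerD//; first by rewrite mulrC.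
rewrite normrM normr_nat; apply: (le_trans (ler_wpM2l (ler0n R n) K2)).
by apply: eq_ler; ring.
Qed.

End ball_divergence.

(** * Polynomial approximation by Landau kernels *)

Section polynomial_functions.
Context {R : realType} {n : nat}.
Implicit Types (f h p q : 'rV[R]_n -> R) (x y : 'rV[R]_n).

(** Polynomial functions; the inductive form supports the inductions for commuting derivatives and
    for the decomposition into harmonics. *)
Inductive pf : ('rV[R]_n -> R) -> Prop :=
| pf_cst (c : R) : pf (fun=> c)
| pf_coord (i : 'I_n) : pf (fun x => x 0 i)
| pfD p q : pf p -> pf q -> pf (fun x => p x + q x)
| pfM p q : pf p -> pf q -> pf (fun x => p x * q x).

Lemma pfZ c p : pf p -> pf (fun x => c * p x).
Proof. by move=> hp; apply: pfM => //; exact: pf_cst. Qed.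

Lemma pfB p q : pf p -> pf q -> pf (fun x => p x - q x).
Proof.
move=> hp hq; rewrite (_ : (fun x => _) = (fun x => p x + (-1) * q x)).
  by apply: pfD => //; exact: pfZ.
by apply/funext => x; rewrite mulN1r.
Qed.

Lemma pf_sum (I : Type) (r : seq I) (F : I -> 'rV[R]_n -> R) :
  (forall i, pf (F i)) -> pf (fun x => \sum_(i <- r) F i x).
Proof.
move=> hF; elim: r => [|i r IH].
  by under eq_fun do rewrite big_nil; exact: pf_cst.
by under eq_fun do rewrite big_cons; exact: pfD.
Qed.

Lemma pf_dotxx : pf (fun x => dot x x).
Proof. by apply: pf_sum => i; apply: pfM; exact: pf_coord. Qed.

Lemma pf_grad p : pf p -> exists2 G : 'I_n -> 'rV[R]_n -> R, (forall i, pf (G i)) &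
  forall x, isgrad p x (\row_i G i x).
Proof.
elim=> [c|i|{}p q _ [Gp hp gp] _ [Gq hq gq]|{}p q pp [Gp hp gp] pq [Gq hq gq]].
- exists (fun _ _ => 0) => [i|x]; first exact: pf_cst.
  by apply: (isgrad_eq (isgrad_cst c x)); apply/rowP => i; rewrite !mxE.
- exists (fun j _ => (j == i)%:R) => [j|x]; first exact: pf_cst.
  by apply: (isgrad_eq (isgrad_coord i x)); apply/rowP => j; rewrite !mxE eqxx.
- exists (fun i x => Gp i x + Gq i x) => [i|x]; first exact: pfD.
  by apply: (isgrad_eq (isgradD (gp x) (gq x))); apply/rowP => i; rewrite !mxE.
- exists (fun i x => p x * Gq i x + q x * Gp i x) => [i|x]; first by apply: pfD; exact: pfM.
  by apply: (isgrad_eq (isgradM (gp x) (gq x))); apply/rowP => i; rewrite !mxE.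
Qed.

Lemma pf_isgrad p x : pf p -> isgrad p x (grad p x).
Proof. by move=> /pf_grad[G _ gG]; rewrite (isgrad_grad (gG x)). Qed.

Lemma pf_partial p i : pf p -> pf (partial i p).
Proof.
move=> /pf_grad[G hG gG]; rewrite (_ : partial i p = G i)//.
by apply/funext => x; rewrite (isgrad_partial i (gG x)) mxE.
Qed.

Lemma pf_continuous p : pf p -> continuous p.
Proof. by move=> hp x; exact: isgrad_continuous (pf_isgrad x hp). Qed.

Lemma pf_C1 p : pf p -> C1 p.
Proof.
move=> hp i; split=> [x|]; first exact: isgrad_derivable (pf_isgrad x hp).
exact/pf_continuous/pf_partial.
Qed.

Definition csupp f := continuous f /\ exists r : R, forall x, r < enorm x -> f x = 0.

Lemma csupp_integrable f : csupp f -> leb.-integrable setT (EFin \o f).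
Proof.
move=> [cf [r f0]]; have [B HB] := bounded_support cf f0.
exact: (integrable_support (measurable_continuous cf) HB f0).
Qed.

Lemma csuppM f h : csupp f -> continuous h -> csupp (fun x => f x * h x).
Proof.
move=> [cf [r f0]] ch; split; first by move=> x; apply: continuousM; [exact: cf|exact: ch].
by exists r => x /f0 ->; rewrite mul0r.
Qed.

Lemma csuppD f h : csupp f -> csupp h -> csupp (fun x => f x + h x).
Proof.
move=> [cf [r f0]] [ch [s h0]]; split; first by move=> x; apply: continuousD; [exact: cf|exact: ch].
by exists (Num.max r s) => x; rewrite gt_max => /andP[/f0 -> /h0 ->]; rewrite addr0.
Qed.

Lemma csupp_sum (I : Type) (r : seq I) (F : I -> 'rV[R]_n -> R) :
  (forall i, csupp (F i)) -> csupp (fun x => \sum_(i <- r) F i x).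
Proof.
move=> hF; elim: r => [|i r IH].
  rewrite (_ : (fun x => _) = cst 0); last by apply/funext => x; rewrite big_nil.
  by split; [exact: cst_continuous|exists 0].
by under eq_fun do rewrite big_cons; exact: csuppD.
Qed.

Lemma Rintegral_csupp_sum (I : Type) (r : seq I) (F : I -> 'rV[R]_n -> R) :
  (forall i, csupp (F i)) -> \int[leb]_x (\sum_(i <- r) F i x) = \sum_(i <- r) \int[leb]_x F i x.
Proof.
move=> hF; elim: r => [|i r IH].
  rewrite (_ : (fun x => _) = cst 0); last by apply/funext => x; rewrite big_nil.
  by rewrite Rintegral_cst// mul0r big_nil.
rewrite big_cons -IH -RintegralD//; [|exact: csupp_integrable|exact/csupp_integrable/csupp_sum].
by congr fine; apply: eq_integral => x _; rewrite big_cons.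
Qed.

Variable L : R.
Hypothesis L0 : 0 < L.

(** Landau's kernel without its normalisation. It is positive and concentrated near 0 only inside
    the ball of radius [L], so it is used for differences of length at most [L]. *)
Definition landau N (z : 'rV[R]_n) : R := (1 - dot z z / L ^+ 2) ^+ N.

Definition landau_conv N f x : R := \int[leb]_y (f y * landau N (x - y)).

Lemma continuous_landau N x : continuous (fun y => landau N (x - y)).
Proof.
move=> y; apply: (@continuous_comp _ _ _ (fun y => 1 - dot (x - y) (x - y) / L ^+ 2) (fun t => t ^+ N)); last exact: exprn_continuous.
apply: continuous_sub; first exact: continuous_cst_at.
apply: continuous_mul; last exact: continuous_cst_at.
by apply: continuous_dot; apply: continuousB; (try exact: cvg_id); exact: cst_continuous.
Qed.

Lemma landau_csupp N f x : csupp f -> csupp (fun y => f y * landau N (x - y)).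
Proof. by move=> hf; apply: csuppM => //; exact: continuous_landau. Qed.

(* Expanding [|x - y|^2] shows that the convolution is a polynomial in [x]. *)
Lemma landau_convS N f x : csupp f -> landau_conv N.+1 f x =
  (1 - dot x x / L ^+ 2) * landau_conv N f x +
  \sum_i (2 / L ^+ 2 * x 0 i) * landau_conv N (fun y => f y * y 0 i) x -
  (L ^+ 2)^-1 * landau_conv N (fun y => f y * dot y y) x.
Proof.
move=> hf; have iL g : csupp g -> leb.-integrable setT (EFin \o (fun y => g y * landau N (x - y))).
  by move=> hg; exact/csupp_integrable/landau_csupp.
have cc i : continuous (fun y : 'rV[R]_n => y 0 i) by exact: continuous_coord.
have cd : continuous (fun y : 'rV[R]_n => dot y y) by exact/pf_continuous/pf_dotxx.
have h1 i := csuppM hf (cc i); have h2 := csuppM hf cd.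
have h3 c g : csupp g -> csupp (fun y => c * (g y * landau N (x - y))).
  move=> hg; under eq_fun do rewrite mulrC; apply: csuppM; first exact: landau_csupp.
  exact: cst_continuous.
rewrite /landau_conv -(RintegralZl _ measurableT (iL _ hf)) -(RintegralZl _ measurableT (iL _ h2)).
under [X in _ + X - _]eq_bigr do rewrite -(RintegralZl _ measurableT (iL _ (h1 _))).
rewrite -Rintegral_csupp_sum; last by move=> i; exact: h3.
rewrite -RintegralD//; [|exact/csupp_integrable/h3|by apply: csupp_integrable; apply: csupp_sum => i; exact: h3].
rewrite -RintegralB//; [|apply: csupp_integrable; apply: csuppD; [exact: h3|by apply: csupp_sum => i; exact: h3]|exact/csupp_integrable/h3].
congr fine; apply: eq_integral => y _; congr _%:E.
rewrite {1}/landau exprS -/(landau N _).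
have -> : \sum_i 2 / L ^+ 2 * x 0 i * (f y * y 0 i * landau N (x - y)) =
    2 / L ^+ 2 * dot x y * f y * landau N (x - y).
  by rewrite /dot mulr_sumr !mulr_suml; apply: eq_bigr => i _; ring.
rewrite dotBl !dotBr (dotC y x); ring.
Qed.

Lemma pf_landau_conv N f : csupp f -> pf (landau_conv N f).
Proof.
elim: N f => [|N IH] f hf.
  rewrite (_ : landau_conv 0 f = (fun=> \int[leb]_y f y)); first exact: pf_cst.
  by apply/funext => x; congr fine; apply: eq_integral => y _; rewrite /landau expr0 mulr1.
have -> : landau_conv N.+1 f = (fun x => (1 - dot x x / L ^+ 2) * landau_conv N f x +
  \sum_i (2 / L ^+ 2 * x 0 i) * landau_conv N (fun y => f y * y 0 i) x -
  (L ^+ 2)^-1 * landau_conv N (fun y => f y * dot y y) x).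
  by apply/funext => x; rewrite landau_convS.
have cc i : continuous (fun y : 'rV[R]_n => y 0 i) by exact: continuous_coord.
have cd : continuous (fun y : 'rV[R]_n => dot y y) by exact/pf_continuous/pf_dotxx.
apply: pfB; last by apply: pfZ; apply: IH; exact: csuppM.
apply: pfD.
  apply: pfM; last exact: IH.
  apply: pfB; first exact: pf_cst.
  by apply: pfM; [exact: pf_dotxx|exact: pf_cst].
apply: pf_sum => i; apply: pfM; last by apply: IH; exact: csuppM.
by apply: pfZ; exact: pf_coord.
Qed.

Lemma csupp_partial f i : C1 f -> csupp f -> csupp (partial i f).
Proof.
move=> cf [_ [r f0]]; split; first by have [] := cf i.
by exists r; exact: C1_support_partial.
Qed.

Lemma C1M f h : C1 f -> C1 h -> C1 (fun x => f x * h x).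
Proof.
move=> cf ch i.
have G x := isgradM (C1_isgrad x cf) (C1_isgrad x ch).
split=> [x|]; first exact: isgrad_derivable (G x).
rewrite (_ : partial i _ = (fun x => f x * partial i h x + h x * partial i f x)); last first.
  by apply/funext => x; rewrite (isgrad_partial i (G x)) !mxE.
have cF (u : 'rV[R]_n -> R) : C1 u -> continuous u by move=> cu x; exact: isgrad_continuous (C1_isgrad x cu).
suff H x : {for x, continuous (fun x => f x * partial i h x + h x * partial i f x)} by exact: H.
apply: continuous_add; apply: continuous_mul.
- exact: cF.
- by have [_] := ch i; exact.
- exact: cF.
- by have [_] := cf i; exact.
Qed.

Lemma landau_conv_lin N (c : R) f h x : csupp f -> csupp h ->
  landau_conv N (fun y => c * f y + h y) x = c * landau_conv N f x + landau_conv N h x.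
Proof.
move=> hf hh; rewrite /landau_conv.
have i1 := csupp_integrable (landau_csupp N x hf).
have i2 := csupp_integrable (landau_csupp N x hh).
rewrite -RintegralZl// -RintegralD//.
  by congr fine; apply: eq_integral => y _; congr _%:E; ring.
exact: (integrableZl measurableT c i1).
Qed.

(** The recursion [landau_convS] carries the identity from [N] to [N + 1] by the product rule, in
    place of a differentiation under the integral. In the base case both sides vanish, because the
    derivative of a compactly supported function has integral zero. *)
Lemma partial_landau_conv N f i : C1 f -> csupp f ->
  partial i (landau_conv N f) = landau_conv N (partial i f).
Proof.
elim: N f => [|N IH] f cf hf; apply/funext => x.
  have -> : landau_conv 0 f = cst (\int[leb]_y f y).
    by apply/funext => z; congr fine; apply: eq_integral => y _; rewrite /landau expr0 mulr1.
  rewrite (isgrad_partial i (isgrad_cst _ x)) mxE /landau_conv.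
  have [_ [r f0]] := hf; rewrite -(Rintegral_partial i cf f0).
  by congr fine; apply: eq_integral => y _; rewrite /landau expr0 mulr1.
have cc j : continuous (fun y : 'rV[R]_n => y 0 j) by exact: continuous_coord.
have cd : continuous (fun y : 'rV[R]_n => dot y y) by exact/pf_continuous/pf_dotxx.
have hj j := csuppM hf (cc j); have hd := csuppM hf cd.
have hi := csupp_partial i cf hf.
have hij j := csuppM hi (cc j); have hid := csuppM hi cd.
have gr g : csupp g -> isgrad (landau_conv N g) x (grad (landau_conv N g) x).
  by move=> hg; apply: pf_isgrad; exact: pf_landau_conv.
have gE g : C1 g -> csupp g -> grad (landau_conv N g) x 0 i = landau_conv N (partial i g) x.
  by move=> cg hg; rewrite mxE IH.
have A1 := isgradM (isgradB (isgrad_cst 1 x) (isgradM (isgrad_dotxx x) (isgrad_cst (L ^+ 2)^-1 x))) (gr f hf).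
have A2 := isgrad_sum (index_enum 'I_n) (fun j => isgradM (isgradZ (2 / L ^+ 2) (isgrad_coord j x)) (gr _ (hj j))).
have A3 := isgradZ (L ^+ 2)^-1 (gr _ hd).
have -> : landau_conv N.+1 f = (fun x => (1 - dot x x / L ^+ 2) * landau_conv N f x +
  \sum_i (2 / L ^+ 2 * x 0 i) * landau_conv N (fun y => f y * y 0 i) x -
  (L ^+ 2)^-1 * landau_conv N (fun y => f y * dot y y) x).
  by apply/funext => z; rewrite landau_convS.
rewrite (isgrad_partial i (isgradB (isgradD A1 A2) A3)) landau_convS// !mxE summxE.
have C1c j : C1 (fun y : 'rV[R]_n => y 0 j) by exact/pf_C1/pf_coord.
have C1d : C1 (fun y : 'rV[R]_n => dot y y) by exact/pf_C1/pf_dotxx.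
have P1 j : partial i (fun y => f y * y 0 j) = (fun y => (i == j)%:R * f y + partial i f y * y 0 j).
  apply/funext => y; rewrite (isgrad_partial i (isgradM (C1_isgrad y cf) (isgrad_coord j y))) !mxE eqxx/=.
  by rewrite (mulrC (f y)) (mulrC (y 0 j)).
have P2 : partial i (fun y => f y * dot y y) = (fun y => 2 * (f y * y 0 i) + partial i f y * dot y y).
  apply/funext => y; rewrite (isgrad_partial i (isgradM (C1_isgrad y cf) (isgrad_dotxx y))) !mxE; ring.
rewrite IH// [X in _ - X](_ : _ = (L ^+ 2)^-1 * (2 * landau_conv N (fun y => f y * y 0 i) x +
   landau_conv N (fun y => partial i f y * dot y y) x)); last first.
  by rewrite IH//; [rewrite P2 landau_conv_lin|exact: C1M].
rewrite (eq_bigr (fun j => 2 / L ^+ 2 * x 0 j * landau_conv N (fun y => partial i f y * y 0 j) x +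
   ((i == j)%:R * (2 / L ^+ 2 * x 0 j * landau_conv N f x) +
    (i == j)%:R * (2 / L ^+ 2 * landau_conv N (fun y => f y * y 0 j) x)))); last first.
  move=> j _; rewrite !mxE eqxx/= IH//; last exact: C1M.
  rewrite P1 landau_conv_lin//; ring.
have sd (a : 'I_n -> R) : \sum_j (i == j)%:R * a j = a i.
  rewrite (bigD1 i)//= eqxx mul1r big1 ?addr0// => j /negbTE ji.
  by rewrite eq_sym ji mul0r.
rewrite !big_split/= !sd; ring.
Qed.

End polynomial_functions.

(** * Convergence of the Landau convolutions *)

Section landau_approximation.
Context {R : realType} {n : nat}.
Implicit Types (f h p q : 'rV[R]_n -> R) (x y : 'rV[R]_n).

Lemma Rintegral_reflect f x : measurable_fun setT f ->
  \int[leb]_y f y = \int[leb]_z f (x - z).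
Proof.
move=> mf; rewrite (Rintegral_affine x (normrN1 R) mf).
by apply: eq_Rintegral => z _; rewrite scaleN1r addrC.
Qed.

Definition eball (r : R) : set 'rV[R]_n := [set x | enorm x < r].

Lemma measurable_eball r : measurable (eball r).
Proof. by apply: measurable_lt_set => //; exact: measurable_enorm. Qed.

Lemma integrable_eball f r : continuous f -> leb.-integrable (eball r) (EFin \o f).
Proof.
move=> cf.
have [B B0 HB] := ball_bounded r cf.
apply: (@integrable_bounded _ _ _ _ r B) => [|x /ltW//||x /ltW /HB//]; first exact: measurable_eball.
by apply: measurable_funTS; exact: measurable_continuous.
Qed.

Lemma isgrad_landau (L : R) N x : isgrad (landau L N.+1) x
  ((N.+1%:R * landau L N x * - (2 / L ^+ 2)) *: x).
Proof.
apply: isgrad_eq; first by apply: isgradX; apply: isgradB (isgrad_cst 1 x) (isgradM (isgrad_dotxx x) (isgrad_cst (L ^+ 2)^-1 x)).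
by rewrite scaler0 !add0r /landau/= -!mulrA -!scalerA; congr (_ *: (_ *: _)); rewrite !scalerA scaleNr mulrC.
Qed.

Lemma pf_landau (L : R) N : pf (@landau R n L N).
Proof.
elim: N => [|N IH].
  by rewrite (_ : landau L 0 = (fun=> 1)); [exact: pf_cst|apply/funext => z; rewrite /landau expr0].
rewrite (_ : landau L N.+1 = (fun z => (1 - dot z z / L ^+ 2) * landau L N z)).
  apply: pfM => //; apply: pfB; first exact: pf_cst.
  by apply: pfM; [exact: pf_dotxx|exact: pf_cst].
by apply/funext => z; rewrite /landau exprS.
Qed.

Hypothesis n1 : (1 < n)%N.
Variable L : R.
Hypothesis L0 : 0 < L.

Definition landau_mass N : R := \int[leb]_(z in eball L) landau L N z.

Lemma landau_base z : eball L z -> 0 <= 1 - dot z z / L ^+ 2 <= 1.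
Proof.
move=> zL; have L2 : 0 < L ^+ 2 by rewrite exprn_gt0.
apply/andP; split; last by rewrite gerBl divr_ge0 ?dotxx_ge0// ltW.
rewrite subr_ge0 ler_pdivrMr// mul1r -enorm_sqr ler_sqr ?nnegrE ?enorm_ge0 ?(ltW L0)//.
exact: ltW.
Qed.

Lemma landau_ge0 N z : eball L z -> 0 <= landau L N z.
Proof. by move=> /landau_base/andP[h _]; exact: exprn_ge0. Qed.

Lemma continuous_landau0 N : continuous (@landau R n L N).
Proof. by apply: pf_continuous; exact: pf_landau. Qed.

Lemma landau_massS N : landau_mass N.+1 <= landau_mass N.
Proof.
apply: le_Rintegral; [exact: measurable_eball|exact/integrable_eball/continuous_landau0..|].
move=> z zL; rewrite /landau exprS ler_piMl//; first exact: landau_ge0.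
by have /andP[] := landau_base zL.
Qed.

Lemma landau_mass_gt0 N : 0 < landau_mass N.
Proof.
have L2 : 0 < L / 2 by rewrite divr_gt0.
have sub : eball (L / 2) `<=` eball L.
  by move=> z /lt_trans; apply; rewrite ltr_pdivrMr// ltr_pMr// ltr1n.
pose V := fine (leb (eball (L / 2))).
have Vfin : (leb (eball (L / 2)) < +oo)%E.
  by apply: (@lebesgue_bounded _ _ _ (L / 2)) => [|x /ltW//]; exact: measurable_eball.
have V0 : 0 < V.
  apply: fine_gt0; rewrite Vfin andbT.
  pose r : R := L / 2 / n.+1%:R; have r0 : 0 < r by rewrite divr_gt0.
  apply: (@lt_le_trans _ _ (leb (cube n r))).
    by rewrite lebesgue_cube ?(ltW r0)// lte_fin exprn_gt0// mulrn_wgt0.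
  apply: le_measure; rewrite ?inE; [exact: measurable_cube|exact: measurable_eball|].
  move=> x /= xr; rewrite /eball/= (le_lt_trans (enorm_le_sum x))//.
  rewrite (le_lt_trans (ler_sum _ (fun i _ => xr i)))//.
  rewrite sumr_const card_ord -[r *+ n]mulr_natl /r mulrCA gtr_pMr// ltr_pdivrMr// mul1r ltr_nat//.
apply: (@lt_le_trans _ _ ((3 / 4) ^+ N * V)); first by rewrite mulr_gt0// exprn_gt0// divr_gt0.
rewrite -(Rintegral_cst _ (measurable_eball (L / 2))).
apply: (@le_trans _ _ (\int[leb]_(z in eball (L / 2)) landau L N z)).
  apply: le_Rintegral; [exact: measurable_eball| |exact/integrable_eball/continuous_landau0|].
    by apply: integrable_eball; exact: cst_continuous.
  move=> z zL; rewrite lerXn2r ?nnegrE ?divr_ge0//; first by have /andP[] := landau_base (sub _ zL).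
  rewrite lerBrDr -lerBrDl -enorm_sqr ler_pdivrMr ?exprn_gt0//.
  rewrite (_ : (1 - 3 / 4) * L ^+ 2 = (L / 2) ^+ 2); last by field.
  by rewrite ler_sqr ?nnegrE ?enorm_ge0 ?(ltW L2)//; exact: ltW.
apply: fine_le.
- by apply: integrable_fin_num; [exact: measurable_eball|exact/integrable_eball/continuous_landau0].
- by apply: integrable_fin_num; [exact: measurable_eball|exact/integrable_eball/continuous_landau0].
- apply: ge0_subset_integral; [exact: measurable_eball|exact: measurable_eball| | |exact: sub].
    by apply/measurable_EFinP; apply: measurable_funTS; apply: measurable_continuous; exact: continuous_landau0.
  by move=> z zL; rewrite lee_fin; exact: landau_ge0.
Qed.

(* The divergence theorem for [landau N.+1 z *: z], which vanishes on the boundary. *)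
Lemma landau_moment N : \int[leb]_(z in eball L) (dot z z * landau L N z) =
  L ^+ 2 * n%:R / (2 * N.+1%:R) * landau_mass N.+1.
Proof.
pose X (z : 'rV[R]_n) : 'rV[R]_n := landau L N.+1 z *: z.
have XE i : (fun x => X x 0 i) = (fun x => landau L N.+1 x * x 0 i) by apply/funext => z; rewrite mxE.
have cX i : C1 (fun x => X x 0 i).
  by rewrite XE; apply: pf_C1; apply: pfM; [exact: pf_landau|exact: pf_coord].
have := ball_divergence n1 L0 cX.
have dX z : divergence X z = n%:R * landau L N.+1 z + (- (2 * N.+1%:R / L ^+ 2)) * (dot z z * landau L N z).
  rewrite /divergence (eq_bigr (fun i => landau L N.+1 z + (- (2 * N.+1%:R / L ^+ 2)) * landau L N z * (z 0 i * z 0 i))); last first.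
    move=> i _; rewrite XE (isgrad_partial i (isgradM (isgrad_landau L N z) (isgrad_coord i z))).
    by rewrite !mxE !eqxx /=; ring.
  by rewrite big_split/= sumr_const card_ord -mulr_natl -mulr_sumr -/(dot z z); ring.
rewrite (_ : sA _ = 0); last first.
  rewrite -[RHS](sA0 (n := n)); apply: eq_sA => y y1.
  rewrite /X dotZl /landau dotZl dotZr -enorm_sqr y1 expr1n mulr1 -expr2 divff ?subrr ?expr0n/= ?mul0r//.
  by rewrite expf_neq0// gt_eqF.
rewrite mulr0 (_ : Rintegral _ _ _ = n%:R * landau_mass N.+1 + (- (2 * N.+1%:R / L ^+ 2)) * \int[leb]_(z in eball L) (dot z z * landau L N z)).
  move=> /eqP; rewrite mulNr subr_eq0 => /eqP h.
  have N0 : N.+1%:R != 0 :> R by rewrite pnatr_eq0.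
  apply: (@mulfI _ (2 * N.+1%:R / L ^+ 2)); last by rewrite -h; field; rewrite nat1r N0 gt_eqF.
  by rewrite mulf_neq0// ?invr_eq0 ?mulf_neq0 ?expf_neq0// gt_eqF.
have c1 : continuous (fun z : 'rV[R]_n => dot z z * landau L N z).
  by apply: pf_continuous; apply: pfM; [exact: pf_dotxx|exact: pf_landau].
have m1 := measurable_eball L.
have i1 := integrable_eball L c1; have i2 := integrable_eball L (@continuous_landau0 N.+1).
rewrite /landau_mass -(RintegralZl _ m1 i1) -(RintegralZl _ m1 i2) -RintegralD//.
- by apply: eq_Rintegral => z _; rewrite dX.
- exact: (integrableZl m1 _ i2).
- exact: (integrableZl m1 _ i1).
Qed.

(** With [x] and the support of [f] within radius [L / 2], only differences of length at most [L]
    matter; at length exactly [L] the kernel vanishes. *)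
Lemma landau_convE N f x : csupp f -> (forall y, L / 2 < enorm y -> f y = 0) -> enorm x <= L / 2 ->
  landau_conv L N.+1 f x = \int[leb]_(z in eball L) (f (x - z) * landau L N.+1 z).
Proof.
move=> hf f0 xr; rewrite /landau_conv (@Rintegral_reflect _ x); last first.
  by have [c _] := landau_csupp L N.+1 x hf; exact: measurable_continuous.
rewrite [RHS]Rintegral_mkcond; apply: eq_Rintegral => z _; rewrite patchE subKr.
case: ifPn => //; rewrite notin_setE => /negP; rewrite -leNgt le_eqVlt => /orP[/eqP zL|zL].
  rewrite /landau -enorm_sqr -zL divff ?subrr ?expr0n/= ?mulr0//.
  by rewrite expf_neq0// gt_eqF.
rewrite f0 ?mul0r//; have := enormB z x; rewrite -(enormN (z - x)) opprB => h.
by apply: lt_le_trans h; lra.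
Qed.

(** A Chebyshev argument: [|f (x - z) - f x|] is at most [e / 2 + (2 B / d^2) |z|^2], and the second
    moment of the kernel is its mass times a quantity of order [1 / N]. *)
Lemma landau_approx f (e : R) : csupp f -> (forall y, L / 2 < enorm y -> f y = 0) -> 0 < e ->
  exists N0, forall N, (N0 <= N)%N -> forall x, enorm x <= L / 2 ->
    `|(landau_mass N)^-1 * landau_conv L N f x - f x| <= e.
Proof.
move=> hf f0 e0; have [cf _] := hf.
have [B HB] := bounded_support cf f0.
have B0 : 0 <= B by exact: le_trans (HB 0).
have e2 : 0 < e / 2 by rewrite divr_gt0.
have [d d0 Hd] := compact_uniform_continuous cf (@compact_closed_enorm_ball _ _ (L / 2)) e2.
pose C := 2 * B / d ^+ 2; have C0 : 0 <= C by rewrite divr_ge0 ?mulr_ge0 ?exprn_ge0// ltW.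
pose K := C * (L ^+ 2 * n%:R); have K0 : 0 <= K by rewrite mulr_ge0// mulr_ge0// exprn_ge0// ltW.
exists (Num.truncn (K / e)).+2 => -[//|N] KN x xL.
have m0 := landau_mass_gt0 N.+1.
rewrite (_ : _ - f x = (landau_mass N.+1)^-1 * (landau_conv L N.+1 f x - landau_mass N.+1 * f x)); last first.
  by field; exact: lt0r_neq0.
rewrite normrM gtr0_norm ?invr_gt0// mulrC ler_pdivrMr//.
have m1 := measurable_eball L.
have c1 : continuous (fun z : 'rV[R]_n => f (x - z) * landau L N.+1 z).
  move=> z; suff : {for z, continuous (fun z : 'rV[R]_n => f (x - z) * landau L N.+1 z)} by [].
  apply: continuous_mul; last exact: continuous_landau0.
  apply: (continuous_comp (f := fun z : 'rV[R]_n => x - z)); last exact: cf.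
  by apply: continuousB; [exact: cst_continuous|exact: cvg_id].
have cL := @continuous_landau0 N.+1.
have c2 : continuous (fun z : 'rV[R]_n => f x * landau L N.+1 z).
  move=> z; suff : {for z, continuous (fun z : 'rV[R]_n => f x * landau L N.+1 z)} by [].
  by apply: continuous_mul; [exact: continuous_cst_at|exact: cL].
have c3 : continuous (fun z : 'rV[R]_n => dot z z * landau L N.+1 z).
  by apply: pf_continuous; apply: pfM; [exact: pf_dotxx|exact: pf_landau].
have i1 := integrable_eball L c1; have i2 := integrable_eball L c2.
have i3 := integrable_eball L c3; have iL := integrable_eball L cL.
rewrite landau_convE// [_ * f x]mulrC /landau_mass -(RintegralZl _ m1 iL) -RintegralB//.
have i12 := integrableB m1 i1 i2.
rewrite (le_trans (le_normr_Rintegral m1 i12))//.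
have i13 := integrableD m1 (integrableZl m1 (e / 2) iL) (integrableZl m1 C i3).
apply: (@le_trans _ _ (\int[leb]_(z in eball L) (e / 2 * landau L N.+1 z + C * (dot z z * landau L N.+1 z)))).
  apply: le_Rintegral => //; first by move/integrable_abse : i12.
  move=> z zL; have lz := landau_ge0 N.+1 zL.
  rewrite -mulrBl normrM (ger0_norm lz) mulrA -mulrDl ler_wpM2r//.
  have [zd|dz] := ltP (enorm z) d.
    apply: (@le_trans _ _ (e / 2)); last by rewrite lerDl mulr_ge0// dotxx_ge0.
    apply/ltW/Hd => //; rewrite addrAC subrr add0r normrN.
    by rewrite (le_lt_trans (norm_le_enorm z)).
  apply: (@le_trans _ _ (C * dot z z)); last by rewrite lerDr ltW.
  apply: (@le_trans _ _ (2 * B)).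
    by rewrite (le_trans (ler_normB _ _))// mulr_natl mulr2n lerD.
  rewrite /C mulrAC ler_pdivlMr ?exprn_gt0// ler_wpM2l ?mulr_ge0//.
  by rewrite -enorm_sqr ler_sqr ?nnegrE ?enorm_ge0// ltW.
rewrite RintegralD//; [|exact: (integrableZl m1 _ iL)|exact: (integrableZl m1 _ i3)].
rewrite !RintegralZl// landau_moment -/(landau_mass N.+1).
rewrite [leRHS](_ : _ = e / 2 * landau_mass N.+1 + e / 2 * landau_mass N.+1); last by field.
rewrite lerD2l mulrA; apply: ler_pM; last exact: landau_massS.
- apply: mulr_ge0 => //; apply: divr_ge0; last by rewrite mulr_ge0.
  by apply: mulr_ge0 => //; apply: exprn_ge0; exact: ltW.
- exact: ltW (landau_mass_gt0 _).
rewrite mulrA -/K ler_pdivrMr ?mulr_gt0//.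
rewrite (_ : e / 2 * (2 * N.+2%:R) = N.+2%:R * e); last by field.
rewrite -ler_pdivrMr//.
have /andP[_ /ltW h] := truncn_itv (divr_ge0 K0 (ltW e0)).
apply: (le_trans h); rewrite ler_nat; exact: leqW (ltnW KN).
Qed.

End landau_approximation.

(** * Simultaneous approximation of a function and its derivatives *)

Section C1_approximation.
Context {R : realType} {n : nat}.
Implicit Types (f p : 'rV[R]_n -> R) (x : 'rV[R]_n).

(** A C^1 quadratic spline rising from 0 to 1 on [0,1], with knots 0, 1/2 and 1. *)
Definition ramp (t : R) : R := 2 * pos2 t - 4 * pos2 (t - 2^-1) + 2 * pos2 (t - 1).

Definition dramp (t : R) : R :=
  4 * Num.max 0 t - 8 * Num.max 0 (t - 2^-1) + 4 * Num.max 0 (t - 1).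

Lemma is_derive_ramp (t : R) : is_derive t 1 ramp (dramp t).
Proof.
have S (a : R) : is_derive t 1 (fun s : R => pos2 (s - a)) (2 * Num.max 0 (t - a)).
  have H1 := is_deriveB (is_derive_id t (1:R)) (is_derive_cst a t 1).
  have := @is_derive1_comp R pos2 _ t _ _ (is_derive_pos2 _) H1.
  by rewrite subr0 mulr1.
have H := is_deriveD (is_deriveB (is_deriveZ 2 (is_derive_pos2 t)) (is_deriveZ 4 (S 2^-1))) (is_deriveZ 2 (S 1)).
by apply: (is_derive_eq H); rewrite /GRing.scale/= /dramp; ring.
Qed.

Lemma ramp_le0 t : t <= 0 -> ramp t = 0 /\ dramp t = 0.
Proof.
move=> t0; rewrite /ramp /dramp /pos2 !max_l ?expr0n/=; [|lra..].
by rewrite !mulr0 subrr addr0.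
Qed.

Lemma ramp_ge1 t : 1 <= t -> ramp t = 1.
Proof. by move=> t1; rewrite /ramp /pos2 !max_r; [field|lra..]. Qed.

(** A function of [|x|^2] rather than [|x|], hence differentiable at the origin. It is 1 on the ball
    of radius [r] when [r] is nonnegative, and vanishes where [|x|^2 >= r^2 + 1]. *)
Definition cutoff (r : R) x : R := 1 - ramp (dot x x - r ^+ 2).

Lemma isgrad_cutoff r x : isgrad (cutoff r) x ((- (2 * dramp (dot x x - r ^+ 2))) *: x).
Proof.
have H := isgrad_comp1 (isgradB (isgrad_dotxx x) (isgrad_cst (r ^+ 2) x)) (is_derive_ramp _).
apply: (isgrad_eq (isgradB (isgrad_cst 1 x) H)).
by rewrite sub0r subr0 scalerA scaleNr mulrC.
Qed.

Lemma C1_cutoff r : C1 (cutoff r).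
Proof.
move=> i; split=> [x|]; first exact: isgrad_derivable (isgrad_cutoff r x).
rewrite (_ : partial i _ = (fun x => - (2 * dramp (dot x x - r ^+ 2)) * x 0 i)); last first.
  by apply/funext => x; rewrite (isgrad_partial i (isgrad_cutoff r x)) mxE.
have cd (t : R) : {for t, continuous dramp}.
  have cm (a : R) : {for t, continuous (fun s : R => Num.max 0 (s - a))}.
    apply: (@continuous_comp _ _ _ (fun s : R => s - a) (Num.max 0)); last exact: continuous_max0.
    by apply: continuous_sub; [exact: cvg_id|exact: continuous_cst_at].
  apply: continuous_add; last by apply: continuous_mul; [exact: continuous_cst_at|exact: cm].
  apply: continuous_sub; last by apply: continuous_mul; [exact: continuous_cst_at|exact: cm].
  by apply: continuous_mul; [exact: continuous_cst_at|exact: continuous_max0].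
move=> x; suff : {for x, continuous (fun x : 'rV[R]_n => - (2 * dramp (dot x x - r ^+ 2)) * x 0 i)} by [].
apply: continuous_mul; last exact: continuous_coord.
apply: continuousN; apply: continuous_mul; first exact: continuous_cst_at.
apply: (@continuous_comp _ _ _ (fun x : 'rV[R]_n => dot x x - r ^+ 2) dramp); last exact: cd.
apply: continuous_sub; last exact: continuous_cst_at.
by apply: continuous_dot; exact: cvg_id.
Qed.

Hypothesis n1 : (1 < n)%N.

(** After truncation, a single Landau convolution approximates the function and all its first
    derivatives, because it commutes with partial derivatives. *)
Lemma C1_approx f (r e : R) : C1 f -> 0 < r -> 0 < e ->
  exists2 p, pf p & forall x, enorm x <= r ->
    `|p x - f x| <= e /\ forall i, `|partial i p x - partial i f x| <= e.
Proof.
move=> cf r0 e0; pose F x := f x * cutoff r x.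
have CF : C1 F by apply: C1M => //; exact: C1_cutoff.
have F0 x : r + 1 < enorm x -> F x = 0.
  move=> xr; rewrite /F /cutoff ramp_ge1 ?subrr ?mulr0//.
  rewrite lerBrDr -enorm_sqr; have : (r + 1) ^+ 2 <= enorm x ^+ 2.
    by rewrite ler_sqr ?nnegrE ?enorm_ge0 ?addr_ge0 ?(ltW r0)// ltW.
  by rewrite sqrrD; lra.
have Fr x : enorm x <= r -> F x = f x /\ forall i, partial i F x = partial i f x.
  move=> xr; have [h1 h2] : ramp (dot x x - r ^+ 2) = 0 /\ dramp (dot x x - r ^+ 2) = 0.
    by apply: ramp_le0; rewrite subr_le0 -enorm_sqr ler_sqr ?nnegrE ?enorm_ge0// ltW.
  split; first by rewrite /F /cutoff h1 subr0 mulr1.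
  move=> i; rewrite (isgrad_partial i (isgradM (C1_isgrad x cf) (isgrad_cutoff r x))) !mxE.
  by rewrite /cutoff h1 h2; ring.
(* The truncated function vanishes beyond radius [r + 1], and the kernel handles supports and points
   of length at most [L / 2]. *)
pose L := 2 * (r + 1); have L0 : 0 < L by rewrite mulr_gt0// addr_gt0.
have LE : L / 2 = r + 1 by rewrite /L mulrC mulKf.
have hF : csupp F.
  by split; [move=> x; exact: isgrad_continuous (C1_isgrad x CF)|exists (r + 1)].
have F0' x : L / 2 < enorm x -> F x = 0 by rewrite LE; exact: F0.
have [N0 HN0] := landau_approx n1 L0 hF F0' e0.
have HNi i : exists N0, forall N, (N0 <= N)%N -> forall x, enorm x <= L / 2 ->
    `|(@landau_mass R n L N)^-1 * landau_conv L N (partial i F) x - partial i F x| <= e.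
  apply: landau_approx => //; first exact: csupp_partial.
  exact: C1_support_partial.
have [Ni HN] := choice HNi.
pose N := maxn N0 (\max_i Ni i).
exists (fun x => (@landau_mass R n L N)^-1 * landau_conv L N F x).
  by apply: pfZ; exact: pf_landau_conv.
move=> x xr; have xL : enorm x <= L / 2 by rewrite LE (le_trans xr)// lerDl.
have [E1 E2] := Fr x xr; split; first by rewrite -E1; apply: HN0 => //; exact: leq_maxl.
move=> i; rewrite -E2.
have hp : isgrad (landau_conv L N F) x (grad (landau_conv L N F) x).
  by apply: pf_isgrad; exact: pf_landau_conv.
rewrite (isgrad_partial i (isgradZ _ hp)) !mxE partial_landau_conv//.
apply: HN => //; apply: leq_trans (leq_maxr _ _); exact: leq_bigmax.
Qed.

End C1_approximation.

(** * Harmonic polynomials and their restriction to the sphere *)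

Section harmonic_polynomials.
Context {R : realType} {n : nat}.
Implicit Types (f h p q u : 'rV[R]_n -> R) (x y : 'rV[R]_n).

Definition laplacian p x : R := \sum_i partial i (partial i p) x.

Lemma partial_pfD p q i : pf p -> pf q ->
  partial i (fun x => p x + q x) = (fun x => partial i p x + partial i q x).
Proof.
move=> hp hq; apply/funext => x.
by rewrite (isgrad_partial i (isgradD (pf_isgrad x hp) (pf_isgrad x hq))) !mxE.
Qed.

Lemma partial_pfM p q i : pf p -> pf q ->
  partial i (fun x => p x * q x) = (fun x => p x * partial i q x + q x * partial i p x).
Proof.
move=> hp hq; apply/funext => x.
by rewrite (isgrad_partial i (isgradM (pf_isgrad x hp) (pf_isgrad x hq))) !mxE.
Qed.

Lemma partial_cst (c : R) i : partial i (fun _ : 'rV[R]_n => c) = (fun=> 0).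
Proof. by apply/funext => x; rewrite (isgrad_partial i (isgrad_cst c x)) mxE. Qed.

Lemma partial_coord i j : partial i (fun x : 'rV[R]_n => x 0 j) = (fun=> (i == j)%:R).
Proof. by apply/funext => x; rewrite (isgrad_partial i (isgrad_coord j x)) mxE eqxx. Qed.

Lemma partial_pfZ (c : R) p i : pf p -> partial i (fun x => c * p x) = (fun x => c * partial i p x).
Proof.
by move=> hp; apply/funext => x; rewrite (isgrad_partial i (isgradZ c (pf_isgrad x hp))) !mxE.
Qed.

Lemma partial_comm p i j : pf p -> partial i (partial j p) = partial j (partial i p).
Proof.
elim=> [c|k|{}p q hp IHp hq IHq|{}p q hp IHp hq IHq].
- by rewrite (partial_cst _ i) (partial_cst _ j) !partial_cst.
- by rewrite !partial_coord !partial_cst.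
- rewrite (partial_pfD j hp hq) (partial_pfD i hp hq).
  rewrite (partial_pfD i (pf_partial j hp) (pf_partial j hq)).
  by rewrite (partial_pfD j (pf_partial i hp) (pf_partial i hq)) IHp IHq.
- have E a b : partial a (partial b (fun x => p x * q x)) = (fun x =>
      (p x * partial a (partial b q) x + partial b q x * partial a p x) +
      (q x * partial a (partial b p) x + partial b p x * partial a q x)).
    rewrite (partial_pfM b hp hq) (partial_pfD a (pfM hp (pf_partial b hq)) (pfM hq (pf_partial b hp))).
    by rewrite (partial_pfM a hp (pf_partial b hq)) (partial_pfM a hq (pf_partial b hp)).
  rewrite (E i j) (E j i) IHp IHq; apply/funext => x.
  by move: (partial j (partial i q) x) (partial j (partial i p) x) (partial i p x) (partial j p x) (partial i q x) (partial j q x) (p x) (q x) => a b c d e f g k; ring.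
Qed.

Lemma laplacianM p q x : pf p -> pf q ->
  laplacian (fun x => p x * q x) x =
  p x * laplacian q x + 2 * dot (grad p x) (grad q x) + q x * laplacian p x.
Proof.
move=> hp hq; rewrite /laplacian /dot !mulr_sumr -!big_split; apply: eq_bigr => i _ /=.
rewrite (partial_pfM i hp hq) (partial_pfD i (pfM hp (pf_partial i hq)) (pfM hq (pf_partial i hp))).
rewrite (partial_pfM i hp (pf_partial i hq)) (partial_pfM i hq (pf_partial i hp)).
rewrite [grad p x 0 i]mxE [grad q x 0 i]mxE.
by move: (partial i (partial i q) x) (partial i (partial i p) x) (partial i p x) (partial i q x) (p x) (q x) => a b c d e f; ring.
Qed.

Lemma laplacianD p q x : pf p -> pf q ->
  laplacian (fun x => p x + q x) x = laplacian p x + laplacian q x.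
Proof.
move=> hp hq; rewrite /laplacian -!big_split; apply: eq_bigr => i _ /=.
by rewrite (partial_pfD i hp hq) (partial_pfD i (pf_partial i hp) (pf_partial i hq)).
Qed.

Lemma laplacianZ (c : R) p x : pf p -> laplacian (fun x => c * p x) x = c * laplacian p x.
Proof.
move=> hp; rewrite /laplacian mulr_sumr; apply: eq_bigr => i _ /=.
by rewrite (partial_pfZ c i hp) (partial_pfZ c i (pf_partial i hp)).
Qed.

Lemma partial_sum_pf (I : Type) (r : seq I) (F : I -> 'rV[R]_n -> R) i : (forall j, pf (F j)) ->
  partial i (fun x => \sum_(j <- r) F j x) = (fun x => \sum_(j <- r) partial i (F j) x).
Proof.
move=> hF; apply/funext => x.
rewrite (isgrad_partial i (isgrad_sum r (fun j => pf_isgrad x (hF j)))) summxE.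
by apply: eq_bigr => j _; rewrite mxE.
Qed.

Definition homogeneous k p := forall (c : R) x, 0 < c -> p (c *: x) = c ^+ k * p x.

Definition harmonic k p := [/\ pf p, homogeneous k p & forall x, laplacian p x = 0].

Lemma euler_homogeneous k p x : pf p -> homogeneous k p -> dot (grad p x) x = k%:R * p x.
Proof.
move=> hp hk.
have [|_ <-] := @is_derive_ray _ _ p x 1 (dot (grad p x) x).
  by rewrite scale1r; apply: isgrad_derive; exact: pf_isgrad.
have H := is_deriveM (is_deriveXn (1 : R) k) (is_derive_cst (p x) (1 : R) 1).
rewrite (@near_eq_derive _ _ _ _ ((fun s : R => s ^+ k) * cst (p x))).
  by have [_ ->] := H; rewrite scaler0 add0r /GRing.scale/= expr1n mulr1 mulrC.
near=> s; rewrite hk//.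
by near: s; exact: lt_nbhsr.
Unshelve. all: by end_near. Qed.

Lemma homogeneous_partial k p i : pf p -> homogeneous k.+1 p -> homogeneous k (partial i p).
Proof.
move=> hp hk c x c0.
have h1 := derivable_scale c0 (isgrad_derive (delta_mx 0 i) (pf_isgrad (c *: x) hp)).
have [_ h2] := h1.
have [_ h3] := isgrad_derive (delta_mx 0 i) (isgradZ (c ^+ k.+1) (pf_isgrad x hp)).
have E : (fun z => p (c *: z)) = (fun z => c ^+ k.+1 * p z) by apply/funext => z; rewrite hk.
rewrite E h3 !dot_delta !mxE in h2.
apply: (@mulfI _ c); first by rewrite gt_eqF.
by rewrite -h2 exprS mulrA.
Qed.

(** Invariance under scaling moves any point arbitrarily close to the origin, where [p] is
    continuous. *)
Lemma homogeneous0_cst p : pf p -> homogeneous 0 p -> forall x, p x = p 0.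
Proof.
move=> hp hk x; apply/eqP; rewrite -subr_eq0 -normr_le0; apply/ler_addgt0Pr => e e0; rewrite add0r.
have cp : continuous p by exact: pf_continuous.
have /cvgrPdist_lt/(_ _ e0)/nbhs_ballP[d /= d0 H] := cp (0 : 'rV[R]_n).
pose c := d / (2 * (`|x| + 1)).
have x1 : 0 < `|x| + 1 by rewrite ltr_wpDl.
have c0 : 0 < c by rewrite divr_gt0// mulr_gt0.
have := hk c x c0; rewrite expr0 mul1r => <-; rewrite distrC; apply/ltW/H.
rewrite -ball_normE/= sub0r normrN normrZ gtr0_norm// /c mulrAC ltr_pdivrMr ?mulr_gt0//.
by rewrite ltr_pM2l//; lra.
Qed.

Lemma harmonic_partial k p i : harmonic k.+1 p -> harmonic k (partial i p).
Proof.
move=> [hp hk hl]; split; [exact: pf_partial|exact: homogeneous_partial|move=> x].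
transitivity (partial i (laplacian p) x); last first.
  by rewrite (_ : laplacian p = (fun=> 0)) ?partial_cst//; exact/funext.
rewrite /laplacian (partial_sum_pf _ _ (fun j => pf_partial j (pf_partial j hp))).
apply: eq_bigr => j _; rewrite (partial_comm j i hp) (partial_comm j i (pf_partial j hp)).
by [].
Qed.

Lemma harmonicD k p q : harmonic k p -> harmonic k q -> harmonic k (fun x => p x + q x).
Proof.
move=> [hp kp lp] [hq kq lq]; split; [exact: pfD|by move=> c x c0; rewrite kp// kq// mulrDr|].
by move=> x; rewrite (laplacianD x hp hq) lp lq addr0.
Qed.

Lemma harmonicZ k (c : R) p : harmonic k p -> harmonic k (fun x => c * p x).
Proof.
move=> [hp kp lp]; split; [exact: pfZ|by move=> d x d0; rewrite kp// mulrCA|].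
by move=> x; rewrite (laplacianZ c x hp) lp mulr0.
Qed.

Lemma harmonic_cst (c : R) : harmonic 0 (fun=> c).
Proof.
split; [exact: pf_cst|by move=> d x d0; rewrite expr0 mul1r|move=> x].
by rewrite /laplacian big1// => i _; rewrite partial_cst partial_cst.
Qed.

Lemma harmonic0 k : harmonic k (fun=> 0).
Proof.
split; [exact: pf_cst|by move=> d x d0; rewrite mulr0|move=> x].
by rewrite /laplacian big1// => i _; rewrite partial_cst partial_cst.
Qed.

Lemma harmonic_coord i : harmonic 1 (fun x => x 0 i).
Proof.
split; [exact: pf_coord|by move=> d x d0; rewrite mxE expr1|move=> x].
by rewrite /laplacian big1// => j _; rewrite partial_coord partial_cst.
Qed.

Lemma laplacian_dotxx x : laplacian (fun z => dot z z) x = 2 * n%:R.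
Proof.
transitivity (\sum_(i < n) (2 : R)); last by rewrite sumr_const card_ord mulr_natr.
apply: eq_bigr => i _.
rewrite (_ : partial i (fun z => dot z z) = (fun z => 2 * z 0 i)); last first.
  by apply/funext => z; rewrite (isgrad_partial i (isgrad_dotxx z)) mxE.
by rewrite (partial_pfZ 2 i (pf_coord i)) partial_coord eqxx mulr1.
Qed.

Hypothesis n1 : (1 < n)%N.

(** The Laplacian of [x_i q] is [2 partial i q], and that of [|x|^2 partial i q] is
    [(2 n + 4 k) partial i q] by Euler's identity; the coefficient makes them cancel. *)
Lemma harmonic_mul_coord k q i : harmonic k.+1 q ->
  harmonic k.+2 (fun x => x 0 i * q x + - ((2 * k%:R + n%:R)^-1) * (dot x x * partial i q x)).
Proof.
move=> hq; have [hp hk hl] := hq; have [hp' hk' hl'] := harmonic_partial i hq.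
have p1 := pfM (pf_coord i) hp; have p2 := pfM pf_dotxx hp'.
split.
- by apply: pfD => //; exact: pfZ.
- move=> c x c0; rewrite hk// hk'// mxE dotZl dotZr [c ^+ k.+2]exprS [c ^+ k.+1]exprS; ring.
- move=> x; rewrite (laplacianD x p1 (pfZ _ p2)) (laplacianZ _ x p2).
  rewrite (laplacianM x (pf_coord i) hp) (laplacianM x pf_dotxx hp').
  rewrite hl hl' laplacian_dotxx (isgrad_grad (isgrad_dotxx x)) (isgrad_grad (isgrad_coord i x)).
  rewrite dotZl (dotC x) (euler_homogeneous x hp' hk') dotC dot_delta mxE.
  have -> : laplacian (fun x : 'rV[R]_n => x 0 i) x = 0 by have [_ _] := harmonic_coord i.
  have nz : 2 * k%:R + n%:R != 0 :> R.
    by rewrite gt_eqF// ltr_wpDl ?mulr_ge0// ltr0n (ltn_trans _ n1).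
  by field.
Qed.

(* Restricted to the sphere, a polynomial is a finite sum of harmonic ones. *)
Definition sphere_harmonic p := exists N (u : nat -> 'rV[R]_n -> R),
  [/\ forall k, harmonic k (u k), forall k x, (N <= k)%N -> u k x = 0 &
      forall y, unit_sphere y -> p y = \sum_(k < N) u k y].

Lemma sphere_harmonic_eq p q : (forall y, unit_sphere y -> p y = q y) ->
  sphere_harmonic p -> sphere_harmonic q.
Proof.
by move=> pq [N [u [h1 h2 h3]]]; exists N, u; split => // y y1; rewrite -pq// h3.
Qed.

Lemma sphere_harmonic1 k p : harmonic k p -> sphere_harmonic p.
Proof.
move=> hp; exists k.+1, (fun j => if j == k then p else fun=> 0); split.
- by move=> j; case: eqP => [->//|_]; exact: harmonic0.
- by move=> j x kj; rewrite gtn_eqF.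
- move=> y _; rewrite (bigD1 ord_max)//= eqxx big1 ?addr0// => j /negbTE jk.
  by rewrite (_ : (j : nat) == k = false).
Qed.

Lemma sphere_harmonicD p q : sphere_harmonic p -> sphere_harmonic q ->
  sphere_harmonic (fun x => p x + q x).
Proof.
move=> [N [u [h1 h2 h3]]] [M [v [g1 g2 g3]]].
have W K (w : nat -> 'rV[R]_n -> R) y L : (forall k x, (K <= k)%N -> w k x = 0) -> (K <= L)%N ->
    \sum_(k < K) w k y = \sum_(k < L) w k y.
  move=> w0 KL; rewrite (big_ord_widen _ (fun k => w k y) KL) big_mkcond; apply: eq_bigr => k _.
  by case: ltnP => // /w0 ->.
exists (maxn N M), (fun k x => u k x + v k x); split.
- by move=> k; exact: harmonicD.
- by move=> k x; rewrite geq_max => /andP[/h2 -> /g2 ->]; rewrite addr0.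
- move=> y y1; rewrite big_split/= h3// g3//; congr (_ + _); apply: W => //.
    exact: leq_maxl.
  exact: leq_maxr.
Qed.

Lemma sphere_harmonicZ (c : R) p : sphere_harmonic p -> sphere_harmonic (fun x => c * p x).
Proof.
move=> [N [u [h1 h2 h3]]]; exists N, (fun k x => c * u k x); split.
- by move=> k; exact: harmonicZ.
- by move=> k x /h2 ->; rewrite mulr0.
- by move=> y y1; rewrite h3// mulr_sumr.
Qed.

Lemma sphere_harmonic_sum (r : seq nat) (F : nat -> 'rV[R]_n -> R) :
  (forall j, sphere_harmonic (F j)) -> sphere_harmonic (fun x => \sum_(j <- r) F j x).
Proof.
move=> hF; elim: r => [|j r IH].
  by under eq_fun do rewrite big_nil; exact: sphere_harmonic1 (harmonic0 0).
by under eq_fun do rewrite big_cons; exact: sphere_harmonicD.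
Qed.

(** Where [|x| = 1], [x_i q] is the polynomial of [harmonic_mul_coord] plus a multiple of
    [partial i q], and both are harmonic. A component of degree 0 is constant and gives a multiple
    of the coordinate. *)
Lemma sphere_harmonic_coord i p : sphere_harmonic p -> sphere_harmonic (fun x => x 0 i * p x).
Proof.
move=> [N [u [h1 h2 h3]]].
apply: (@sphere_harmonic_eq (fun x => \sum_(k <- iota 0 N) x 0 i * u k x)).
  by move=> y y1; rewrite h3// mulr_sumr -(big_mkord xpredT (fun k => y 0 i * u k y)) /index_iota subn0.
apply: sphere_harmonic_sum => -[|k].
  have [hp hk _] := h1 0%N.
  apply: (@sphere_harmonic_eq (fun x => u 0%N 0 * x 0 i)).
    by move=> y _; rewrite (homogeneous0_cst hp hk y) mulrC.
  exact/sphere_harmonicZ/(sphere_harmonic1 (harmonic_coord i)).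
have H1 := sphere_harmonic1 (harmonic_mul_coord i (h1 k.+1)).
have H2 := sphere_harmonicZ (2 * k%:R + n%:R)^-1 (sphere_harmonic1 (harmonic_partial i (h1 k.+1))).
apply: (sphere_harmonic_eq _ (sphere_harmonicD H1 H2)) => y y1.
by rewrite -enorm_sqr y1 expr1n mul1r mulNr subrK.
Qed.

(** The induction proves that multiplication by [p] preserves the class; this form passes through
    products, while a product of harmonic polynomials need not be harmonic. *)
Lemma pf_sphere_harmonic p : pf p -> sphere_harmonic p.
Proof.
move=> hp; have H q : sphere_harmonic q -> sphere_harmonic (fun x => p x * q x).
  elim: hp q => [c|i|{}p p' _ IH _ IH'|{}p p' _ IH _ IH'] q hq.
  - exact: sphere_harmonicZ.
  - exact: sphere_harmonic_coord.
  - apply: (sphere_harmonic_eq _ (sphere_harmonicD (IH q hq) (IH' q hq))) => y _.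
    by rewrite mulrDl.
  - by apply: (sphere_harmonic_eq _ (IH _ (IH' q hq))) => y _; rewrite mulrA.
apply: (sphere_harmonic_eq _ (H _ (sphere_harmonic1 (harmonic_cst 1)))) => y _.
by rewrite mulr1.
Qed.

End harmonic_polynomials.

(** * Steklov's inequality on the unit ball *)

Section steklov.
Context {R : realType} {n : nat}.
Local Notation leb := (@lebesgue_rV R n).
Implicit Types (f h p q : 'rV[R]_n -> R) (x y : 'rV[R]_n).

Lemma C1_continuous f : C1 f -> continuous f.
Proof. by move=> cf x; exact: isgrad_continuous (C1_isgrad x cf). Qed.

Lemma C1D f h : C1 f -> C1 h -> C1 (fun x => f x + h x).
Proof.
move=> cf ch i; split=> [x|]; first exact: isgrad_derivable (isgradD (C1_isgrad x cf) (C1_isgrad x ch)).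
rewrite (_ : partial i _ = (fun x => partial i f x + partial i h x)); last first.
  by apply/funext => x; rewrite (isgrad_partial i (isgradD (C1_isgrad x cf) (C1_isgrad x ch))) !mxE.
by move=> x; apply: continuous_add; [exact: (cf i).2|exact: (ch i).2].
Qed.

Lemma C1Z (c : R) f : C1 f -> C1 (fun x => c * f x).
Proof. by move=> cf; apply: C1M => //; exact: pf_C1 (pf_cst c). Qed.

Lemma C1B f h : C1 f -> C1 h -> C1 (fun x => f x - h x).
Proof.
move=> cf ch; rewrite (_ : (fun x => _) = (fun x => f x + (-1) * h x)).
  by apply: C1D => //; exact: C1Z.
by apply/funext => x; rewrite mulN1r.
Qed.

Lemma scont_C1 f : C1 f -> scont f.
Proof. by move=> cf; apply/scont_continuous/C1_continuous. Qed.

Lemma scont_pf p : pf p -> scont p.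
Proof. by move=> hp; exact/scont_C1/pf_C1. Qed.

Lemma continuous_dot_grad f h : C1 f -> C1 h -> continuous (fun x => dot (grad f x) (grad h x)).
Proof.
move=> cf ch x; apply: continuous_sum => i.
rewrite (_ : (fun x => _) = (fun x => partial i f x * partial i h x)).
  by apply: continuous_mul; [exact: (cf i).2|exact: (ch i).2].
by apply/funext => z; rewrite !mxE.
Qed.

Lemma Rintegral_eball_sum (I : Type) (s : seq I) (F : I -> 'rV[R]_n -> R) (r : R) :
  (forall j, continuous (F j)) ->
  \int[leb]_(x in eball r) (\sum_(j <- s) F j x) = \sum_(j <- s) \int[leb]_(x in eball r) F j x.
Proof.
move=> cF; have mB := @measurable_eball R n r.
elim: s => [|j s IH].
  rewrite big_nil -[RHS](@mul0r R (fine (leb (eball r)))) -Rintegral_cst//.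
  by apply: eq_Rintegral => x _; rewrite big_nil.
rewrite big_cons -IH -RintegralD//; last 2 first.
- exact: integrable_eball.
- by apply: integrable_eball => x; apply: continuous_sum => k; exact: cF.
by apply: eq_Rintegral => x _; rewrite big_cons.
Qed.

Hypothesis n1 : (1 < n)%N.
Let n0 : (0 < n)%N := ltnW n1.
Let nR0 : 0 < n%:R :> R. Proof. by rewrite ltr0n. Qed.
Local Notation V := (sA (fun _ : 'rV[R]_n => 1)).

Lemma sA1E : V = ballvol n.
Proof.
have -> : V = fine (leb pball).
  rewrite /sA -[RHS]mul1r -(Rintegral_cst leb (@measurable_pball R n)).
  by apply: eq_Rintegral => x _.
rewrite /ballvol; congr fine.
have U : @unit_ball R n = pball `|` [set (0 : 'rV[R]_n)].
  apply/seteqP; split=> [x x1|x].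
    by case: (eqVneq x 0) => [->|x0]; [right|left].
  by move=> [[]//|->]; rewrite /unit_ball/= enorm0.
have m0 := @measurable_zero R n.
have d0 : pball `&` [set (0 : 'rV[R]_n)] = set0.
  by rewrite -subset0 => x [[/eqP x0 _] /=].
have E : (leb (pball `|` [set 0%R : 'rV[R]_n]) = leb pball + leb [set 0%R : 'rV[R]_n])%E.
  exact: (measureU leb (@measurable_pball R n) m0 d0).
have Z : leb [set (0 : 'rV[R]_n)] = 0%E by exact: (@lebesgue_set0 R n n0).
by rewrite U E Z adde0.
Qed.

Lemma sA1_gt0 : 0 < V.
Proof. by rewrite sA1E ballvol_gt0. Qed.

Lemma Rintegral_eball1 : \int[leb]_(x in eball 1) 1 = V.
Proof.
rewrite Rintegral_cst ?mul1r ?sA1E//; exact: measurable_eball.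
Qed.

(** Divergence theorem for [f grad q]: the Laplacian of [q] vanishes, and on the sphere the normal
    derivative of [q] is [k q] by Euler's identity. *)
Lemma green_harmonic f k q : C1 f -> harmonic k q ->
  \int[leb]_(x in eball 1) dot (grad f x) (grad q x) = n%:R * (k%:R * sA (fun y => f y * q y)).
Proof.
move=> cf [hq kq lq].
have cX i : C1 (fun x => (\row_j (f x * partial j q x) : 'rV[R]_n) 0 i).
  rewrite (_ : (fun x => _) = (fun x => f x * partial i q x)).
    by apply: C1M => //; exact: pf_C1 (pf_partial i hq).
  by apply/funext => x; rewrite mxE.
have := ball_divergence n1 (@ltr01 R) cX; rewrite expr1n mulr1 -(sAZ k%:R); last first.
  by apply: scontM; [exact: scont_C1|exact: scont_pf].
rewrite (_ : sA (fun y => dot _ y) = sA (fun y => k%:R * (f y * q y))); last first.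
  apply: eq_sA => y y1; rewrite scale1r mulrCA -(euler_homogeneous y hq kq) /dot mulr_sumr.
  by apply: eq_bigr => i _; rewrite !mxE mulrA.
move=> <-; apply: eq_Rintegral => x _.
transitivity (dot (grad f x) (grad q x) + f x * laplacian q x); first by rewrite lq mulr0 addr0.
rewrite /divergence /dot /laplacian mulr_sumr -big_split; apply: eq_bigr => i _ /=.
rewrite (_ : (fun y => _) = (fun x => f x * partial i q x)); last by apply/funext => z; rewrite mxE.
rewrite (isgrad_partial i (isgradM (C1_isgrad x cf) (pf_isgrad x (pf_partial i hq)))) !mxE; ring.
Qed.

(** The Dirichlet integral of the pair is symmetric, and Green's formula evaluates it as [j] times
    and as [k] times the same product integral. *)
Lemma sphere_orthogonal j k p q : harmonic j p -> harmonic k q -> j != k ->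
  sA (fun y => p y * q y) = 0.
Proof.
move=> hp hq jk.
have := green_harmonic (pf_C1 (let: And3 a _ _ := hp in a)) hq.
have := green_harmonic (pf_C1 (let: And3 a _ _ := hq in a)) hp.
have -> : sA (fun y => q y * p y) = sA (fun y => p y * q y) by apply: eq_sA => y _; rewrite mulrC.
have -> : \int[leb]_(x in eball 1) dot (grad q x) (grad p x) =
  \int[leb]_(x in eball 1) dot (grad p x) (grad q x) by apply: eq_Rintegral => x _; rewrite dotC.
move=> -> /(mulfI (lt0r_neq0 nR0))/eqP; rewrite -subr_eq0 -mulrBl mulf_eq0 => /orP[|/eqP//].
by rewrite subr_eq0 eqr_nat (negbTE jk).
Qed.

(** Green's formula for two coordinates, whose gradients are constant. *)
Lemma sphere_moment i j : sA (fun y : 'rV[R]_n => y 0 i * y 0 j) = (i == j)%:R * (V / n%:R).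
Proof.
have := green_harmonic (pf_C1 (pf_coord i)) (harmonic_coord j); rewrite mul1r => E.
apply: (mulfI (lt0r_neq0 nR0)); rewrite -E.
have -> : n%:R * ((i == j)%:R * (V / n%:R)) = V * (i == j)%:R by field; rewrite gt_eqF.
rewrite -[in RHS]Rintegral_eball1 -RintegralZr//; last first.
- exact: (@integrable_eball _ _ (fun=> 1) 1 (@cst_continuous _ _ _)).
- exact: measurable_eball.
apply: eq_Rintegral => x _.
by rewrite (isgrad_grad (isgrad_coord i x)) (isgrad_grad (isgrad_coord j x)) dot_delta mxE eqxx/= mul1r eq_sym.
Qed.

(** Discards the Dirichlet energy of [f - sum_k c_k u_k]; the cross terms come from Green's formula
    and orthogonality. The coefficients [c_k] remain free, to be optimised in [steklov]. *)
Lemma dirichlet_ge (N : nat) (u : nat -> 'rV[R]_n -> R) (c : nat -> R) f : C1 f ->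
  (forall k, harmonic k (u k)) ->
  n%:R * \sum_(k < N) (k%:R * (2 * c k * sA (fun y => f y * u k y) - c k ^+ 2 * sA (fun y => u k y ^+ 2)))
  <= \int[leb]_(x in eball 1) dot (grad f x) (grad f x).
Proof.
move=> cf hu; pose w x := \sum_(k < N) c k * u k x.
have pu k : pf (u k) by have [] := hu k.
have pw : pf w by apply: pf_sum => k; exact: pfZ.
pose g x := f x - w x.
have cg : C1 g by apply: C1B => //; exact: pf_C1.
have I f1 f2 : C1 f1 -> C1 f2 -> leb.-integrable (eball 1) (EFin \o (fun x => dot (grad f1 x) (grad f2 x))).
  by move=> c1 c2; apply: integrable_eball; exact: continuous_dot_grad.
have mB := @measurable_eball R n 1.
have S k : sA (fun y => g y * u k y) = sA (fun y => f y * u k y) - (if (k < N)%N then c k else 0) * sA (fun y => u k y ^+ 2).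
  rewrite (@eq_sA _ _ _ (fun y => f y * u k y - \sum_(j < N) c j * (u j y * u k y))); last first.
    move=> y _; rewrite /g mulrBl /w mulr_suml; congr (_ - _).
    by apply: eq_bigr => j _; rewrite mulrA.
  have sc j l : scont (fun y => u j y * u l y) by apply: scontM; exact: scont_pf.
  rewrite sAB//; last 2 first.
  - by apply: scontM; [exact: scont_C1|exact: scont_pf].
  - by apply: scont_sum => j; apply: scontM => //; exact: scont_cst.
  congr (_ - _); rewrite sA_sum; last by move=> j; apply: scontM => //; exact: scont_cst.
  under eq_bigr do rewrite sAZ//.
  case: ltnP => kN; last first.
    rewrite mul0r big1// => j _; rewrite (sphere_orthogonal (hu j) (hu k)) ?mulr0//.
    by rewrite neq_ltn (leq_trans (ltn_ord j) kN).
  rewrite (bigD1 (Ordinal kN))//= big1 ?addr0// => j jk.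
  rewrite (sphere_orthogonal (hu j) (hu k)) ?mulr0//.
have E : \int[leb]_(x in eball 1) dot (grad f x) (grad f x) =
  \int[leb]_(x in eball 1) dot (grad g x) (grad g x) +
  \int[leb]_(x in eball 1) (\sum_(k < N) c k * (dot (grad f x) (grad (u k) x) + dot (grad g x) (grad (u k) x))).
  rewrite -RintegralD//; last first.
  - apply: integrable_eball => x; apply: continuous_sum => k; apply: continuous_mul; first exact: continuous_cst_at.
    by apply: continuous_add; apply: continuous_dot_grad => //; exact: pf_C1.
  - exact: I.
  apply: eq_Rintegral => x _.
  have gw : grad w x = \sum_(k < N) c k *: grad (u k) x.
    by apply: isgrad_grad; apply: isgrad_sum => k; apply: isgradZ; exact: pf_isgrad.
  have gg : grad g x = grad f x - grad w x.
    by apply: isgrad_grad; apply: isgradB; [exact: C1_isgrad|exact: pf_isgrad].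
  have ds v : dot v (grad w x) = \sum_(k < N) c k * dot v (grad (u k) x).
    rewrite gw /dot; transitivity (\sum_i \sum_(k < N) v 0 i * (c k *: grad (u k) x) 0 i).
      by apply: eq_bigr => i _; rewrite summxE mulr_sumr.
    rewrite exchange_big/=; apply: eq_bigr => k _; rewrite mulr_sumr; apply: eq_bigr => i _.
    by rewrite mxE mulrCA.
  under eq_bigr do rewrite mulrDr.
  rewrite big_split/= -!ds gg !(dotBl, dotBr) (dotC (grad w x) (grad f x)); ring.
have cd0 k : continuous (fun x => dot (grad f x) (grad (u k) x) + dot (grad g x) (grad (u k) x)).
  have c1 := @continuous_dot_grad f (u k) cf (pf_C1 (pu k)).
  have c2 := @continuous_dot_grad g (u k) cg (pf_C1 (pu k)).
  by move=> x; exact: (continuous_add (c1 x) (c2 x)).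
have cd k : continuous (fun x => c k * (dot (grad f x) (grad (u k) x) + dot (grad g x) (grad (u k) x))).
  by move=> x; exact: (continuous_mul (@cst_continuous _ _ (c k : R) x) (cd0 k x)).
rewrite E (Rintegral_eball_sum _ _ (fun k : 'I_N => cd k)) mulr_sumr ler_wpDl//.
  by apply: Rintegral_ge0 => x _; exact: dotxx_ge0.
apply: eq_ler; apply: eq_bigr => k _.
rewrite RintegralZl//; last first.
  exact: integrable_eball (cd0 k).
rewrite RintegralD//; [|by apply: I => //; exact: pf_C1|by apply: I => //; exact: pf_C1].
rewrite !(green_harmonic _ (hu k))// S ltn_ord.
ring.
Qed.

(** A harmonic of degree [k] has Steklov quotient [k], so degrees at least 2 contribute with factor
    2, and the last two terms compensate degrees 0 and 1. The boundary values of [f] are not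
    expanded themselves: a polynomial [p] close to [f] is decomposed, and the sum of [2 s k - q k]
    is the boundary mass of [f] minus that of [f - p]. *)
Lemma steklov f : C1 f ->
  2 * n%:R * sA (fun y => f y ^+ 2) <= \int[leb]_(x in eball 1) dot (grad f x) (grad f x) +
    2 * n%:R / V * sA f ^+ 2 + n%:R ^+ 2 / V * \sum_i sA (fun y => f y * y 0 i) ^+ 2.
Proof.
move=> cf; have V0 := sA1_gt0; have sf := scont_C1 cf.
apply/ler_addgt0Pr => e e0.
have [d d0 de] : exists2 d : R, 0 < d & 2 * n%:R * (d ^+ 2 * V) <= e.
  have k0 : 0 < e / (2 * n%:R * V) by rewrite divr_gt0// !mulr_gt0.
  exists (Num.sqrt (e / (2 * n%:R * V))); first by rewrite sqrtr_gt0.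
  rewrite sqr_sqrtr ?(ltW k0)// le_eqVlt; apply/orP; left; apply/eqP.
  by field; rewrite !gt_eqF.
have [p hp pe] := C1_approx n1 cf (@ltr01 R) d0.
have [N0 [u [hu u0 pu]]] := pf_sphere_harmonic n1 hp.
(* The additional terms vanish; there are now always at least two, so degrees 0 and 1 can be split
   off. *)
have {}pu y : unit_sphere y -> p y = \sum_(k < N0.+2) u k y.
  move=> y1; rewrite pu// (big_ord_widen N0.+2 (fun k => u k y)) ?leqW// big_mkcond; apply: eq_bigr => k _.
  by case: ltnP => // /u0 ->.
have pfu k : pf (u k) by have [] := hu k.
pose s k := sA (fun y => f y * u k y); pose q k := sA (fun y => u k y ^+ 2).
have q0 k : 0 <= q k by apply: sA_ge0 => y _; exact: sqr_ge0.
(* For [k >= 2] this makes the contribution [4 s k - (4 / k) q k], which is at least twice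
   [2 s k - q k]. *)
pose c k : R := if k is j.+2 then 2 / k%:R else 1.
have /= D := dirichlet_ge N0.+2 c cf hu.
have total : \sum_(k < N0.+2) (2 * s k - q k) = sA (fun y => f y ^+ 2) - sA (fun y => (f y - p y) ^+ 2).
  have sfu k : scont (fun y => f y * u k y) by apply: scontM => //; exact: scont_pf.
  have E1 : \sum_(k < N0.+2) s k = sA (fun y => f y * p y).
    rewrite /s -(sA_sum _ (fun k : 'I_N0.+2 => sfu k)); apply: eq_sA => y y1.
    by rewrite pu// mulr_sumr.
  have suu j k : scont (fun y => u j y * u k y) by apply: scontM; exact: scont_pf.
  have E2 : \sum_(k < N0.+2) q k = sA (fun y => p y ^+ 2).
    transitivity (\sum_(k < N0.+2) \sum_(j < N0.+2) sA (fun y => u k y * u j y)).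
      apply: eq_bigr => k _; rewrite (bigD1 k)//= big1 ?addr0 => [|j jk]; first by apply: eq_sA.
      by apply: (sphere_orthogonal (hu k) (hu j)); rewrite eq_sym.
    rewrite (eq_bigr (fun k : 'I_N0.+2 => sA (fun y => \sum_(j < N0.+2) u k y * u j y))); last first.
      by move=> k _; rewrite sA_sum.
    rewrite -sA_sum; last by move=> k; apply: scont_sum.
    apply: eq_sA => y y1; rewrite pu// expr2 mulr_suml; apply: eq_bigr => k _.
    by rewrite mulr_sumr.
  rewrite sumrB -mulr_sumr E1 E2 -sAZ; last by apply: scontM => //; exact: scont_pf.
  have sp := scont_pf hp.
  have a1 : scont (fun y => 2 * (f y * p y)) by scont.
  have a2 : scont (fun y => p y ^+ 2) by exact: scontX.
  have a3 : scont (fun y => f y ^+ 2) by exact: scontX.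
  have a4 : scont (fun y => (f y - p y) ^+ 2) by apply/scontX/scontB.
  rewrite -(sAB a1 a2) -(sAB a3 a4).
  by apply: eq_sA => y _; ring.
have small : sA (fun y => (f y - p y) ^+ 2) <= d ^+ 2 * V.
  rewrite -sA_cst; apply: le_sA; [|exact: scont_cst|].
    by apply: scontX; apply: scontB => //; exact: scont_pf.
  move=> y y1; rewrite -[leLHS]real_normK ?num_real// lerXn2r ?nnegrE ?(ltW d0)//.
  by rewrite distrC; apply: (pe y _).1; rewrite y1.
(* The component of degree 0 is a constant [a], and completing the square in [2 a I - a^2 V] with
   [I = sA f] gives the bound. Degree 1 is treated in the same way, coordinate by coordinate, with
   [sphere_moment]. *)
have b0 : 2 * s 0%N - q 0%N <= sA f ^+ 2 / V.
  have [h0 k0 _] := hu 0%N; have E := homogeneous0_cst h0 k0.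
  have -> : s 0%N = u 0%N 0 * sA f.
    by rewrite -sAZ//; apply: eq_sA => y _; rewrite (E y) mulrC.
  have -> : q 0%N = u 0%N 0 ^+ 2 * V.
    by rewrite -sA_cst; apply: eq_sA => y _; rewrite (E y).
  rewrite ler_pdivlMr//; have := sqr_ge0 (sA f - u 0%N 0 * V); nra.
have b1 : 2 * s 1%N - q 1%N <= n%:R / V * \sum_i sA (fun y => f y * y 0 i) ^+ 2.
  have [h0 k0 _] := hu 1%N.
  pose l i := partial i (u 1%N) 0.
  have E y : u 1%N y = \sum_i l i * y 0 i.
    rewrite -[LHS]mul1r -(euler_homogeneous y h0 k0); apply: eq_bigr => i _; rewrite mxE.
    by rewrite (homogeneous0_cst (pf_partial i h0) (homogeneous_partial i h0 k0)).
  have sfi i : scont (fun y => f y * y 0 i) by apply: scontM => //; exact: scont_coord.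
  have sii i j : scont (fun y : 'rV[R]_n => y 0 i * y 0 j) by apply: scontM; exact: scont_coord.
  have -> : s 1%N = \sum_i l i * sA (fun y => f y * y 0 i).
    rewrite /s (@eq_sA _ _ _ (fun y => \sum_i l i * (f y * y 0 i))); last first.
      by move=> y _; rewrite E mulr_sumr; apply: eq_bigr => i _; rewrite mulrCA.
    rewrite sA_sum => [|i]; last by scont.
    by apply: eq_bigr => i _; rewrite sAZ.
  have -> : q 1%N = \sum_i l i ^+ 2 * (V / n%:R).
    rewrite /q (@eq_sA _ _ _ (fun y => \sum_i \sum_j (l i * l j) * (y 0 i * y 0 j))); last first.
      move=> y _; rewrite E expr2 mulr_suml; apply: eq_bigr => i _; rewrite mulr_sumr.
      by apply: eq_bigr => j _; ring.
    have sll i j : scont (fun y : 'rV[R]_n => (l i * l j) * (y 0 i * y 0 j)).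
      by scont.
    rewrite sA_sum => [|i]; last exact: scont_sum.
    apply: eq_bigr => i _; rewrite sA_sum//.
    rewrite (bigD1 i)//= big1 ?addr0 => [|j ji].
      by rewrite sAZ// sphere_moment eqxx mul1r expr2.
    by rewrite sAZ// sphere_moment eq_sym (negbTE ji) mul0r mulr0.
  rewrite mulr_sumr -sumrB mulr_sumr; apply: ler_sum => i _.
  rewrite [leRHS]mulrAC ler_pdivlMr//.
  have -> : (2 * (l i * sA (fun y => f y * y 0 i)) - l i ^+ 2 * (V / n%:R)) * V =
    2 * (l i * V * sA (fun y => f y * y 0 i)) - (l i * V) ^+ 2 / n%:R.
    by field; rewrite gt_eqF.
  move: (l i * V) (sA (fun y => f y * y 0 i)) => a b.
  rewrite lerBlDr -subr_ge0.
  have -> : n%:R * b ^+ 2 + a ^+ 2 / n%:R - 2 * (a * b) = (n%:R * b - a) ^+ 2 / n%:R.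
    by field; rewrite gt_eqF.
  by rewrite divr_ge0 ?sqr_ge0.
have L : 2 * \sum_(k < N0.+2) (2 * s k - q k) - 2 * (2 * s 0%N - q 0%N) - (2 * s 1%N - q 1%N) <=
  \sum_(k < N0.+2) (k%:R * (2 * c k * s k - c k ^+ 2 * q k)).
  have R2 (F : nat -> R) : \sum_(k < N0.+2) F k = F 0%N + F 1%N + \sum_(k < N0) F k.+2.
    by rewrite !big_ord_recl addrA.
  rewrite (R2 (fun k => 2 * s k - q k)) (R2 (fun k => k%:R * (2 * c k * s k - c k ^+ 2 * q k))).
  rewrite mul0r add0r mul1r /= expr1n mulr1 mul1r !mulrDr mulr_sumr.
  have : \sum_(i < N0) 2 * (2 * s i.+2 - q i.+2) <=
    \sum_(i < N0) i.+2%:R * (2 * (2 / i.+2%:R) * s i.+2 - (2 / i.+2%:R) ^+ 2 * q i.+2).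
    apply: ler_sum => i _.
    have k2 : 2 <= i.+2%:R :> R by rewrite ler_nat.
    have k0 : i.+2%:R != 0 :> R by rewrite pnatr_eq0.
    have -> : i.+2%:R * (2 * (2 / i.+2%:R) * s i.+2 - (2 / i.+2%:R) ^+ 2 * q i.+2) =
      2 * (2 * s i.+2 - (2 / i.+2%:R) * q i.+2) by field.
    rewrite ler_wpM2l// lerB// ler_piMl// ler_pdivrMr ?mul1r// ltr0n//.
  move: (\sum_(i < N0) _) (\sum_(i < N0) _) (s 0%N) (q 0%N) (s 1%N) (q 1%N) => X Y a1 a2 a3 a4; lra.
have := ler_wpM2l (ltW nR0) (lerD L (le_refl 0)); rewrite !addr0 => {}L.
have := le_trans L D; rewrite total; move: b0 b1 small de nR0.
have -> : 2 * n%:R / V * sA f ^+ 2 = 2 * n%:R * (sA f ^+ 2 / V) by field; rewrite gt_eqF.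
have -> : n%:R ^+ 2 / V * \sum_i sA (fun y => f y * y 0 i) ^+ 2 = n%:R * (n%:R / V * \sum_i sA (fun y => f y * y 0 i) ^+ 2) by ring.
move: (sA f ^+ 2 / V) (n%:R / V * \sum_i sA (fun y => f y * y 0 i) ^+ 2) (sA (fun y => f y ^+ 2)) (sA (fun y => (f y - p y) ^+ 2)) (d ^+ 2 * V)
  (\int[leb]_(x in eball 1) _) (2 * s 0%N - q 0%N) (2 * s 1%N - q 1%N) (n%:R : R) => a b A B C D' X Y m.
move=> h1 h2 h3 h4 m0 h5.
have g1 := ler_wpM2l (ltW m0) h1; have g2 := ler_wpM2l (ltW m0) h2; have g3 := ler_wpM2l (ltW m0) h3.
rewrite !mulrDr !mulrN in h5; lra.
Qed.

End steklov.

(** * Hausdorff measure as a metric outer measure *)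

Section hausdorff_outer_measure.
Context {R : realType} {n k : nat}.
Local Open Scope ereal_scope.
Local Notation H := (@hausdorff_outer R n k).
Implicit Types (A B U X : set 'rV[R]_n) (x y : 'rV[R]_n) (d : R).

Lemma hausdorff_gauge_ge0 d U : 0 <= hausdorff_gauge k d U.
Proof.
rewrite /hausdorff_gauge; case: eqP => // /eqP/set0P[x Ux]; case: ifPn => // _.
apply: mule_ge0 => //; rewrite lee_fin exprn_ge0// divr_ge0// fine_ge0//.
by apply: ereal_sup_ubound; exists x => //; exists x => //; rewrite subrr enorm0.
Qed.

Lemma hausdorff_gauge0 d : hausdorff_gauge k d (set0 : set 'rV[R]_n) = 0.
Proof. by rewrite /hausdorff_gauge eqxx. Qed.

Lemma le_ediam U x y : U x -> U y -> (enorm (x - y))%:E <= ediam U.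
Proof. by move=> Ux Uy; apply: ereal_sup_ubound; exists x => //; exists y. Qed.

Lemma hausdorff_gauge_large d U x y : U x -> U y -> (d < enorm (x - y))%R ->
  hausdorff_gauge k d U = +oo.
Proof.
move=> Ux Uy dxy; rewrite /hausdorff_gauge ifF; last by apply/eqP => U0; rewrite U0 in Ux.
by rewrite ifF//; apply/negbTE; rewrite -ltNge (lt_le_trans _ (le_ediam Ux Uy)).
Qed.

Lemma le_hausdorff_gauge d e U : (d <= e)%R -> hausdorff_gauge k e U <= hausdorff_gauge k d U.
Proof.
move=> de; rewrite /hausdorff_gauge; case: ifP => // _.
case: (boolP (ediam U <= d%:E)) => [Ud|_]; last by rewrite leey.
by rewrite (le_trans Ud) ?lee_fin.
Qed.

Lemma le_hausdorff_content d e A : (d <= e)%R -> hausdorff_content k e A <= hausdorff_content k d A.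
Proof.
move=> de; apply: le_ereal_inf_tmp => _ [F FA <-].
apply: (@le_trans _ _ (\sum_(j <oo) hausdorff_gauge k e (F j))).
  by apply: ereal_inf_lbound; exists F.
by apply: lee_nneseries => [j _ _|j _]; [exact: hausdorff_gauge_ge0|exact: le_hausdorff_gauge].
Qed.

(** A covering set of finite gauge has diameter at most [d < e], so it cannot meet both [A] and [B]:
    every cover of the union splits into a cover of [A] and one of [B]. *)
Lemma hausdorff_content_separated d e A B : (d < e)%R ->
  (forall x y, A x -> B y -> (e <= enorm (x - y))%R) ->
  hausdorff_content k d A + hausdorff_content k d B <= hausdorff_content k d (A `|` B).
Proof.
move=> de AB; apply: le_ereal_inf_tmp => _ [F [mF FAB] <-].
have g0 := hausdorff_gauge_ge0 d.
have [[j Fj]|Fn] := pselect (exists j, hausdorff_gauge k d (F j) = +oo).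
  by rewrite (nneseries_pinfty _ _ Fj)// leey.
pose meets j := `[< exists2 x, A x & F j x >].
pose FA j := if meets j then F j else set0.
pose FB j := if meets j then set0 else F j.
have -> : \sum_(j <oo) hausdorff_gauge k d (F j) =
  \sum_(j <oo) hausdorff_gauge k d (FA j) + \sum_(j <oo) hausdorff_gauge k d (FB j).
  rewrite -nneseriesD//; apply: eq_eseriesr => j _; rewrite /FA /FB.
  by case: ifP => _; rewrite hausdorff_gauge0 ?adde0 ?add0e.
apply: leeD; apply: ereal_inf_lbound.
- exists FA => //; split; first by move=> j; rewrite /FA; case: ifP => //; exact: mF.
  move=> x Ax; have [j _ Fjx] := FAB x (or_introl Ax); exists j => //.
  by rewrite /FA ifT//; apply/asboolP; exists x.
- exists FB => //; split; first by move=> j; rewrite /FB; case: ifP => // _; exact: mF.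
  move=> y By; have [j _ Fjy] := FAB y (or_intror By); exists j => //.
  rewrite /FB ifF//; apply/asboolP => -[x Ax Fjx]; apply: Fn; exists j.
  by apply: (hausdorff_gauge_large Fjx Fjy); exact: lt_le_trans de (AB _ _ Ax By).
Qed.

(** The defining property of a metric outer measure. The two suprema over mesh sizes are treated
    together by passing to a common smaller mesh, below [e]. *)
Lemma hausdorff_separated e A B : (0 < e)%R ->
  (forall x y, A x -> B y -> (e <= enorm (x - y))%R) -> H A + H B <= H (A `|` B).
Proof.
move=> e0 AB.
have [HU|HU] := ltP (H (A `|` B)) +oo; last by rewrite (le_trans _ HU) ?leey.
have fA : H A \is a fin_num.
  rewrite ge0_fin_numE ?outer_measure_ge0// (le_lt_trans _ HU)//; apply: le_outer_measure.
  by move=> x; left.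
have fB : H B \is a fin_num.
  rewrite ge0_fin_numE ?outer_measure_ge0// (le_lt_trans _ HU)//; apply: le_outer_measure.
  by move=> x; right.
have C d1 d2 : (0 < d1)%R -> (0 < d2)%R ->
    hausdorff_content k d1 A + hausdorff_content k d2 B <= H (A `|` B).
  move=> d10 d20; pose d := Num.min (Num.min d1 d2) (e / 2)%R.
  have d0 : (0 < d)%R by rewrite !lt_min d10 d20 divr_gt0.
  apply: (@le_trans _ _ (hausdorff_content k d A + hausdorff_content k d B)).
    by apply: leeD; apply: le_hausdorff_content; rewrite /d !ge_min lexx ?orbT.
  apply: (@le_trans _ _ (hausdorff_content k d (A `|` B))).
    apply: (@hausdorff_content_separated d e) => //.
    by rewrite /d gt_min; apply/orP; right; rewrite ltr_pdivrMr// ltr_pMr// ltr1n.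
  by apply: ereal_sup_ubound; exists d.
rewrite -leeBrDr//; apply: ge_ereal_sup => _ [d1 d10 <-].
rewrite leeBrDr// addeC.
have fC : hausdorff_content k d1 A \is a fin_num.
  rewrite ge0_fin_numE; last exact/mu_ext_ge0/hausdorff_gauge_ge0.
  rewrite (le_lt_trans _ (_ : H A < +oo))//; first by apply: ereal_sup_ubound; exists d1.
  by rewrite -ge0_fin_numE// outer_measure_ge0.
rewrite -leeBrDr//; apply: ge_ereal_sup => _ [d2 d20 <-].
by rewrite leeBrDr// addeC; exact: C.
Qed.

Lemma hausdorff_slabs i (a b : R) A B : (a < b)%R -> (forall x, A x -> (x 0%R i <= a)%R) ->
  (forall x, B x -> (b <= x 0%R i)%R) -> H A + H B <= H (A `|` B).
Proof.
move=> ab Aa Bb; apply: (@hausdorff_separated (b - a)%R); first by rewrite subr_gt0.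
move=> x y /Aa xa /Bb yb; rewrite -enormN opprB; apply: (le_trans _ (coord_le_enorm _ i)).
by rewrite !mxE; apply: (le_trans _ (ler_norm _)); rewrite lerB.
Qed.

(** Caratheodory's criterion. The slabs [S j] accumulate at the bounding hyperplane. Their measures
    form a convergent series, whose tail bounds the part of [X] in the half-space that is missed by
    [D (2 j + 1)]; the latter is at positive distance from the complement. *)
Lemma caratheodory_halfspace i (c : R) : H.-caratheodory [set x | (x 0%R i < c)%R].
Proof.
set C := [set x | _]; apply: le_caratheodory_measurable => X.
have [HX|HX] := ltP (H X) +oo; last by rewrite (le_trans _ HX) ?leey.
pose t j : R := (c - (j.+1)%:R^-1)%R.
have tS j : (t j < t j.+1)%R by rewrite ltrD2l ltrN2 ltf_pV2 ?posrE ?ltr0n// ltr_nat.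
have tc j : (t j < c)%R by rewrite gtrDl oppr_lt0 invr_gt0.
have tmono j l : (j <= l)%N -> (t j <= t l)%R.
  by move=> jl; rewrite lerD2l lerN2 lef_pV2 ?posrE ?ltr0n// ler_nat.
pose D j := X `&` [set x | (x 0%R i < t j)%R].
pose S j := X `&` [set x | (t j <= x 0%R i < t j.+1)%R].
have SX A : A `<=` X -> H A <= H X by exact: le_outer_measure.
(* Slabs whose indices have the same parity are separated by the slabs between them: [p = 1] sums
   the odd ones, [p = 2] the even ones. *)
have half p : (0 < p)%N -> forall N, \sum_(0 <= j < N) H (S (2 * j + p)%N) <= H (D (2 * N + p).-1).
  move=> p0; elim=> [|N IH]; first by rewrite big_nil outer_measure_ge0.
  rewrite big_nat_recr//=; apply: le_trans (leeD2r _ IH) _.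
  apply: (le_trans (@hausdorff_slabs i (t (2 * N + p).-1) (t (2 * N + p)%N) _ _ _ _ _)).
  - by apply: (lt_le_trans (tS _)); rewrite prednK ?addn_gt0 ?p0 ?orbT.
  - by move=> x [_ /= /ltW].
  - by move=> x [_ /= /andP[]].
  apply: le_outer_measure => x [[Xx /= xt]|[Xx /= /andP[_ xt]]]; split => //=; apply: (lt_le_trans xt);
    apply: tmono; lia.
pose r j := H (S (2 * j + 1)%N) + H (S (2 * j + 2)%N).
have r0 j : 0 <= r j by apply: adde_ge0; exact: outer_measure_ge0.
have rfin : \sum_(j <oo) r j < +oo.
  apply: (@le_lt_trans _ _ (H X + H X)); last by rewrite lte_add_pinfty.
  apply: lime_le; first by apply: is_cvg_nneseries.
  apply: nearW => N; rewrite big_split/=; apply: leeD; apply: (le_trans (half _ _ _)) => //;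
    by apply: SX => x [].
have tail := nneseries_tail_cvg rfin (fun j _ => r0 j).
have key j : H (X `&` C) + H (X `&` ~` C) <= H X + \sum_(j <= l <oo) r l.
  have H1 : H (X `&` C) <= H (D (2 * j + 1)%N) + \sum_(j <= l <oo) r l.
    have sub : X `&` C `<=` D (2 * j + 1)%N `|` \bigcup_(l in ~` `I_j) (S (2 * l + 1)%N `|` S (2 * l + 2)%N).
      move=> x [Xx /= xc].
      have [l xl] : exists l, (x 0%R i < t l)%R.
        exists (Num.truncn ((c - x 0%R i)^-1)%R); rewrite ltrBrDr -ltrBrDl.
        rewrite -[ltRHS]invrK ltf_pV2 ?posrE ?invr_gt0 ?subr_gt0 ?ltr0n// truncnS_gt//.
      have [l0 xl0 lmin] := ex_minnP (ex_intro (fun l => x 0%R i < t l)%R l xl).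
      have [l1|l1] := leqP l0 (2 * j + 1)%N.
        by left; split => //=; exact: lt_le_trans xl0 (tmono _ _ l1).
      right; exists ((l0 - 2) %/ 2)%N => /=.
        by rewrite /=; apply/negP; rewrite -leqNgt; lia.
      have e0 : l0 = l0.-1.+1 by lia.
      have Sx : S l0.-1 x.
        split => //=; rewrite -e0 xl0 andbT leNgt; apply/negP => /lmin; lia.
      have [] : (l0.-1 = 2 * ((l0 - 2) %/ 2) + 1 \/ l0.-1 = 2 * ((l0 - 2) %/ 2) + 2)%N by lia.
        by move=> o; left; rewrite -o.
      by move=> o; right; rewrite -o.
    apply: (@le_trans _ _ (H (D (2 * j + 1)%N `|` \bigcup_(l in ~` `I_j) (S (2 * l + 1)%N `|` S (2 * l + 2)%N)))).
      exact: le_outer_measure.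
    apply: (le_trans (outer_measureU2 H _ _)); apply: leeD2l; apply: (le_trans (outer_measure_sigma_subadditive_tail H j _)).
    by apply: lee_nneseries => [l _ _|l _]; [exact: outer_measure_ge0|exact: outer_measureU2].
  apply: (le_trans (leeD2r _ H1)); rewrite -addeA [X in _ + X]addeC addeA; apply: leeD2r.
  apply: (le_trans (@hausdorff_slabs i (t (2 * j + 1)%N) c _ _ _ _ _)) => //.
  - by move=> x [_ /= /ltW].
  - by move=> x [_ /= /negP]; rewrite -leNgt.
  - by apply: SX => x [[]|[]].
have cv : H X + \sum_(j <= l <oo) r l @[j --> \oo] --> H X + 0.
  apply: cvgeD => //; [by rewrite fin_num_adde_defl// ge0_fin_numE// outer_measure_ge0|exact: cvg_cst].
rewrite adde0 in cv; rewrite -(cvg_lim _ cv)//; apply: lime_ge; first by apply/cvg_ex; eexists; exact: cv.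
exact: nearW.
Qed.

Lemma caratheodory_borel A : measurable A -> H.-caratheodory A.
Proof.
move=> mA.
suff : measurable_fun setT (id : caratheodory_type H -> 'rV[R]_n).
  by move=> /(_ measurableT A mA); rewrite setTI preimage_id.
apply: measurable_fun_rV => i.
apply: (measurability _ (RGenInftyO.measurableE R)) => //.
move=> _ [_ [c ->] <-]; rewrite setTI.
rewrite (_ : _ @^-1` _ = [set x : 'rV[R]_n | (x 0%R i < c)%R]); first exact: caratheodory_halfspace.
by apply/seteqP; split => x /=; rewrite in_itv.
Qed.

Lemma ediam_image (s : 'rV[R]_n -> 'rV[R]_n) U : (forall x y, enorm (s x - s y) = enorm (x - y)) ->
  involutive s -> ediam (s @^-1` U) = ediam U.
Proof.
move=> se si; rewrite /ediam; congr ereal_sup; apply/seteqP; split=> _ [x Ux [y Uy <-]].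
  by exists (s x) => //; exists (s y) => //; rewrite se.
by exists (s x); rewrite /= ?si//; exists (s y); rewrite /= ?si// se.
Qed.

Lemma hausdorff_isometry (s : 'rV[R]_n -> 'rV[R]_n) A : measurable_fun setT s ->
  (forall x y, enorm (s x - s y) = enorm (x - y)) -> involutive s -> H (s @^-1` A) = H A.
Proof.
move=> ms se si.
have L B : H (s @^-1` B) <= H B.
  apply: ge_ereal_sup => _ [d d0 <-]; apply: (@le_trans _ _ (hausdorff_content k d B)); last first.
    by apply: ereal_sup_ubound; exists d.
  apply: le_ereal_inf_tmp => _ [F [mF FB] <-].
  rewrite (eq_eseriesr (g := fun j => hausdorff_gauge k d (s @^-1` F j))).
    apply: ereal_inf_lbound; exists (fun j => s @^-1` F j) => //; split.
      by move=> j; rewrite -[X in measurable X]setTI; apply: ms => //; exact: mF.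
    by move=> x /FB[j _ Fj]; exists j.
  move=> j _; rewrite /hausdorff_gauge (ediam_image _ se si).
  have -> : (s @^-1` F j == set0) = (F j == set0); last by [].
  apply/eqP/eqP => [F0|->]; last by rewrite preimage_set0.
  rewrite -subset0 => x Fx; have : (s @^-1` F j) (s x) by rewrite /= si.
  by rewrite F0.
apply/eqP; rewrite eq_le L/=; have := L (s @^-1` A).
rewrite (_ : s @^-1` (s @^-1` A) = A)//; by apply/seteqP; split => x /=; rewrite si.
Qed.

End hausdorff_outer_measure.

(** * Finiteness and positivity of the Hausdorff measure of the sphere *)

Section sphere_hausdorff_finite.
Context {R : realType} {n : nat}.
Implicit Types (x y z : 'rV[R]_n).

Lemma measurable_enormB z : measurable_fun setT (fun x => enorm (x - z)).
Proof.
apply: (measurableT_comp measurable_enorm); have := @measurable_affine R n 1 (- z).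
by under eq_fun do rewrite scale1r.
Qed.

Lemma measurable_ball z (r : R) : measurable [set x | enorm (x - z) < r].
Proof. by apply: measurable_lt_set => //; exact: measurable_enormB. Qed.

Lemma measurable_cball z (r : R) : measurable [set x | enorm (x - z) <= r].
Proof. by apply: measurable_le_set => //; exact: measurable_enormB. Qed.

Lemma lebesgue_ball z (r : R) : 0 < r -> leb [set x | enorm (x - z) < r] = (r ^+ n * ballvol n)%:E.
Proof.
move=> r0.
have mB := measurable_ball.
have ind A : measurable A -> leb A = (\int[leb]_x (\1_A x)%:E)%E.
  by move=> mA; rewrite integral_indic// setIT.
rewrite ind//.
rewrite (ge0_integral_rV_affine (c := r) z); last 3 first.
- by rewrite gt_eqF.
- by apply/measurable_EFinP; exact: measurable_indic.
- by [].
rewrite gtr0_norm// EFinM; congr (_ * _)%E; rewrite -ballvolE ind; last exact: measurable_unit_ball.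
apply: eq_integral => x _; congr (_%:E); rewrite !indicE; congr ((_ : bool)%:R).
apply/idP/idP; rewrite !inE /= addrK enormZ gtr0_norm// /unit_ball/= => h.
  by rewrite -(ltr_pM2l r0) mulr1.
by rewrite -[ltRHS]mulr1 ltr_pM2l.
Qed.

Lemma exprn_shell (x : R) k : 0 <= x <= 1 ->
  (1 + x) ^+ k - (1 - x) ^+ k <= k%:R * 2 ^+ k * x.
Proof.
move=> /andP[x0 x1]; elim: k => [|k IH]; first by rewrite !expr0 subrr !mul0r.
rewrite !exprS -natr1.
have a2 : (1 + x) ^+ k <= 2 ^+ k by rewrite lerXn2r ?nnegrE//; lra.
have a1 : (1 - x) ^+ k <= 1 by rewrite exprn_ile1//; lra.
have a3 : (1 : R) <= 2 ^+ k by rewrite exprn_ege1// ler1n.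
have a4 : 0 <= (1 - x) ^+ k by rewrite exprn_ge0//; lra.
move: IH a1 a2 a3 a4; move: ((1 + x) ^+ k) ((1 - x) ^+ k) (2 ^+ k : R) => a b c IH a1 a2 a3 a4.
have kc : 0 <= k%:R * c * x by rewrite !mulr_ge0//; lra.
have h1 : x * a <= x * c by rewrite ler_wpM2l.
have h2 : x * b <= x * c by rewrite ler_wpM2l//; lra.
have -> : (k%:R + 1) * (2 * c) * x = 2 * (k%:R * c * x) + 2 * (x * c) by ring.
have -> : (1 + x) * a - (1 - x) * b = (a - b) + x * a + x * b by ring.
lra.
Qed.

Definition separated (e : R) K := exists s : nat -> 'rV[R]_n,
  (forall i, (i < K)%N -> unit_sphere (s i)) /\
  (forall i j, (i < K)%N -> (j < K)%N -> i != j -> e <= enorm (s i - s j)).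

(* Disjoint balls of radius e/2 fit into a shell of width e. *)
Lemma separated_card (e : R) K : 0 < e <= 1 -> separated e K ->
  K%:R * (e / 2) ^+ n <= n%:R * 2 ^+ n * e.
Proof.
move=> /andP[e0 e1] [s [sS sD]]; have e20 : 0 < e / 2 by rewrite divr_gt0.
pose B (i : 'I_K) := [set x | enorm (x - s i) < e / 2].
have mE r c := measurable_ball c r.
have tB : trivIset setT B.
  apply/trivIsetP => i j _ _ ij; rewrite -subset0 => x [xi xj].
  have {}xi : enorm (x - s i) < e / 2 := xi.
  have {}xj : enorm (x - s j) < e / 2 := xj.
  have : enorm (s i - s j) < e.
    rewrite (_ : s i - s j = - (x - s i) + (x - s j)); last by rewrite opprB addrA subrK.
    by apply: (le_lt_trans (enormD _ _)); rewrite enormN; lra.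
  by rewrite ltNge sD.
have U : leb (\big[setU/set0]_(i < K) B i) = (K%:R * ((e / 2) ^+ n * ballvol n))%:E.
  rewrite measure_bigsetU_ord//; last by move=> i; exact: mE.
  rewrite (eq_bigr (fun=> ((e / 2) ^+ n * ballvol n)%:E)) => [|i _]; last exact: lebesgue_ball.
  by rewrite sumEFin sumr_const card_ord mulr_natl.
have UB : (\big[setU/set0]_(i < K) B i) `<=` [set x | 1 - e / 2 <= enorm x < 1 + e / 2].
  elim/big_ind : _ => [x []//|U1 U2 h1 h2 x [/h1|/h2]//|i _ x xi].
  have {}xi : enorm (x - s i) < e / 2 := xi; have i1 := sS i (ltn_ord i).
  have := enormD (x - s i) (s i); rewrite subrK (i1 : enorm _ = 1).
  have := enormB (s i) (s i - x); rewrite subKr (i1 : enorm _ = 1).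
  rewrite -[enorm (s i - x)]enormN opprB => h1 h2; apply/andP; split; lra.
have mU : measurable (\big[setU/set0]_(i < K) B i) by apply: bigsetU_measurable => i _; exact: mE.
have b1 : 0 < 1 - e / 2 by lra.
have b2 : 0 < 1 + e / 2 by lra.
pose Bs := [set x : 'rV[R]_n | enorm (x - 0) < 1 - e / 2].
pose Bl := [set x : 'rV[R]_n | enorm (x - 0) < 1 + e / 2].
have dis : (\big[setU/set0]_(i < K) B i) `&` Bs = set0.
  rewrite -subset0 => x [/UB /= /andP[h _]]; rewrite /Bs/= subr0 ltNge h//.
have W : (leb (\big[setU/set0]_(i < K) B i) + leb Bs <= leb Bl)%E.
  have <- := measureU leb mU (measurable_ball _ _ : measurable Bs) dis.
  apply: le_measure; rewrite ?inE; [by apply: measurableU => //; exact: measurable_ball|exact: measurable_ball|].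
  by move=> x [/UB/andP[_]|]; rewrite /Bs/Bl/= subr0//; lra.
rewrite U /Bs /Bl !lebesgue_ball// -EFinD lee_fin in W.
have V0 := @ballvol_gt0 R n.
rewrite -(ler_pM2r V0); have := @exprn_shell (e / 2) n; move=> /(_ _)/wrap[]; first by lra.
move=> h; have := ler_wpM2r (ltW V0) h; rewrite mulrBl.
have : 0 <= n%:R * 2 ^+ n * (e / 2) * ballvol n by rewrite !mulr_ge0// ?exprn_ge0// ltW.
move: W; rewrite (_ : n%:R * 2 ^+ n * e = 2 * (n%:R * 2 ^+ n * (e / 2))); last by field.
rewrite !mulrA; lra.
Qed.

(** The bound on the cardinality provides a separated set with the largest number of points;
    maximality makes it an [e]-net. *)
Lemma sphere_separated_net (e : R) : 0 < e <= 1 -> exists K (s : nat -> 'rV[R]_n),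
  K%:R * (e / 2) ^+ n <= n%:R * 2 ^+ n * e /\
  forall x, unit_sphere x -> exists2 i, (i < K)%N & enorm (x - s i) < e.
Proof.
move=> e01; have e0 : 0 < e by case/andP: e01.
have b K : `[< separated e K >] -> (K <= Num.truncn (n%:R * 2 ^+ n * e / (e / 2) ^+ n))%N.
  move=> /asboolP/(separated_card e01); rewrite -ler_pdivlMr ?exprn_gt0 ?divr_gt0// => h.
  by rewrite truncn_ge_nat// divr_ge0 ?mulr_ge0 ?exprn_ge0 ?divr_ge0// ltW.
have ex : exists K, `[< separated e K >] by exists 0%N; apply/asboolP; exists (fun=> 0); split.
have [K /asboolP sK Kmax] := ex_maxnP ex b.
have cK := separated_card e01 sK; have [s [sS sD]] := sK; exists K, s; split => // x x1.
apply: contrapT => nx; have : (K.+1 <= K)%N; last by rewrite ltnn.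
have far i : (i < K)%N -> e <= enorm (x - s i).
  by move=> iK; rewrite leNgt; apply/negP => xi; apply: nx; exists i.
apply: Kmax; apply/asboolP; exists (fun i => if i == K then x else s i); split.
  by move=> i; case: eqVneq => // iK; rewrite ltnS leq_eqVlt (negbTE iK) => /sS.
move=> i j; rewrite !ltnS => iK jK ij.
have lt l : (l <= K)%N -> l != K -> (l < K)%N by move=> lK lN; rewrite ltn_neqAle lN.
case: (eqVneq i K) => [iE|iN]; case: (eqVneq j K) => [jE|jN].
- by rewrite iE jE eqxx in ij.
- exact/far/lt.
- by rewrite -enormN opprB; exact/far/lt.
- by apply: sD => //; exact: lt.
Qed.

Hypothesis n1 : (1 < n)%N.

(** The net has at most a constant times [e^(1-n)] points and the balls around them have gauge at
    most a constant times [e^(n-1)], so the product is bounded independently of the mesh. *)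
Lemma hausdorff_sphere_fin : (@hausdorff_outer R n n.-1 unit_sphere < +oo)%E.
Proof.
pose M := n%:R * 2 ^+ n * 2 ^+ n * ballvol n.-1 : R.
apply: (@le_lt_trans _ _ M%:E); last exact: ltry.
apply: ge_ereal_sup => _ [d d0 <-].
pose e := Num.min 1 (d / 2).
have e0 : 0 < e by rewrite lt_min ltr01 divr_gt0.
have ed : 2 * e <= d by have : e <= d / 2 by [rewrite ge_min lexx orbT]; lra.
have e01 : 0 < e <= 1 by rewrite e0 ge_min lexx.
have [K [s [cK sS]]] := sphere_separated_net e01.
pose F i := if (i < K)%N then [set x | enorm (x - s i) < e] else set0.
have mE r c := measurable_ball c r.
have cov : measurable_cover unit_sphere F.
  split; first by move=> i; rewrite /F; case: ifP => // _; exact: mE.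
  by move=> x /sS[i iK xi]; exists i => //; rewrite /F iK.
have gle i : (i < K)%N -> (hausdorff_gauge n.-1 d (F i) <= (ballvol n.-1 * e ^+ n.-1)%:E)%E.
  move=> iK; rewrite /hausdorff_gauge; case: ifPn => [_|F0].
    by rewrite lee_fin mulr_ge0 ?exprn_ge0 ?ltW ?ballvol_gt0.
  have dm : (ediam (F i) <= (2 * e)%:E)%E.
    apply: ge_ereal_sup => _ [x + [y + <-]]; rewrite /F iK /= => xi yi; rewrite lee_fin.
    rewrite (_ : x - y = (x - s i) + - (y - s i)); last by rewrite opprB addrA subrK.
    apply: (le_trans (enormD _ _)); rewrite enormN; lra.
  rewrite (le_trans dm) ?lee_fin// ballvolE -EFinM lee_fin.
  have /set0P[x Fx] := F0; have dm0 : (0 <= ediam (F i))%E.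
    by apply: (le_trans _ (le_ediam Fx Fx)); rewrite subrr enorm0.
  have fd : ediam (F i) \is a fin_num by rewrite ge0_fin_numE// (le_lt_trans dm) ?ltry.
  apply: ler_wpM2l; first exact: ltW (ballvol_gt0 _).
  rewrite lerXn2r ?nnegrE ?divr_ge0 ?fine_ge0 ?(ltW e0)//.
  by rewrite ler_pdivrMr// mulrC -lee_fin fineK.
apply: (@le_trans _ _ (\sum_(j <oo) hausdorff_gauge n.-1 d (F j))%E).
  by apply: ereal_inf_lbound; exists F.
rewrite (nneseries_split _ K); last by move=> j _; exact: hausdorff_gauge_ge0.
rewrite add0n [X in (_ + X)%E]eseries0 ?adde0; last first.
  by move=> j Kj _; rewrite /F ltnNge Kj hausdorff_gauge0.
apply: (@le_trans _ _ (\sum_(0 <= j < K) (ballvol n.-1 * e ^+ n.-1)%:E)%E).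
  by rewrite !big_mkord; apply: lee_sum => j _; exact: gle.
rewrite big_mkord sumEFin sumr_const card_ord lee_fin -mulr_natl.
have -> : K%:R * (ballvol n.-1 * e ^+ n.-1) = ballvol n.-1 * (K%:R * e ^+ n.-1) by ring.
have -> : M = ballvol n.-1 * (n%:R * 2 ^+ n * 2 ^+ n) by rewrite /M; ring.
apply: ler_wpM2l; first exact: ltW (ballvol_gt0 _).
rewrite -(ler_pM2l e0) mulrCA -exprS.
have := ler_wpM2l (exprn_ge0 n (ler0n R 2)) cK; rewrite expr_div_n.
have -> : 2 ^+ n * (K%:R * (e ^+ n / 2 ^+ n)) = K%:R * e ^+ n.
  by field; rewrite expf_neq0//.
have -> : n.-1.+1 = n by case: (n) n1.
move=> h; apply: (le_trans h); apply: eq_ler; ring.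
Qed.

End sphere_hausdorff_finite.

(** Dropping the first coordinate is a contraction whose image of the sphere contains the unit ball
    of R^n. Each set of a cover then projects into a ball of radius its diameter, whose volume is at
    most [4^n] times the gauge of the set. *)
Lemma hausdorff_sphere_gt0 (R : realType) n : (0 < n)%N ->
  (0 < @hausdorff_outer R n.+1 n unit_sphere)%E.
Proof.
move=> n0; have V0 := @ballvol_gt0 R n.
apply: (@lt_le_trans _ _ (ballvol n / 4 ^+ n)%:E).
  by rewrite lte_fin divr_gt0// exprn_gt0.
apply: (@le_trans _ _ (hausdorff_content n 1 (@unit_sphere R n.+1))); last first.
  by apply: ereal_sup_ubound; exists 1 => //=.
apply: le_ereal_inf_tmp => _ [F [mF FS] <-].
have [[j Fj]|Fn] := pselect (exists j, hausdorff_gauge n 1 (F j) = +oo%E).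
  by rewrite (nneseries_pinfty _ _ Fj) ?leey// => i _; exact: hausdorff_gauge_ge0.
pose p (x : 'rV[R]_n.+1) := (rV_uncons x).2.
have pB x y : enorm (p x - p y) <= enorm (x - y).
  rewrite /enorm ler_sqrt ?sumr_ge0// => [|i _]; last exact: sqr_ge0.
  rewrite [leRHS]big_ord_recl/= ler_wpDl ?sqr_ge0// le_eqVlt; apply/orP; left; apply/eqP.
  by apply: eq_bigr => i _; rewrite !mxE.
pose P j := if `[< F j = set0 >] then set0 else
  [set v : 'rV[R]_n | enorm (v - p (get (F j))) <= fine (ediam (F j))].
have mP j : measurable (P j) by rewrite /P; case: ifP => // _; exact: measurable_cball.
have dF j : F j !=set0 -> [/\ (0 <= ediam (F j))%E, ediam (F j) \is a fin_num &
    hausdorff_gauge n 1 (F j) = (ballvol n * (fine (ediam (F j)) / 2) ^+ n)%:E].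
  move=> [x Fx].
  have d0 : (0 <= ediam (F j))%E by apply: (le_trans _ (le_ediam Fx Fx)); rewrite subrr enorm0.
  have := Fn; move=> /forallNP/(_ j); rewrite /hausdorff_gauge.
  rewrite ifF; last by apply/eqP => F0; rewrite F0 in Fx.
  case: ifP => // d1 _; split => //; first by rewrite ge0_fin_numE// (le_lt_trans d1) ?ltry.
  by rewrite ballvolE.
have leP j : (lebesgue_rV n (P j) <= (4 ^+ n)%:E * hausdorff_gauge n 1 (F j))%E.
  rewrite /P; case: asboolP => [->|/eqP/set0P F0].
    by rewrite measure0 mule_ge0 ?hausdorff_gauge_ge0// lee_fin exprn_ge0.
  have [d0 fd ->] := dF j F0; have : 0 <= fine (ediam (F j)) by exact: fine_ge0.
  move: (fine _) => d {}d0; rewrite -EFinM.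
  have ub t : d < t -> (lebesgue_rV n [set v | (enorm (v - p (get (F j)))%R <= d)%R] <= (t ^+ n * ballvol n)%:E)%E.
    move=> dt; rewrite -(lebesgue_ball (p (get (F j)))); last exact: le_lt_trans d0 dt.
    apply: le_measure; rewrite ?inE; [exact: measurable_cball|exact: measurable_ball|].
    by move=> v /= vd; exact: le_lt_trans vd dt.
  (* For diameter 0 the enclosing balls are taken arbitrarily small; otherwise the radius [2 d]
     leaves strict room. *)
  move: d0; rewrite le_eqVlt => /predU1P[d0|d0].
    apply: (@le_trans _ _ 0%E); last first.
      by rewrite lee_fin !mulr_ge0 ?exprn_ge0 ?divr_ge0 -?d0// ltW.
    apply/lee_addgt0Pr => e e0; rewrite add0e.
    pose t := Num.min 1 (e / ballvol n).
    have t0 : 0 < t by rewrite lt_min ltr01 divr_gt0.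
    apply: (le_trans (ub t _)); first by rewrite -d0.
    rewrite lee_fin; apply: (@le_trans _ _ (t * ballvol n)).
      rewrite ler_wpM2r ?(ltW V0)//; case: (n) n0 => // k _; rewrite exprS ler_piMr ?(ltW t0)//.
      by rewrite exprn_ile1// ?(ltW t0)// ge_min lexx.
    by rewrite -ler_pdivlMr// ge_min lexx orbT.
  apply: (le_trans (ub (2 * d) _)); first by lra.
  rewrite lee_fin le_eqVlt; apply/orP; left; apply/eqP.
  have -> : (4 : R) = 2 * 2 by ring.
  rewrite !exprMn exprVn; field.
  by rewrite expf_neq0.
have cov : @unit_ball R n `<=` \bigcup_j P j.
  move=> v v1; pose x := rV_cons (Num.sqrt (1 - enorm v ^+ 2), v).
  have xS : unit_sphere x.
    rewrite /unit_sphere/= /enorm big_ord_recl /x /rV_cons mxE unlift_none/=.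
    rewrite sqr_sqrtr; last first.
      by rewrite subr_ge0 expr_le1// ?enorm_ge0// ltW.
    rewrite (eq_bigr (fun i => v 0 i * v 0 i)) => [|i _]; last by rewrite mxE liftK expr2.
    by rewrite enorm_sqr subrK sqrtr1.
  have [j _ Fx] := FS x xS; exists j => //; rewrite /P.
  case: asboolP => [F0|F0]; first by rewrite F0 in Fx.
  have Fg : F j (get (F j)) by exact: (getPex (ex_intro _ x Fx)).
  have [d0 fd _] := dF j (ex_intro _ x Fx).
  rewrite /= -lee_fin fineK//; apply: (le_trans _ (le_ediam Fx Fg)); rewrite lee_fin.
  by apply: (le_trans _ (pB _ _)); rewrite /p /x rV_consK.
have key : ((ballvol n)%:E <= (4 ^+ n)%:E * \sum_(j <oo) hausdorff_gauge n 1 (F j))%E.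
  rewrite -ballvolE -nneseriesZl; last by move=> j _; exact: hausdorff_gauge_ge0.
  apply: (@le_trans _ _ (\sum_(j <oo) lebesgue_rV n (P j))%E); last exact: lee_nneseries.
  by apply: measure_sigma_subadditive => //; exact: measurable_unit_ball.
by rewrite mulrC EFinM lee_pdivrMl// exprn_gt0.
Qed.

(** * Uniqueness of the reflection-invariant measure on the sphere *)

Section reflection.
Context {R : realType} {n : nat}.
Implicit Types (x y w : 'rV[R]_n).

(** Householder's reflection in the hyperplane orthogonal to [w]; for [w = 0] it is the identity. *)
Definition reflection w x := x - (2 * dot x w / dot w w) *: w.

Lemma reflection_coef w x : dot w w * (dot x w / dot w w) = dot x w.
Proof.
have [w0|w0] := eqVneq (dot w w) 0; last by field.
suff -> : dot x w = 0 by rewrite mul0r mulr0.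
have : w == 0 by rewrite -enorm_eq0 -sqrf_eq0 enorm_sqr w0.
by move=> /eqP ->; rewrite dot0r.
Qed.

Lemma reflection_dot w x y : dot (reflection w x) (reflection w y) = dot x y.
Proof.
have := reflection_coef w x; have := reflection_coef w y; rewrite /reflection -!mulrA.
move: (dot x w / dot w w) (dot y w / dot w w) => a b hb ha.
rewrite !dotBl !dotBr !dotZl !dotZr (dotC w y) -ha -hb; ring.
Qed.

Lemma reflectionB w x y : reflection w (x - y) = reflection w x - reflection w y.
Proof.
rewrite /reflection dotBl mulrBr mulrBl scalerBl; apply/rowP => i; rewrite !mxE; ring.
Qed.

Lemma reflectionK w : involutive (reflection w).
Proof.
move=> x; rewrite /reflection dotBl dotZl.
have [w0|w0] := eqVneq (dot w w) 0; first by rewrite w0 invr0 !mulr0 !scale0r !subr0.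
rewrite (_ : 2 * (dot x w - 2 * dot x w / dot w w * dot w w) / dot w w = - (2 * dot x w / dot w w)); last by field.
by rewrite scaleNr opprK subrK.
Qed.

Lemma enorm_reflection w x : enorm (reflection w x) = enorm x.
Proof. by rewrite !enormE reflection_dot. Qed.

Lemma reflectionZ w (c : R) x : reflection w (c *: x) = c *: reflection w x.
Proof. by rewrite /reflection scalerBr dotZl scalerA; congr (_ - _ *: _); ring. Qed.

Lemma measurable_reflection w : measurable_fun setT (reflection w).
Proof.
apply: measurable_fun_rV => i; apply: measurable_continuous => x.
rewrite (_ : (fun t => _) = (fun t : 'rV[R]_n => t 0 i - dot t w * (2 / dot w w * w 0 i))); last first.
  by apply/funext => t; rewrite !mxE; ring.
have c1 : {for x, continuous (fun t => dot t w)}.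
  by apply: continuous_dot => //; exact: cst_continuous.
exact: (continuous_sub (@continuous_coord _ _ i x) (continuous_mul c1 (@cst_continuous _ _ _ x))).
Qed.

(** Reflections act transitively on the sphere, so they can take the place of the rotation group in
    the comparison of invariant measures. *)
Lemma reflection_swap y z : unit_sphere y -> unit_sphere z -> reflection (y - z) y = z.
Proof.
move=> y1 z1; have [->|yz] := eqVneq y z; first by rewrite subrr /reflection scaler0 subr0.
have w0 : dot (y - z) (y - z) != 0 by rewrite -enorm_sqr sqrf_eq0 enorm_eq0 subr_eq0.
rewrite /reflection (_ : 2 * dot y (y - z) / dot (y - z) (y - z) = 1); first by rewrite scale1r subKr.
apply: (mulIf w0); rewrite mulfVK// mul1r !dotBl !dotBr -!enorm_sqr (y1 : enorm y = 1) (z1 : enorm z = 1) (dotC z y); ring.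
Qed.

Lemma nx_reflection w x : nx (reflection w x) = reflection w (nx x).
Proof. by rewrite /nx enorm_reflection reflectionZ. Qed.

End reflection.

Section sphere_measure.
Context {R : realType} {n : nat}.
Hypothesis n1 : (1 < n)%N.
Local Notation H := (@hausdorff_outer R n n.-1).
Local Notation S := (@unit_sphere R n).
Local Notation V := (sA (fun _ : 'rV[R]_n => 1)).
Implicit Types (f h : 'rV[R]_n -> R) (x y z : 'rV[R]_n).

Let hid : caratheodory_type H -> 'rV[R]_n := id.

Let measurable_hid : measurable_fun setT hid.
Proof. by move=> _ A mA; rewrite setTI; exact: caratheodory_borel. Qed.

(** The Hausdorff measure lives on the Caratheodory sigma-algebra; its image under the identity map
    restricts it to Borel sets, the common ground with Lebesgue measure in Tonelli's theorem. *)
Let mu : {measure set 'rV[R]_n -> \bar R} :=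
  measure_function_pushforward__canonical__measure_function_Measure
    (@hausdorff_measure R n n.-1) measurable_hid.

Let mS : measurable S.
Proof.
rewrite -(setCK S); apply: measurableC; apply: open_measurable_rV.
exact/closed_openC/closed_unit_sphere.
Qed.

Let muS_fin : (mu S < +oo)%E. Proof. exact: hausdorff_sphere_fin. Qed.

Let muS : {finite_measure set 'rV[R]_n -> \bar R} := mfrestr mS muS_fin.

Let muSE (f : 'rV[R]_n -> \bar R) : (\int[muS]_(y in S) f y = \int[mu]_(y in S) f y)%E.
Proof.
apply: eq_measure_integral => A mA AS.
by rewrite /muS /= /mfrestr /mrestr setIidl.
Qed.

Let ge0_hausdorffE f : measurable_fun setT f -> (forall y, S y -> 0 <= f y) ->
  (\int[@hausdorff_measure R n n.-1]_(y in S) (f y)%:E = \int[mu]_(y in S) (f y)%:E)%E.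
Proof.
move=> mf f0; rewrite /mu ge0_integral_pushforward//.
- by apply/measurable_EFinP; exact: measurable_funTS.
- by move=> y; rewrite inE => /f0; rewrite lee_fin.
Qed.

Definition cap_kernel (r : R) x y : R := (enorm (nx x - y) < r)%R%:R.

Lemma cap_kernel_reflection w r x y :
  cap_kernel r (reflection w x) (reflection w y) = cap_kernel r x y.
Proof. by rewrite /cap_kernel nx_reflection -reflectionB enorm_reflection. Qed.

Lemma pball_reflection w x : pball (reflection w x) <-> pball x.
Proof. by rewrite /pball/= -!enorm_gt0 enorm_reflection. Qed.

Lemma measurable_cap_kernel r : measurable_fun setT (fun p : 'rV[R]_n * 'rV[R]_n => cap_kernel r p.2 p.1).
Proof.
rewrite (_ : (fun p => _) = (fun p : 'rV[R]_n * 'rV[R]_n => if enorm (nx p.2 - p.1) < cst r p then 1 else 0)); last first.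
  by apply/funext => p; rewrite /cap_kernel; case: ifP.
apply: measurable_fun_ifT => //; apply: measurable_fun_ltr; last exact: measurable_cst.
apply: (measurableT_comp measurable_enorm); apply: measurable_fun_rV => i; under eq_fun do rewrite mxE [X in _ + X]mxE.
apply: measurable_funB.
  exact: (measurableT_comp (measurableT_comp (measurable_coord i) measurable_nx) measurable_snd).
exact: (measurableT_comp (measurable_coord i) measurable_fst).
Qed.

Lemma cap_kernel_ge0 r x y : 0 <= cap_kernel r x y. Proof. exact: ler0n. Qed.

Let mcap1 r y : measurable_fun setT (cap_kernel r ^~ y).
Proof.
rewrite (_ : cap_kernel r ^~ y = (fun p => cap_kernel r p.2 p.1) \o pair y)//.
exact: measurableT_comp (@measurable_cap_kernel r) (measurable_pair1 y).
Qed.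

Let mcap2 r x : measurable_fun setT (cap_kernel r x).
Proof.
rewrite (_ : cap_kernel r x = (fun p => cap_kernel r p.2 p.1) \o pair^~ x)//.
exact: measurableT_comp (@measurable_cap_kernel r) (measurable_pair2 x).
Qed.

Let cap_leb r y := (\int[leb]_(x in pball) (cap_kernel r x y)%:E)%E.
Let cap_mu r x := (\int[mu]_(y in S) (cap_kernel r x y)%:E)%E.

Let cap_leb_cst r y z : S y -> S z -> cap_leb r y = cap_leb r z.
Proof.
move=> y1 z1; have e := reflection_swap y1 z1; set w := y - z in e.
have {}e : reflection w z = y by rewrite -e reflectionK.
rewrite /cap_leb [LHS]integral_mkcond [RHS]integral_mkcond.
rewrite -(ge0_integral_isometry (measurable_reflection w) (@reflectionB _ _ w) (@reflectionK _ _ w) (@enorm_reflection _ _ w)).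
- apply: eq_integral => x _; rewrite !patchE -e cap_kernel_reflection.
  have -> : (reflection w x \in pball) = (x \in pball).
    by apply/idP/idP; rewrite !inE => /pball_reflection.
  by [].
- apply: (proj1 (measurable_restrict _ (@measurable_pball R n) measurableT)).
  by apply: measurable_funTS; apply/measurable_EFinP; exact: mcap1.
- by move=> x; rewrite patchE; case: ifP => // _; rewrite lee_fin cap_kernel_ge0.
Qed.

Let cap_muE r x : cap_mu r x = H (S `&` [set y | enorm (nx x - y) < r]).
Proof.
have mB : measurable [set y | enorm (nx x - y) < r].
  rewrite (_ : [set y | _] = [set y | enorm (y - nx x) < r]); first exact: measurable_ball.
  by apply/seteqP; split => y /=; rewrite -enormN opprB.
rewrite /cap_mu (eq_integral (fun y => (\1_[set y | enorm (nx x - y) < r] y)%:E)).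
  by rewrite integral_indic// setIC.
move=> y _; rewrite /cap_kernel indicE; congr ((_ : bool)%:R%:E).
by apply/idP/idP; rewrite inE.
Qed.

Let cap_mu_cst r x z : x != 0 -> z != 0 -> cap_mu r x = cap_mu r z.
Proof.
move=> x0 z0; rewrite !cap_muE.
have y1 : S (nx x) by exact: enorm_nx.
have z1 : S (nx z) by exact: enorm_nx.
have e := reflection_swap y1 z1; set w := _ - _ in e.
have sB a b : enorm (reflection w a - reflection w b) = enorm (a - b).
  by rewrite -reflectionB enorm_reflection.
rewrite -[RHS](hausdorff_isometry _ (measurable_reflection w) sB (@reflectionK _ _ w)).
congr (H _); apply/seteqP; split => y /=.
  by move=> [yS yr]; split; [rewrite /unit_sphere/= enorm_reflection|rewrite -e sB].
by rewrite /unit_sphere/= enorm_reflection -e sB.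
Qed.

Let G f r y := (\int[leb]_(x in pball) (hextend f x * cap_kernel r x y)%:E)%E.
Let K f r (p : 'rV[R]_n * 'rV[R]_n) : R :=
  if (p.1 \in S) && (p.2 \in pball) then hextend f p.2 * cap_kernel r p.2 p.1 else 0.

Let mK f r : scont f -> measurable_fun setT (fun p => (K f r p)%:E).
Proof.
move=> sf; apply/measurable_EFinP; apply: measurable_fun_ifT => //.
  apply: measurable_and; first exact: (measurableT_comp (measurable_mem mS) measurable_fst).
  exact: (measurableT_comp (measurable_mem (@measurable_pball R n)) measurable_snd).
exact: measurable_funM (measurableT_comp (measurable_hextend sf) measurable_snd) (measurable_cap_kernel r).
Qed.

Let hf0 f x : (forall y, S y -> 0 <= f y) -> pball x -> 0 <= hextend f x.
Proof. by move=> f0 [x0 _]; apply: f0; exact: enorm_nx. Qed.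

Let K0 f r p : (forall y, S y -> 0 <= f y) -> (0 <= (K f r p)%:E)%E.
Proof.
move=> f0; rewrite lee_fin /K; case: ifPn => // /andP[_]; rewrite inE => /(hf0 f0) h.
exact: mulr_ge0 h (cap_kernel_ge0 _ _ _).
Qed.

Let GE f r y : S y -> G f r y = (\int[leb]_x (K f r (y, x))%:E)%E.
Proof.
move=> yS; rewrite /G [LHS]integral_mkcond; apply: eq_integral => x _.
by rewrite patchE /K/= (mem_set yS); case: ifP.
Qed.

Let mG f r : scont f -> (forall y, S y -> 0 <= f y) -> measurable_fun S (G f r).
Proof.
move=> sf f0; apply: (@eq_measurable_fun _ _ _ _ _ (fubini_F leb (fun p => (K f r p)%:E))) => [y|].
  by rewrite inE => /GE ->.
by apply: measurable_funTS; apply: measurable_fun_fubini_tonelli_F; [exact: mK|move=> p; exact: K0].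
Qed.

Let tonelli f r : scont f -> (forall y, S y -> 0 <= f y) ->
  (\int[mu]_(y in S) G f r y = \int[leb]_(x in pball) ((hextend f x)%:E * cap_mu r x))%E.
Proof.
move=> sf f0; transitivity (\int[muS]_y \int[leb]_x (K f r (y, x))%:E)%E.
  rewrite -muSE [LHS]integral_mkcond; apply: eq_integral => y _; rewrite patchE.
  case: ifPn => yS; first by apply: GE; rewrite inE in yS.
  by rewrite integral0_eq// => x _; rewrite /K (negbTE yS).
rewrite (fubini_tonelli (m1 := muS) (m2 := leb) (fun p => (K f r p)%:E)); [|exact: mK|by move=> p; exact: K0].
rewrite [RHS]integral_mkcond; apply: eq_integral => x _; rewrite patchE.
case: ifPn => xb; last by rewrite integral0_eq// => y _; rewrite /K (negbTE xb) andbF.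
transitivity (\int[muS]_(y in S) ((hextend f x)%:E * (cap_kernel r x y)%:E))%E.
  rewrite [RHS]integral_mkcond; apply: eq_integral => y _; rewrite patchE /K xb andbT.
  by case: ifP.
rewrite muSE ge0_integralZl_EFin//.
- by move=> y _; rewrite lee_fin cap_kernel_ge0.
- by apply/measurable_EFinP; apply: measurable_funTS.
- by apply: hf0 => //; rewrite inE in xb.
Qed.

Let cap_mu_fin r x : (cap_mu r x < +oo)%E.
Proof.
rewrite cap_muE; apply: le_lt_trans (hausdorff_sphere_fin n1); apply: le_outer_measure.
by move=> y [].
Qed.

Let pball_fin : (leb (@pball R n) < +oo)%E.
Proof. by apply: (lebesgue_bounded measurable_pball) => x [_ /ltW]; exact. Qed.

Let cap_leb_fin r y : (cap_leb r y < +oo)%E.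
Proof.
apply: (@le_lt_trans _ _ (\int[leb]_(x in pball) (cst 1%:E x))%E).
  apply: ge0_le_integral => //.
  - exact: measurable_pball.
  - by move=> x _; rewrite lee_fin cap_kernel_ge0.
  - by apply: measurable_funTS; apply/measurable_EFinP; exact: mcap1.
  - by move=> x _; rewrite lee_fin /cap_kernel lern1 leq_b1.
by rewrite integral_cst ?mul1e//; exact: measurable_pball.
Qed.

(** Points near [y / 2] have directions near [y], so the cone over the cap contains a small ball. *)
Let cap_leb_gt0 r y : 0 < r -> S y -> (0 < cap_leb r y)%E.
Proof.
move=> r0 y1; rewrite /cap_leb.
pose e := Num.min 4^-1 (r / 8).
have e0 : 0 < e by rewrite lt_min invr_gt0 ltr0n divr_gt0.
have e1 : e <= 4^-1 by rewrite ge_min lexx.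
have e2 : e <= r / 8 by rewrite ge_min lexx orbT.
pose B := [set x | enorm (x - 2^-1 *: y) < e].
have Bx x : B x -> 4^-1 <= enorm x <= 3 / 4 /\ enorm (x - 2^-1 *: y) < e.
  move=> xB; split=> //; have h : enorm (2^-1 *: y) = 2^-1.
    by rewrite enorm_ray.
  have := enormD (x - 2^-1 *: y) (2^-1 *: y); rewrite subrK h.
  have := enormB (2^-1 *: y) (2^-1 *: y - x); rewrite subKr h -[enorm (_ *: y - x)]enormN opprB.
  move: xB; rewrite /B/= => a b c; apply/andP; split; lra.
have Bk x : B x -> cap_kernel r x y = 1.
  move=> /Bx[/andP[x1 x2] xe]; rewrite /cap_kernel (_ : enorm _ < r)//.
  have ex : 0 < enorm x by lra.
  rewrite (_ : nx x - y = (enorm x)^-1 *: ((x - 2^-1 *: y) + (2^-1 - enorm x) *: y)); last first.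
    rewrite /nx !scalerDr scalerN !scalerA; apply/rowP => i; rewrite !mxE; field.
    by rewrite gt_eqF.
  rewrite enormZ gtr0_norm ?invr_gt0// ltr_pdivrMl//.
  apply: (le_lt_trans (enormD _ _)); rewrite enormZ (y1 : enorm y = 1) mulr1.
  have : `|2^-1 - enorm x| <= e.
    rewrite -[X in `|X - _|](_ : enorm (2^-1 *: y) = 2^-1); last by rewrite enorm_ray.
    rewrite ler_norml; have := enormB (2^-1 *: y) x; have := enormB x (2^-1 *: y).
    rewrite -[enorm (_ *: y - x)]enormN opprB; lra.
  have := ler_pM2l r0 4^-1 (enorm x); rewrite x1 => /idP; lra.
have mB : measurable B by exact: measurable_ball.
apply: (@lt_le_trans _ _ (\int[leb]_(x in B) (cap_kernel r x y)%:E)%E).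
  rewrite (eq_integral (cst 1%:E)) => [|x]; last by rewrite inE => /Bk ->.
  have BE : leb B = (e ^+ n * ballvol n)%:E by exact: lebesgue_ball.
  rewrite integral_cst// mul1e; suff : (0 < leb B)%E by [].
  by rewrite BE lte_fin mulr_gt0 ?exprn_gt0 ?ballvol_gt0.
apply: ge0_subset_integral => //.
- exact: measurable_pball.
- by apply: measurable_funTS; apply/measurable_EFinP; exact: mcap1.
- by move=> x _; rewrite lee_fin cap_kernel_ge0.
- by move=> x xB; have [/andP[x1 x2] _] := Bx x xB; split; [rewrite -enorm_gt0; lra|lra].
Qed.

Let kappa : R := fine (H S) / V.

Let V0 : 0 < V := sA1_gt0 n1.

Let HS_fin : H S \is a fin_num.
Proof. by rewrite ge0_fin_numE ?outer_measure_ge0//; exact: hausdorff_sphere_fin. Qed.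

Let i0 : 'I_n := Ordinal (ltnW n1).

Let pole : 'rV[R]_n := delta_mx 0 i0.
Let pole1 : S pole. Proof. exact: enorm_delta. Qed.

(** The factor [|x|] removes the discontinuity at the origin, so that uniform continuity on the
    compact sphere can be taken from a function continuous on the whole space. *)
Let continuous_radial f : scont f -> continuous (fun x => enorm x * hextend f x).
Proof.
move=> sf x; have [->|x0] := eqVneq x 0; last first.
  exact: (continuous_mul (@continuous_enorm _ _ x) (sf x x0)).
have [M M0 fM] := scont_bounded sf.
suff : {for (0 : 'rV[R]_n), continuous (fun x => enorm x * hextend f x)} by [].
apply/(@cvgrPdist_lt _ _ _ _ (nbhs_filter (0 : 'rV[R]_n))) => e e0; rewrite /= enorm0 mul0r.
have M1 : 0 < M + 1 by lra.
have d0 : 0 < e / (M + 1) by rewrite divr_gt0.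
have ce : {for (0 : 'rV[R]_n), continuous (@enorm R n)} by exact: continuous_enorm.
have /cvgrPdist_lt/(_ _ d0) := ce; rewrite enorm0; apply: filterS => z.
rewrite !sub0r !normrN normrM (ger0_norm (enorm_ge0 z)) => ze.
have [->|z0] := eqVneq z 0; first by rewrite enorm0 mul0r.
apply: (@le_lt_trans _ _ (enorm z * M)); first by rewrite ler_wpM2l ?enorm_ge0// (fM (nx z) (enorm_nx z0)).
apply: (@le_lt_trans _ _ (enorm z * (M + 1))); first by rewrite ler_wpM2l ?enorm_ge0//; lra.
by rewrite -ltr_pdivlMr.
Qed.

Let uniform f e : scont f -> 0 < e -> exists2 r : R, 0 < r &
  forall y z, S y -> S z -> enorm (z - y) < r -> `|f z - f y| < e.
Proof.
move=> sf e0.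
have [d d0 H] := compact_uniform_continuous (continuous_radial sf) (@compact_unit_sphere R n) e0.
exists d => // y z y1 z1 zy; have := H y z y1 (le_lt_trans (norm_le_enorm _) zy).
by rewrite (y1 : enorm y = 1) (z1 : enorm z = 1) !mul1r !hextend_sphere.
Qed.

(* Averaging over caps compares the two invariant measures. *)
Let hausdorff_ge f : scont f -> (forall y, S y -> 0 <= f y) ->
  ((kappa * sA f)%:E <= \int[mu]_(y in S) (hextend f y)%:E)%E.
Proof.
move=> sf f0; have mf := measurable_hextend sf.
have hs0 : 0 <= fine (H S) by apply: fine_ge0; exact: outer_measure_ge0.
have hS0 y : S y -> 0 <= hextend f y by move=> y1; rewrite hextend_sphere//; exact: f0.
pose m r := fine (cap_leb r pole).
have mE r y : S y -> cap_leb r y = (m r)%:E.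
  move=> y1; rewrite (cap_leb_cst r y1 pole1) fineK// ge0_fin_numE ?cap_leb_fin//.
  by apply: integral_ge0 => x _; rewrite lee_fin cap_kernel_ge0.
pose N r := fine (cap_mu r pole).
have NE r x : pball x -> cap_mu r x = (N r)%:E.
  move=> [x0 _]; rewrite (cap_mu_cst r x0 (unit_sphere_neq0 pole1)) fineK// ge0_fin_numE ?cap_mu_fin//.
  by apply: integral_ge0 => y _; rewrite lee_fin cap_kernel_ge0.
have mB := @measurable_pball R n.
have T r g : scont g -> (forall y, S y -> 0 <= g y) -> (\int[mu]_(y in S) G g r y = (N r * sA g)%:E)%E.
  move=> sg g0; rewrite tonelli//.
  rewrite (eq_integral (fun x => (N r)%:E * (hextend g x)%:E)%E) => [|x]; last first.
    by rewrite inE => /NE ->; rewrite muleC.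
  have N0 : 0 <= N r by apply/fine_ge0/integral_ge0 => y _; rewrite lee_fin cap_kernel_ge0.
  rewrite ge0_integralZl_EFin//.
  - rewrite EFinM; congr (_ * _)%E; rewrite /sA /Rintegral fineK//.
    by apply: integrable_fin_num => //; exact: integrable_hextend.
  - by move=> x xb; rewrite lee_fin hf0.
  - by apply/measurable_EFinP; apply: measurable_funTS; exact: measurable_hextend.
(* Tonelli's formula for the constant 1: the Hausdorff measure of a cap and the Lebesgue measure of
   the cone over it have the ratio [kappa] for every [r]. *)
have balance r : N r = m r * kappa.
  suff : N r * V = m r * fine (H S) by move=> h; rewrite /kappa mulrA -h mulfK// gt_eqF.
  apply: EFin_inj; rewrite -(T r (fun=> 1))//; last exact: scont_cst.
  rewrite (eq_integral (cst (m r)%:E)) => [|y]; last first.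
    by rewrite inE => y1; rewrite -(mE r y y1); apply: eq_integral => x _; rewrite /hextend mul1r.
  by rewrite integral_cst// EFinM; congr (_ * _)%E; rewrite fineK.
have h1 : 0 < fine (H S) + 1 by lra.
apply/lee_addgt0Pr => e' e'0; pose e := e' / (fine (H S) + 1); have e0 : 0 < e by rewrite divr_gt0.
(* On caps of this radius [f] varies by less than [e], so the average of [f] over the cap around [y]
   is at most [f y + e]. *)
have [r r0 Hr] := uniform sf e0; have m0 : 0 < m r by rewrite -lte_fin -(mE r _ pole1) cap_leb_gt0.
have he0 y : S y -> 0 <= hextend f y + e by move=> /hS0 h; rewrite addr_ge0// ltW.
have up y : S y -> (G f r y <= (m r)%:E * (hextend f y + e)%:E)%E.
  move=> y1; have mc : measurable_fun pball (fun x => (cap_kernel r x y)%:E).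
    by apply/measurable_EFinP; exact: measurable_funTS.
  rewrite -(mE r y y1) muleC -ge0_integralZl_EFin ?he0// => [|x _]; last by rewrite lee_fin cap_kernel_ge0.
  apply: ge0_le_integral => // [x xb|||x [x0 _]].
  + by rewrite lee_fin mulr_ge0 ?hf0// cap_kernel_ge0.
  + by apply/measurable_EFinP; apply: measurable_funTS; exact: measurable_funM.
  + exact: measurable_funeM.
  + rewrite -EFinM lee_fin (hextend_sphere _ y1) /cap_kernel; case h: (enorm (nx x - y) < r); last by rewrite !mulr0.
    have := Hr y (nx x) y1 (enorm_nx x0) h; rewrite ltr_norml !mulr1 => /andP[_]; rewrite /hextend -/(nx x); lra.
have mfe : measurable_fun S (fun y => (hextend f y + e)%:E).
  by apply/measurable_EFinP; apply: measurable_funTS; exact: measurable_funD.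
have : ((m r)%:E * (kappa * sA f)%:E <= (m r)%:E * \int[mu]_(y in S) (hextend f y + e)%:E)%E.
  rewrite -EFinM mulrA -balance -T// -ge0_integralZl_EFin ?(ltW m0)//.
  apply: ge0_le_integral => //; [|exact: mG|exact: measurable_funeM].
  by move=> y y1; apply: integral_ge0 => x /hf0 h; rewrite lee_fin mulr_ge0 ?h// cap_kernel_ge0.
rewrite lee_pmul2l// => /le_trans; apply; under eq_integral do rewrite EFinD.
rewrite ge0_integralD//; [|by apply/measurable_EFinP; exact: measurable_funTS|by move=> y _; rewrite lee_fin ltW].
rewrite integral_cst// leeD2l// -[mu S]/(H S) -(fineK HS_fin) -EFinM lee_fin /e mulrAC ler_pdivrMr//.
by rewrite ler_wpM2l ?(ltW e'0)//; lra.
Qed.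

(** [hausdorff_ge] is an equality for constants; applied to the nonnegative functions [f + M] and
    [M - f] it yields the two inequalities. *)
Lemma sphere_integral_sA : exists2 k : R, 0 < k &
  forall f, {within S, continuous f} -> sphere_integral f = k * sA f.
Proof.
have HS0 : 0 < fine (H S).
  apply: fine_gt0; rewrite hausdorff_sphere_fin// andbT.
  by case: (n) n1 => [//|k k1]; exact: hausdorff_sphere_gt0.
exists kappa => [|f cf]; first exact: divr_gt0.
have sf := within_scont cf; have [M M0 fM] := scont_bounded sf.
pose hm := @hausdorff_measure R n n.-1.
have mSc : measurable (S : set (caratheodory_type H)) by exact: caratheodory_borel.
have hmS : (hm S < +oo)%E by exact: hausdorff_sphere_fin.
have iF g : scont g -> hm.-integrable S (EFin \o hextend g).
  move=> sg; have [B B0 gB] := scont_bounded sg; apply: measurable_bounded_integrable => //.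
    by apply: measurable_funTS; exact: (measurableT_comp (measurable_hextend sg) measurable_hid).
  exists B; split; first exact: num_real.
  by move=> x Bx y y1; rewrite /= hextend_sphere// (le_trans (gB _ y1))// ltW.
have L g : scont g -> (forall y, S y -> 0 <= g y) -> kappa * sA g <= \int[hm]_(y in S) hextend g y.
  move=> sg g0; rewrite /Rintegral -lee_fin fineK; last exact: integrable_fin_num (iF _ sg).
  rewrite ge0_hausdorffE; [exact: hausdorff_ge|exact: measurable_hextend|].
  by move=> y y1; rewrite hextend_sphere//; exact: g0.
have -> : sphere_integral f = \int[hm]_(y in S) hextend f y.
  by apply: eq_Rintegral => y; rewrite inE => y1; rewrite hextend_sphere.
have sM : scont (fun _ : 'rV[R]_n => M) by exact: scont_cst.
have kM : kappa * (M * V) = M * fine (hm S) by rewrite /kappa; field; rewrite gt_eqF.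
have := L _ (scontD sf sM) _; rewrite sAD// RintegralD ?iF//.
have := L _ (scontB sM sf) _; rewrite sAB// RintegralB ?iF//.
rewrite !Rintegral_cst// sA_cst mulrBr mulrDr kM => lo up; apply/le_anti/andP.
have ab y : S y -> 0 <= f y + M /\ 0 <= M - f y by move=> /fM; rewrite ler_norml; lra.
by split; [move: (lo (fun y yS => proj2 (ab y yS)))|move: (up (fun y yS => proj1 (ab y yS)))]; rewrite /hextend; lra.
Qed.

End sphere_measure.

(** * Flat functions and the construction of test functions *)

Section flat_functions.
Context {R : realType}.
Variable e : R.
Hypothesis e0 : 0 < e.

(** The powers in front of the standard flat function make the span of the family closed under
    differentiation. *)
Definition flat k (t : R) : R := if 0 < t then t ^- k * expR (- (e / t)) else 0.

Lemma flat_le0 k t : t <= 0 -> flat k t = 0.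
Proof. by move=> t0; rewrite /flat ltNge t0. Qed.

Lemma flat_ge0 k t : 0 <= flat k t.
Proof.
rewrite /flat; case: ifP => // t0; rewrite mulr_ge0 ?expR_ge0// invr_ge0 exprn_ge0// ltW//.
Qed.

Lemma expRN_le k (u : R) : 0 < u -> expR (- u) <= (k.+1`!)%:R / u ^+ k.+1.
Proof.
move=> u0; have h := expR_ge1Dxn k (ltW u0).
have k0 : 0 < (k.+1`!)%:R :> R by rewrite ltr0n fact_gt0.
have h2 : u ^+ k.+1 / (k.+1`!)%:R <= expR u by apply: le_trans h; lra.
rewrite expRN -[leRHS]invrK lef_pV2 ?posrE ?expR_gt0 ?invr_gt0 ?divr_gt0 ?exprn_gt0//.
by rewrite invf_div.
Qed.

Lemma flat_quadratic k : exists2 C, 0 <= C & forall t, flat k t <= C * t ^+ 2.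
Proof.
exists ((k.+2`!)%:R / e ^+ k.+2); first by rewrite divr_ge0// exprn_ge0// ltW.
move=> t; rewrite /flat; case: ifPn => [t0|_]; last first.
  by rewrite mulr_ge0 ?sqr_ge0// divr_ge0// exprn_ge0// ltW.
have := @expRN_le k.+1 (e / t) (divr_gt0 e0 t0) => h.
have tk : 0 <= t ^- k by rewrite invr_ge0 exprn_ge0// ltW.
apply: (le_trans (ler_wpM2l tk h)); apply: eq_ler.
rewrite expr_div_n -addn2 !exprD; field; rewrite !expf_neq0 ?gt_eqF//.
Qed.

Lemma is_derive_flat k (t : R) :
  is_derive t 1 (flat k) (e * flat k.+2 t - k%:R * flat k.+1 t).
Proof.
have [t0|t0|->] := ltgtP t 0.
- rewrite !flat_le0 ?(ltW t0)// !mulr0 subr0.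
  apply: (@near_eq_is_derive _ _ _ (cst 0) _ t 1 0); rewrite ?oner_neq0//.
  near=> s; rewrite flat_le0//; apply: ltW; near: s; exact: lt_nbhsl.
- rewrite /flat t0.
  have tn : t != 0 by rewrite gt_eqF.
  have d1 := is_deriveVX k tn.
  have d2 : is_derive t 1 (fun s => - (e / s)) (e * t ^- 2).
    have d0 : is_derive t 1 (fun s : R => e * s^-1) (e * - t ^- 2) by exact: is_deriveZ (is_deriveVn tn).
    by apply: (is_derive_eq (is_deriveN d0)); rewrite mulrN opprK.
  have d3 : is_derive t 1 (fun s => expR (- (e / s))) (e * t ^- 2 * expR (- (e / t))).
    by apply: (is_derive_eq (@is_derive1_comp _ expR (fun s => - (e / s)) t _ _ (is_derive_expR _) d2)); rewrite mulrC.
  have d4 : is_derive t 1 (fun s => s ^- k * expR (- (e / s)))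
      (e * (t ^- k.+2 * expR (- (e / t))) - k%:R * (t ^- k.+1 * expR (- (e / t)))).
    apply: (is_derive_eq (is_deriveM d1 d3)); rewrite /GRing.scale/=.
    have E1 : t ^- k.+1 = t ^- k * t^-1 by rewrite exprS invfM mulrC.
    have E2 : t ^- k.+2 = t ^- k * t ^- 2 by rewrite -addn2 exprD invfM.
    by rewrite E1 E2; ring.
  apply: near_eq_is_derive d4; near=> s.
  have s0 : 0 < s by near: s; exact: lt_nbhsr.
  by rewrite /flat s0.
- rewrite !flat_le0// !mulr0 subr0.
  have [C C0 fC] := flat_quadratic k.
  by apply: (is_derive0_quadratic C0) => h; rewrite ger0_norm ?flat_ge0.
Unshelve. all: by end_near. Qed.

(* A smooth odd nondecreasing contraction, close to the identity and vanishing near 0. *)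
Definition squash (t : R) : R := (t - e) * flat 0 (t - e) - (- t - e) * flat 0 (- t - e).

Definition dsquash (t : R) : R :=
  (flat 0 (t - e) + (t - e) * (e * flat 2 (t - e))) +
  (flat 0 (- t - e) + (- t - e) * (e * flat 2 (- t - e))).

Lemma is_derive_squash (t : R) : is_derive t 1 squash (dsquash t).
Proof.
have D (s : R) : is_derive s 1 (fun s => s * flat 0 s) (flat 0 s + s * (e * flat 2 s)).
  apply: (is_derive_eq (is_deriveM (is_derive_id s 1) (is_derive_flat 0 s))).
  by rewrite /GRing.scale/= mul0r subr0 mulr1 addrC.
have d1 : is_derive t 1 (fun s : R => s - e) 1.
  by apply: (is_derive_eq (is_deriveB (is_derive_id t 1) (is_derive_cst e t 1))); rewrite subr0.
have d2 : is_derive t 1 (fun s : R => - s - e) (-1).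
  by apply: (is_derive_eq (is_deriveB (is_deriveN (is_derive_id t 1)) (is_derive_cst e t 1))); rewrite subr0.
have := is_deriveB (@is_derive1_comp _ _ _ t _ _ (D (t - e)) d1) (@is_derive1_comp _ _ _ t _ _ (D (- t - e)) d2).
move=> H; apply: (is_derive_eq H); rewrite /dsquash; ring.
Qed.

Lemma flat_deriv_bound (s : R) : 0 <= flat 0 s + s * (e * flat 2 s) <= 1.
Proof.
have [s0|s0] := leP s 0; first by rewrite !flat_le0// !mulr0 addr0 lexx ler01.
have -> : flat 0 s + s * (e * flat 2 s) = (1 + e / s) * expR (- (e / s)).
  by rewrite /flat s0 expr0 invr1 mul1r; field; rewrite gt_eqF.
have es : 0 < e / s by rewrite divr_gt0.
rewrite mulr_ge0 ?expR_ge0//=; last by lra.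
by rewrite expRN ler_pdivrMr ?expR_gt0// mul1r expR_ge1Dx.
Qed.

Lemma dsquash_bound t : 0 <= dsquash t <= 1.
Proof.
have h1 := flat_deriv_bound (t - e); have h2 := flat_deriv_bound (- t - e).
have ep := e0; rewrite /dsquash; have [t0|t0] := leP 0 t.
  have z : - t - e <= 0 by lra.
  by rewrite (flat_le0 0 z) (flat_le0 2 z) !mulr0 !addr0.
have z : t - e <= 0 by lra.
by rewrite (flat_le0 0 z) (flat_le0 2 z) !mulr0 !addr0 add0r.
Qed.

Lemma squash0 t : `|t| <= e -> squash t = 0.
Proof. by rewrite ler_norml => /andP[h1 h2]; rewrite /squash !flat_le0 ?mulr0 ?subr0//; lra. Qed.

Lemma flat0_close (s : R) : 0 < s -> s - e <= s * flat 0 s <= s.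
Proof.
move=> s0; rewrite /flat s0 expr0 invr1 mul1r; apply/andP; split.
  have := expR_ge1Dx (- (e / s)) => h; have := ler_wpM2l (ltW s0) h.
  by apply: le_trans; apply: eq_ler; field; rewrite gt_eqF.
by rewrite ler_piMr ?(ltW s0)// expR_le1 oppr_le0 divr_ge0// ltW.
Qed.

Lemma squash_close t : `|squash t - t| <= 2 * e.
Proof.
have ep := e0; have [h|h] := leP `|t| e; first by rewrite squash0// sub0r normrN; lra.
rewrite /squash; have [t0|t0] := leP 0 t.
  rewrite ger0_norm// in h; have z : - t - e <= 0 by lra.
  rewrite (flat_le0 0 z) mulr0 subr0.
  have zp : 0 < t - e by lra.
  have := flat0_close zp; case/andP.
  by move=> a b; rewrite ler_norml; lra.
rewrite ltr0_norm// in h; have z : t - e <= 0 by lra.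
rewrite (flat_le0 0 z) mulr0 sub0r.
have zp : 0 < - t - e by lra.
  have := flat0_close zp; case/andP.
by move=> a b; rewrite ler_norml; lra.
Qed.

End flat_functions.

Section smooth_functions.
Context {R : realType} {n : nat}.
Implicit Types (f h p q psi phi : 'rV[R]_n -> R) (x y : 'rV[R]_n) (Om : set 'rV[R]_n).
Variable e : R.
Hypothesis e0 : 0 < e.

(** A class closed under partial derivatives: smoothness, which concerns iterated derivatives of
    every order, then follows from first-order statements alone. *)
Inductive flatpf : ('rV[R]_n -> R) -> Prop :=
| flatpf_pf p : pf p -> flatpf p
| flatpf_flat p k : pf p -> flatpf (fun x => flat e k (p x))
| flatpfD p q : flatpf p -> flatpf q -> flatpf (fun x => p x + q x)
| flatpfM p q : flatpf p -> flatpf q -> flatpf (fun x => p x * q x).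

Lemma flatpf_grad q : flatpf q -> exists2 G : 'I_n -> 'rV[R]_n -> R, (forall i, flatpf (G i)) &
  forall x, isgrad q x (\row_i G i x).
Proof.
elim=> [p hp|p k hp|{}q1 q2 hq1 [G1 sG1 H1] hq2 [G2 sG2 H2]|{}q1 q2 hq1 [G1 sG1 H1] hq2 [G2 sG2 H2]].
- exists (fun i => partial i p) => [i|x]; first exact/flatpf_pf/pf_partial.
  by apply: (isgrad_eq (pf_isgrad x hp)); apply/rowP => i; rewrite !mxE.
- exists (fun i x => (e * flat e k.+2 (p x) + - k%:R * flat e k.+1 (p x)) * partial i p x) => [i|x].
    have c (a : R) : flatpf (fun=> a) by exact/flatpf_pf/pf_cst.
    apply: flatpfM; last exact/flatpf_pf/pf_partial.
    by apply: flatpfD; apply: flatpfM => //; exact: flatpf_flat.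
  apply: (isgrad_eq (isgrad_comp1 (pf_isgrad x hp) (is_derive_flat e0 k (p x)))).
  by apply/rowP => i; rewrite !mxE mulNr.
- exists (fun i x => G1 i x + G2 i x) => [i|x]; first exact: flatpfD.
  by apply: (isgrad_eq (isgradD (H1 x) (H2 x))); apply/rowP => i; rewrite !mxE.
- exists (fun i x => q1 x * G2 i x + q2 x * G1 i x) => [i|x].
    by apply: flatpfD; exact: flatpfM.
  by apply: (isgrad_eq (isgradM (H1 x) (H2 x))); apply/rowP => i; rewrite !mxE.
Qed.

Lemma flatpf_isgrad q x : flatpf q -> isgrad q x (grad q x).
Proof. by move=> /flatpf_grad[G _ /(_ x) H]; rewrite (isgrad_grad H). Qed.

Lemma flatpf_partial q i : flatpf q -> flatpf (partial i q).
Proof.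
move=> /flatpf_grad[G sG H]; rewrite (_ : partial i q = G i)//.
by apply/funext => x; rewrite (isgrad_partial i (H x)) mxE.
Qed.

Lemma flatpf_squash p : pf p -> flatpf (fun x => squash e (p x)).
Proof.
move=> hp; rewrite /squash.
have c (a : R) : pf (fun _ : 'rV[R]_n => a) by exact: pf_cst.
have h1 : pf (fun x => p x - e) by exact: pfB.
have h2 : pf (fun x => - p x - e).
  rewrite (_ : (fun x => _) = (fun x => -1 * p x - e)); last by apply/funext => x; rewrite mulN1r.
  by apply: pfB => //; exact: pfM.
rewrite (_ : (fun x => _) = (fun x => (p x - e) * flat e 0 (p x - e) + -1 * ((- p x - e) * flat e 0 (- p x - e)))).
  by apply: flatpfD; [|apply: flatpfM; first exact/flatpf_pf]; apply: flatpfM; try exact: flatpf_pf;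
     exact: (@flatpf_flat (fun x => _) 0).
by apply/funext => x; rewrite mulN1r.
Qed.

Variables (Om K : set 'rV[R]_n).
Hypotheses (oOm : open Om) (cK : closed K) (KOm : K `<=` Om).

Definition vanish_off q := flatpf q /\ forall x, Om x -> ~ K x -> q x = 0.

Let ext q x := if `[< Om x >] then q x else 0.

(** Every point lies in the open set [Om] or in the open complement of [K]; near it the extension
    coincides with [q] or with zero. *)
Lemma ext_isgrad q x : vanish_off q ->
  isgrad (ext q) x (if `[< Om x >] then grad q x else 0).
Proof.
move=> [hq q0]; case: asboolP => Ox.
  apply: (isgrad_near _ (flatpf_isgrad x hq)).
  by apply: filterS (open_nbhs_nbhs (conj oOm Ox)) => z Oz; rewrite /ext; case: asboolP.
apply: (isgrad_near _ (isgrad_cst 0 x)).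
have oK : open (~` K) by exact: closed_openC.
have Kx : (~` K) x by move=> /KOm.
apply: filterS (open_nbhs_nbhs (conj oK Kx)) => z Kz; rewrite /ext.
by case: asboolP => // Oz; rewrite q0.
Qed.

Lemma vanish_off_partial q i : vanish_off q -> vanish_off (partial i q).
Proof.
move=> [hq q0]; split=> [|x Ox Kx]; first exact: flatpf_partial.
have : isgrad q x 0.
  apply: (isgrad_near _ (isgrad_cst 0 x)).
  have oD : open (Om `&` ~` K) by apply: openI => //; exact: closed_openC.
  by apply: filterS (open_nbhs_nbhs (conj oD (conj Ox Kx))) => z [Oz Kz]; rewrite q0.
by move=> /isgrad_partial ->; rewrite mxE.
Qed.

Lemma ext_partial q i : vanish_off q -> partial i (ext q) = ext (partial i q).
Proof.
move=> hq; apply/funext => x; rewrite (isgrad_partial i (ext_isgrad x hq)) /ext.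
by case: asboolP => _; rewrite !mxE.
Qed.

Lemma ext_C1 q : vanish_off q -> C1 (ext q).
Proof.
move=> hq i; split=> [x|]; first exact: isgrad_derivable (ext_isgrad x hq).
rewrite ext_partial// => x; exact: isgrad_continuous (ext_isgrad x (vanish_off_partial i hq)).
Qed.

Lemma ext_test q : vanish_off q -> compact K -> test_function Om (ext q).
Proof.
move=> hq kK; split.
  move=> s; have [q' hq' ->] : exists2 q', vanish_off q' & foldr partial (ext q) s = ext q'.
    elim: s => [|i s [q' hq' /= ->]]; first by exists q.
    by exists (partial i q'); [exact: vanish_off_partial|exact: ext_partial].
  exact: ext_C1.
have sub : closure [set x | ext q x != 0] `<=` K.
  move=> y; rewrite closureE => /(_ K); apply; split=> // x /=; rewrite /ext; case: asboolP => Ox; last by rewrite eqxx.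
  by apply: contraNP => nK; apply/eqP; exact: hq.2.
split; last by move=> x /sub /KOm.
by apply: (subclosed_compact _ kK) => //; exact: closed_closure.
Qed.

End smooth_functions.

(** * Bounds for the torsion by test functions *)

Section sobolev_bounds.
Context {R : realType} {n : nat}.
Implicit Types (f h phi psi : 'rV[R]_n -> R) (g : 'rV[R]_n -> 'rV[R]_n) (x : 'rV[R]_n).

Variables (Om : set 'rV[R]_n) (r : R).
Hypotheses (oOm : open Om) (r0 : 0 < r) (bOm : forall x, Om x -> enorm x <= r).

Local Notation energy psi := (\int[leb]_(x in Om) enorm (grad psi x) ^+ 2).
Local Notation mass psi := (\int[leb]_(x in Om) psi x ^+ 2).

Let mOm : measurable Om. Proof. exact: open_measurable_rV. Qed.

Let Om_fin : (leb Om < +oo)%E. Proof. exact: lebesgue_bounded bOm. Qed.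

Lemma integrable_continuous f : continuous f -> leb.-integrable Om (EFin \o f).
Proof.
move=> cf; apply: (@integrableS _ _ _ leb (eball (r + 1))) => //; last exact: integrable_eball.
  exact: measurable_eball.
by move=> x /bOm xr; rewrite /eball/=; lra.
Qed.

Let icst (c : R) := @integrable_continuous (fun=> c) (@cst_continuous _ _ _).

Let cs c f : leb.-integrable Om (EFin \o f) -> leb.-integrable Om (EFin \o (fun x => c * f x)).
Proof. by move=> hf; exact: (integrableZl mOm c hf). Qed.

Lemma test_C1 psi : test_function Om psi -> C1 psi. Proof. by move=> [/(_ [::])]. Qed.

Lemma test_off psi x : test_function Om psi -> ~ Om x -> psi x = 0 /\ forall i, partial i psi x = 0.
Proof.
move=> [_ [_ sup]] nx; have ncl : ~ closure [set x | psi x != 0] x by move=> /sup.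
split.
  by apply/eqP/contraT => h; exfalso; apply: ncl; exact: subset_closure.
move=> i; have : isgrad psi x 0; last by move=> /isgrad_partial ->; rewrite mxE.
apply: (isgrad_near _ (isgrad_cst 0 x)).
have oD : open (~` closure [set x | psi x != 0]) by apply/closed_openC/closed_closure.
apply: filterS (open_nbhs_nbhs (conj oD ncl)) => z nz /=.
by apply/esym/eqP/contraT => h; exfalso; apply: nz; exact: subset_closure.
Qed.

Lemma L2_continuous f : continuous f -> L2 Om f.
Proof.
move=> cf; split; first exact: measurable_funTS (measurable_continuous cf).
have cf2 := continuous_sqr cf.
have /integrableP[_] := integrable_continuous cf2; apply: le_lt_trans.
rewrite le_eqVlt; apply/orP; left; apply/eqP; apply: eq_integral => x _.
by rewrite /= ger0_norm ?sqr_ge0.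
Qed.

Lemma test_H10 psi : test_function Om psi -> H10 Om psi (grad psi).
Proof.
move=> tp; have cp := test_C1 tp; have copsi := C1_continuous cp.
split; last first.
  move=> e e0; exists psi => //; rewrite integral0_eq ?lte_fin// => x _.
  by rewrite !subrr expr0n/= enorm0 expr0n/= addr0.
split.
- exact: L2_continuous.
- by move=> i; rewrite gradE; exact: L2_continuous (cp i).2.
- move=> eta i te; have ce := test_C1 te; have coe := C1_continuous ce.
  have cF := C1M cp ce.
  have F0 x : r < enorm x -> psi x * eta x = 0.
    move=> rx; have nOm : ~ Om x by move=> /bOm; rewrite leNgt rx.
    by rewrite (test_off tp nOm).1 mul0r.
  have := Rintegral_partial i cF F0.
  have dF x : partial i (fun x => psi x * eta x) x = psi x * partial i eta x + partial i psi x * eta x.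
    by rewrite (isgrad_partial i (isgradM (C1_isgrad x cp) (C1_isgrad x ce))) !mxE; ring.
  have -> : \int[leb]_x partial i (fun x => psi x * eta x) x =
    \int[leb]_(x in Om) (psi x * partial i eta x + partial i psi x * eta x).
    rewrite [RHS]Rintegral_mkcond; apply: eq_Rintegral => x _; rewrite patchE dF.
    case: ifPn => //; rewrite notin_setE => nOm.
    by rewrite (test_off tp nOm).1 (test_off tp nOm).2 !mul0r addr0.
  rewrite RintegralD//.
  + by move=> /eqP; rewrite addr_eq0 => /eqP ->; congr (- _); apply: eq_Rintegral => x _; rewrite mxE.
  + by apply: integrable_continuous => x; exact: (continuous_mul (copsi x) ((ce i).2 x)).
  + by apply: integrable_continuous => x; exact: (continuous_mul ((cp i).2 x) (coe x)).
Qed.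

Lemma test_sqr_gradE psi x : enorm (grad psi x) ^+ 2 = \sum_i partial i psi x ^+ 2.
Proof. by rewrite enorm_sqr; apply: eq_bigr => i _; rewrite mxE expr2. Qed.

Lemma continuous_sqr_grad psi : C1 psi -> continuous (fun x => enorm (grad psi x) ^+ 2).
Proof.
by move=> cp; under eq_fun do rewrite enorm_sqr; exact: continuous_dot_grad.
Qed.

Lemma L2_integrable f : L2 Om f -> leb.-integrable Om (EFin \o (fun x => f x ^+ 2)).
Proof.
move=> [mf f2]; apply/integrableP; split.
  by apply/measurable_EFinP; exact: measurable_funX.
apply: le_lt_trans f2; rewrite le_eqVlt; apply/orP; left; apply/eqP; apply: eq_integral => x _.
by rewrite /= ger0_norm ?sqr_ge0.
Qed.

Lemma L2_integrable1 f : L2 Om f -> leb.-integrable Om (EFin \o f).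
Proof.
move=> hf; have i1 := L2_integrable hf.
have i2 := icst 1.
apply: (le_integrable mOm _ _ (integrableD mOm i1 i2)); first by apply/measurable_EFinP; case: hf.
move=> x _ /=; rewrite lee_fin [leRHS]ger0_norm ?addr_ge0 ?sqr_ge0//.
rewrite -(real_normK (num_real (f x))); have := sqr_ge0 (`|f x| - 2^-1); nra.
Qed.

Lemma sqr_grad_integrable phi g : H1 Om phi g -> leb.-integrable Om (EFin \o (fun x => enorm (g x) ^+ 2)).
Proof.
move=> [_ hg _]; rewrite (_ : EFin \o _ = (fun x => \sum_(i <- index_enum 'I_n) (g x 0 i ^+ 2)%:E)%E); last first.
  by apply/funext => x /=; rewrite sumEFin enorm_sqr; congr (_%:E); apply: eq_bigr => i _; rewrite expr2.
by apply: integrable_sum => // i _; exact: L2_integrable.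
Qed.

Lemma sqr_split (t a b : R) : 0 < t -> a ^+ 2 <= (1 + t) * b ^+ 2 + (1 + t^-1) * (a - b) ^+ 2.
Proof.
move=> t0; rewrite -subr_ge0.
rewrite (_ : _ - _ = (t * b - (a - b)) ^+ 2 / t); first by rewrite divr_ge0 ?sqr_ge0// ltW.
by field; rewrite gt_eqF.
Qed.

Lemma enorm_split (t : R) (a b : 'rV[R]_n) : 0 < t ->
  enorm a ^+ 2 <= (1 + t) * enorm b ^+ 2 + (1 + t^-1) * enorm (a - b) ^+ 2.
Proof.
move=> t0; rewrite !enorm_sqr /dot !mulr_sumr -big_split; apply: ler_sum => i _ /=.
by rewrite !mxE -!expr2; exact: sqr_split.
Qed.

Lemma H10_approx phi g (t : R) : 0 < t -> H10 Om phi g -> exists2 psi, test_function Om psi &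
  [/\ leb.-integrable Om (EFin \o (fun x => (phi x - psi x) ^+ 2)),
      \int[leb]_(x in Om) (phi x - psi x) ^+ 2 <= t ^+ 2 &
      energy psi <=
        (1 + t) * \int[leb]_(x in Om) enorm (g x) ^+ 2 + (1 + t^-1) * t ^+ 2].
Proof.
move=> t0 [hH /(_ (t ^+ 2))]; have [hphi hg _] := hH; rewrite exprn_gt0// => /(_ isT)[psi tp le].
have cp := test_C1 tp.
have mphi : measurable_fun Om (fun x => (phi x - psi x) ^+ 2).
  apply: measurable_funX; apply: measurable_funB; first by case: hphi.
  exact: measurable_funTS (measurable_continuous (C1_continuous cp)).
have mg : measurable_fun Om (fun x => enorm (g x - grad psi x) ^+ 2).
  rewrite (_ : (fun x => _) = (fun x => \sum_i (g x 0 i - partial i psi x) ^+ 2)); last first.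
    by apply/funext => x; rewrite enorm_sqr; apply: eq_bigr => i _; rewrite !mxE expr2.
  apply: measurable_sum => i; apply: measurable_funX; apply: measurable_funB; first by case: (hg i).
  exact: measurable_funTS (measurable_continuous (cp i).2).
have I h1 h2 : measurable_fun Om h1 -> (forall x, 0 <= h1 x) -> (forall x, h1 x <= h2 x) ->
   measurable_fun Om h2 -> (\int[leb]_(x in Om) (h2 x)%:E < (t ^+ 2)%:E)%E ->
   leb.-integrable Om (EFin \o h1) /\ \int[leb]_(x in Om) h1 x <= t ^+ 2.
  move=> m1 h10 h12 m2 i2.
  have le12 : (\int[leb]_(x in Om) (h1 x)%:E <= \int[leb]_(x in Om) (h2 x)%:E)%E.
    apply: ge0_le_integral => //; [by move=> x _; rewrite lee_fin|exact/measurable_EFinP|exact/measurable_EFinP|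
      by move=> x _; rewrite lee_fin].
  have i1 := le_lt_trans le12 i2; have i0 : (0 <= \int[leb]_(x in Om) (h1 x)%:E)%E.
    by apply: integral_ge0 => x _; rewrite lee_fin.
  split.
    apply/integrableP; split; first exact/measurable_EFinP.
    rewrite (eq_integral (fun x => (h1 x)%:E)) => [|x _]; last by rewrite /= ger0_norm.
    exact: lt_trans i1 (ltry _).
  rewrite /Rintegral -lee_fin fineK; first exact: ltW.
  by rewrite ge0_fin_numE// (lt_trans i1) ?ltry.
have m12 := measurable_funD mphi mg.
have [a1 a2] := I _ _ mphi (fun x => sqr_ge0 _) (fun x => ler_wpDr (sqr_ge0 _) (lexx _)) m12 le.
have [b1 b2] := I _ _ mg (fun x => sqr_ge0 _) (fun x => ler_wpDl (sqr_ge0 _) (lexx _)) m12 le.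
exists psi => //; split=> //.
have u0 : 0 <= 1 + t^-1 by rewrite addr_ge0// invr_ge0 ltW.
have j1 := integrable_continuous (continuous_sqr_grad cp); have j2 := sqr_grad_integrable hH.
apply: (@le_trans _ _ (\int[leb]_(x in Om) ((1 + t) * enorm (g x) ^+ 2 + (1 + t^-1) * enorm (g x - grad psi x) ^+ 2))).
  apply: le_Rintegral => //; first exact: (integrableD mOm (cs (1 + t) j2) (cs (1 + t^-1) b1)).
  by move=> x _; rewrite -[enorm (g x - _)]enormN opprB; exact: enorm_split.
rewrite RintegralD//; [|exact: cs|exact: cs].
by rewrite !RintegralZl// lerD2l ler_wpM2l.
Qed.

Lemma le_of_small (a b c : R) : (forall t, 0 < t <= 1 -> a <= b + t * c) -> a <= b.
Proof.
move=> H; apply/ler_addgt0Pr => e e0.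
pose t := Num.min 1 (e / (`|c| + 1)).
have c1 : 0 < `|c| + 1 by rewrite ltr_wpDl.
have t0 : 0 < t by rewrite lt_min ltr01 divr_gt0.
have t1 : t <= 1 by rewrite ge_min lexx.
apply: (le_trans (H t _)); first by rewrite t0.
rewrite lerD2l; apply: (@le_trans _ _ (t * (`|c| + 1))); last by rewrite -ler_pdivlMr// ge_min lexx orbT.
rewrite ler_wpM2l ?(ltW t0)//; have := ler_norm c; lra.
Qed.

(** The inequality passes from test functions to their closure; Young's inequality with parameter
    [t] keeps all errors of order [t]. *)
Lemma H10_rayleigh (l : R) phi g : 0 <= l ->
  (forall psi, test_function Om psi ->
     l * mass psi <= energy psi) ->
  H10 Om phi g -> l * mass phi <= \int[leb]_(x in Om) enorm (g x) ^+ 2.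
Proof.
move=> l0 H hphi; have [h1 _] := hphi; have [L2p _ _] := h1.
set A := \int[leb]_(x in Om) enorm (g x) ^+ 2; set B := mass phi.
have A0 : 0 <= A by apply: Rintegral_ge0 => x _; exact: sqr_ge0.
apply: (@le_of_small _ _ (3 * A + 4 + 2 * l)) => t /andP[t0 t1].
have [psi tp [i1 d1 e2]] := H10_approx t0 hphi; rewrite -/A in e2.
have cp := test_C1 tp.
have j3 : leb.-integrable Om (EFin \o (fun x => psi x ^+ 2)).
  exact: (integrable_continuous (continuous_sqr (C1_continuous cp))).
have j4 := L2_integrable L2p.
have u0 : 0 <= 1 + t^-1 by rewrite addr_ge0// invr_ge0 ltW.
have e1 : B <= (1 + t) * mass psi + (1 + t^-1) * t ^+ 2.
  apply: (@le_trans _ _ (\int[leb]_(x in Om) ((1 + t) * psi x ^+ 2 + (1 + t^-1) * (phi x - psi x) ^+ 2))).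
    apply: le_Rintegral => //; first exact: (integrableD mOm (cs (1 + t) j3) (cs (1 + t^-1) i1)).
    by move=> x _; exact: sqr_split.
  rewrite RintegralD//; [|exact: cs|exact: cs].
  by rewrite !RintegralZl// lerD2l ler_wpM2l.
have E : (1 + t^-1) * t ^+ 2 = t ^+ 2 + t by field; rewrite gt_eqF.
rewrite E in e1 e2; have := H psi tp; move: e1 e2.
move: (mass psi) (energy psi) => P G e1 e2 e3.
have q1 := ler_wpM2l l0 e1.
have t1p : 0 <= 1 + t by lra.
have q2 := ler_wpM2l t1p e3; have q3 := ler_wpM2l t1p e2.
have tt : t ^+ 2 <= t by rewrite expr2 ler_piMr// ltW.
have q4 : l * t ^+ 2 <= l * t by rewrite ler_wpM2l.
have q5 : t ^+ 2 * A <= t * A by rewrite ler_wpM2r.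
have q6 : t ^+ 3 <= t ^+ 2 by rewrite exprSr ler_piMr ?sqr_ge0.
have -> : A + t * (3 * A + 4 + 2 * l) = A + 3 * (t * A) + 4 * t + 2 * (l * t) by ring.
have q1' : l * B <= (1 + t) * (l * P) + l * t ^+ 2 + l * t by move: q1; rewrite mulrDr mulrDr; nra.
have q3' : (1 + t) * G <= A + 2 * (t * A) + t ^+ 2 * A + t + 2 * t ^+ 2 + t ^+ 3 by apply: le_trans q3 _; apply: eq_ler; ring.
lra.
Qed.

(** For [A > 0] the quotient [P^2 / A] is the maximum over [s] of [2 s P - s^2 A]; in this form
    there is no denominator, and limits are easy to take. *)
Definition torsion_bound (T : R) := forall psi (s : R), test_function Om psi ->
  2 * s * \int[leb]_(x in Om) psi x - s ^+ 2 * energy psi <= T.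

Lemma H10_torsion (T : R) phi g : torsion_bound T -> H10 Om phi g -> forall s : R,
  2 * s * \int[leb]_(x in Om) phi x - s ^+ 2 * \int[leb]_(x in Om) enorm (g x) ^+ 2 <= T.
Proof.
move=> H hphi s; have [h1 _] := hphi; have [L2p _ _] := h1.
set A := \int[leb]_(x in Om) enorm (g x) ^+ 2; set B := \int[leb]_(x in Om) phi x.
apply: (@le_of_small _ _ (T + fine (leb Om) + s ^+ 2 * 2)) => t /andP[t0 t1].
have [psi tp [i1 d1 e2]] := H10_approx t0 hphi; rewrite -/A in e2.
have cp := test_C1 tp.
have j3 : leb.-integrable Om (EFin \o psi) by apply: integrable_continuous; exact: C1_continuous.
have j4 := L2_integrable1 L2p.
have j5 := icst t.
have s2t : 0 <= s ^+ 2 / t by rewrite divr_ge0 ?sqr_ge0// ltW.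
have e1 : 2 * s * B <= 2 * s * \int[leb]_(x in Om) psi x + (t * fine (leb Om) + s ^+ 2 / t * t ^+ 2).
  rewrite -!RintegralZl//.
  apply: (@le_trans _ _ (\int[leb]_(x in Om) (2 * s * psi x + (t + s ^+ 2 / t * (phi x - psi x) ^+ 2)))).
    apply: le_Rintegral => //; first exact: cs.
      exact: (integrableD mOm (cs (2 * s) j3) (integrableD mOm j5 (cs (s ^+ 2 / t) i1))).
    move=> x _; rewrite -subr_ge0 (_ : _ - _ = (t - s * (phi x - psi x)) ^+ 2 / t).
      by rewrite divr_ge0 ?sqr_ge0// ltW.
    by field; rewrite gt_eqF.
  rewrite RintegralD//; [|exact: cs|exact: (integrableD mOm j5 (cs (s ^+ 2 / t) i1))].
  rewrite lerD2l RintegralD//; last exact: cs.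
  by rewrite Rintegral_cst// lerD2l RintegralZl// ler_wpM2l.
have t1p : 0 < 1 + t by lra.
(* The rescaled parameter compensates the factor [1 + t] in the estimate of the energy of [psi]. *)
have := H psi (s / (1 + t)) tp; move: e1 e2; rewrite -/B.
move: (\int[leb]_(x in Om) psi x) (energy psi) (fine (leb Om)) => P G V e1 e2 e3.
have {e3} e3 := ler_wpM2l (ltW t1p) e3.
have E3 : (1 + t) * (2 * (s / (1 + t)) * P - (s / (1 + t)) ^+ 2 * G) = 2 * s * P - s ^+ 2 * (G / (1 + t)).
  by field; rewrite gt_eqF.
rewrite E3 in e3.
have E1 : s ^+ 2 / t * t ^+ 2 = s ^+ 2 * t by field; rewrite gt_eqF.
rewrite E1 in e1.
have e4 : G / (1 + t) <= A + t.
  rewrite ler_pdivrMr//; apply: (le_trans e2); apply: eq_ler.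
  by field; rewrite gt_eqF.
have {e4} e4 := ler_wpM2l (sqr_ge0 s) e4; rewrite mulrDr in e4.
have -> : T + t * (T + V + s ^+ 2 * 2) = (1 + t) * T + t * V + 2 * (s ^+ 2 * t) by ring.
lra.
Qed.

Lemma torsion_le (T : R) : torsion_bound T ->
  (forall phi g, H10 Om phi g ->
     (\int[leb]_(x in Om) phi x) ^+ 2 / \int[leb]_(x in Om) enorm (g x) ^+ 2 <= T) /\ 0 <= T.
Proof.
move=> H; have z : test_function Om (fun=> 0).
  split.
    move=> s; rewrite (_ : foldr partial (fun=> 0) s = (fun=> 0)); first exact: pf_C1 (pf_cst 0).
    by elim: s => //= i s ->; rewrite partial_cst.
  rewrite /compact_support (_ : [set x | _] = set0) ?closure0; first by split => //; exact: compact0.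
  by rewrite -subset0 => x /=; rewrite eqxx.
have T0 : 0 <= T by have := H _ 0 z; rewrite mulr0 expr0n/= !mul0r subr0.
split=> // phi g hphi; have := H10_torsion H hphi.
have A0 : 0 <= \int[leb]_(x in Om) enorm (g x) ^+ 2 by apply: Rintegral_ge0 => x _; exact: sqr_ge0.
move: (\int[leb]_(x in Om) phi x) (\int[leb]_(x in Om) enorm (g x) ^+ 2) A0 => P A.
rewrite le_eqVlt => /predU1P[<- _|A0 /(_ (P / A))]; first by rewrite invr0 mulr0.
suff -> : 2 * (P / A) * P - (P / A) ^+ 2 * A = P ^+ 2 / A by [].
by field; rewrite gt_eqF.
Qed.

Hypothesis n1 : (1 < n)%N.

(** A polynomial close to [phi] is small, but not zero, near the boundary. Composition with [squash]
    sets it to zero where it is below the threshold [d] and does not increase its gradient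
    elsewhere, so the result is a test function. *)
Lemma test_approx phi (eta : R) : C1 phi -> (forall x, closure Om x -> ~ Om x -> phi x = 0) -> 0 < eta ->
  exists2 psi, test_function Om psi & forall x, Om x ->
    `|psi x - phi x| <= eta /\ enorm (grad psi x) ^+ 2 <= enorm (grad phi x) ^+ 2 + eta.
Proof.
move=> cphi phi0 eta0.
have [M M0 HM] : exists2 M : R, 0 <= M & forall x i, enorm x <= r -> `|partial i phi x| <= M.
  have B i : exists M : R, 0 <= M /\ forall x, enorm x <= r -> `|partial i phi x| <= M.
    by have [M M0 H] := ball_bounded r (cphi i).2; exists M.
  have [f /all_and2[f0 fP]] := choice B.
  exists (\sum_i f i) => [|x i xr]; first exact: sumr_ge0.
  by apply: (le_trans (fP i x xr)); rewrite (bigD1 i)//= lerDl sumr_ge0.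
(* Changing every partial derivative by at most [d <= 1] changes the squared gradient by at most
   [n (2 M d + d^2)], which is at most [d c]. *)
pose c := n%:R * (2 * M + 1) + 1 : R.
have c0 : 0 < c by rewrite ltr_wpDl// mulr_ge0// addr_ge0// mulr_ge0.
pose d := Num.min 1 (Num.min (eta / 3) (eta / c)).
have d0 : 0 < d by rewrite !lt_min ltr01 !divr_gt0.
have d1 : d <= 1 by rewrite ge_min lexx.
have d2 : d <= eta / 3 by rewrite !ge_min lexx orbT.
have d3 : d * c <= eta by rewrite -ler_pdivlMr// !ge_min lexx !orbT.
have d20 : 0 < d / 2 by rewrite divr_gt0.
have [p hp pa] := C1_approx n1 cphi r0 d20.
have clr x : closure Om x -> enorm x <= r by exact: closure_enorm_le.
(* Outside this set the squashed polynomial vanishes in [Om]. It is compact and avoids the boundary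
   of [Om], where [|p| <= d / 2]. *)
pose K := closure Om `&` [set x | d <= `|p x|].
have cK : closed K.
  apply: closedI; first exact: closed_closure.
  rewrite (_ : [set x | _] = (fun x => `|p x|) @^-1` [set t | d <= t])//.
  apply: closed_comp => [z _|]; last exact: closed_ge.
  have cpz := @pf_continuous _ _ _ hp z.
  exact: (continuous_comp cpz (@norm_continuous _ _ (p z))).
have kK : compact K.
  by apply: (subclosed_compact cK (@compact_closed_enorm_ball R n r)) => x [/clr].
have KOm : K `<=` Om.
  move=> x [cx dx]; apply: contrapT => nOm; have [+ _] := pa x (clr x cx).
  by rewrite (phi0 x cx nOm) subr0 => h; move: (le_trans dx h); lra.
have vq : vanish_off d Om K (fun x => squash d (p x)).
  split; first exact: flatpf_squash.
  move=> x Ox nK; apply: squash0; rewrite leNgt; apply/negP => dp; apply: nK; split; last exact: ltW.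
  exact: subset_closure.
have tq := ext_test d0 oOm cK KOm vq kK.
eexists; first exact: tq.
move=> x Ox; have [px gx] := pa x (bOm Ox).
rewrite (isgrad_grad (ext_isgrad d0 oOm cK KOm x vq)); case: asboolP => // _; split.
  have := squash_close d0 (p x); move: px; rewrite !ler_norml => /andP[a1 a2] /andP[b1 b2].
  apply/andP; split; lra.
have G : isgrad (fun x => squash d (p x)) x (dsquash d (p x) *: grad p x).
  exact: (isgrad_comp1 (pf_isgrad x hp) (is_derive_squash d0 (p x))).
rewrite (isgrad_grad G) enormZ exprMn.
have /andP[q0 q1] := dsquash_bound d0 (p x).
apply: (@le_trans _ _ (enorm (grad p x) ^+ 2)).
  by rewrite ler_piMl ?sqr_ge0// real_normK ?num_real// exprn_ile1.
apply: (@le_trans _ _ (enorm (grad phi x) ^+ 2 + n%:R * (2 * M * d + d ^+ 2))).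
  have -> : n%:R * (2 * M * d + d ^+ 2) = \sum_(i < n) (2 * M * d + d ^+ 2).
    by rewrite sumr_const card_ord mulr_natl.
  rewrite !test_sqr_gradE -big_split; apply: ler_sum => i _ /=.
  have h1 := HM x i (bOm Ox); have h2 : `|partial i p x - partial i phi x| <= d by apply: (le_trans (gx i)); lra.
  move: (partial i p x) (partial i phi x) h1 h2 => a b h1 h2.
  have k1 := ler_sqr_norm h2.
  have k2 : (a - b) * b <= d * M.
    by apply: (le_trans (ler_norm _)); rewrite normrM ler_pM.
  have -> : a ^+ 2 = (a - b) ^+ 2 + 2 * ((a - b) * b) + b ^+ 2 by ring.
  lra.
rewrite lerD2l; apply: le_trans d3; rewrite /c.
have dd : d ^+ 2 <= d by rewrite expr2 ler_piMr// ltW.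
have : n%:R * (2 * M * d + d ^+ 2) <= n%:R * (2 * M * d + d) :> R by rewrite ler_wpM2l// lerD2l.
move=> h; apply: (le_trans h); have -> : d * (n%:R * (2 * M + 1) + 1) = n%:R * (2 * M * d + d) + d by ring.
lra.
Qed.

Let nonzero_test psi : test_function Om psi -> 0 < \int[leb]_(x in Om) psi x ->
  mass psi != 0.
Proof.
move=> tp P0; apply/eqP => Z; have cp := C1_continuous (test_C1 tp).
have cf2 := continuous_sqr cp.
have i2 := integrable_continuous cf2.
suff : \int[leb]_(x in Om) psi x <= 0 by rewrite leNgt P0.
apply: (@le_of_small _ _ (fine (leb Om))) => t /andP[t0 _]; rewrite add0r.
have i3 := icst t.
have i4 : leb.-integrable Om (EFin \o (fun x => t^-1 * psi x ^+ 2)) by exact: (integrableZl mOm t^-1 i2).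
apply: (@le_trans _ _ (\int[leb]_(x in Om) (t + t^-1 * psi x ^+ 2))).
  apply: le_Rintegral => //; [exact: integrable_continuous|exact: (integrableD mOm i3 i4)|].
  move=> x _; rewrite -subr_ge0 (_ : _ - _ = ((t - psi x / 2) ^+ 2 + 3 / 4 * psi x ^+ 2) / t).
    by rewrite divr_ge0 ?(ltW t0)// addr_ge0 ?sqr_ge0// mulr_ge0 ?sqr_ge0.
  by field; rewrite gt_eqF.
by rewrite RintegralD// RintegralZl// Z mulr0 addr0 Rintegral_cst.
Qed.

Variable T : R.
Hypothesis HT : torsion_bound T.

Lemma torsion_ub : torsion Om <= T.
Proof.
have [H T0] := torsion_le HT; rewrite /torsion.
have [ne|ne] := pselect ([set t | exists phi g, H10_nonzero Om phi g /\
    t = (\int[leb]_(x in Om) phi x) ^+ 2 / \int[leb]_(x in Om) (enorm (g x) ^+ 2)] !=set0).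
  by apply: ge_sup => // _ [phi [g [[hphi _] ->]]]; exact: H.
(* If there is no competitor, the supremum of the empty set is 0. *)
by rewrite sup_out// => -[].
Qed.

Let test_torsion psi : test_function Om psi -> 0 < \int[leb]_(x in Om) psi x ->
  (\int[leb]_(x in Om) psi x) ^+ 2 <= torsion Om * energy psi.
Proof.
move=> tp P0; have [H T0] := torsion_le HT.
have A0 : 0 < energy psi.
  rewrite lt_neqAle Rintegral_ge0 ?andbT => [|x _]; last exact: sqr_ge0.
  (* With zero energy the bound is linear in [s]: the value [T / P], where [P] is the integral,
     forces [T = 0], and then [s = 1] contradicts [P > 0]. *)
  apply/eqP => Z; have := HT (T / \int[leb]_(x in Om) psi x) tp; rewrite -Z mulr0 subr0 -mulrA mulfVK ?gt_eqF//.
  move=> h; have TT : T = 0 by lra.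
  have := HT 1 tp; rewrite -Z mulr0 subr0 mulr1 TT; lra.
rewrite -ler_pdivrMr//; apply: ub_le_sup.
  by exists T => _ [phi [g [[hphi _] ->]]]; exact: H.
exists psi, (grad psi); split=> //; split; [exact: test_H10|exact: nonzero_test].
Qed.

Lemma torsion_lb phi : C1 phi -> (forall x, closure Om x -> ~ Om x -> phi x = 0) ->
  0 < \int[leb]_(x in Om) phi x ->
  (\int[leb]_(x in Om) phi x) ^+ 2 <= torsion Om * energy phi.
Proof.
move=> cphi phi0; set P := \int[leb]_(x in Om) phi x => P0.
set A := energy phi; pose W := fine (leb Om).
have W0 : 0 <= W by exact: fine_ge0.
(* Uniform errors of size [c] change the integral by at most half of [P], so the approximating test
   functions keep a positive integral. *)
pose c := Num.min 1 (P / (2 * (W + 1))).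
have c0 : 0 < c by rewrite lt_min ltr01 divr_gt0//; lra.
have cW : 2 * (c * W) <= P.
  have h : c <= P / (2 * (W + 1)) by rewrite ge_min lexx orbT.
  rewrite ler_pdivlMr in h; last by lra.
  have c0' := ltW c0; lra.
apply: (@le_of_small _ _ (c * W * torsion Om + 2 * P * (c * W))) => t /andP[t0 t1].
have [psi tp close] := test_approx cphi phi0 (mulr_gt0 t0 c0).
have cp := test_C1 tp.
have i1 := integrable_continuous (C1_continuous cp); have i2 := integrable_continuous (C1_continuous cphi).
have i3 := icst (t * c).
have tc0 : 0 <= t * c by rewrite mulr_ge0// ltW.
have e1 : P <= \int[leb]_(x in Om) psi x + t * c * W.
  rewrite -Rintegral_cst// -RintegralD//; apply: le_Rintegral => //; first exact: (integrableD mOm i1 i3).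
  by move=> x /close[+ _]; rewrite ler_norml; lra.
have e2 : energy psi <= A + t * c * W.
  have j1 := integrable_continuous (continuous_sqr_grad cp).
  have j2 := integrable_continuous (continuous_sqr_grad cphi).
  rewrite -Rintegral_cst// -(RintegralD mOm j2 i3); apply: (le_Rintegral mOm j1 (integrableD mOm j2 i3)).
  by move=> x /close[].
have tcW : t * c * W <= c * W by rewrite -mulrA ler_piMl// mulr_ge0// ltW.
have cW0 : 0 <= c * W by rewrite mulr_ge0// ltW.
have Q0 : 0 < \int[leb]_(x in Om) psi x by lra.
have tau0 : 0 <= torsion Om.
  rewrite -(@pmulr_lge0 _ (energy psi)); last first.
    rewrite lt_neqAle Rintegral_ge0 ?andbT => [|x _]; last exact: sqr_ge0.
    apply/eqP => Z; have := test_torsion tp Q0; rewrite -Z mulr0.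
    by rewrite leNgt exprn_gt0.
  by rewrite (le_trans _ (test_torsion tp Q0))// sqr_ge0.
have := test_torsion tp Q0; move: e1 e2 Q0.
move: (\int[leb]_(x in Om) psi x) (energy psi) => Q G e1 e2 Q0 e3.
have h1 := ler_wpM2l tau0 e2.
have tcW0 : 0 <= t * c * W by rewrite mulr_ge0// mulr_ge0// ltW.
have h2 : (P - t * c * W) ^+ 2 <= Q ^+ 2 by rewrite lerXn2r ?nnegrE//; lra.
have h3 : P ^+ 2 - 2 * P * (t * c * W) <= (P - t * c * W) ^+ 2.
  rewrite sqrrB -mulr_natl; have := sqr_ge0 (t * c * W); lra.
have -> : t * (c * W * torsion Om + 2 * P * (c * W)) = torsion Om * (t * c * W) + 2 * P * (t * c * W) by ring.
rewrite mulrDr in h1; lra.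
Qed.

End sobolev_bounds.

(** * Bounds for the eigenvalue by test functions *)

Section eigenvalue_bounds.
Context {R : realType} {n : nat}.
Implicit Types (phi psi : 'rV[R]_n -> R).
Variables (Om : set 'rV[R]_n) (r : R).
Hypotheses (n1 : (1 < n)%N) (oOm : open Om) (r0 : 0 < r) (bOm : forall x, Om x -> enorm x <= r).

Local Notation energy psi := (\int[leb]_(x in Om) enorm (grad psi x) ^+ 2).
Local Notation mass psi := (\int[leb]_(x in Om) psi x ^+ 2).

Let mOm : measurable Om. Proof. exact: open_measurable_rV. Qed.

Variable phi : 'rV[R]_n -> R.
Hypotheses (cphi : C1 phi) (phi0 : forall x, closure Om x -> ~ Om x -> phi x = 0)
  (phi_neq0 : 0 < mass phi).

Let W := fine (leb Om).
Let W0 : 0 <= W. Proof. exact: fine_ge0. Qed.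

Let approx : exists2 C, 0 <= C & forall t : R, 0 < t <= 1 -> exists psi, [/\ test_function Om psi,
  mass phi <= mass psi + t * C,
  energy psi <= energy phi + t * C &
  0 < mass psi].
Proof.
set B := mass phi.
have cc := C1_continuous cphi.
have [M M0 HM] := ball_bounded r cc.
pose K := (2 * M + 1) * W.
have K0 : 0 <= K by rewrite mulr_ge0//; lra.
pose c := Num.min 1 (B / (2 * (K + 1))).
have c0 : 0 < c by rewrite lt_min ltr01 divr_gt0//; lra.
have cK : 2 * (c * K) <= B.
  have h : c <= B / (2 * (K + 1)) by rewrite ge_min lexx orbT.
  rewrite ler_pdivlMr in h; last by lra.
  have c0' := ltW c0; lra.
have cK0 : 0 <= c * K by rewrite mulr_ge0// ltW.
exists (c * K) => // t /andP[t0 t1].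
have [psi tp close] := test_approx oOm r0 bOm n1 cphi phi0 (mulr_gt0 t0 c0).
have cp := test_C1 tp; have cpc := C1_continuous cp.
have tc0 : 0 <= t * c by rewrite mulr_ge0// ltW.
have cst a := @integrable_continuous _ _ Om r oOm bOm (fun=> a) (@cst_continuous _ _ _).
have sq (f : 'rV[R]_n -> R) : continuous f -> leb.-integrable Om (EFin \o (fun x => f x ^+ 2)).
  by move=> /continuous_sqr; exact: (integrable_continuous oOm bOm).
have e1 : B <= mass psi + t * (c * K).
  rewrite (_ : t * (c * K) = t * c * (2 * M + 1) * W); last by rewrite /K; ring.
  rewrite -Rintegral_cst// -(RintegralD mOm (sq _ cpc) (cst _)).
  apply: le_Rintegral => //; [exact: sq|exact: (integrableD mOm (sq _ cpc) (cst _))|].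
  move=> x Ox; have [+ _] := close x Ox; have := HM x (bOm Ox).
  move: (phi x) (psi x) => a b h1 h2.
  have h3 : (a - b) * a <= t * c * M.
    by apply: (le_trans (ler_norm _)); rewrite normrM distrC ler_pM.
  have : 0 <= (a - b) ^+ 2 by exact: sqr_ge0.
  have -> : (a - b) ^+ 2 = b ^+ 2 - a ^+ 2 + 2 * ((a - b) * a) by ring.
  lra.
exists psi; split => //.
- apply: (@le_trans _ _ (energy phi + t * c * W)).
    have j1 := integrable_continuous oOm bOm (continuous_sqr_grad cp).
    have j2 := integrable_continuous oOm bOm (continuous_sqr_grad cphi).
    rewrite -Rintegral_cst// -(RintegralD mOm j2 (cst _)).
    by apply: (le_Rintegral mOm j1 (integrableD mOm j2 (cst _))) => x /close[].
  rewrite lerD2l -mulrA ler_wpM2l ?(ltW t0)// ler_wpM2l ?(ltW c0)// /K ler_peMl//; lra.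
- have h : t * (c * K) <= c * K by rewrite ler_piMl.
  have B0 : 0 < B := phi_neq0.
  move: e1; move: (mass psi) => P e1; lra.
Qed.

Let nonneg : has_lbound [set t | exists phi g, H10_nonzero Om phi g /\
    t = \int[leb]_(x in Om) (enorm (g x) ^+ 2) / mass phi].
Proof.
exists 0 => _ [f [g [_ ->]]]; rewrite divr_ge0//; apply: Rintegral_ge0 => x _; exact: sqr_ge0.
Qed.

Lemma eigenvalue1_ge0 : 0 <= eigenvalue1 Om.
Proof.
rewrite /eigenvalue1; set E := [set t | _].
have [ne|ne] := pselect (E !=set0); last by rewrite inf_out// => -[].
apply: lb_le_inf => // _ [f [g [_ ->]]]; rewrite divr_ge0//; apply: Rintegral_ge0 => x _; exact: sqr_ge0.
Qed.

Lemma eigenvalue1_ub : eigenvalue1 Om * mass phi <= energy phi.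
Proof.
have [C C0 A] := approx.
have ev0 := eigenvalue1_ge0.
apply: (@le_of_small _ _ _ (eigenvalue1 Om * C + C)) => t t01.
have [psi [tp e1 e2 p0]] := A t t01.
have e3 : eigenvalue1 Om * mass psi <= energy psi.
  rewrite -ler_pdivlMr//; apply: ge_inf => //; exists psi, (grad psi); split => //.
  by split; [exact: (test_H10 oOm bOm)|rewrite gt_eqF].
apply: (le_trans (ler_wpM2l ev0 e1)); rewrite mulrDr (mulrDr t) mulrCA addrA [leRHS]addrAC lerD2r.
exact: le_trans e3 e2.
Qed.

(** The infimum of the empty set is 0, so a lower bound also requires a competitor, which the
    approximation of [phi] provides. *)
Lemma eigenvalue1_lb (l : R) : 0 <= l -> (forall psi, test_function Om psi ->
     l * mass psi <= energy psi) ->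
  l <= eigenvalue1 Om.
Proof.
move=> l0 H; apply: lb_le_inf.
  have [C C0 A] := approx; have [|psi [tp _ _ p0]] := A 1; first by rewrite ltr01 lexx.
  eexists; exists psi, (grad psi); split; last reflexivity.
  by split; [exact: (test_H10 oOm bOm)|rewrite gt_eqF].
move=> _ [f [g [[hf f0] ->]]].
have B0 : 0 < mass f.
  by rewrite lt_neqAle eq_sym f0 Rintegral_ge0// => x _; exact: sqr_ge0.
by rewrite ler_pdivlMr//; exact: (H10_rayleigh oOm bOm l0 H hf).
Qed.

End eigenvalue_bounds.

(** * Entire power series and the Bessel equation *)

Section entire_series.
Context {R : realType}.

(** Domination by the exponential series gives convergence everywhere and is stable under
    [pseries_diffs], so termwise differentiation can be iterated. *)
Definition exp_bounded (c : nat -> R) := forall k, `|c k| <= (k`!%:R)^-1.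

Lemma exp_bounded_diffs c : exp_bounded c -> exp_bounded (pseries_diffs c).
Proof.
move=> hc k; rewrite /pseries_diffs normrM ger0_norm//.
apply: (le_trans (ler_wpM2l _ (hc k.+1))) => //.
by rewrite factS natrM invfM mulrA divff ?mul1r// pnatr_eq0.
Qed.

Lemma exp_bounded_cvg c (x : R) : exp_bounded c -> cvgn (pseries c x).
Proof.
move=> hc; apply: normed_cvg; rewrite /normed_series_of /=.
apply: (@series_le_cvg _ _ (exp_coeff `|x|)) => [k|k|k|].
- exact: normr_ge0.
- by rewrite /exp_coeff divr_ge0// exprn_ge0.
- by rewrite /exp_coeff normrM normrX mulrC ler_wpM2l// exprn_ge0.
- exact: is_cvg_series_exp_coeff.
Qed.

Definition psum c (x : R) : R := limn (pseries c x).

Lemma is_derive_psum c (x : R) : exp_bounded c -> is_derive x 1 (psum c) (psum (pseries_diffs c) x).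
Proof.
move=> hc; apply: (@pseries_snd_diffs _ c (`|x| + 1)).
- exact: exp_bounded_cvg.
- exact/exp_bounded_cvg/exp_bounded_diffs.
- exact/exp_bounded_cvg/exp_bounded_diffs/exp_bounded_diffs.
- by rewrite [ltRHS]ger0_norm ?addr_ge0// ltrDl.
Qed.

Lemma psum0 c : psum c 0 = c 0%N.
Proof.
apply: cvg_lim => //; rewrite -cvg_shiftS (_ : (fun k => _) = (fun=> c 0%N)); first exact: cvg_cst.
apply/funext => k; rewrite /pseries /series /= big_nat_recl// expr0 mulr1 big1 ?addr0// => j _.
by rewrite expr0n mulr0.
Qed.

Section bessel.
Variable m : nat.
Hypothesis m0 : (0 < m)%N.

(** Coefficients, in the variable [r^2], of the Bessel function of order [m / 2 - 1] divided by
    [r^(m/2-1)], normalised to the value 1 at 0. *)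
Fixpoint bessel_coef (k : nat) : R :=
  if k is j.+1 then - bessel_coef j / (2 * j.+1%:R * (2 * j + m)%:R) else 1.

(* The radial solution of [- Delta w = w] on R^m is [w x = bessel 0 (|x|^2)]. *)
Definition bessel j : R -> R := psum (iter j (@pseries_diffs R) bessel_coef).

Let den_neq0 k : (2 * k.+1%:R * (2 * k + m)%:R : R) != 0.
Proof. by rewrite !mulf_neq0 ?pnatr_eq0// addn_eq0 negb_and -[m != 0%N]lt0n m0 orbT. Qed.

Lemma bessel_rec k : 2 * k.+1%:R * (2 * k%:R + m%:R) * bessel_coef k.+1 = - bessel_coef k.
Proof. by have d0 := den_neq0 k; rewrite /= natrD natrM in d0 *; rewrite mulrC divfK. Qed.

Lemma bessel_exp_bounded j : exp_bounded (iter j (@pseries_diffs R) bessel_coef).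
Proof.
elim: j => [|j IH /=]; last exact: exp_bounded_diffs.
elim=> [|k IH] /=; first by rewrite fact0 normr1 invr1.
have d1 : (1 : R) <= 2 * (2 * k + m)%:R.
  have : (1 : R) <= (2 * k + m)%:R by rewrite ler1n addn_gt0 m0 orbT.
  lra.
rewrite normrM normrN normfV factS natrM invfM mulrC ler_pM//.
rewrite ger0_norm ?mulr_ge0// lef_pV2 ?posrE ?mulr_gt0 ?ltr0n ?addn_gt0 ?m0 ?orbT//.
by rewrite -mulrA mulrCA ler_peMr.
Qed.

Lemma is_derive_bessel j (x : R) : is_derive x 1 (bessel j) (bessel j.+1 x).
Proof. exact: is_derive_psum (bessel_exp_bounded j). Qed.

Lemma bessel0 : bessel 0 0 = 1. Proof. by rewrite /bessel psum0. Qed.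

(** With indices shifted to match the degrees, the partial sums of the three series satisfy the
    equation exactly at every stage; it then passes to the limit. *)
Lemma bessel_ode x : 4 * x * bessel 2 x + 2 * m%:R * bessel 1 x + bessel 0 x = 0.
Proof.
pose S j k := pseries (iter j (@pseries_diffs R) bessel_coef) x k.
have cS j : S j k @[k --> \oo] --> bessel j x by exact: exp_bounded_cvg (bessel_exp_bounded j).
have cS1 j : S j k.+1 @[k --> \oo] --> bessel j x by rewrite (cvg_shiftS (S j)).
have C : (fun k => 4 * x * S 2%N k + 2 * m%:R * S 1%N k.+1 + S 0%N k.+1) @ \oo -->
    4 * x * bessel 2 x + 2 * m%:R * bessel 1 x + bessel 0 x.
  apply: cvgD; last exact: cS1.
  by apply: cvgD; apply: cvgM; [exact: cvg_cst|exact: cS|exact: cvg_cst|exact: cS1].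
have Z : (fun k => 4 * x * S 2%N k + 2 * m%:R * S 1%N k.+1 + S 0%N k.+1) = (fun=> 0).
  apply/funext; elim=> [|k IH].
    rewrite /S /pseries /series /= !big_nat1 big_geq// mulr0 add0r !expr0 !mulr1 /pseries_diffs.
    have := bessel_rec 0; rewrite /= mulr0 add0r mul1r; move: (- 1 / _) => c; lra.
  have St j : S j k.+1 = S j k + iter j (@pseries_diffs R) bessel_coef k * x ^+ k.
    by rewrite /S /pseries /series /= big_nat_recr.
  have St' j : S j k.+2 = S j k.+1 + iter j (@pseries_diffs R) bessel_coef k.+1 * x ^+ k.+1.
    by rewrite /S /pseries /series /= big_nat_recr.
  rewrite !St' St; have r := bessel_rec k.+1.
  have -> : iter 2 (@pseries_diffs R) bessel_coef k = k.+1%:R * (k.+2%:R * bessel_coef k.+2) by [].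
  have -> : iter 1 (@pseries_diffs R) bessel_coef k.+1 = k.+2%:R * bessel_coef k.+2 by [].
  have -> : iter 0 (@pseries_diffs R) bessel_coef k.+1 = bessel_coef k.+1 by [].
  have -> : bessel_coef k.+1 = - (2 * k.+2%:R * (2 * k.+1%:R + m%:R) * bessel_coef k.+2) by rewrite r opprK.
  rewrite -[RHS]IH exprS; ring.
rewrite Z in C; rewrite -(cvg_lim _ C)//; exact: lim_cst.
Qed.

End bessel.

End entire_series.

(** * Barta's inequality and the first zero of the Bessel series *)

Section barta.
Context {R : realType} {n : nat}.
Implicit Types (f phi psi : 'rV[R]_n -> R) (x : 'rV[R]_n).
Hypothesis n1 : (1 < n)%N.

Lemma near_continuous (f h : 'rV[R]_n -> R) x : (\forall z \near x, f z = h z) ->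
  {for x, continuous f} -> {for x, continuous h}.
Proof.
move=> E cf; suff : h @ x --> h x by [].
rewrite -(nbhs_singleton E).
by apply: cvg_trans; [exact: near_eq_cvg E|exact: cf].
Qed.

Lemma C1_of_isgrad f (g : 'rV[R]_n -> 'rV[R]_n) : (forall x, isgrad f x (g x)) ->
  (forall i, continuous (fun x => g x 0 i)) -> C1 f.
Proof.
move=> fg cg i; split=> [x|]; first exact: isgrad_derivable (fg x).
by rewrite (_ : partial i f = (fun x => g x 0 i))//; apply/funext => x; exact: isgrad_partial.
Qed.

Lemma Rintegral_gt0 (Om : set 'rV[R]_n) f z (rho c : R) (B := [set x | enorm (x - z) < rho]) :
  measurable Om -> leb.-integrable Om (EFin \o f) -> 0 < rho -> 0 < c -> B `<=` Om ->
  (forall x, Om x -> 0 <= f x) -> (forall x, B x -> c <= f x) -> 0 < \int[leb]_(x in Om) f x.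
Proof.
move=> mOm i rho0 c0 sub f0 fc; have mB : measurable B by exact: measurable_ball.
have i2 := integrableS mOm mB sub i; have LB := @lebesgue_ball R n z _ rho0.
apply: (@lt_le_trans _ _ (\int[leb]_(x in B) c)).
  rewrite Rintegral_cst// mulr_gt0// (_ : fine _ = rho ^+ n * ballvol n); last exact: (congr1 fine LB).
  by rewrite mulr_gt0 ?exprn_gt0 ?ballvol_gt0.
apply: (@le_trans _ _ (\int[leb]_(x in B) f x)).
  apply: le_Rintegral => //; apply: (@integrable_bounded _ _ _ _ (enorm z + rho) c) => // x Bx.
    have := enormB x z; rewrite /B/= in Bx; lra.
  by rewrite ger0_norm// ltW.
apply: fine_le; [exact: integrable_fin_num|exact: integrable_fin_num|].
by apply: ge0_subset_integral => //; case/integrableP: i.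
Qed.

Lemma continuous_dotxx : continuous (fun x => dot x x).
Proof. by move=> x; apply: continuous_dot; exact: cvg_id. Qed.

Lemma dotxx_lt1 x : unit_ball x <-> dot x x < 1.
Proof. by rewrite -enorm_sqr /unit_ball/= expr_lt1// enorm_ge0. Qed.

Let bU (x : 'rV[R]_n) : unit_ball x -> enorm x <= 1. Proof. by move=> /ltW. Qed.
Let iB f := @integrable_continuous _ _ _ _ (@open_unit_ball R n) bU f.

(* Integrate the divergence of [psi^2 grad z / z], where [z x = Z (|x|^2)]. *)
Lemma barta (Z Z1 Z2 : R -> R) (l : R) psi :
  (forall t : R, is_derive t 1 Z (Z1 t)) -> (forall t : R, is_derive t 1 Z1 (Z2 t)) ->
  continuous Z2 -> (forall t, 0 <= t < 1 -> 0 < Z t) ->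
  (forall t, 0 <= t < 1 -> 4 * t * Z2 t + 2 * n%:R * Z1 t <= - l * Z t) ->
  test_function (@unit_ball R n) psi ->
  l * \int[leb]_(x in @unit_ball R n) psi x ^+ 2 <= \int[leb]_(x in @unit_ball R n) enorm (grad psi x) ^+ 2.
Proof.
move=> dZ dZ1 cZ2 Zpos ineq tp; have cp := test_C1 tp; have cpc := C1_continuous cp.
(* [a (|x|^2) x] is the quotient [grad z / z]. *)
pose a t := 2 * (Z1 t * (Z t)^-1).
pose da t := 2 * (Z1 t * (- (Z t) ^- 2 * Z1 t) + (Z t)^-1 * Z2 t).
have s0 x : unit_ball x -> 0 <= dot x x < 1.
  by move=> /dotxx_lt1 x1; rewrite dotxx_ge0.
have Zx x : unit_ball x -> 0 < Z (dot x x) by move=> /s0/Zpos.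
have dera t : 0 < Z t -> is_derive t 1 a (da t).
  move=> Zt; have Zn : Z t != 0 by rewrite gt_eqF.
  have dV := @is_derive1_comp _ (fun s : R => s^-1) Z t _ _ (is_deriveVn Zn) (dZ t).
  have dM := is_deriveM (dZ1 t) dV.
  have dd : is_derive t 1 (fun s => 2 * (Z1 s * (Z s)^-1)) (2 * (Z1 t * (- (Z t) ^- 2 * Z1 t) + (Z t)^-1 * Z2 t)).
    exact: (is_deriveZ (2 : R) dM).
  exact: dd.
have cZ : continuous Z by move=> t; exact: is_derive_continuous (dZ t).
have cZ1 : continuous Z1 by move=> t; exact: is_derive_continuous (dZ1 t).
have ca t : 0 < Z t -> {for t, continuous a} by move=> /dera; exact: is_derive_continuous.
have cda t : 0 < Z t -> {for t, continuous da}.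
  move=> Zt; have Zn : Z t != 0 by rewrite gt_eqF.
  have cV : {for t, continuous (fun s => (Z s)^-1)} by exact: (cvgV Zn (cZ t)).
  have cV2 : {for t, continuous (fun s => (Z s) ^- 2)}.
    rewrite (_ : (fun s => _) = (fun s => (Z s)^-1 * (Z s)^-1)).
      exact: (continuous_mul cV cV).
    by apply/funext => s; rewrite expr2 invfM.
  have cN : {for t, continuous (fun s => - (Z s) ^- 2 * Z1 s)}.
    rewrite (_ : (fun s => _) = (fun s => 0 - (Z s) ^- 2 * Z1 s)); last by apply/funext => s; rewrite sub0r mulNr.
    exact: (continuous_sub (@cst_continuous _ _ 0 t) (continuous_mul cV2 (cZ1 t))).
  have c4 := continuous_add (continuous_mul (cZ1 t) cN) (continuous_mul cV (cZ2 t)).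
  exact: (@continuous_mul _ _ (fun=> 2) _ t (@cst_continuous _ _ (2 : R) t) c4).
pose X x : 'rV[R]_n := (psi x ^+ 2 * a (dot x x)) *: x.
pose G i x : 'rV[R]_n := (psi x ^+ 2 * a (dot x x)) *: delta_mx 0 i +
  x 0 i *: (psi x ^+ 2 *: (da (dot x x) *: (2 *: x)) + a (dot x x) *: ((2 * psi x) *: grad psi x)).
(* [Z] may vanish at 1 and beyond; but [psi] vanishes near every point outside the open ball, so the
   field has no singularity. *)
have off x : ~ unit_ball x -> \forall z \near x, psi z = 0.
  move=> nx; have [_ [_ sup]] := tp; have ncl : ~ closure [set x | psi x != 0] x by move=> /sup.
  have oD : open (~` closure [set x | psi x != 0]) by apply/closed_openC/closed_closure.
  apply: filterS (open_nbhs_nbhs (conj oD ncl)) => z nz /=.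
  by apply/eqP/contraT => h; exfalso; apply: nz; exact: subset_closure.
have gX i x : isgrad (fun z => X z 0 i) x (if `[< unit_ball x >] then G i x else 0).
  case: asboolP => xB; last first.
    apply: (isgrad_near _ (isgrad_cst 0 x)); apply: filterS (off x xB) => z z0.
    by rewrite /X z0 expr0n !mul0r scale0r mxE.
  rewrite (_ : (fun z => X z 0 i) = (fun z => psi z ^+ 2 * a (dot z z) * z 0 i)); last by apply/funext => z; rewrite mxE.
  have g1 := isgrad_comp1 (isgrad_dotxx x) (dera _ (Zx x xB)).
  have g2 := isgradX 2 (C1_isgrad x cp).
  exact: (isgrad_eq (isgradM (isgradM g2 g1) (isgrad_coord i x)) erefl).
have cX i : C1 (fun z => X z 0 i).
  apply: (C1_of_isgrad (gX i)) => j x; have [xB|xB] := pselect (unit_ball x); last first.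
    apply: (@near_continuous (fun=> 0)); last exact: cst_continuous.
    near=> z.
    have z0 : \forall w \near z, psi w = 0 by near: z; exact: (near_join (off x xB)).
    have zz : psi z = 0 by exact: nbhs_singleton z0.
    case: asboolP => zB; rewrite mxE//.
    by rewrite /G zz !mxE expr0n /=; ring.
  apply: (@near_continuous (fun z => G i z 0 j)).
    apply: filterS (open_nbhs_nbhs (conj (@open_unit_ball R n) xB)) => z zB.
    by case: asboolP.
  have c1 : {for x, continuous (fun z => psi z ^+ 2)} by exact: (continuous_mul (cpc x) (cpc x)).
  have cd := @continuous_dotxx x.
  have ca' : {for x, continuous (fun z => a (dot z z))} by exact: (continuous_comp cd (ca _ (Zx x xB))).
  have cda' : {for x, continuous (fun z => da (dot z z))} by exact: (continuous_comp cd (cda _ (Zx x xB))).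
  rewrite (_ : (fun z => G i z 0 j) = (fun z => psi z ^+ 2 * a (dot z z) * (i == j)%:R +
     z 0 i * (psi z ^+ 2 * (da (dot z z) * (2 * z 0 j)) + a (dot z z) * (2 * psi z * partial j psi z)))); last first.
    by apply/funext => z; rewrite !mxE eqxx/= [j == i]eq_sym.
  have k c := @cst_continuous 'rV[R]_n R c x.
  have cj l := @continuous_coord R n l x.
  exact: (continuous_add (continuous_mul (continuous_mul c1 ca') (k _)) (continuous_mul (cj i)
    (continuous_add (continuous_mul c1 (continuous_mul cda' (continuous_mul (k 2) (cj j))))
      (continuous_mul ca' (continuous_mul (continuous_mul (k 2) (cpc x)) ((cp j).2 x)))))).
have := ball_divergence n1 (@ltr01 R) cX.
have -> : sA (fun y => dot (X (1 *: y)) y) = 0.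
  rewrite -(@sA0 R n); apply: eq_sA => y y1; rewrite scale1r /X.
  have nB : ~ unit_ball y by rewrite /unit_ball/= (y1 : enorm y = 1) ltxx.
  by rewrite (test_off tp nB).1 expr0n !mul0r scale0r dot0l.
rewrite mulr0 => I0.
have mU := @measurable_unit_ball R n.
have cf2 := continuous_sqr cpc.
have i1 := iB cf2.
have i2 := iB (continuous_sqr_grad cp).
have i3 : leb.-integrable (@unit_ball R n) (EFin \o (fun x => l * psi x ^+ 2)) by exact: (integrableZl mU l i1).
have cdiv : continuous (divergence X) by move=> x; apply: continuous_sum => i; exact: (cX i i).2.
have i4 := iB cdiv.
rewrite -RintegralZl//.
apply: (@le_trans _ _ (\int[leb]_(x in @unit_ball R n) (enorm (grad psi x) ^+ 2 - divergence X x))); last first.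
  by rewrite RintegralB// (I0 : \int[leb]_(x in @unit_ball R n) divergence X x = 0) subr0.
apply: le_Rintegral => //; first exact: (integrableB mU i2 i4).
move=> x xB; have Zp := Zx x xB; have Zn : Z (dot x x) != 0 by rewrite gt_eqF.
rewrite lerBrDr.
have -> : divergence X x = \sum_i (psi x ^+ 2 * a (dot x x) + x 0 i * (psi x ^+ 2 * (da (dot x x) * (2 * x 0 i)) + a (dot x x) * (2 * psi x * partial i psi x))).
  apply: eq_bigr => i _; rewrite (isgrad_partial i (gX i x)); case: asboolP => // _.
  by rewrite !mxE !eqxx mulr1.
rewrite test_sqr_gradE; set s := dot x x.
(* Picone's identity: once the square of [grad psi - psi grad z / z] is completed, a multiple of the
   differential inequality for [Z] remains. *)
apply: (@le_trans _ _ (l * psi x ^+ 2 + \sum_i (psi x ^+ 2 * a s + (2 * psi x ^+ 2 * da s + psi x ^+ 2 * a s ^+ 2) * (x 0 i * x 0 i) + partial i psi x ^+ 2))).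
  rewrite lerD2l; apply: ler_sum => i _; rewrite -subr_ge0.
  rewrite (_ : _ - _ = (psi x * a s * x 0 i - partial i psi x) ^+ 2); first exact: sqr_ge0.
  by ring.
rewrite !big_split/= sumr_const card_ord -mulr_sumr -/(dot x x) -/s addrA gerDr -[_ *+ n]mulr_natl.
have Zs : Z s != 0 by []; have I := ineq s (s0 x xB).
have -> : l * psi x ^+ 2 + (n%:R * (psi x ^+ 2 * a s) + (2 * psi x ^+ 2 * da s + psi x ^+ 2 * a s ^+ 2) * s) =
    psi x ^+ 2 / Z s * (l * Z s + (4 * s * Z2 s + 2 * n%:R * Z1 s)).
  by rewrite /a /da; field.
apply: mulr_ge0_le0; first by rewrite divr_ge0 ?sqr_ge0// ltW.
by rewrite mulNr in I; lra.
Unshelve. all: by end_near. Qed.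

Lemma paraboloid_C1 : C1 (fun x : 'rV[R]_n => 1 - dot x x).
Proof. by apply/pf_C1/pfB; [exact: pf_cst|exact: pf_dotxx]. Qed.

Lemma paraboloid_boundary x : closure (@unit_ball R n) x -> ~ unit_ball x -> 1 - dot x x = 0.
Proof.
move=> /(closure_enorm_le bU) x1 /negP; rewrite -leNgt => x1'.
have e : enorm x = 1 by apply/eqP; rewrite eq_le x1 x1'.
by rewrite -enorm_sqr e expr1n subrr.
Qed.

Lemma paraboloid_gt0 : 0 < \int[leb]_(x in @unit_ball R n) (1 - dot x x) ^+ 2.
Proof.
have cp := C1_continuous paraboloid_C1.
apply: (@Rintegral_gt0 _ _ 0 2^-1 4^-1) => //.
- exact: measurable_unit_ball.
- exact: (iB (continuous_sqr cp)).
- by move=> x; rewrite /unit_ball/= subr0 => h; lra.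
- by move=> x _; exact: sqr_ge0.
- move=> x; rewrite /= subr0 => xh; have : dot x x <= 4^-1.
    rewrite -enorm_sqr (_ : 4^-1 = 2^-1 ^+ 2); last by field.
    by rewrite lerXn2r ?nnegrE ?enorm_ge0// ltW.
  move: (dot x x) => s sh; have : 0 <= (4^-1 - s) * (1 - s - 3 / 4) + (3 / 4 - 4^-1) by nra.
  nra.
Qed.

Lemma ball_eigenvalue_ge (Z Z1 Z2 : R -> R) (l : R) : 0 <= l ->
  (forall t : R, is_derive t 1 Z (Z1 t)) -> (forall t : R, is_derive t 1 Z1 (Z2 t)) ->
  continuous Z2 -> (forall t, 0 <= t < 1 -> 0 < Z t) ->
  (forall t, 0 <= t < 1 -> 4 * t * Z2 t + 2 * n%:R * Z1 t <= - l * Z t) ->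
  l <= eigenvalue1 (@unit_ball R n).
Proof.
move=> l0 dZ dZ1 cZ2 Zp I.
apply: (eigenvalue1_lb n1 (@open_unit_ball R n) (@ltr01 R) bU paraboloid_C1 paraboloid_boundary paraboloid_gt0 l0).
by move=> psi; exact: (barta dZ dZ1 cZ2 Zp I).
Qed.

(** Barta's inequality with [z = (1 - |x|^2) exp (- n |x|^2 / 4)]. With this exponent the defect in
    the differential inequality is the exponential times [(1 - t)^2 n^2 / 4], a nonnegative
    quantity. *)
Lemma ball_eigenvalue_lower : n%:R ^+ 2 / 4 + 2 * n%:R <= eigenvalue1 (@unit_ball R n).
Proof.
pose c := n%:R / 4 : R.
have dE (t : R) : is_derive t 1 (fun s => expR (- c * s)) (- c * expR (- c * t)).
  by apply: (is_derive_eq (@is_derive1_comp _ expR (fun s => - c * s) t _ _ (is_derive_expR _) (is_derive_mull (- c) t))); rewrite mulrC.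
have lin (b k t : R) : is_derive t 1 (fun s : R => b + k * s) k.
  by apply: (is_derive_eq (is_deriveD (is_derive_cst b t 1) (is_derive_mull k t))); rewrite add0r.
have dP (b k t : R) : is_derive t 1 (fun s => expR (- c * s) * (b + k * s)) (expR (- c * t) * ((k - c * b) + - (c * k) * t)).
  by apply: (is_derive_eq (is_deriveM (dE t) (lin b k t))); rewrite /GRing.scale/=; ring.
pose Z (b k t : R) : R := expR (- c * t) * (b + k * t).
have dZ (b k t : R) : is_derive t 1 (Z b k) (Z (k - c * b) (- (c * k)) t) by exact: dP.
apply: (@ball_eigenvalue_ge (Z 1 (-1)) _ _ _ _ (dZ 1 (-1)) (dZ _ _)).
- by rewrite addr_ge0// ?divr_ge0 ?sqr_ge0// mulr_ge0.
- by move=> t; exact: is_derive_continuous (dZ _ _ t).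
- by move=> t /andP[t0 t1]; rewrite /Z mulr_gt0 ?expR_gt0//; lra.
- move=> t /andP[t0 t1]; rewrite /Z -subr_ge0.
  rewrite (_ : _ - _ = expR (- c * t) * ((1 - t) ^+ 2 * (n%:R ^+ 2 / 4))); last by rewrite /c; field.
  by rewrite mulr_ge0 ?expR_ge0// mulr_ge0 ?sqr_ge0// divr_ge0 ?sqr_ge0.
Qed.

(** Barta's inequality itself produces the zero: positivity of the series on [[0, l)] gives [l <= E]
    after rescaling, so the series cannot remain positive beyond the eigenvalue [E]. The first zero
    is the infimum of the closed set where it is nonpositive. *)
Lemma bessel_first_zero : exists l : R, [/\ 0 < l, bessel n 0 l = 0,
  forall t : R, 0 <= t < l -> 0 < bessel n 0 t & l <= eigenvalue1 (@unit_ball R n)].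
Proof.
have n0 : (0 < n)%N := ltnW n1.
have cW j : continuous (bessel n j : R -> R) by move=> t; exact: is_derive_continuous (is_derive_bessel n0 j t).
set E := eigenvalue1 (@unit_ball R n).
have key (l : R) : 0 <= l -> (forall t : R, 0 <= t < l -> 0 < bessel n 0 t) -> l <= E.
  rewrite le_eqVlt => /predU1P[<- _|l0 Wp].
    apply: (le_trans _ ball_eigenvalue_lower).
    by rewrite addr_ge0// ?divr_ge0 ?sqr_ge0// mulr_ge0.
  have d j (k t : R) : is_derive t 1 (fun s => k * bessel n j (l * s)) (k * l * bessel n j.+1 (l * t)).
    have h2 := @is_derive1_comp _ (bessel n j) _ t _ _ (is_derive_bessel n0 j (l * t)) (is_derive_mull l t).
    by apply: (is_derive_eq (is_deriveZ k h2)); rewrite /GRing.scale/=; ring.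
  pose Z j (k s : R) : R := k * bessel n j (l * s).
  have dZ j (k t : R) : is_derive t 1 (Z j k) (Z j.+1 (k * l) t) by exact: d.
  apply: (@ball_eigenvalue_ge (Z 0%N 1) _ _ _ (ltW l0) (dZ _ _) (dZ _ _)).
  - by move=> t; exact: is_derive_continuous (dZ _ _ t).
  - by move=> t /andP[t0 t1]; rewrite /Z mul1r Wp// mulr_ge0 ?(ltW l0)//= gtr_pMr.
  - move=> t _; rewrite /Z; have := bessel_ode n0 (l * t).
    move: (bessel n 0 _) (bessel n 1 _) (bessel n 2 _) => w0 w1 w2 h.
    apply: eq_ler; rewrite (_ : w0 = - (4 * (l * t) * w2 + 2 * n%:R * w1)); [ring|lra].
have E0 : 0 <= E by apply: key => // t; lra.
pose A := [set t : R | 0 <= t /\ bessel n 0 t <= 0].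
have A0 : A !=set0.
  apply: contrapT => nA; have : E + 1 <= E; last lra.
  apply: key; first lra.
  move=> t /andP[t0 _]; rewrite ltNge; apply/negP => Wt; apply: nA; by exists t.
have lbA : has_lbound A by exists 0 => t [].
pose l := inf A.
have l0 : 0 <= l by apply: lb_le_inf => // t [].
have pos t : 0 <= t < l -> 0 < bessel n 0 t.
  move=> /andP[t0 tl]; rewrite ltNge; apply/negP => Wt.
  by move: tl; rewrite ltNge => /negP; apply; apply: ge_inf.
have cl : A l.
  have cA : closed A.
    rewrite (_ : A = [set t | 0 <= t] `&` (bessel n 0 @^-1` [set t | t <= 0]))//.
    apply: closedI; first exact: closed_ge.
    by apply: closed_comp => [z _|]; [exact: cW|exact: closed_le].
  apply: cA; rewrite /closure /= => B /nbhs_ballP[e /= e0 Be].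
  have hi : has_inf A by split.
  have [t At tl] := inf_adherent e0 hi.
  exists t; split => //; apply: Be; rewrite /ball/= ltr_norml.
  have := ge_inf lbA At; rewrite -/l in tl *; move=> h; apply/andP; split; lra.
have lp : 0 < l.
  rewrite lt_neqAle l0 andbT; apply/eqP => e; case: cl => _; rewrite -e bessel0; lra.
exists l; split => //; last exact: key.
apply/eqP; rewrite eq_le cl.2 /=.
rewrite leNgt; apply/negP => W0.
have cl0 : {for l, continuous (bessel n 0 : R -> R)} by exact: cW.
have /cvgrPdist_lt/(_ (- bessel n 0 l)) := cl0; rewrite oppr_gt0 => /(_ W0)/nbhs_ballP[e /= e0 He].
pose t := Num.max (l - e / 2) (l / 2).
have tl : t < l by rewrite gt_max; apply/andP; split; lra.
have t0 : 0 <= t by rewrite le_max; apply/orP; right; lra.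
have te : l - e / 2 <= t by rewrite le_max lexx.
have := pos t _; rewrite t0 tl => /(_ isT).
have : ball l e t by rewrite /ball/= ltr_norml; apply/andP; split; lra.
by move=> /He; rewrite ltr_norml => /andP[h1 h2]; lra.
Qed.

End barta.

(** * Calculus of tangential gradients *)

Section sgrad_algebra.
Context {R : realType} {n : nat}.
Implicit Types (f h : 'rV[R]_n -> R) (F G : 'rV[R]_n -> 'rV[R]_n) (x y : 'rV[R]_n).

Lemma sgradM f h F G : sgrad f F -> sgrad h G ->
  sgrad (fun y => f y * h y) (fun y => f y *: G y + h y *: F y).
Proof.
move=> sf sh; have cf := sgrad_scont sf; have ch := sgrad_scont sh.
case: sf sh => gf cF [gh cG]; split=> [x x0|i].
  apply: (isgrad_eq (isgradM (gf x x0) (gh x x0))).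
  by rewrite !hextendE !scalerDr !scalerA [h _ * _]mulrC [f _ * _]mulrC.
rewrite (_ : (fun x => _) = (fun x => f x * G x 0 i + h x * F x 0 i)); last first.
  by apply/funext => x; rewrite !mxE.
by apply: scontD; apply: scontM.
Qed.

Lemma sgradB f h F G : sgrad f F -> sgrad h G -> sgrad (fun y => f y - h y) (fun y => F y - G y).
Proof.
move=> [gf cF] [gh cG]; split=> [x x0|i].
  by apply: (isgrad_eq (isgradB (gf x x0) (gh x x0))); rewrite scalerBr.
rewrite (_ : (fun x => _) = (fun x => F x 0 i - G x 0 i)); last by apply/funext => x; rewrite !mxE.
exact: scontB.
Qed.

Lemma sgradD f h F G : sgrad f F -> sgrad h G -> sgrad (fun y => f y + h y) (fun y => F y + G y).
Proof.
move=> [gf cF] [gh cG]; split=> [x x0|i].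
  by apply: (isgrad_eq (isgradD (gf x x0) (gh x x0))); rewrite scalerDr.
rewrite (_ : (fun x => _) = (fun x => F x 0 i + G x 0 i)); last by apply/funext => x; rewrite !mxE.
exact: scontD.
Qed.

Lemma sgrad_cst (c : R) : sgrad (fun _ : 'rV[R]_n => c) (fun=> 0).
Proof.
split=> [x x0|i]; first by rewrite scaler0; exact: isgrad_cst.
by rewrite (_ : (fun x => _) = (fun=> 0)); [exact: scont_cst|apply/funext => x; rewrite mxE].
Qed.

Lemma sgrad_comp (w w1 : R -> R) f F : sgrad f F ->
  (forall y, unit_sphere y -> is_derive (f y) 1 w (w1 (f y))) -> scont (fun y => w1 (f y)) ->
  sgrad (fun y => w (f y)) (fun y => w1 (f y) *: F y).
Proof.
move=> [gf cF] D cw; split=> [x x0|i].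
  apply: (isgrad_eq (isgrad_comp1 (gf x x0) (D (nx x) (enorm_nx x0)))).
  by rewrite !scalerA mulrC.
rewrite (_ : (fun x => _) = (fun x => w1 (f x) * F x 0 i)); last by apply/funext => x; rewrite mxE.
exact: scontM.
Qed.

Lemma sgradX f F k : sgrad f F -> sgrad (fun y => f y ^+ k) (fun y => (k%:R * f y ^+ k.-1) *: F y).
Proof.
move=> sf; apply: (sgrad_comp (w := fun t => t ^+ k) (w1 := fun t => k%:R * t ^+ k.-1) sf).
  by move=> y _; exact: is_deriveXn.
by apply: scontM; [exact: scont_cst|apply: scontX; exact: sgrad_scont sf].
Qed.

Lemma sgrad_sum (I : Type) (r : seq I) (f : I -> 'rV[R]_n -> R) (F : I -> 'rV[R]_n -> 'rV[R]_n) :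
  (forall i, sgrad (f i) (F i)) -> sgrad (fun y => \sum_(i <- r) f i y) (fun y => \sum_(i <- r) F i y).
Proof.
move=> sf; elim: r => [|i r IH].
  rewrite (_ : (fun y => _) = (fun=> 0)); last by apply/funext => y; rewrite big_nil.
  rewrite [X in sgrad _ X](_ : _ = (fun=> 0)); [exact: sgrad_cst|by apply/funext => y; rewrite big_nil].
rewrite (_ : (fun y => _) = (fun y => f i y + \sum_(j <- r) f j y)); last by apply/funext => y; rewrite big_cons.
rewrite [X in sgrad _ X](_ : _ = (fun y => F i y + \sum_(j <- r) F j y)); first exact: sgradD.
by apply/funext => y; rewrite big_cons.
Qed.

Hypothesis n1 : (1 < n)%N.

Lemma sgrad_coord i : exists F, sgrad (fun y => y 0 i) F.
Proof.
have := sgrad_scale (@ltr01 R) (pf_C1 (pf_coord i)).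
by rewrite (_ : (fun y => _) = (fun y => y 0 i)); [eexists; eassumption|apply/funext => y; rewrite scale1r].
Qed.

End sgrad_algebra.

(** * Geometry of the perturbed balls *)

Section starball_geometry.
Context {R : realType} {n : nat}.
Implicit Types (f h : 'rV[R]_n -> R) (x y : 'rV[R]_n).
Hypothesis n1 : (1 < n)%N.
Let n0 : (0 < n)%N := ltnW n1.

(* The perturbations [h] considered below: small in C^1, with vanishing mean and first moments. *)
Record admissible (d : R) h : Prop := Admissible {
  adm_C2 : sphere_C2 h;
  adm_le : forall y, unit_sphere y -> `|h y| <= d;
  adm_grad : forall y, unit_sphere y -> enorm (tgrad h y) <= d;
  adm_mean : sA h = 0;
  adm_moment : forall i, sA (fun y => h y * y 0 i) = 0 }.

Variables (d : R) (h : 'rV[R]_n -> R).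
Hypotheses (d4 : 0 < d <= 4^-1) (ah : admissible d h).

Let r1 y := 1 + h y.

Lemma adm_sgrad : sgrad h (tgrad h). Proof. exact: sphere_C1_sgrad (adm_C2 ah).1. Qed.
Lemma adm_scont : scont h. Proof. exact: sgrad_scont adm_sgrad. Qed.
Lemma adm_scont1 : scont r1. Proof. by apply: scontD; [exact: scont_cst|exact: adm_scont]. Qed.

Lemma adm_radius y : unit_sphere y -> 3 / 4 <= 1 + h y <= 5 / 4.
Proof.
move=> y1; have := adm_le ah y1; rewrite ler_norml => /andP[a b]; case/andP: d4 => c e.
by apply/andP; split; lra.
Qed.

Lemma starballE x : starball h x <-> x = 0 \/ (x != 0 /\ enorm x < 1 + h (nx x)).
Proof.
split.
  move=> [t [y [/andP[t0 t1] y1 ->]]]; have /andP[r0 _] := adm_radius y1.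
  have rp : 0 < 1 + h y by lra.
  have [->|tn] := eqVneq t 0; first by left; rewrite mul0r scale0r.
  have tp : 0 < t by rewrite lt_neqAle eq_sym tn.
  right; rewrite nxZ ?mulr_gt0// nx_id// enorm_ray ?mulr_gt0//.
  rewrite gtr_pMl//; split => //.
  by rewrite -enorm_gt0 enorm_ray ?mulr_gt0.
move=> [->|[x0 xr]].
  exists 0, (delta_mx 0 (Ordinal n0)); split; [by rewrite lexx ltr01|exact: enorm_delta|by rewrite mul0r scale0r].
have y1 : unit_sphere (nx x) by exact: enorm_nx.
have /andP[r0 _] := adm_radius y1; have rp : 0 < 1 + h (nx x) by lra.
exists (enorm x / (1 + h (nx x))), (nx x); split => //.
  by rewrite divr_ge0 ?enorm_ge0 ?(ltW rp)//= ltr_pdivrMr// mul1r.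
by rewrite mulfVK ?gt_eqF// enorm_nxE.
Qed.

Lemma starball_region : starball h = [set 0] `|` region (fun=> 0) r1.
Proof.
apply/seteqP; split=> x.
  move=> /starballE[->|[x0 xr]]; [by left|right; split => //].
  by rewrite /hextend enorm_gt0.
by move=> [->|[x0 _ xr]]; apply/starballE; [left|right].
Qed.

Lemma open_starball : open (starball h).
Proof.
rewrite openE => x /starballE[->|[x0 xr]].
  apply/nbhs_ballP; exists (n%:R^-1 / 4) => /=; first by rewrite divr_gt0// invr_gt0 ltr0n.
  move=> z; rewrite -ball_normE/= sub0r normrN => zn; apply/starballE.
  have [->|z0] := eqVneq z 0; [by left|right; split => //].
  have /andP[r0 _] := adm_radius (enorm_nx z0 : unit_sphere (nx z)).
  apply: (le_lt_trans (enorm_le_norm z)); apply: (@lt_le_trans _ _ 4^-1); last by lra.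
  by rewrite -ltr_pdivlMl ?ltr0n.
have c1 : {for x, continuous (fun z => hextend r1 z - enorm z)}.
  exact: (continuous_sub (adm_scont1 x0) (@continuous_enorm _ _ x)).
have p : 0 < hextend r1 x - enorm x by rewrite subr_gt0.
have /cvgrPdist_lt/(_ _ p) := c1.
move: (near_neq0 x0); apply: filterS2 => z z0; rewrite ltr_norml => /andP[_ zr].
apply/starballE; right; split => //; rewrite -subr_gt0; change (0 < hextend r1 z - enorm z); lra.
Qed.

Lemma starball_bounded x : starball h x -> enorm x <= 2.
Proof.
move=> /starballE[->|[x0 xr]]; first by rewrite enorm0.
by have := adm_radius (enorm_nx x0 : unit_sphere (nx x)); lra.
Qed.

Lemma starball_boundary x : closure (starball h) x -> ~ starball h x -> x != 0 /\ enorm x = 1 + h (nx x).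
Proof.
move=> cx nx0; have x0 : x != 0 by apply/eqP => e; apply: nx0; apply/starballE; left.
split => //; apply/eqP; rewrite eq_le; apply/andP; split; last first.
  by rewrite leNgt; apply/negP => xr; apply: nx0; apply/starballE; right.
rewrite leNgt; apply/negP => xr.
have c1 : {for x, continuous (fun z => enorm z - hextend r1 z)}.
  exact: (continuous_sub (@continuous_enorm _ _ x) (adm_scont1 x0)).
have p : 0 < enorm x - hextend r1 x by rewrite subr_gt0.
have /cvgrPdist_lt/(_ _ p) := c1 => near1.
have [z [/starballE zS [z0]]] := cx _ (filterI (near_neq0 x0) near1).
rewrite /= ltr_norml => /andP[_ zr]; case: zS => [ze|[_ zr2]]; first by rewrite ze eqxx in z0.
by move: zr; rewrite /hextend -/(nx z) /r1; lra.
Qed.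

Lemma Rintegral_starball f : leb.-integrable (starball h) (EFin \o f) ->
  \int[leb]_(x in starball h) f x = \int[leb]_(x in region (fun=> 0) r1) f x.
Proof.
rewrite starball_region => i.
have m0 := @measurable_zero R n.
have mr := measurable_region (@scont_cst R n 0) adm_scont1.
rewrite Rintegral_setU//; last first.
  by apply/disj_set2P; rewrite -subset0 => x [-> [/eqP]].
rewrite [X in X + _](_ : _ = 0) ?add0r// /Rintegral.
have im0 := integrableS (measurableU _ _ m0 mr) m0 (@subsetUl _ _ _) i.
by rewrite (null_set_integral m0 (measurable_int leb im0) (lebesgue_set0 n0)).
Qed.

Lemma measurable_sphere (rho : R) : measurable [set x : 'rV[R]_n | enorm x = rho].
Proof.
rewrite (_ : [set x | _] = (@enorm R n) @^-1` [set rho])//.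
by rewrite -[X in measurable X]setTI; apply: (@measurable_enorm R n).
Qed.

Lemma lebesgue_sphere (rho : R) : 0 < rho -> leb [set x : 'rV[R]_n | enorm x = rho] = 0%E.
Proof.
move=> r0; set S := [set x | _]; have mS := measurable_sphere rho.
have -> : leb S = (\int[leb]_(x in [set x | x != 0%R]) (\1_S x)%:E)%E.
  rewrite integral_indic ?setIidl//; first by move=> x /= xr; rewrite -enorm_gt0 xr.
  exact: measurable_neq0.
rewrite (@ge0_polar _ _ n0)//; apply: integral0_eq => x [x0 _].
apply: etrans (integral_set1 (fun s => (n%:R * s ^+ n.-1 * \1_S (s *: nx x))%:E) rho).
rewrite [LHS]integral_mkcond [RHS]integral_mkcond; apply: eq_integral => s _.
rewrite !patchE mem_setE in_itv/= andbT; have [->|sr] := eqVneq s rho; first by rewrite r0 mem_set.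
rewrite [s \in [set rho]]memNset; last exact/eqP.
case: ifP => // s0; rewrite indicE memNset ?mulr0//.
by rewrite /S/= enorm_ray//; [exact/eqP|exact: enorm_nx].
Qed.

(** Separates an inner ball, where the divergence theorem and Steklov's inequality are available,
    from a shell that is treated along rays. *)
Lemma Rintegral_starball_split f (rho : R) : 0 < rho -> (forall y, unit_sphere y -> rho < 1 + h y) ->
  leb.-integrable (starball h) (EFin \o f) ->
  \int[leb]_(x in starball h) f x = \int[leb]_(x in eball rho) f x +
    \int[leb]_(x in region (fun=> rho) r1) f x.
Proof.
move=> rho0 rho1 i.
have mS := measurable_sphere rho.
have mB := @measurable_eball R n rho.
have mr := measurable_region (@scont_cst R n rho) adm_scont1.
have E : starball h = (eball rho `|` region (fun=> rho) r1) `|` [set x | enorm x = rho].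
  apply/seteqP; split=> x.
    move=> /starballE[->|[x0 xr]]; first by left; left; rewrite /eball/= enorm0.
    by have [xl|xg|xe] := ltgtP (enorm x) rho; [left; left|left; right; split|right].
  move=> [[xl|[x0 _ xr]]|/= xe]; apply/starballE.
  - have [->|x0] := eqVneq x 0; [by left|right; split => //].
    have := rho1 _ (enorm_nx x0); rewrite /eball/= in xl; lra.
  - by right.
  - have x0 : x != 0 by rewrite -enorm_gt0 xe.
    by right; split => //; have := rho1 _ (enorm_nx x0); lra.
rewrite E in i *; have mU := measurableU _ _ mB mr.
have iS := integrableS (measurableU _ _ mU mS) mS (@subsetUr _ _ _) i.
have iU := integrableS (measurableU _ _ mU mS) mU (@subsetUl _ _ _) i.
rewrite Rintegral_setU//; last first.
  apply/disj_set2P; rewrite -subset0 => x [[xl|[x0 xr _]] /= xe].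
    by rewrite /eball/= xe ltxx in xl.
  by rewrite /hextend xe ltxx in xr.
rewrite [X in _ + X](_ : _ = 0) ?addr0; last first.
  by rewrite /Rintegral (null_set_integral mS (measurable_int leb iS) (lebesgue_sphere rho0)).
rewrite Rintegral_setU//.
apply/disj_set2P; rewrite -subset0 => x [/= xl [x0 xr _]].
by rewrite /eball/= in xl; rewrite /hextend in xr; lra.
Qed.

Lemma integrable_starball f : continuous f -> leb.-integrable (starball h) (EFin \o f).
Proof. exact: (integrable_continuous open_starball starball_bounded). Qed.

Lemma Rintegral_starball_primitive f (K : 'rV[R]_n -> R -> R) : continuous f ->
  (forall y (r : R), unit_sphere y -> 0 <= r -> is_derive r 1 (K y) (r ^+ n.-1 * f (r *: y))) ->
  (forall y, K y 0 = 0) -> scont (fun y => K y (1 + h y)) ->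
  \int[leb]_(x in starball h) f x = n%:R * sA (fun y => K y (1 + h y)).
Proof.
move=> cf dK K0 sK; rewrite (Rintegral_starball (integrable_starball cf)).
have [M _ HM] := ball_bounded 2 cf.
have E : (fun y => K y (1 + h y)) = (fun y => K y (1 + h y) - K y 0).
  by apply/funext => y; rewrite K0 subr0.
rewrite E in sK *; apply: (@polar_primitive _ _ n0 (fun=> 0) (fun y => 1 + h y) f K M) => //.
- exact: scont_cst.
- exact: adm_scont1.
- by move=> y y1; have := adm_radius y1; lra.
- exact: measurable_continuous.
- by move=> x [x0 _ xr]; apply: HM; apply: starball_bounded; apply/starballE; right.
move=> y r y1 /andP[r0 _]; split; first exact: dK.
have cs : {for r, continuous (fun s : R => s *: y)} by exact: scalel_continuous.
exact: (continuous_mul (@exprn_continuous _ n.-1 r) (continuous_comp cs (cf (r *: y)))).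
Qed.

End starball_geometry.

(** * Lower bound for the perimeter *)

Section perimeter.
Context {R : realType} {n : nat}.
Implicit Types (f h : 'rV[R]_n -> R) (x y : 'rV[R]_n).
Hypothesis n1 : (1 < n)%N.
Let n0 : (0 < n)%N := ltnW n1.
Local Notation V := (sA (fun _ : 'rV[R]_n => 1)).

Lemma perimeter_ball_le : (perimeter (@unit_ball R n) <= (n%:R * V)%:E)%E.
Proof.
apply: ge_ereal_sup => _ [X [cX X1] <-]; rewrite lee_fin.
have := ball_divergence n1 (@ltr01 R) (fun i => (cX i).1); rewrite expr1n mulr1 => ->.
rewrite ler_wpM2l//; apply: le_sA; [|exact: scont_cst|].
  apply: scont_dot => i; last exact: scont_coord.
  rewrite (_ : (fun x => X (1 *: x) 0 i) = (fun x => X x 0 i)); first exact: scont_C1 (cX i).1.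
  by apply/funext => x; rewrite scale1r.
move=> y y1; apply: (le_trans (dot_le _ _)); rewrite (y1 : enorm y = 1) mulr1; exact: X1.
Qed.

Lemma ramp_bounds (t : R) : 0 <= ramp t <= 1.
Proof.
have [t0|t0] := leP t 0; first by rewrite (ramp_le0 t0).1 lexx ler01.
have [t1|t1] := leP 1 t; first by rewrite (ramp_ge1 t1) lexx ler01.
rewrite /ramp /pos2 (max_r (ltW t0)) (@max_l _ _ 0 (t - 1)); last by lra.
have [th|th] := leP t 2^-1; [rewrite (@max_l _ _ 0 (t - 2^-1))|rewrite (@max_r _ _ 0 (t - 2^-1))]; try lra.
  by apply/andP; split; nra.
by apply/andP; split; nra.
Qed.

Lemma C1_scale f (c : R) : 0 < c -> C1 f -> C1 (fun x => f (c *: x)).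
Proof.
move=> c0 cf i.
have D x : is_derive x (delta_mx 0 i) (fun z => f (c *: z)) (c * partial i f (c *: x)).
  apply: derivable_scale => //; have := isgrad_derive (delta_mx 0 i) (C1_isgrad (c *: x) cf).
  by rewrite dot_delta mxE.
split=> [x|]; first by have [] := D x.
rewrite (_ : partial i _ = (fun x => c * partial i f (c *: x))); last by apply/funext => x; have [_] := D x.
move=> x; have cs : {for x, continuous (fun z : 'rV[R]_n => c *: z)} by exact: scaler_continuous.
exact: (continuous_mul (@cst_continuous _ _ (c : R) x) (continuous_comp cs ((cf i).2 (c *: x)))).
Qed.

(** Equal to 1 around all the boundaries considered, with radii between 3/4 and 5/4. It vanishes
    near the origin, where [nx] is singular, and far away, which gives compact support. *)
Definition annulus_cutoff x : R := (1 - cutoff 1 (4 *: x)) * cutoff 2 x.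

Lemma C1_annulus_cutoff : C1 annulus_cutoff.
Proof.
apply: C1M; last exact: C1_cutoff.
by apply: C1B; [exact/pf_C1/pf_cst|apply: (@C1_scale (cutoff 1) 4); [|exact: C1_cutoff]].
Qed.

Lemma annulus_cutoff_bounds x : 0 <= annulus_cutoff x <= 1.
Proof.
rewrite /annulus_cutoff /cutoff.
have := ramp_bounds (dot (4 *: x) (4 *: x) - 1 ^+ 2); have := ramp_bounds (dot x x - 2 ^+ 2).
move: (ramp _) (ramp _) => a b /andP[a0 a1] /andP[b0 b1]; rewrite opprB addrC subrK.
by rewrite mulr_ge0 ?subr_ge0//= mulr_ile1 ?subr_ge0// gerBl.
Qed.

Lemma annulus_cutoff1 x : 8^-1 <= dot x x <= 4 -> annulus_cutoff x = 1.
Proof.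
move=> /andP[a b]; rewrite /annulus_cutoff /cutoff dotZl dotZr ramp_ge1; last by rewrite expr1n; lra.
by rewrite (ramp_le0 _).1 ?subrr ?subr0 ?mulr1//; lra.
Qed.

Lemma annulus_cutoff0 x : dot x x <= 16^-1 \/ 5 <= dot x x -> annulus_cutoff x = 0.
Proof.
rewrite /annulus_cutoff /cutoff => -[a|a].
  by rewrite dotZl dotZr (ramp_le0 _).1 ?subr0 ?subrr ?mul0r// expr1n; lra.
by rewrite (@ramp_ge1 _ (dot x x - _)) ?subrr ?mulr0//; lra.
Qed.

Lemma dot_enorm_le x (c : R) : 0 <= c -> (dot x x <= c ^+ 2) = (enorm x <= c).
Proof. by move=> c0; rewrite -enorm_sqr ler_pXn2r// nnegrE ?enorm_ge0. Qed.

Lemma open_enorm_gt (c : R) : open [set x : 'rV[R]_n | c < enorm x].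
Proof.
apply: (open_comp (f := @enorm R n) (D := [set t | c < t])) => // x _; exact: continuous_enorm.
Qed.

Lemma open_eball (c : R) : open (eball c : set 'rV[R]_n).
Proof.
apply: (open_comp (f := @enorm R n) (D := [set t | t < c])) => // x _; exact: continuous_enorm.
Qed.

Section lower_bound.
Variables (d : R) (h : 'rV[R]_n -> R).
Hypotheses (d4 : 0 < d <= 4^-1) (ah : admissible d h).
Variables (N : 'rV[R]_n -> 'rV[R]_n) (G : 'I_n -> 'rV[R]_n -> 'rV[R]_n).
Hypotheses (sN : forall i, sgrad (fun y => N y 0 i) (G i)) (N1 : forall y, unit_sphere y -> enorm (N y) <= 1).

Let X x : 'rV[R]_n := annulus_cutoff x *: N (nx x).

Let gX i x : x != 0 -> isgrad (fun x => X x 0 i) x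
  (annulus_cutoff x *: ((enorm x)^-1 *: G i (nx x)) + N (nx x) 0 i *: grad annulus_cutoff x).
Proof.
move=> x0; have := isgradM (C1_isgrad x C1_annulus_cutoff) ((sN i).1 x x0).
rewrite (_ : (fun z => X z 0 i) = (fun z => annulus_cutoff z * hextend (fun y => N y 0 i) z))//.
by apply/funext => z; rewrite /X mxE.
Qed.

Let cX i : C1 (fun x => X x 0 i).
Proof.
have near0 : \forall z \near (0 : 'rV[R]_n), annulus_cutoff z = 0.
  have o : eball 4^-1 (0 : 'rV[R]_n) by rewrite /eball/= enorm0 invr_gt0.
  apply: filterS (open_nbhs_nbhs (conj (@open_eball 4^-1) o)) => z zl.
  apply: annulus_cutoff0; left; rewrite (_ : 16^-1 = 4^-1 ^+ 2); last by field.
  by rewrite dot_enorm_le ?invr_ge0//; exact: ltW.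
pose g x := if x == 0 then 0 else (annulus_cutoff x *: ((enorm x)^-1 *: G i (nx x)) + N (nx x) 0 i *: grad annulus_cutoff x).
apply: (@C1_of_isgrad _ _ _ g) => [x|j x].
  rewrite /g; case: eqP => [->|/eqP x0]; last exact: gX.
  apply: (isgrad_near _ (isgrad_cst 0 0)); apply: filterS near0 => z z0.
  by rewrite /X z0 scale0r mxE.
have [->|x0] := eqVneq x 0.
  apply: (@near_continuous _ _ (fun=> 0)); last exact: cst_continuous.
  near=> z; rewrite /g; case: eqP => [_|_]; first by rewrite mxE.
  have z0 : \forall w \near z, annulus_cutoff w = 0 by near: z; exact: (near_join near0).
  rewrite (nbhs_singleton z0) scale0r add0r.
  have -> : grad annulus_cutoff z = 0.
    by apply: isgrad_grad; apply: (isgrad_near _ (isgrad_cst 0 z)); apply: filterS z0 => w ->.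
  by rewrite scaler0 mxE.
apply: (@near_continuous _ _ (fun z => annulus_cutoff z * ((enorm z)^-1 * hextend (fun y => G i y 0 j) z) + hextend (fun y => N y 0 i) z * partial j annulus_cutoff z)).
  by apply: filterS (near_neq0 x0) => z /negbTE z0; rewrite /g z0 !mxE.
have ce : {for x, continuous (fun z : 'rV[R]_n => (enorm z)^-1)}.
  have e0 : enorm x != 0 by rewrite enorm_eq0.
  exact: (cvgV e0 (@continuous_enorm _ _ x)).
have c1 : {for x, continuous annulus_cutoff} by exact: (C1_continuous C1_annulus_cutoff).
have c2 := (sN i).2 j x x0.
have c3 := sgrad_scont (sN i) x0.
exact: (continuous_add (continuous_mul c1 (continuous_mul ce c2)) (continuous_mul c3 ((C1_annulus_cutoff j).2 x))).
Unshelve. all: by end_near. Qed.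

Let X_field : [set X : 'rV[R]_n -> 'rV[R]_n | (forall i, C1 (fun y => X y 0 i) /\
   compact_support setT (fun y => X y 0 i)) /\ (forall x, enorm (X x) <= 1)] X.
Proof.
split=> [i|x].
  split; first exact: cX.
  split; last by [].
  apply: (subclosed_compact _ (@compact_closed_enorm_ball R n 3)); first exact: closed_closure.
  move=> x; apply: closure_enorm_le.
  move=> z /=; apply: contraNT; rewrite -ltNge => z3.
  rewrite /X mxE annulus_cutoff0 ?mul0r//; right; rewrite -enorm_sqr.
  by have := ltW z3; rewrite -(ler_pXn2r (n := 2))// ?nnegrE ?enorm_ge0//; lra.
have /andP[a0 a1] := annulus_cutoff_bounds x.
rewrite /X enormZ ger0_norm//; have [->|x0] := eqVneq x 0.
  by rewrite annulus_cutoff0 ?mul0r//; left; rewrite dot0l invr_ge0.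
by rewrite mulr_ile1 ?enorm_ge0// N1//; exact: enorm_nx.
Qed.

Let D y := \sum_i G i y 0 i.

Let divX y (r : R) : unit_sphere y -> 2^-1 <= r <= 5 / 4 -> divergence X (r *: y) = D y / r.
Proof.
move=> y1 /andP[ra rb]; have rp : 0 < r by lra.
have e : enorm (r *: y) = r by exact: enorm_ray.
have x0 : r *: y != 0 by rewrite -enorm_gt0 e.
rewrite /divergence /D mulr_suml; apply: eq_bigr => i _.
rewrite (isgrad_partial i (gX i x0)) e nxZ// nx_id//.
have a1 : annulus_cutoff (r *: y) = 1.
  by apply: annulus_cutoff1; rewrite -enorm_sqr e; apply/andP; split; nra.
have -> : grad annulus_cutoff (r *: y) = 0.
  apply: isgrad_grad; apply: (isgrad_near _ (isgrad_cst 1 _)).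
  have o1 : [set x | 2 / 5 < enorm x] (r *: y) by rewrite /= e; lra.
  have o2 : eball (3 / 2) (r *: y) by rewrite /eball/= e; lra.
  near=> z.
  have z1 : 2 / 5 < enorm z by near: z; exact: (open_nbhs_nbhs (conj (@open_enorm_gt (2 / 5)) o1)).
  have z2 : enorm z < 3 / 2 by near: z; exact: (open_nbhs_nbhs (conj (@open_eball (3 / 2)) o2)).
  rewrite annulus_cutoff1// -enorm_sqr.
  by move: (enorm z) z1 z2 => t z1 z2; apply/andP; split; nra.
by rewrite a1 scaler0 addr0 scale1r !mxE mulrC.
Unshelve. all: by end_near. Qed.

(** The left side is the flux through the boundary of the 0-homogeneous extension of [N], written
    over the unit sphere. It is obtained from the divergence theorem on the ball of radius 1/2 and
    from exact radial integration in the shell, where the divergence is the tangential one divided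
    by [r]. *)
Lemma perimeter_ge : ((n%:R * sA (fun y => (1 + h y) ^+ n.-2 * ((1 + h y) * dot (N y) y - dot (tgrad h y) (N y))))%:E
  <= perimeter (starball h))%E.
Proof.
have cdiv : continuous (divergence X) by move=> x; apply: continuous_sum => i; exact: (cX i i).2.
have E : \int[leb]_(x in starball h) divergence X x =
   n%:R * sA (fun y => (1 + h y) ^+ n.-2 * ((1 + h y) * dot (N y) y - dot (tgrad h y) (N y))).
  have i := integrable_starball n1 d4 ah cdiv; have half : 0 < (2^-1 : R) by rewrite invr_gt0.
  have lthalf y : unit_sphere y -> 2^-1 < 1 + h y by move=> y1; have := adm_radius d4 ah y1; lra.
  rewrite (Rintegral_starball_split n1 d4 ah half lthalf i).
  have -> := ball_divergence n1 half cX.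
  have n12 : n = n.-2.+2 by case: (n) n1 => [|[]].
  pose K y (r : R) := D y / n.-1%:R * r ^+ n.-1.
  have nn : n.-1%:R != 0 :> R by rewrite pnatr_eq0 -lt0n -subn1 subn_gt0.
  have sD : scont D by apply: scont_sum => j; exact: (sN j).2.
  have s1 := adm_scont1 ah.
  have [M _ HM] := ball_bounded 2 cdiv.
  have sK : scont (fun y => K y (1 + h y) - K y 2^-1).
    by rewrite /K; scont.
  rewrite (@polar_primitive _ _ n0 (fun=> 2^-1) (fun y => 1 + h y) (divergence X) K M) //; last 5 first.
  - exact: scont_cst.
  - by move=> y y1; have := adm_radius d4 ah y1; lra.
  - exact: measurable_continuous.
  - by move=> x [x0 _ xr]; apply: HM; apply: (starball_bounded n1 d4 ah); apply/(starballE n1 d4 ah); right.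
  - move=> y r y1 /andP[ra rb]; have rr : 2^-1 <= r <= 5 / 4 by have := adm_radius d4 ah y1; lra.
    split; last first.
      have cs : {for r, continuous (fun s : R => s *: y)} by exact: scalel_continuous.
      have cp : {for r, continuous (fun s : R => s ^+ n.-1)} by exact: exprn_continuous.
      exact: (continuous_mul cp (continuous_comp cs (cdiv (r *: y)))).
    rewrite divX//; apply: (is_derive_eq (is_deriveZ (D y / n.-1%:R) (is_deriveXn r n.-1))).
    rewrite /GRing.scale/=; have rn : r != 0 by rewrite gt_eqF//; lra.
    have -> : r ^+ n.-1 = r * r ^+ n.-2 by rewrite -exprS; congr (_ ^+ _); rewrite n12.
    by field; rewrite rn nn.
  rewrite -mulrA -mulrDr; congr (_ * _).
  have sdN : scont (fun y => dot (N y) y) by apply: scont_dot => j; [exact: sgrad_scont (sN j)|exact: scont_coord].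
  have s2N : sA (fun y => dot (X (2^-1 *: y)) y) = sA (fun y => dot (N y) y).
    apply: eq_sA => y y1; rewrite /X nxZ// nx_id// annulus_cutoff1 ?scale1r//.
    by rewrite -enorm_sqr enorm_ray//; apply/andP; split; lra.
  have sg1 : sgrad (fun y => 1 + h y) (fun y => 0 + tgrad h y) := sgradD (sgrad_cst 1) (adm_sgrad ah).
  have sP i' : sgrad (fun y => ((1 + h y) ^+ n.-1 *: N y) 0 i') (fun y => (1 + h y) ^+ n.-1 *: G i' y +
      N y 0 i' *: ((n.-1%:R * (1 + h y) ^+ n.-1.-1) *: (0 + tgrad h y))).
    rewrite (_ : (fun y => _) = (fun y => (1 + h y) ^+ n.-1 * N y 0 i')); last by apply/funext => y; rewrite mxE.
    exact: sgradM (sgradX n.-1 sg1) (sN i').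
  (* Integration by parts on the sphere for [(1 + h)^(n-1) N] trades the tangential divergence of
     [N] for the gradient of [h]. *)
  have div2 := sphere_divergence n1 sP.
  have spow k : scont (fun y => (1 + h y) ^+ k) by exact: scontX.
  have stN : scont (fun y => dot (tgrad h y) (N y)).
    by apply: scont_dot => j; [exact: (adm_sgrad ah).2|exact: sgrad_scont (sN j)].
  have E2 : sA (fun y => (1 + h y) ^+ n.-1 * D y) + n.-1%:R * sA (fun y => (1 + h y) ^+ n.-2 * dot (tgrad h y) (N y)) =
      n.-1%:R * sA (fun y => (1 + h y) ^+ n.-1 * dot (N y) y).
    rewrite -(sAZ n.-1%:R) -?sAD; try by scont.
    rewrite -(_ : sA (fun y => dot ((1 + h y) ^+ n.-1 *: N y) y) = sA (fun y => (1 + h y) ^+ n.-1 * dot (N y) y)); last first.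
      by apply: eq_sA => y _; rewrite dotZl.
    rewrite -div2; apply: eq_sA => y _; rewrite /D mulr_sumr /dot !mulr_sumr -big_split; apply: eq_bigr => j _ /=.
    by rewrite !mxE add0r; ring.
  have E1 : sA (fun y => K y (1 + h y) - K y 2^-1) = n.-1%:R^-1 * sA (fun y => (1 + h y) ^+ n.-1 * D y) - n.-1%:R^-1 * (2^-1 ^+ n.-1) * sA D.
    rewrite -!sAZ -?sAB; try by scont.
    by apply: eq_sA => y _; rewrite /K; ring.
  have E3 : sA (fun y => (1 + h y) ^+ n.-2 * ((1 + h y) * dot (N y) y - dot (tgrad h y) (N y))) =
     sA (fun y => (1 + h y) ^+ n.-1 * dot (N y) y) - sA (fun y => (1 + h y) ^+ n.-2 * dot (tgrad h y) (N y)).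
    rewrite -sAB; try by scont.
    apply: eq_sA => y _; have -> : (1 + h y) ^+ n.-1 = (1 + h y) * (1 + h y) ^+ n.-2.
      by rewrite -exprS; congr (_ ^+ _); rewrite n12.
    ring.
  have Dd : sA D = n.-1%:R * sA (fun y => dot (N y) y) := sphere_divergence n1 sN.
  rewrite E1 E3 s2N Dd (_ : sA (fun y => (1 + h y) ^+ n.-1 * D y) = n.-1%:R * sA (fun y => (1 + h y) ^+ n.-1 * dot (N y) y) -
    n.-1%:R * sA (fun y => (1 + h y) ^+ n.-2 * dot (tgrad h y) (N y))); last by rewrite -E2 addrK.
  by field.
by rewrite -E; apply: ereal_sup_ubound; exists X.
Qed.

End lower_bound.

End perimeter.

Lemma binomial_linear (R : realType) k : exists2 C : R, 0 <= C & forall t : R, `|t| <= 4^-1 ->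
  `|(1 + t) ^+ k - 1| <= C * `|t|.
Proof.
elim: k => [|k [C C0 IH]]; first by exists 0 => // t _; rewrite expr0 subrr normr0 mul0r.
exists (2 * C + 1) => [|t t4]; first by rewrite addr_ge0// mulr_ge0.
rewrite exprS (_ : _ - 1 = (1 + t) * ((1 + t) ^+ k - 1) + t); last by ring.
apply: (le_trans (ler_normD _ _)); rewrite normrM mulrDl mul1r lerD2r -mulrA ler_pM// ?IH//.
by apply: (le_trans (ler_normD _ _)); rewrite normr1; lra.
Qed.

Lemma binomial_quadratic (R : realType) k : exists2 C : R, 0 <= C & forall t : R, `|t| <= 4^-1 ->
  `|(1 + t) ^+ k - (1 + k%:R * t + k%:R * (k%:R - 1) / 2 * t ^+ 2)| <= C * (`|t| * t ^+ 2).
Proof.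
elim: k => [|k [C C0 IH]].
  by exists 0 => // t _; rewrite expr0 mulr0n !mul0r !addr0 subrr normr0.
pose q : R := k%:R * (k%:R - 1) / 2.
exists (2 * C + `|q|) => [|t t4]; first by rewrite addr_ge0// mulr_ge0.
rewrite exprS -natr1 (_ : _ - _ = (1 + t) * ((1 + t) ^+ k - (1 + k%:R * t + q * t ^+ 2)) + q * (t * t ^+ 2)); last first.
  by rewrite /q; field.
apply: (le_trans (ler_normD _ _)); rewrite (mulrDl (2 * C)); apply: lerD.
  rewrite normrM -mulrA ler_pM// ?IH//.
  by apply: (le_trans (ler_normD _ _)); rewrite normr1; lra.
by rewrite (normrM q) (normrM t) (ger0_norm (sqr_ge0 t)).
Qed.

(** * Second-order expansion of the perimeter *)

Section perimeter_quadratic.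
Context {R : realType} {n : nat}.
Implicit Types (f h : 'rV[R]_n -> R) (x y : 'rV[R]_n).
Hypothesis n1 : (1 < n)%N.
Local Notation V := (sA (fun _ : 'rV[R]_n => 1)).

Definition L2mass h := sA (fun y => h y ^+ 2).
Definition gradmass h := sA (fun y => dot (tgrad h y) (tgrad h y)).

Lemma scont_grad2 d h : admissible d h -> scont (fun y => dot (tgrad h y) (tgrad h y)).
Proof. by move=> ah; apply: scont_dot; exact: (adm_sgrad ah).2. Qed.

(** An error in the direction of the normal changes the flux only by its square, so a field that
    agrees with the normal to first order, with length at most 1, yields the expansion of the area
    up to third order. *)
Lemma perimeter_quadratic : exists2 C : R, 0 <= C & forall d h, 0 < d <= 4^-1 -> admissible d h ->
  ((n%:R * (V + n.-1%:R * n.-2%:R / 2 * L2mass h + gradmass h / 2 - C * d * (L2mass h + gradmass h)))%:E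
   <= perimeter (starball h))%E.
Proof.
have [C1 C10 B1] := @binomial_linear R n.-2.
have [C3 C30 B3] := @binomial_quadratic R n.-1.
have n12 : n.-1 = n.-2.+1 by case: (n) n1 => [|[]].
exists (C3 + 2 * C1 + 2) => [|d h d4 ah]; first by rewrite !addr_ge0// mulr_ge0.
pose g2 y := dot (tgrad h y) (tgrad h y).
have sg2 : scont g2 := scont_grad2 ah.
(* A polynomial substitute for normalising [y - grad h], whose squared length is [1 + g] with
   [g = |grad h|^2]. The length stays at most 1 since [(1 - g/2)^2 (1 + g) = 1 - g^2 (3 - g) / 4].
   It is C^1 because [h] is C^2. *)
pose N y : 'rV[R]_n := (1 - g2 y / 2) *: (y - tgrad h y).
have tg i : exists F, sgrad (fun y => (tgrad h y) 0 i) F.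
  eexists; rewrite (_ : (fun y => _) = tpartial i h); last by apply/funext => y; rewrite mxE.
  exact: sphere_C1_sgrad ((adm_C2 ah).2 i).
have [TF HTF] := choice tg.
have g2E : exists F, sgrad g2 F.
  by eexists; apply: sgrad_sum => i; exact: sgradM (HTF i) (HTF i).
have [G2 HG2] := g2E.
have sN i : exists F, sgrad (fun y => N y 0 i) F.
  have [F HF] := @sgrad_coord R n i.
  eexists; rewrite (_ : (fun y => _) = (fun y => (1 - 2^-1 * g2 y) * (y 0 i - tgrad h y 0 i))); last first.
    by apply/funext => y; rewrite !mxE mulrC [g2 y / 2]mulrC mulrC.
  by apply: sgradM (sgradB (sgrad_cst 1) (sgradM (sgrad_cst 2^-1) HG2)) (sgradB HF (HTF i)).
have [GN HGN] := choice sN.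
have g2d y : unit_sphere y -> 0 <= g2 y <= d ^+ 2.
  move=> y1; rewrite dotxx_ge0 /= /g2 -enorm_sqr lerXn2r ?nnegrE ?enorm_ge0//.
    by case/andP: d4 => /ltW.
  exact: (adm_grad ah).
case/andP: (d4) => d0 d4'.
have yt y : unit_sphere y -> dot (tgrad h y) y = 0 by exact: sgrad_tangent (adm_sgrad ah).
have yy y : unit_sphere y -> dot y y = 1 by move=> y1; rewrite -enorm_sqr (y1 : enorm y = 1) expr1n.
have N1 y : unit_sphere y -> enorm (N y) <= 1.
  move=> y1; rewrite -dot_enorm_le// expr1n /N dotZl dotZr !dotBl !dotBr (dotC y (tgrad h y)) yt// yy// -/(g2 y).
  have /andP[] := g2d y y1; move: (g2 y) => g a b.
  have gd : g <= 1 by apply: (le_trans b); nra.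
  have -> : (1 - g / 2) * ((1 - g / 2) * (1 - 0 - (0 - g))) = 1 - g ^+ 2 * (3 - g) / 4 by field.
  by have : 0 <= g ^+ 2 * (3 - g) / 4; [rewrite divr_ge0// mulr_ge0 ?sqr_ge0//; lra|lra].
apply: (le_trans _ (perimeter_ge n1 d4 ah HGN N1)); rewrite lee_fin ler_wpM2l//.
have sh := adm_scont ah; have c k : scont (fun _ : 'rV[R]_n => k : R) by exact: scont_cst.
have sh2 : scont (fun y => h y ^+ 2) by exact: scontX.
pose lhs y := 1 + n.-1%:R * h y + (n.-1%:R * n.-2%:R / 2 - (C3 + 2 * C1 + 2) * d) * h y ^+ 2 + (2^-1 - (C3 + 2 * C1 + 2) * d) * g2 y.
have -> : V + n.-1%:R * n.-2%:R / 2 * L2mass h + gradmass h / 2 - (C3 + 2 * C1 + 2) * d * (L2mass h + gradmass h) = sA lhs.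
  rewrite /lhs !sAD; try by scont.
  rewrite !sAZ// (adm_mean ah) /L2mass /gradmass -/g2; ring.
apply: le_sA.
- by rewrite /lhs; scont.
- by have sg := (adm_sgrad ah).2; have sG i := sgrad_scont (HGN i); scont.
move=> y y1; rewrite /lhs /N dotZl dotZr dotBl dotBr (dotC (tgrad h y) y) (dotC y (tgrad h y)) yt// yy// -/(g2 y).
have hd := adm_le ah y1.
have t4 : `|h y| <= 4^-1 by exact: le_trans hd d4'.
have := B1 _ t4; have := B3 _ t4; have /andP[] := g2d y y1.
have -> : (1 + h y) ^+ n.-1 = (1 + h y) * (1 + h y) ^+ n.-2 by rewrite -exprS -n12.
have -> : n.-1%:R - 1 = n.-2%:R :> R by rewrite n12 -natr1 addrK.
move: hd t4; rewrite -(real_normK (num_real (h y))) ; have := ler_norm (h y); have := ler_norm (- h y); rewrite normrN.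
move: (h y) `|h y| ((1 + h y) ^+ n.-2) (g2 y) (n.-1%:R * n.-2%:R / 2 : R) (n.-1%:R : R) => t u p g q k a1 a2 hd t4 g0 gd.
have u0 : 0 <= u by lra.
rewrite !ler_norml => /andP[b3 _] /andP[b1 b1'].
have -> : (1 + t) * ((1 - g / 2) * (1 - 0)) - (1 - g / 2) * (0 - g) = (1 + t) * (1 - g / 2) + (1 - g / 2) * g by ring.
clear -C10 C30 d0 d4' a1 a2 hd t4 g0 gd u0 b3 b1 b1'.
have dd : d ^+ 2 <= d by nra.
have ud : u * u ^+ 2 <= d * u ^+ 2 by rewrite ler_wpM2r ?sqr_ge0.
have e1 : C3 * (u * u ^+ 2) <= C3 * (d * u ^+ 2) by rewrite ler_wpM2l.
have cu : C1 * u <= C1 * d by rewrite ler_wpM2l.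
have e2 : (2^-1 - (C1 + 1) * d) <= p * (1 - t) / 2.
  have : `|p - 1| * `|1 - t| <= C1 * d * 2.
    by rewrite ler_pM// ler_norml; apply/andP; split; lra.
  rewrite -normrM ler_norml => /andP[z _].
  have -> : p * (1 - t) / 2 = 2^-1 + ((p - 1) * (1 - t) - t) / 2 by field.
  lra.
have e3 := ler_wpM2r g0 e2.
have p2 : p <= 1 + C1.
  have q0 : C1 * u <= C1 * 1 by rewrite ler_wpM2l//; lra.
  lra.
have p0 : p * g ^+ 2 / 2 <= (1 + C1) * (d * g).
  have q1 : p * g ^+ 2 <= (1 + C1) * g ^+ 2 by rewrite ler_wpM2r// sqr_ge0.
  have q2 : g ^+ 2 <= d * g by rewrite expr2 ler_wpM2r//; lra.
  have q3 : (1 + C1) * g ^+ 2 <= (1 + C1) * (d * g) by rewrite ler_wpM2l//; lra.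
  have q4 : 0 <= (1 + C1) * g ^+ 2 by rewrite mulr_ge0 ?sqr_ge0//; lra.
  lra.
have -> : p * ((1 + t) * (1 - g / 2) + (1 - g / 2) * g) = (1 + t) * p + p * (1 - t) / 2 * g - p * g ^+ 2 / 2 by field.
have w : 0 <= (C3 + 2 * C1 + 2) * (d * u ^+ 2) - C3 * (d * u ^+ 2).
  by rewrite -mulrBl mulr_ge0 ?mulr_ge0 ?sqr_ge0//; lra.
have w2 : 0 <= C3 * (d * g) by rewrite !mulr_ge0// ltW.
lra.
Qed.

End perimeter_quadratic.

(** * Second-order expansion of the torsion *)

Section torsion_quadratic.
Context {R : realType} {n : nat}.
Local Notation leb := (@lebesgue_rV R n).
Implicit Types (f h k : 'rV[R]_n -> R) (x y : 'rV[R]_n).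
Hypothesis n1 : (1 < n)%N.
Let n0 : (0 < n)%N := ltnW n1.
Let nR : 0 < n%:R :> R. Proof. by rewrite ltr0n. Qed.
Local Notation V := (sA (fun _ : 'rV[R]_n => 1)).
Let V0 : 0 < V := sA1_gt0 n1.
Let sc (a : R) : scont (fun _ : 'rV[R]_n => a). Proof. exact: scont_cst. Qed.

Lemma Rintegral_eball_scale f (rho : R) : 0 < rho -> continuous f -> (forall x, 0 <= f x) ->
  \int[leb]_(x in eball rho) f x = rho ^+ n * \int[leb]_(x in eball 1) f (rho *: x).
Proof.
move=> r0 cf f0; have mB s := @measurable_eball R n s.
have mf := measurable_continuous cf.
have cfr : continuous (fun x => f (rho *: x)).
  by move=> x; exact: (continuous_comp (@scaler_continuous _ _ rho x) (cf (rho *: x))).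
rewrite /Rintegral.
have -> : (\int[leb]_(x in eball rho) (f x)%:E = (rho ^+ n)%:E * \int[leb]_(x in eball 1) (f (rho *: x))%:E)%E.
  rewrite [LHS]integral_mkcond (ge0_integral_rV_affine (c := rho) 0); last 3 first.
  - by rewrite gt_eqF.
  - by apply: (proj1 (measurable_restrict _ (mB rho) measurableT)); apply: measurable_funTS; apply/measurable_EFinP.
  - by move=> x; rewrite patchE; case: ifP => // _; rewrite lee_fin.
  rewrite gtr0_norm//; congr (_ * _)%E; rewrite [RHS]integral_mkcond; apply: eq_integral => x _.
  rewrite !patchE addr0; congr (if _ then _ else _).
  by apply/idP/idP; rewrite !inE /eball/= enormZ (gtr0_norm r0) (gtr_pMr _ r0).
rewrite fineM//; apply: integrable_fin_num => //; exact: integrable_eball.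
Qed.

Definition steklov_form f := 2 * n%:R * sA (fun y => f y ^+ 2) - 2 * n%:R / V * sA f ^+ 2 -
  n%:R ^+ 2 / V * \sum_i sA (fun y => f y * y 0 i) ^+ 2.

Lemma steklov_eball f (rho : R) : 0 < rho -> C1 f ->
  rho ^+ n.-2 * steklov_form (fun y => f (rho *: y)) <= \int[leb]_(x in eball rho) dot (grad f x) (grad f x).
Proof.
move=> r0 cf; have cF := C1_scale r0 cf; have S := steklov n1 cF.
have gF x : grad (fun x => f (rho *: x)) x = rho *: grad f (rho *: x).
  apply/rowP => i; rewrite !mxE.
  have := isgrad_derive (delta_mx 0 i) (C1_isgrad (rho *: x) cf); rewrite dot_delta mxE => D.
  by have [_ <-] := derivable_scale r0 D.
rewrite (Rintegral_eball_scale r0 (continuous_dot_grad cf cf)); last by move=> x; exact: dotxx_ge0.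
have n12 : n = n.-2.+2 by case: (n) n1 => [|[]].
have -> : rho ^+ n = rho ^+ n.-2 * rho ^+ 2 by rewrite -exprD addn2 -n12.
rewrite -mulrA ler_wpM2l ?exprn_ge0 ?(ltW r0)//.
have E : \int[leb]_(x in eball 1) dot (grad (fun x => f (rho *: x)) x) (grad (fun x => f (rho *: x)) x) =
   rho ^+ 2 * \int[leb]_(x in eball 1) dot (grad f (rho *: x)) (grad f (rho *: x)).
  rewrite -RintegralZl; [|exact: measurable_eball|].
    by apply: eq_Rintegral => x _; rewrite gF dotZl dotZr mulrA.
  apply: integrable_eball => x; have cg := continuous_dot_grad cf cf.
  exact: (continuous_comp (@scaler_continuous _ _ rho x) (cg (rho *: x))).
by rewrite E in S; rewrite /steklov_form lerBlDr lerBlDr addrAC.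
Qed.

Section fixed_domain.
Variables (d : R) (h : 'rV[R]_n -> R).
Hypotheses (d4 : 0 < d <= 4^-1) (ah : admissible d h).
Local Notation r1 := (fun y => 1 + h y).
Local Notation c := ((2^-1 : R) ^+ n.-1).

Let c_gt0 : 0 < c. Proof. by rewrite exprn_gt0// invr_gt0. Qed.

Lemma scont_ray f (r : 'rV[R]_n -> R) : continuous f -> scont r -> scont (fun y => f (r y *: y)).
Proof.
move=> cf sr x x0.
have cn := continuous_nx x0; have cr := sr x x0.
have cz : {for x, continuous (fun z => hextend r z *: nx z)} by exact: (cvgZ cr cn).
exact: (continuous_comp cz (cf (hextend r x *: nx x))).
Qed.

(** The inequality [2 k e - k^2 <= e^2] for the radial derivative [e] makes the integrand linear in
    [f], so that it integrates exactly along rays. The weight [c r^(1-n)], at most 1 for [r >= 1/2],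
    cancels the polar factor. *)
Lemma shell_ge f k (rho : R) : C1 f -> scont k -> 2^-1 <= rho <= 1 - d ->
  n%:R * sA (fun y => c * (2 * k y * (f ((1 + h y) *: y) - f (rho *: y)) - k y ^+ 2 * (1 + h y - rho)))
  <= \int[leb]_(x in region (fun=> rho) r1) dot (grad f x) (grad f x).
Proof.
move=> cf sk /andP[rho2 rhod].
have rhor y : unit_sphere y -> rho <= 1 + h y.
  by move=> y1; have := adm_le ah y1; rewrite ler_norml; lra.
have sr := adm_scont1 ah; have mreg := measurable_region (@scont_cst R n rho) sr.
pose q x := c * (enorm x ^- n.-1) * (2 * hextend k x * dot (grad f x) (nx x) - hextend k x ^+ 2).
pose K y (r : R) := c * (2 * k y * f (r *: y) - k y ^+ 2 * r).
have cgi j : continuous (partial j f) by exact: (cf j).2.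
have regE x : region (fun=> rho) r1 x -> [/\ x != 0, 2^-1 <= enorm x & enorm x <= 2].
  move=> [x0 xa xb]; split => //; first by rewrite /hextend in xa; lra.
  by have := adm_radius d4 ah (enorm_nx x0 : unit_sphere (nx x)); rewrite /hextend -/(nx x) in xb; lra.
have w1 x : 2^-1 <= enorm x -> 0 <= c * (enorm x ^- n.-1) <= 1.
  move=> xe; have ep : 0 < enorm x by lra.
  rewrite mulr_ge0 ?(ltW c_gt0) ?invr_ge0 ?exprn_ge0 ?enorm_ge0//= ler_pdivrMr ?exprn_gt0// mul1r.
  by rewrite lerXn2r ?nnegrE ?enorm_ge0// invr_ge0.
have mq : measurable_fun setT q.
  have mk := measurable_hextend sk.
  apply: measurable_funM.
    apply: measurable_funM => //; exact: (measurableT_comp (measurable_exprV n.-1) (@measurable_enorm R n)).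
  apply: measurable_funB; last exact: measurable_funX.
  apply: measurable_funM; first by apply: measurable_funM.
  rewrite /dot; apply: measurable_sum => i; apply: measurable_funM; first by rewrite gradE; exact: measurable_continuous.
  exact: (measurableT_comp (measurable_coord i) (@measurable_nx R n)).
have cgr := continuous_sqr_grad cf.
have [Mf HMf] : exists M : R, forall x, enorm x <= 2 -> enorm (grad f x) <= M.
  have [M _ HM] := ball_bounded 2 cgr; exists (M + 1) => x /HM.
  by rewrite ger0_norm ?sqr_ge0//; have := sqr_ge0 (enorm (grad f x) - 1); nra.
have [Mk Mk0 HMk] := scont_bounded sk.
have rad x : x != 0 -> `|dot (grad f x) (nx x)| <= enorm (grad f x).
  by move=> x0; apply: (le_trans (cauchy_schwarz _ _)); rewrite enorm_nx// mulr1.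
have qle x : region (fun=> rho) r1 x -> q x <= dot (grad f x) (grad f x).
  move=> /regE[x0 xa xb]; rewrite /q -enorm_sqr; have := rad x x0; have /andP[] := w1 x xa.
  move: (c * _) (hextend k x) (dot _ _) (enorm (grad f x)) => w b e g w0 w1' eg.
  have h1 : 2 * b * e - b ^+ 2 <= e ^+ 2 by have := sqr_ge0 (b - e); nra.
  have h2 := ler_sqr_norm eg.
  apply: (le_trans (ler_wpM2l w0 h1)); apply: le_trans h2.
  by rewrite ler_piMl ?sqr_ge0.
have qb x : region (fun=> rho) r1 x -> `|q x| <= 2 * Mk * Mf + Mk ^+ 2.
  move=> /regE[x0 xa xb]; rewrite /q normrM; have /andP[w0 w1'] := w1 x xa.
  rewrite (ger0_norm w0); apply: (le_trans (ler_piMl _ w1')) => //.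
  have hk : `|hextend k x| <= Mk by apply: HMk; exact: enorm_nx.
  have hd : `|dot (grad f x) (nx x)| <= Mf by exact: le_trans (rad x x0) (HMf x xb).
  apply: (le_trans (ler_normB _ _)); apply: lerD.
    by rewrite !normrM (ger0_norm (ler0n R 2)) ler_pM// ?mulr_ge0// ler_wpM2l.
  by rewrite normrX lerXn2r ?nnegrE.
have iq : leb.-integrable (region (fun=> rho) r1) (EFin \o q).
  apply: (integrable_bounded mreg _ _ qb); first by move=> x /regE[_ _]; exact.
  exact: measurable_funTS.
have ig : leb.-integrable (region (fun=> rho) r1) (EFin \o (fun x => dot (grad f x) (grad f x))).
  apply: (@integrableS _ _ _ leb (eball 3)) => //; [exact: measurable_eball| |].
    by move=> x /regE[_ _ xb]; rewrite /eball/=; lra.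
  by apply: integrable_eball; exact: continuous_dot_grad.
apply: le_trans (le_Rintegral mreg iq ig qle).
have rpos r y : unit_sphere y -> rho <= r <= 1 + h y -> 0 < r by move=> _ /andP[a _]; lra.
have qray y (r : R) : unit_sphere y -> 0 < r -> r ^+ n.-1 * q (r *: y) = c * (2 * k y * dot (grad f (r *: y)) y - k y ^+ 2).
  move=> y1 rp; rewrite /q hextendZ// hextend_sphere// nxZ// nx_id// enorm_ray//.
  by rewrite mulrA mulrCA divff ?mulr1// expf_neq0// gt_eqF.
have sfr1 := scont_ray (C1_continuous cf) sr.
have sfr0 := scont_ray (C1_continuous cf) (@scont_cst R n rho).
have bnd y : unit_sphere y -> 0 <= rho <= 1 + h y by move=> y1; rewrite (rhor y y1) andbT; lra.
have dK y (r : R) : unit_sphere y -> rho <= r <= 1 + h y -> is_derive r 1 (K y) (r ^+ n.-1 * q (r *: y)) /\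
  {for r, continuous (fun s : R => s ^+ n.-1 * q (s *: y))}.
  move=> y1 hr; have rp := rpos r y y1 hr; split.
    rewrite (qray y r y1 rp).
    have D1 := is_derive_ray (isgrad_derive y (C1_isgrad (r *: y) cf)).
    exact: (is_deriveZ c (is_deriveB (is_deriveZ (2 * k y) D1) (is_derive_mull _ r))).
  have cs : {for r, continuous (fun s : R => s *: y)} by exact: scalel_continuous.
  have cg : {for r, continuous (fun s : R => dot (grad f (s *: y)) y)}.
    apply: continuous_sum => i; rewrite (_ : (fun s => _) = (fun s => partial i f (s *: y) * y 0 i)).
      exact: (continuous_mul (continuous_comp cs (cgi i (r *: y))) (@cst_continuous _ _ (y 0 i) r)).
    by apply/funext => s; rewrite mxE.
  have kc (a : R) := @cst_continuous R R a r.
  have cl : {for r, continuous (fun s : R => c * (2 * k y * dot (grad f (s *: y)) y - k y ^+ 2))}.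
    exact: (continuous_mul (kc c) (continuous_sub (continuous_mul (kc (2 * k y)) cg) (kc (k y ^+ 2)))).
  suff : (fun s : R => s ^+ n.-1 * q (s *: y)) @ r --> r ^+ n.-1 * q (r *: y) by [].
  rewrite (qray y r y1 rp); apply: cvg_trans; last exact: cl.
  apply: near_eq_cvg; near=> s.
  have sp : 0 < s by near: s; exact: lt_nbhsr.
  by rewrite (qray y s y1 sp).
have sK : scont (fun y => K y (1 + h y) - K y rho) by rewrite /K; scont.
rewrite (polar_primitive n0 (@sc rho) sr bnd mq qb dK sK).
rewrite ler_wpM2l//; apply: eq_ler; apply: eq_sA => y y1; rewrite /K; ring.
Unshelve. all: by end_near. Qed.

Lemma starball_moment : \int[leb]_(x in starball h) dot x x =
  n%:R * sA (fun y => (1 + h y) ^+ n.+2 / n.+2%:R).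
Proof.
apply: (Rintegral_starball_primitive n1 d4 ah (K := fun _ (r : R) => r ^+ n.+2 / n.+2%:R)) => [|y r y1 _|y|].
- exact: continuous_dotxx.
- have E : n.+2%:R^-1 * (n.+2%:R * r ^+ n.+1) = r ^+ n.-1 * dot (r *: y) (r *: y).
    rewrite -enorm_sqr enormZ (y1 : enorm y = 1) mulr1 real_normK ?num_real// mulrA mulVf ?pnatr_eq0// mul1r -exprD.
    congr (_ ^+ _); lia.
  rewrite -E (_ : (fun s => s ^+ n.+2 / n.+2%:R) = (fun s => n.+2%:R^-1 * s ^+ n.+2)); first exact: (is_deriveZ _ (is_deriveXn r n.+2)).
  by apply/funext => s; rewrite mulrC.
- by rewrite expr0n mul0r.
- by apply: scontM; [apply: scontX; exact: adm_scont1 ah|exact: scont_cst].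
Qed.

(* With f = u - s psi and u = (1 - |x|^2)/(2n), the energy of psi becomes that of f. *)
Lemma torsion_energy psi (s : R) (f := fun x => (1 - dot x x) / (2 * n%:R) - s * psi x) :
  test_function (starball h) psi ->
  2 * s * \int[leb]_(x in starball h) psi x - s ^+ 2 * \int[leb]_(x in starball h) enorm (grad psi x) ^+ 2 =
  \int[leb]_(x in starball h) dot x x / n%:R ^+ 2 - \int[leb]_(x in starball h) dot (grad f x) (grad f x).
Proof.
move=> tp; have cp := test_C1 tp; have cpc := C1_continuous cp.
have oS := open_starball n1 d4 ah; have mS := open_measurable_rV oS.
have bS := starball_bounded n1 d4 ah.
have iS (g : 'rV[R]_n -> R) : continuous g -> leb.-integrable (starball h) (EFin \o g).
  exact: (integrable_starball n1 d4 ah).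
have gf x : grad f x = - (n%:R^-1 *: x) - s *: grad psi x.
  apply: isgrad_grad; apply: isgrad_eq.
    apply: isgradB (isgradZ s (C1_isgrad x cp)).
    rewrite (_ : (fun z => (1 - dot z z) / (2 * n%:R)) = (fun z => (2 * n%:R)^-1 * (1 - dot z z))).
      exact: isgradZ (isgradB (isgrad_cst 1 x) (isgrad_dotxx x)).
    by apply/funext => z; rewrite mulrC.
  rewrite sub0r scalerN scalerA; congr (- (_ *: _) - _); field; rewrite gt_eqF//.
have I : \int[leb]_(x in starball h) dot (grad psi x) x = - (n%:R * \int[leb]_(x in starball h) psi x).
  have cF i : C1 (fun x => psi x * x 0 i) by apply: C1M => //; exact/pf_C1/pf_coord.
  have F0 i x : 2 < enorm x -> psi x * x 0 i = 0.
    move=> x2; have nO : ~ starball h x by move=> /bS; rewrite leNgt x2.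
    by rewrite (test_off tp nO).1 mul0r.
  have dF i x : partial i (fun x => psi x * x 0 i) x = psi x + partial i psi x * x 0 i.
    rewrite (isgrad_partial i (isgradM (C1_isgrad x cp) (isgrad_coord i x))) !mxE !eqxx /=; ring.
  have Z i : \int[leb]_(x in starball h) (partial i psi x * x 0 i) = - \int[leb]_(x in starball h) psi x.
    have i1 : leb.-integrable (starball h) (EFin \o (fun x => partial i psi x * x 0 i)).
      by apply: iS => x; exact: (continuous_mul ((cp i).2 x) (@continuous_coord _ _ i x)).
    have := Rintegral_partial i (cF i) (F0 i).
    have -> : \int[leb]_x partial i (fun x => psi x * x 0 i) x =
       \int[leb]_(x in starball h) (psi x + partial i psi x * x 0 i).
      rewrite [RHS]Rintegral_mkcond; apply: eq_Rintegral => x _; rewrite patchE dF.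
      case: ifPn => //; rewrite notin_setE => nO.
      by rewrite (test_off tp nO).1 (test_off tp nO).2 mul0r addr0.
    rewrite (RintegralD mS (iS _ cpc) i1) => /eqP; rewrite addrC addr_eq0 => /eqP; exact.
  have sumI (r : seq 'I_n) : \int[leb]_(x in starball h) (\sum_(i <- r) partial i psi x * x 0 i) =
     \sum_(i <- r) \int[leb]_(x in starball h) (partial i psi x * x 0 i).
    have ci i : continuous (fun x : 'rV[R]_n => partial i psi x * x 0 i).
      by move=> x; exact: (continuous_mul ((cp i).2 x) (@continuous_coord _ _ i x)).
    elim: r => [|i r IH].
      rewrite big_nil -[RHS](@mul0r R (fine (leb (starball h)))) -Rintegral_cst//.
      by apply: eq_Rintegral => x _; rewrite big_nil.
    have cs : continuous (fun x => \sum_(i <- r) partial i psi x * x 0 i).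
      by move=> x; apply: continuous_sum => j; exact: ci.
    rewrite big_cons -IH -(RintegralD mS (iS _ (ci i)) (iS _ cs)).
    by apply: eq_Rintegral => x _; rewrite big_cons.
  have -> : \int[leb]_(x in starball h) dot (grad psi x) x = \int[leb]_(x in starball h) (\sum_i partial i psi x * x 0 i).
    by apply: eq_Rintegral => x _; apply: eq_bigr => i _; rewrite mxE.
  by rewrite sumI (eq_bigr _ (fun i _ => Z i)) sumr_const card_ord mulNrn mulr_natl.
have E : \int[leb]_(x in starball h) dot (grad f x) (grad f x) =
  n%:R ^- 2 * \int[leb]_(x in starball h) dot x x + (2 * s / n%:R) * \int[leb]_(x in starball h) dot (grad psi x) x
   + s ^+ 2 * \int[leb]_(x in starball h) enorm (grad psi x) ^+ 2.
  have c1 := @continuous_dotxx R n; have c3 := continuous_sqr_grad cp.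
  have c2 : continuous (fun x => dot (grad psi x) x).
    move=> x; apply: continuous_sum => i; rewrite (_ : (fun x => _) = (fun x => partial i psi x * x 0 i)).
      exact: (continuous_mul ((cp i).2 x) (@continuous_coord _ _ i x)).
    by apply/funext => z; rewrite mxE.
  have z (a : R) (g : 'rV[R]_n -> R) : continuous g -> leb.-integrable (starball h) (EFin \o (fun x => a * g x)).
    by move=> cg; exact: (integrableZl mS a (iS _ cg)).
  rewrite -(RintegralZl (n%:R ^- 2) mS (iS _ c1)) -(RintegralZl (2 * s / n%:R) mS (iS _ c2)) -(RintegralZl (s ^+ 2) mS (iS _ c3)).
  rewrite -(RintegralD mS (z _ _ c1) (z _ _ c2)) -(RintegralD mS (integrableD mS (z _ _ c1) (z _ _ c2)) (z _ _ c3)).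
  apply: eq_Rintegral => x _; rewrite gf enorm_sqr !(dotBl, dotBr, dotNl, dotNr, dotZl, dotZr) (dotC x (grad psi x)).
  by field; rewrite gt_eqF.
rewrite E I.
by field; rewrite gt_eqF.
Qed.

End fixed_domain.

(* The energy of f on the ball of radius 1 - 2d is bounded below by the Steklov
   inequality and on the remaining shell by its radial variation. *)
Lemma boundary_energy : exists C d0 : R, [/\ 0 <= C, 0 < d0 <= 4^-1 & forall d h f, 0 < d <= d0 -> admissible d h -> C1 f ->
  (forall y, unit_sphere y -> f ((1 + h y) *: y) = (1 - (1 + h y) ^+ 2) / (2 * n%:R)) ->
  (2 / n%:R - C * d) * L2mass h <= \int[leb]_(x in starball h) dot (grad f x) (grad f x)].
Proof.
pose c : R := 2^-1 ^+ n.-1.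
have c0 : 0 < c by rewrite exprn_gt0// invr_gt0.
pose N : R := n%:R.
(* [K d] is the parameter of Young's inequality in [sq1]. The value 24 makes the resulting multiple
   of [S1] equal to [c N / (6 d)], half of the energy available in the shell. *)
pose K : R := 24 / c; have K0 : 0 < K by rewrite divr_gt0.
pose W : R := 2 * N + N ^+ 3.
have W0 : 0 < W by rewrite addr_gt0 ?mulr_gt0 ?exprn_gt0.
have [B B0 HB] := @binomial_linear R n.-2.
(* The second entry gives [2 W <= c N / (6 d)]: the mean and the moments of the error are paid by
   the other half of the shell energy. *)
pose d0 : R := Num.min 16^-1 (c * N / (12 * W)).
have d00 : 0 < d0 by rewrite lt_min invr_gt0 ltr0n !divr_gt0 ?mulr_gt0.
pose C := 2 / N * (K + 2 * B) + (2 * N / K + W) * (2 / N ^+ 2).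
exists C, d0; split.
- have N0 : 0 <= N by [].
  have a1 : 0 <= 2 / N by exact: divr_ge0.
  have a2 : 0 <= 2 / N ^+ 2 by rewrite divr_ge0 ?sqr_ge0.
  have a3 : 0 <= K + 2 * B by rewrite addr_ge0 ?(ltW K0)// mulr_ge0.
  have a4 : 0 <= 2 * N / K + W.
    have b1 : 0 <= 2 * N / K := divr_ge0 (mulr_ge0 (ler0n R 2) N0) (ltW K0).
    exact: addr_ge0 b1 (ltW W0).
  by rewrite /C addr_ge0// mulr_ge0.
- by rewrite d00 /= ge_min; apply/orP; left; lra.
move=> d h f /andP[dp dd0] ah cf bf.
have d16 : d <= 16^-1 by apply: (le_trans dd0); rewrite ge_min lexx.
have dW : d * (12 * W) <= c * N by rewrite -ler_pdivlMr ?mulr_gt0// (le_trans dd0)// ge_min lexx orbT.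
have d4 : 0 < d <= 4^-1 by rewrite dp /=; lra.
pose rho := 1 - 2 * d.
have rho2 : 2^-1 <= rho by rewrite /rho; lra.
have rp : 0 < rho by lra.
have sh := adm_scont ah; have sr := adm_scont1 ah.
pose p1 y := f ((1 + h y) *: y); pose p0 y := f (rho *: y); pose e y := p1 y - p0 y.
have s1 : scont p1 by exact: scont_ray (C1_continuous cf) sr.
have s0 : scont p0 by exact: scont_ray (C1_continuous cf) (@sc rho).
have se : scont e by exact: scontB.
set A := L2mass h; have A0 : 0 <= A by apply: sA_ge0 => y _; exact: sqr_ge0.
pose S1 := sA (fun y => e y ^+ 2); have S10 : 0 <= S1 by apply: sA_ge0 => y _; exact: sqr_ge0.
have hy y : unit_sphere y -> - d <= h y <= d by move=> /(adm_le ah); rewrite ler_norml.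
have shell : c * N / (3 * d) * S1 <= \int[leb]_(x in region (fun=> rho) (fun y => 1 + h y)) dot (grad f x) (grad f x).
  (* The radial increment [e] divided by [3 d], an upper bound for the thickness of the shell. *)
  have sk : scont (fun y => (3 * d)^-1 * e y) by exact: scontM.
  have hr : 2^-1 <= rho <= 1 - d by rewrite rho2 /rho /=; lra.
  apply: le_trans (shell_ge d4 ah cf sk hr).
  rewrite -/c -/N (_ : c * N / (3 * d) * S1 = N * (c / (3 * d) * S1)); last by ring.
  rewrite ler_wpM2l// -sAZ; last exact: scontX.
  apply: le_sA.
  - by scont.
  - by scont.
  move=> y y1; rewrite -/(p1 y) -/(p0 y) -/(e y).
  have -> : c * (2 * ((3 * d)^-1 * e y) * e y - ((3 * d)^-1 * e y) ^+ 2 * (1 + h y - rho)) =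
    c / (3 * d) * e y ^+ 2 + c * e y ^+ 2 / (3 * d) ^+ 2 * (3 * d - (1 + h y - rho)).
    by field; rewrite gt_eqF.
  have hr3 : 0 <= 3 * d - (1 + h y - rho) by have /andP[_] := hy y y1; rewrite /rho; lra.
  have hw : 0 <= c * e y ^+ 2 / (3 * d) ^+ 2.
    by rewrite divr_ge0 ?sqr_ge0// mulr_ge0 ?sqr_ge0// ltW.
  by rewrite lerDl mulr_ge0.
have ball := steklov_eball rp cf; rewrite -/p0 in ball.
(* On the sphere of radius [rho], [f] equals [- h / n] plus this error, which consists of the
   quadratic part of the boundary value and of the increment across the shell. *)
pose eta y := - (2 * N)^-1 * h y ^+ 2 - e y.
have seta : scont eta by rewrite /eta; scont.
have p0E y : unit_sphere y -> p0 y = - N^-1 * h y + eta y.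
  move=> y1; rewrite (_ : p0 y = p1 y - e y); last by rewrite /e subKr.
  rewrite /p1 bf// /eta; field; rewrite gt_eqF//.
pose E := sA (fun y => eta y ^+ 2); have E0 : 0 <= E by apply: sA_ge0 => y _; exact: sqr_ge0.
have EA : E <= d * (2 / N ^+ 2) * (d * A) + 2 * S1.
  rewrite /E /A /L2mass /S1 mulrA -!sAZ -?sAD; try by scont.
  apply: le_sA; [by scont|by scont|].
  move=> y y1; have /andP[h1 h2] := hy y y1; rewrite /eta.
  have q := ler_sqr_norm (adm_le ah y1).
  have q2 : h y ^+ 2 * h y ^+ 2 <= d ^+ 2 * h y ^+ 2 by rewrite ler_wpM2r ?sqr_ge0.
  have := sqr_ge0 (- (2 * N)^-1 * h y ^+ 2 + e y).
  have -> : (- (2 * N)^-1 * h y ^+ 2 - e y) ^+ 2 = 2 * ((2 * N)^-1 ^+ 2 * (h y ^+ 2 * h y ^+ 2)) + 2 * e y ^+ 2 - (- (2 * N)^-1 * h y ^+ 2 + e y) ^+ 2 by ring.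
  have w : (2 * N)^-1 ^+ 2 * (h y ^+ 2 * h y ^+ 2) <= N^-1 ^+ 2 * (d ^+ 2 * h y ^+ 2).
    apply: ler_pM; rewrite ?sqr_ge0 ?mulr_ge0 ?sqr_ge0//.
    by rewrite lerXn2r ?nnegrE ?invr_ge0 ?mulr_ge0// lef_pV2 ?posrE ?mulr_gt0//; have : 0 < N by []; lra.
  have -> : d * (2 / N ^+ 2) * d * h y ^+ 2 = 2 * (N^-1 ^+ 2 * (d ^+ 2 * h y ^+ 2)) by rewrite exprVn; ring.
  lra.
have tau0 : 0 < K * d by rewrite mulr_gt0.
have sq1 : (1 - K * d) / N ^+ 2 * A - (K * d)^-1 * E <= sA (fun y => p0 y ^+ 2).
  rewrite /A /L2mass /E -!sAZ -?sAB; try by scont.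
  apply: le_sA; [by scont|by scont|].
  move=> y y1; rewrite p0E// -subr_ge0.
  rewrite (_ : _ - _ = ((K * d * (N^-1 * h y) - eta y) ^+ 2 / (K * d) + eta y ^+ 2)).
    by rewrite addr_ge0 ?sqr_ge0// divr_ge0 ?sqr_ge0// ltW.
  by field; rewrite !gt_eqF.
(* The Cauchy-Schwarz inequality for a weight bounded by 1, from a quadratic polynomial in [t] that
   is bounded by [E]. *)
have CS k : scont k -> (forall y, unit_sphere y -> `|k y| <= 1) -> sA (fun y => eta y * k y) ^+ 2 <= V * E.
  move=> sk k1; pose I := sA (fun y => eta y * k y).
  have sek : scont (fun y => eta y * k y) by exact: scontM.
  have H (t : R) : 2 * t * I - t ^+ 2 * V <= E.
    rewrite /I /E -(sA_cst (t ^+ 2)) -sAZ// -sAB//; last exact: scontM.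
    apply: le_sA; [by apply: scontB => //; exact: scontM|exact: scontX|move=> y y1].
    have := sqr_ge0 (t * k y - eta y); have k2 : k y ^+ 2 <= 1 by rewrite -real_normK ?num_real// exprn_ile1// k1.
    have := ler_wpM2l (sqr_ge0 t) k2; rewrite mulr1.
    have -> : (t * k y - eta y) ^+ 2 = t ^+ 2 * k y ^+ 2 - 2 * t * (eta y * k y) + eta y ^+ 2 by ring.
    lra.
  have := H (I / V); have -> : 2 * (I / V) * I - (I / V) ^+ 2 * V = I ^+ 2 / V by field; rewrite gt_eqF.
  by rewrite ler_pdivrMr// mulrC.
(* The mean and the first moments of [h] vanish, so the terms that Steklov's inequality subtracts
   only see [eta]. *)
have m0 : sA p0 ^+ 2 <= V * E.
  rewrite (@eq_sA _ _ p0 (fun y => - N^-1 * h y + eta y))// sAD//; last exact: scontM.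
  rewrite sAZ// (adm_mean ah) mulr0 add0r (@eq_sA _ _ eta (fun y => eta y * 1)) => [|y _]; last by rewrite mulr1.
  by apply: CS => // y _; rewrite normr1.
have mi i : sA (fun y => p0 y * y 0 i) ^+ 2 <= V * E.
  have si := @scont_coord R n i.
  rewrite (@eq_sA _ _ _ (fun y => - N^-1 * (h y * y 0 i) + eta y * y 0 i)) => [|y y1]; last by rewrite p0E// mulrDl mulrA.
  rewrite sAD; [|by scont|by scont].
  rewrite sAZ; last by scont.
  rewrite (adm_moment ah) mulr0 add0r; apply: CS => // y y1.
  by apply: (le_trans (coord_le_enorm _ _)); rewrite (y1 : enorm y = 1).
have msum : \sum_i sA (fun y => p0 y * y 0 i) ^+ 2 <= N * (V * E).
  have -> : N * (V * E) = \sum_(i < n) V * E by rewrite sumr_const card_ord mulr_natl.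
  by apply: ler_sum => i _; exact: mi.
pose X := (2 * N / K + W) * (2 / N ^+ 2).
have KdE : 2 * N * ((K * d)^-1 * E) <= 2 * N / K * (2 / N ^+ 2) * (d * A) + c * N / (6 * d) * S1.
  have := ler_wpM2l (_ : 0 <= 2 * N / (K * d)) EA; move=> /(_ _)h1.
  have {}h1 : 2 * N / (K * d) * E <= 2 * N / (K * d) * (d * (2 / N ^+ 2) * (d * A) + 2 * S1).
    by apply: h1; apply: divr_ge0; apply: mulr_ge0 => //; exact: ltW.
  have -> : 2 * N * ((K * d)^-1 * E) = 2 * N / (K * d) * E by ring.
  apply: (le_trans h1); apply: eq_ler.
  by rewrite /K; field; rewrite !gt_eqF.
have WE : W * E <= W * (2 / N ^+ 2) * (d * A) + c * N / (6 * d) * S1.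
  have h1 := ler_wpM2l (ltW W0) EA; apply: (le_trans h1); rewrite mulrDr; apply: lerD.
    have dA : 0 <= d * A by rewrite mulr_ge0// ltW.
    have -> : W * (d * (2 / N ^+ 2) * (d * A)) = d * (W * (2 / N ^+ 2) * (d * A)) by ring.
    by rewrite ler_piMl//; [rewrite mulr_ge0// mulr_ge0 ?(ltW W0)// divr_ge0 ?sqr_ge0|lra].
  rewrite mulrA ler_wpM2r// ler_pdivlMr ?mulr_gt0//.
  by have -> : W * 2 * (6 * d) = d * (12 * W) by ring.
have form : (2 / N - 2 / N * K * d) * A - X * (d * A) - c * N / (3 * d) * S1 <= steklov_form p0.
  rewrite /steklov_form -/N.
  have a1 : 2 * N / V * sA p0 ^+ 2 <= 2 * N * E.
    have -> : 2 * N * E = 2 * N / V * (V * E) by field; rewrite gt_eqF.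
    have q : 0 <= 2 * N / V := divr_ge0 (mulr_ge0 (ler0n R 2) (ler0n R n)) (ltW V0).
    exact: ler_wpM2l q _ _ m0.
  have a2 : N ^+ 2 / V * \sum_i sA (fun y => p0 y * y 0 i) ^+ 2 <= N ^+ 3 * E.
    have -> : N ^+ 3 * E = N ^+ 2 / V * (N * (V * E)) by field; rewrite gt_eqF.
    have q : 0 <= N ^+ 2 / V := divr_ge0 (sqr_ge0 N) (ltW V0).
    exact: ler_wpM2l q _ _ msum.
  have a3 := ler_wpM2l (_ : 0 <= 2 * N) sq1; have {}a3 := a3 (mulr_ge0 (ler0n _ 2) (ler0n _ n)).
  have a4 : 2 * N * ((1 - K * d) / N ^+ 2 * A) = (2 / N - 2 / N * K * d) * A by field; rewrite gt_eqF.
  rewrite mulrBr a4 in a3; rewrite mulrDl in WE.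
  have a5 : c * N / (3 * d) * S1 = c * N / (6 * d) * S1 + c * N / (6 * d) * S1 by field; rewrite gt_eqF.
  rewrite /X mulrDl mulrDl a5; lra.
have rn : 1 - B * (2 * d) <= rho ^+ n.-2 <= 1.
  have t4 : `|- (2 * d)| <= 4^-1 by rewrite normrN ger0_norm; lra.
  have := HB _ t4; rewrite normrN (ger0_norm (_ : 0 <= 2 * d)); last by lra.
  rewrite -/rho ler_norml => /andP[b1 _]; apply/andP; split; first by lra.
  by rewrite exprn_ile1 ?(ltW rp)//; rewrite /rho; lra.
have rh y : unit_sphere y -> rho < 1 + h y by move=> y1; have := hy y y1; rewrite /rho; lra.
rewrite (Rintegral_starball_split n1 d4 ah rp rh); last first.
  exact: (integrable_starball n1 d4 ah (continuous_dot_grad cf cf)).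
apply: le_trans (lerD ball shell).
have /andP[rn0 rn1] := rn.
have w0 : 0 <= rho ^+ n.-2 by rewrite exprn_ge0// ltW.
have := ler_wpM2l w0 form.
have sg : 0 <= c * N / (3 * d) * S1 by rewrite mulr_ge0// divr_ge0 ?mulr_ge0 ?(ltW c0) ?(ltW dp)//.
have dA : 0 <= d * A by rewrite mulr_ge0// ltW.
have K1 : 0 <= 2 / N * K + X.
  have b1 : 0 <= 2 * N / K := divr_ge0 (mulr_ge0 (ler0n R 2) (ler0n R n)) (ltW K0).
  have b2 : 0 <= 2 / N * K := mulr_ge0 (divr_ge0 (ler0n R 2) (ler0n R n)) (ltW K0).
  have b3 : 0 <= 2 / N ^+ 2 := divr_ge0 (ler0n R 2) (sqr_ge0 N).
  exact: addr_ge0 b2 (mulr_ge0 (addr_ge0 b1 (ltW W0)) b3).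
have N2 : 0 <= 2 / N by exact: divr_ge0.
have -> : (2 / N - C * d) * A = 2 / N * A - (2 / N * K + X) * (d * A) - 2 * B * (2 / N * (d * A)).
  by rewrite /C /X; ring.
rewrite (_ : (2 / N - 2 / N * K * d) * A - X * (d * A) = 2 / N * A - (2 / N * K + X) * (d * A)); last by ring.
have p1' := ler_piMl (mulr_ge0 K1 dA) rn1; have p2 := ler_piMl sg rn1.
have p3 := ler_wpM2r (mulr_ge0 N2 A0) rn0.
have p4 : (1 - B * (2 * d)) * (2 / N * A) = 2 / N * A - 2 * B * (2 / N * (d * A)) by ring.
rewrite !mulrBr; move: p1' p2 p3 p4; rewrite -/A.
move: (rho ^+ n.-2 * (2 / N * A)) (rho ^+ n.-2 * _) (rho ^+ n.-2 * _) (rho ^+ n.-2 * _).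
move=> u1 u2 u3 u4; lra.
Qed.

(* The linear terms in h vanish because h has mean zero. *)
Lemma torsion_quadratic : exists C d0 : R, [/\ 0 <= C, 0 < d0 <= 4^-1 & forall d h, 0 < d <= d0 -> admissible d h ->
  torsion (starball h) <= V / (n%:R * n.+2%:R) + (n.+1%:R / (2 * n%:R) - 2 / n%:R + C * d) * L2mass h].
Proof.
have [C [d0 [C0 /andP[d00 d04] BE]]] := boundary_energy; have [D D0 HD] := @binomial_quadratic R n.+2.
exists (C + D / (n%:R * n.+2%:R)), d0; split; first by rewrite addr_ge0// divr_ge0// mulr_ge0.
  by rewrite d00.
move=> d h /andP[dp dd0] ah; have d4 : 0 < d <= 4^-1 by rewrite dp (le_trans dd0).
have oS := open_starball n1 d4 ah; have bS := starball_bounded n1 d4 ah.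
apply: (torsion_ub oS bS) => psi s tp; rewrite (torsion_energy d4 ah s tp).
have cp := test_C1 tp.
have cf : C1 (fun x => (1 - dot x x) / (2 * n%:R) - s * psi x).
  apply: C1B; last exact: C1Z.
  rewrite (_ : (fun x => _) = (fun x => (2 * n%:R)^-1 * (1 - dot x x))); first exact/C1Z/paraboloid_C1.
  by apply/funext => x; rewrite mulrC.
have bf y : unit_sphere y ->
    (fun x => (1 - dot x x) / (2 * n%:R) - s * psi x) ((1 + h y) *: y) = (1 - (1 + h y) ^+ 2) / (2 * n%:R).
  move=> y1 /=; have rr := adm_radius d4 ah y1; have rp : 0 < 1 + h y by lra.
  have nO : ~ starball h ((1 + h y) *: y).
    move=> /(starballE n1 d4 ah)[|[_]].
      by move=> /(congr1 (@enorm R n)); rewrite enorm0 enorm_ray//; lra.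
    by rewrite nxZ// nx_id// enorm_ray// ltxx.
  rewrite (test_off tp nO).1 mulr0 subr0 dotZl dotZr -[dot y y]enorm_sqr (y1 : enorm y = 1) expr1n mulr1.
  by rewrite expr2.
have d40 : 0 < d <= d0 by rewrite dp.
have low := BE d h _ d40 ah cf bf.
rewrite (starball_moment d4 ah).
have sh := adm_scont ah; have sr := adm_scont1 ah.
have up : sA (fun y => (1 + h y) ^+ n.+2 / n.+2%:R) <=
    V / n.+2%:R + (n.+1%:R / 2 + D * d / n.+2%:R) * L2mass h.
  have -> : V / n.+2%:R + (n.+1%:R / 2 + D * d / n.+2%:R) * L2mass h =
     sA (fun y => n.+2%:R^-1 * 1 + (h y + (n.+1%:R / 2 + D * d / n.+2%:R) * h y ^+ 2)).
    rewrite sAD; [|by scont|by scont].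
    rewrite sAZ// sAD//; last by scont.
    rewrite sAZ ?(adm_mean ah) ?add0r; last exact: scontX.
    by rewrite mulrC.
  apply: le_sA.
  - by scont.
  - by scont.
  move=> y y1; have hd := adm_le ah y1; have h4 : `|h y| <= 4^-1 by case/andP: d4 => _; exact: le_trans.
  have := HD _ h4; rewrite ler_norml => /andP[_]; rewrite lerBlDl => hb.
  have N2 : 0 < n.+2%:R :> R by [].
  have E1 : n.+2%:R - 1 = n.+1%:R :> R by rewrite -[n.+2%:R]natr1 addrK.
  rewrite ler_pdivrMr//; apply: (le_trans hb); rewrite E1.
  have hD : D * (`|h y| * h y ^+ 2) <= D * (d * h y ^+ 2).
    by rewrite ler_wpM2l// ler_wpM2r ?sqr_ge0// (adm_le ah).
  rewrite [leRHS](_ : _ = 1 + n.+2%:R * h y + n.+2%:R * n.+1%:R / 2 * h y ^+ 2 + D * (d * h y ^+ 2)); last first.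
    by field; rewrite gt_eqF.
  by rewrite lerD2l.
have A0 : 0 <= L2mass h by apply: sA_ge0 => y _; exact: sqr_ge0.
have up2 := ler_wpM2l (ltW (exprn_gt0 2 nR)) up.
rewrite lerBlDr; apply: le_trans (lerD (lexx _) low).
rewrite ler_pdivrMr ?exprn_gt0//; apply: le_trans (ler_wpM2l (ltW nR) up) _.
apply: eq_ler.
by field; rewrite !gt_eqF.
Qed.

(** The unit ball is the member [h = 0] of the family, so the bounds for perturbed balls specialise
    to it. *)
Lemma admissible0 d : 0 <= d -> admissible d (fun _ : 'rV[R]_n => 0).
Proof.
move=> d0; have T i : tpartial i (fun _ : 'rV[R]_n => 0 : R) = (fun=> 0).
  by apply/funext => x; rewrite /tpartial /hextend (isgrad_partial i (isgrad_cst 0 x)) mxE.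
have G y : tgrad (fun _ : 'rV[R]_n => 0 : R) y = 0 by apply/rowP => i; rewrite !mxE T.
have C : sphere_C1 (fun _ : 'rV[R]_n => 0 : R).
  have c0 : continuous (fun _ : 'rV[R]_n => 0 : R) by move=> x; exact: cst_continuous.
  split=> [|i]; first exact: continuous_subspaceT.
  split=> [y _|]; last by rewrite T; exact: continuous_subspaceT.
  by rewrite /hextend; exact: derivable_cst.
split.
- by split=> [//|i]; rewrite T.
- by move=> y _; rewrite normr0.
- by move=> y _; rewrite G enorm0.
- by rewrite sA_cst mul0r.
- move=> i; rewrite (@eq_sA _ _ _ (fun=> 0)) => [|y _]; last by rewrite mul0r.
  by rewrite sA_cst mul0r.
Qed.

Lemma admissible5 : (0 < (5^-1 : R) <= 4^-1) /\ admissible 5^-1 (fun _ : 'rV[R]_n => 0 : R).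
Proof. by split; [apply/andP; split; lra|apply: admissible0; rewrite invr_ge0]. Qed.

Lemma starball0 : starball (fun _ : 'rV[R]_n => 0) = @unit_ball R n.
Proof.
have [d4 a0] := admissible5.
apply/seteqP; split=> x.
  move=> /(starballE n1 d4 a0)[->|[x0]]; first by rewrite /unit_ball/= enorm0.
  by rewrite addr0.
move=> x1; apply/(starballE n1 d4 a0); have [->|x0] := eqVneq x 0; [by left|right].
by rewrite addr0.
Qed.

(** The paraboloid is a multiple of the torsion function of the ball, so its quotient is the exact
    value. *)
Lemma torsion_ball_ge : V / (n%:R * n.+2%:R) <= torsion (@unit_ball R n).
Proof.
have [d4 a0] := admissible5.
have E := starball0.
have oS := open_starball n1 d4 a0; have bS := starball_bounded n1 d4 a0.
have iB := integrable_starball n1 d4 a0 (C1_continuous (@paraboloid_C1 R n)).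
have M := starball_moment d4 a0; rewrite E in oS bS iB M.
have mB := @measurable_unit_ball R n.
have N2 : 0 < n.+2%:R :> R by [].
have {}M : \int[leb]_(x in unit_ball) dot x x = n%:R * V / n.+2%:R.
  rewrite M -mulrA; congr (_ * _); rewrite (@eq_sA _ _ _ (fun=> n.+2%:R^-1 * 1)) => [|y _].
    by rewrite sAZ 1?mulrC//; exact: scont_cst.
  by rewrite addr0 expr1n mul1r mulr1.
have id : leb.-integrable (@unit_ball R n) (EFin \o (fun x => dot x x)).
  by apply: (integrable_continuous oS bS); exact: continuous_dotxx.
have i1 : leb.-integrable (@unit_ball R n) (EFin \o (fun x => 1)).
  by apply: (integrable_continuous oS bS) => x; exact: cst_continuous.
have I1 : \int[leb]_(x in unit_ball) (1 - dot x x) = 2 * V / n.+2%:R.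
  rewrite (RintegralB mB i1 id) M (Rintegral_eball1 n1 : \int[leb]_(x in unit_ball) 1 = V).
  have -> : n.+2%:R = n%:R + 2 :> R by rewrite -natrD addn2.
  by field; rewrite gt_eqF// addr_gt0.
have G x : enorm (grad (fun x => 1 - dot x x) x) ^+ 2 = 4 * dot x x.
  rewrite (isgrad_grad (isgradB (isgrad_cst 1 x) (isgrad_dotxx x))) sub0r enorm_sqr.
  by rewrite dotNl dotNr opprK dotZl dotZr; ring.
have I2 : \int[leb]_(x in unit_ball) enorm (grad (fun x => 1 - dot x x) x) ^+ 2 = 4 * (n%:R * V / n.+2%:R).
  by rewrite -M -(RintegralZl 4 mB id); apply: eq_Rintegral => x _; rewrite G.
have P : 0 < \int[leb]_(x in unit_ball) (1 - dot x x) by rewrite I1 divr_gt0// mulr_gt0.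
have HT psi (s : R) : test_function (@unit_ball R n) psi ->
    2 * s * \int[leb]_(x in unit_ball) psi x - s ^+ 2 * \int[leb]_(x in unit_ball) enorm (grad psi x) ^+ 2
    <= n%:R * V / n.+2%:R / n%:R ^+ 2.
  rewrite -E => tp; rewrite (torsion_energy d4 a0 s tp) E M lerBlDr lerDl.
  by apply: Rintegral_ge0 => x _; exact: dotxx_ge0.
have := torsion_lb oS (ltr0Sn R 1) bS n1 HT paraboloid_C1 paraboloid_boundary P.
have Q : 0 < 4 * (n%:R * V / n.+2%:R) by rewrite mulr_gt0// divr_gt0// mulr_gt0.
rewrite I1 I2 -ler_pdivrMr//; apply: le_trans; apply: eq_ler.
by field; rewrite !gt_eqF.
Qed.

End torsion_quadratic.

(** * Taylor estimates at radius 1 *)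

Section lipschitz_at_one.
Context {R : realType}.
Implicit Types (f g : R -> R).

Definition lip1 f := exists2 M : R, 0 <= M & forall t, `|t| <= 4^-1 -> `|f (1 + t) - f 1| <= M * `|t|.

(** Raises the order of vanishing by one; iterated, it replaces Taylor's formula. The alternative in
    the hypotheses covers both entire functions and functions that are singular at 0. *)
Lemma mvt_bound f f1 k (M : R) : 0 <= M -> (forall r : R, is_derive r 1 f (f1 r)) \/
    (forall r : R, `|r - 1| <= 4^-1 -> is_derive r 1 f (f1 r)) ->
  (forall t, `|t| <= 4^-1 -> `|f1 (1 + t)| <= M * `|t| ^+ k) ->
  forall t, `|t| <= 4^-1 -> `|f (1 + t) - f 1| <= M * `|t| ^+ k.+1.
Proof.
move=> M0 D0 B t t4.
have D (r : R) : `|r - 1| <= 4^-1 -> is_derive r 1 f (f1 r) by case: D0 => D r4; exact: D.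
have C (a b : R) : `|a - 1| <= 4^-1 -> `|b - 1| <= 4^-1 -> {within `[a, b], continuous f}.
  move=> a4 b4; apply: derivable_within_continuous => x; rewrite in_itv/= => /andP[ax xb].
  suff /D[] : `|x - 1| <= 4^-1 by [].
  by move: a4 b4; rewrite !ler_norml => /andP[a1 a2] /andP[b1 b2]; apply/andP; split; lra.
have t4' : `|1 + t - 1| <= 4^-1 by rewrite addrAC subrr add0r.
have o4 : `|(1 : R) - 1| <= 4^-1 by rewrite subrr normr0 invr_ge0.
have [xi xt E] : exists2 xi : R, `|xi| <= `|t| & f (1 + t) - f 1 = f1 (1 + xi) * t.
  have [t0|t0] := leP t 0.
    have h : 1 + t <= 1 by lra.
    have Dx (x : R) : x \in `]1 + t, 1[%R -> is_derive x 1 f (f1 x).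
      rewrite in_itv/= => /andP[a b]; apply: D.
      by move: t4; rewrite !ler_norml => /andP[e g]; apply/andP; split; lra.
    have [c ci E] := MVT_segment h Dx (C _ _ t4' o4).
    exists (c - 1); last by rewrite (_ : 1 + (c - 1) = c) -1?opprB ?E; ring.
    move: ci; rewrite in_itv/= => /andP[a b]; rewrite (ler0_norm t0) ler0_norm; lra.
  have h : 1 <= 1 + t by lra.
  have Dx (x : R) : x \in `]1, 1 + t[%R -> is_derive x 1 f (f1 x).
    rewrite in_itv/= => /andP[a b]; apply: D.
    by move: t4; rewrite !ler_norml => /andP[e g]; apply/andP; split; lra.
  have [c ci E] := MVT_segment h Dx (C _ _ o4 t4').
  exists (c - 1); last by rewrite (_ : 1 + (c - 1) = c) ?E; ring.
  move: ci; rewrite in_itv/= => /andP[a b]; rewrite (gtr0_norm t0) ger0_norm; lra.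
rewrite E normrM exprSr mulrA ler_wpM2r//.
apply: (le_trans (B xi (le_trans xt t4))); rewrite ler_wpM2l//.
by rewrite lerXn2r ?nnegrE.
Qed.

Lemma lip1M f g : lip1 f -> lip1 g -> lip1 (fun r => f r * g r).
Proof.
move=> [M M0 fM] [N N0 gN]; exists (M * (`|g 1| + N) + `|f 1| * N).
  by rewrite addr_ge0// mulr_ge0// addr_ge0.
move=> t t4; have h1 := fM t t4; have h2 := gN t t4.
have h3 : `|g (1 + t)| <= `|g 1| + N.
  rewrite -(subrK (g 1) (g (1 + t))); apply: (le_trans (ler_normD _ _)); rewrite addrC lerD2l.
  apply: (le_trans h2); rewrite ler_piMr//; lra.
have -> : f (1 + t) * g (1 + t) - f 1 * g 1 = (f (1 + t) - f 1) * g (1 + t) + f 1 * (g (1 + t) - g 1) by ring.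
apply: (le_trans (ler_normD _ _)); rewrite !normrM mulrDl; apply: lerD.
  by rewrite mulrAC; apply: ler_pM.
by rewrite -mulrA ler_wpM2l.
Qed.

Lemma lip1D f g : lip1 f -> lip1 g -> lip1 (fun r => f r + g r).
Proof.
move=> [M M0 fM] [N N0 gN]; exists (M + N) => [|t t4]; first exact: addr_ge0.
rewrite opprD addrACA mulrDl; apply: (le_trans (ler_normD _ _)); apply: lerD; [exact: fM|exact: gN].
Qed.

Lemma lip1_cst (c : R) : lip1 (fun=> c).
Proof. by exists 0 => // t _; rewrite subrr normr0 mul0r. Qed.

Lemma lip1Z (c : R) f : lip1 f -> lip1 (fun r => c * f r).
Proof. exact/lip1M/lip1_cst. Qed.

Lemma lip1X f k : lip1 f -> lip1 (fun r => f r ^+ k).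
Proof.
move=> lf; elim: k => [|k IH]; first exact: lip1_cst.
have -> : (fun r => f r ^+ k.+1) = (fun r => f r * f r ^+ k) by apply/funext => r; rewrite exprS.
exact: lip1M.
Qed.

Lemma lip1_id : lip1 id.
Proof. by exists 1 => // t _; rewrite addrAC subrr add0r mul1r. Qed.

Lemma lip1_inv : lip1 (fun r => r^-1).
Proof.
exists 2 => // t t4; have t1 : 2^-1 <= 1 + t by move: t4; rewrite ler_norml => /andP[a _]; lra.
have t0 : 0 < 1 + t by lra.
have -> : (1 + t)^-1 - 1^-1 = - t / (1 + t) by field; rewrite gt_eqF.
rewrite normrM normrN mulrC ler_wpM2r// normfV gtr0_norm// -[leRHS]invrK lef_pV2 ?posrE ?invr_gt0//.
Qed.

Lemma lip1_derive f f1 : (forall r : R, is_derive r 1 f (f1 r)) -> continuous f1 -> lip1 f.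
Proof.
move=> D c.
have ck : compact (f1 @` `[(1 - 4^-1 : R), 1 + 4^-1]).
  by apply: continuous_compact; [exact: continuous_subspaceT|exact: segment_compact].
have [M [_ MP]] := compact_bounded ck; exists (`|M| + 1); first exact: addr_ge0.
move=> t t4; rewrite -[`|t|]expr1.
have MM : 0 <= `|M| + 1 by exact: addr_ge0.
apply: (mvt_bound (k := 0) MM (or_introl D)) t4 => s s4; rewrite expr0 mulr1.
apply: MP; first by rewrite (le_lt_trans (ler_norm M))// ltrDl.
by exists (1 + s) => //=; rewrite in_itv/=; move: s4; rewrite ler_norml => /andP[a b]; apply/andP; split; lra.
Qed.

End lipschitz_at_one.

(** * Energy and mass of radial trial functions *)

Section radial_energy.
Context {R : realType} {n : nat}.
Hypothesis n1 : (1 < n)%N.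
Let n0 : (0 < n)%N := ltnW n1.
Variable l : R.
Hypotheses (l0 : 0 < l) (Wl : bessel n 0 l = 0).
Local Notation W j r := (bessel n j (l * r ^+ 2)).
Local Notation N := (n%:R : R).
Local Notation v1 := (2 * l * bessel n 1 l).

Lemma is_derive_radial j (r : R) : is_derive r 1 (fun s : R => W j s) (2 * l * r * W j.+1 r).
Proof.
have h : is_derive r 1 (fun s : R => l * s ^+ 2) (2 * l * r).
  apply: (is_derive_eq (is_deriveZ l (is_deriveXn r 2))); rewrite /GRing.scale/= expr1; ring.
by apply: (is_derive_eq (@is_derive1_comp _ (bessel n j) _ r _ _ (is_derive_bessel n0 j _) h)); rewrite mulrC.
Qed.

Lemma is_derive_pow (a : R) k (r : R) : is_derive r 1 (fun s : R => a * s ^+ k) (a * (k%:R * r ^+ k.-1)).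
Proof. exact: (is_deriveZ a (is_deriveXn r k)). Qed.

Lemma is_derive_pow1 (a : R) k j (r : R) : is_derive r 1 (fun s : R => a * (s ^+ k * W j s))
  (a * (k%:R * r ^+ k.-1 * W j r + r ^+ k * (2 * l * r * W j.+1 r))).
Proof.
apply: (is_derive_eq (is_deriveZ a (is_deriveM (is_deriveXn r k) (is_derive_radial j r)))).
rewrite /GRing.scale/=; ring.
Qed.

Lemma is_derive_pow2 (a : R) k i j (r : R) : is_derive r 1 (fun s : R => a * (s ^+ k * (W i s * W j s)))
  (a * (k%:R * r ^+ k.-1 * (W i r * W j r) +
        r ^+ k * (2 * l * r * (W i.+1 r * W j r + W i r * W j.+1 r)))).
Proof.
have D : is_derive r 1 (fun s : R => W i s * W j s) (W i r * (2 * l * r * W j.+1 r) + W j r * (2 * l * r * W i.+1 r)).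
  exact: is_deriveM (is_derive_radial i r) (is_derive_radial j r).
by apply: (is_derive_eq (is_deriveZ a (is_deriveM (is_deriveXn r k) D))); rewrite /GRing.scale/=; ring.
Qed.

(* The trial function is v(r) - c r^2 along a ray, with v(r) = W(l r^2) the radial
   eigenfunction of the unit ball and g the square of the tangential gradient of c;
   both primitives come from the Bessel equation. *)
Definition energy_primitive (c g r : R) := 2 * l * (r ^+ n * (W 0 r * W 1 r)) +
  (- (4 * l * c)) * (r ^+ n.+2 * W 1 r) + ((4 * c ^+ 2 + g) / (N + 2) * r ^+ n.+2 +
  (- (l * c ^+ 2) / (N + 4)) * r ^+ n.+4).

Definition mass_primitive (c r : R) := 2 * l * (r ^+ n.+2 * (W 1 r * W 1 r)) +
  2^-1 * (r ^+ n * (W 0 r * W 0 r)) + ((N - 2) * (r ^+ n * (W 0 r * W 1 r)) +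
  (4 * c) * (r ^+ n.+2 * W 1 r)) + ((- (4 * c / l)) * (r ^+ n * W 0 r) +
  (- (8 * N * c / l)) * (r ^+ n * W 1 r) + c ^+ 2 / (N + 4) * r ^+ n.+4).

Let pows (r : R) (p := r ^+ n.-1) : [/\ r ^+ n = p * r, r ^+ n.+1 = p * r ^+ 2, r ^+ n.+2 = p * r ^+ 3,
  r ^+ n.+3 = p * r ^+ 4 & r ^+ n.+4 = p * r ^+ 5].
Proof. by split; rewrite /p; case: (n) n0 => // k _; rewrite /= !exprS; ring. Qed.

Let natS : n.+2%:R = N + 2 /\ n.+4%:R = N + 4.
Proof. by rewrite -!natrD addn2 addn4. Qed.

Lemma energy_derive c g (r : R) : is_derive r 1 (energy_primitive c g)
  (r ^+ n.-1 * ((2 * l * r * W 1 r - 2 * c * r) ^+ 2 + r ^+ 2 * g - l * (W 0 r - r ^+ 2 * c) ^+ 2)).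
Proof.
apply: (is_derive_eq (is_deriveD (is_deriveD (is_derive_pow2 (2 * l) n 0 1 r)
  (is_derive_pow1 (- (4 * l * c)) n.+2 1 r)) (is_deriveD (is_derive_pow ((4 * c ^+ 2 + g) / (N + 2)) n.+2 r)
  (is_derive_pow (- (l * c ^+ 2) / (N + 4)) n.+4 r)))).
have [-> ->] := natS; have [e0 e1 e2 e3 e4] := pows r; rewrite [n.+2.-1]/= [n.+4.-1]/= e0 e1 e2 e3.
have ode := bessel_ode n0 (l * r ^+ 2); move: ode; rewrite -/N.
have a2 : N + 2 != 0 by rewrite gt_eqF// addr_gt0// ltr0n.
have a4 : N + 4 != 0 by rewrite gt_eqF// addr_gt0// ltr0n.
move: (W 0 r) (W 1 r) (W 2 r) (r ^+ n.-1) (N) a2 a4 => w0 w1 w2 p m a2 a4 ode.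
(* The two sides differ by this multiple of the Bessel equation; the multiplier is read off from the
   terms that contain [w2]. *)
have z : p * (l * w0 - 2 * l * c * r ^+ 2) * (4 * (l * r ^+ 2) * w2 + 2 * m * w1 + w0) = 0 by rewrite ode mulr0.
rewrite -[RHS]addr0 -z; field; rewrite a2 a4//.
Qed.

Lemma mass_derive c (r : R) : is_derive r 1 (mass_primitive c) (r ^+ n.-1 * (W 0 r - r ^+ 2 * c) ^+ 2).
Proof.
apply: (is_derive_eq (is_deriveD (is_deriveD (is_deriveD (is_derive_pow2 (2 * l) n.+2 1 1 r)
  (is_derive_pow2 2^-1 n 0 0 r)) (is_deriveD (is_derive_pow2 (N - 2) n 0 1 r)
  (is_derive_pow1 (4 * c) n.+2 1 r))) (is_deriveD (is_deriveD (is_derive_pow1 (- (4 * c / l)) n 0 r)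
  (is_derive_pow1 (- (8 * N * c / l)) n 1 r)) (is_derive_pow (c ^+ 2 / (N + 4)) n.+4 r)))).
have [-> ->] := natS; have [e0 e1 e2 e3 e4] := pows r; rewrite [n.+2.-1]/= [n.+4.-1]/= e0 e1 e2 e3.
have ode := bessel_ode n0 (l * r ^+ 2); move: ode; rewrite -/N.
have a4 : N + 4 != 0 by rewrite gt_eqF// addr_gt0// ltr0n.
have lz : l != 0 by rewrite gt_eqF.
move: (W 0 r) (W 1 r) (W 2 r) (r ^+ n.-1) (N) a4 => w0 w1 w2 p m a4 ode.
have z : p * (2 * l * r ^+ 2 * w1 + (m - 2) / 2 * w0 + 2 * c * r ^+ 2 - 4 * m * c / l) *
  (4 * (l * r ^+ 2) * w2 + 2 * m * w1 + w0) = 0 by rewrite ode mulr0.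
rewrite -[RHS]addr0 -z; field; rewrite a4 lz//.
Qed.

Lemma lip1_radial j : lip1 (fun r : R => W j r).
Proof.
apply: (lip1_derive (is_derive_radial j)) => r.
have D := is_deriveM (is_derive_pow (2 * l) 1 r) (is_derive_radial j.+1 r).
have [d _] := D; have := differentiable_continuous ((derivable1_diffP _ _).1 d).
by rewrite (_ : (_ * _)%R = (fun s : R => 2 * l * s * W j.+1 s)).
Qed.

Lemma lip1_pow k : lip1 (fun r : R => r ^+ k). Proof. exact/lip1X/lip1_id. Qed.

Let at1 (f : R -> R) : f (l * 1 ^+ 2) = f l. Proof. by rewrite expr1n mulr1. Qed.

(** The flux is [energy_primitive 0 0], whose derivative is known. A second derivative, simplified
    by the Bessel equation, is Lipschitz at 1, and two applications of [mvt_bound] give the cubic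
    remainder. Here [v1] is the slope of the radial eigenfunction at the boundary. *)
Lemma flux_quadratic : exists2 C : R, 0 <= C & forall t, `|t| <= 4^-1 ->
  `|2 * l * ((1 + t) ^+ n * (W 0 (1 + t) * W 1 (1 + t))) - (v1 ^+ 2 * t - (N - 1) / 2 * v1 ^+ 2 * t ^+ 2)|
   <= C * `|t| ^+ 3.
Proof.
pose P2 (r : R) := 4 * l ^+ 2 * (r ^+ n * ((1 - N) * W 1 r ^+ 2 - 2 * (W 0 r * W 1 r)))
   + (- (l * (N - 1))) * (r ^+ n.-2 * W 0 r ^+ 2).
have lW := lip1_radial; have lp := lip1_pow.
have L : lip1 P2.
  apply: lip1D; apply: lip1Z; apply: lip1M => //; last exact: lip1X.
  have e : (fun r : R => (1 - N) * W 1 r ^+ 2 - 2 * (W 0 r * W 1 r)) =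
    (fun r : R => (1 - N) * W 1 r ^+ 2 + (- 2) * (W 0 r * W 1 r)) by apply/funext => r; rewrite mulNr.
  by rewrite e; apply: lip1D; apply: lip1Z; [exact: lip1X|exact: lip1M].
have [C C0 H] := L; exists C => // t t4.
have P21 : P2 1 = (1 - N) * v1 ^+ 2 by rewrite /P2 !at1 Wl !expr1n; ring.
pose Q (r : R) := energy_primitive 0 0 r - (v1 ^+ 2 * r ^+ 1 - (N - 1) / 2 * v1 ^+ 2 * (r - 1) ^+ 2).
pose Q1 (r : R) := 4 * l ^+ 2 * (r ^+ n.+1 * (W 1 r * W 1 r)) + (- l) * (r ^+ n.-1 * (W 0 r * W 0 r))
  - (v1 ^+ 2 - (N - 1) * v1 ^+ 2 * (r ^+ 1 - 1)).
have D1 (r : R) : is_derive r 1 Q (Q1 r).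
  have s2 : is_derive r 1 (fun s : R => (N - 1) / 2 * v1 ^+ 2 * (s - 1) ^+ 2) ((N - 1) * v1 ^+ 2 * (r - 1)).
    have i1 : is_derive r 1 (fun s : R => s - 1) 1.
      by apply: (is_derive_eq (is_deriveB (is_derive_id r (1 : R)) (is_derive_cst (1 : R) r 1))); rewrite subr0.
    have i2 : is_derive r 1 (fun s : R => (s - 1) ^+ 2) ((r - 1) * 1 + (r - 1) * 1) by exact: (is_deriveM i1 i1).
    by apply: (is_derive_eq (is_deriveZ ((N - 1) / 2 * v1 ^+ 2) i2)); rewrite /GRing.scale/=; field.
  apply: (is_derive_eq (is_deriveB (energy_derive 0 0 r) (is_deriveB (is_derive_pow (v1 ^+ 2) 1 r) s2))).
  by rewrite /Q1; have [_ -> _ _ _] := pows r; rewrite expr0 expr1; ring.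
have D2 (r : R) : is_derive r 1 Q1 (P2 r - P2 1).
  have s2 : is_derive r 1 (fun s : R => v1 ^+ 2 - (N - 1) * v1 ^+ 2 * (s ^+ 1 - 1)) (- ((N - 1) * v1 ^+ 2)).
    have i1 := is_deriveB (is_deriveXn r 1) (is_derive_cst (1 : R) r 1).
    apply: (is_derive_eq (is_deriveB (is_derive_cst (v1 ^+ 2) r 1) (is_deriveZ ((N - 1) * v1 ^+ 2) i1))).
    by rewrite /GRing.scale/= expr0 subr0 !mulr1 sub0r.
  apply: (is_derive_eq (is_deriveB (is_deriveD (is_derive_pow2 (4 * l ^+ 2) n.+1 1 1 r)
    (is_derive_pow2 (- l) n.-1 0 0 r)) s2)).
  rewrite P21 /P2; have ode := bessel_ode n0 (l * r ^+ 2); move: ode; rewrite -/N.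
  have n12 : n = n.-2.+2 by case: (n) n1 => [|[]].
  have q1 : r ^+ n.-1 = r * r ^+ n.-2 by rewrite -exprS; congr (_ ^+ _); rewrite [in LHS]n12.
  have q0 : r ^+ n = r ^+ 2 * r ^+ n.-2 by rewrite -exprD; congr (_ ^+ _).
  have q2 : r ^+ n.+1.-1 = r ^+ 2 * r ^+ n.-2 by [].
  rewrite (exprS r n) q2 q1 -[n.+1%:R]natr1.
  have -> : n.-1%:R = N - 1 by rewrite -subn1 natrB.
  move: (W 0 r) (W 1 r) (W 2 r) (r ^+ n.-2) (N) => w0 w1 w2 p m ode.
  have z : 4 * l ^+ 2 * r ^+ 2 * p * w1 * (4 * (l * r ^+ 2) * w2 + 2 * m * w1 + w0) = 0 by rewrite ode mulr0.
  rewrite -[RHS]addr0 -z; ring.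
have Q11 : Q1 1 = 0 by rewrite /Q1 !at1 Wl !expr1n; ring.
have B1 s : `|s| <= 4^-1 -> `|Q1 (1 + s)| <= C * `|s| ^+ 2.
  move=> s4; have := mvt_bound C0 (or_introl D2) (k := 1) _ s4; rewrite Q11 subr0; apply.
  by move=> u u4; rewrite expr1; exact: H.
have := mvt_bound C0 (or_introl D1) B1 t4.
congr (`| _ | <= _); rewrite /Q /energy_primitive !at1 Wl !expr1n; field.
by rewrite !gt_eqF ?addr_gt0 ?ltr0n.
Qed.

End radial_energy.

(** * Quadratic extensions and the Poincare inequality on the sphere *)

Section homogeneous_trial.
Context {R : realType} {n : nat}.
Implicit Types (x y z : 'rV[R]_n).
Variables (c : 'rV[R]_n -> R) (G : 'rV[R]_n -> 'rV[R]_n).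
Hypothesis sc : sgrad c G.

Let near0 (e : R) : 0 < e -> \forall z \near (0 : 'rV[R]_n), enorm z < e.
Proof.
move=> e0; have /cvgrPdist_lt/(_ e e0) := @continuous_enorm R n 0.
by apply: filterS => z; rewrite enorm0 sub0r normrN ger0_norm// enorm_ge0.
Qed.

Let continuous0 (f : 'rV[R]_n -> R) (K : R) x : x = 0 -> 0 < K -> f 0 = 0 ->
  (forall z, z != 0 -> `|f z| <= enorm z * K) -> {for x, continuous f}.
Proof.
move=> x0 K0 f0 H; apply/(@cvgrPdist_lt _ _ _ (nbhs x) (nbhs_filter x)) => e e0; rewrite x0; apply: filterS (near0 (divr_gt0 e0 K0)) => z.
rewrite ltr_pdivlMr// f0 sub0r normrN; have [->|z0 h1] := eqVneq z 0; first by rewrite f0 normr0.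
exact: le_lt_trans (H z z0) h1.
Qed.

Let sphere_bound f : scont f -> exists2 M : R, 0 < M & forall x, x != 0 -> `|f (nx x)| <= M.
Proof.
move=> /scont_bounded[M M0 H]; exists (M + 1) => [|x x0]; first by rewrite ltr_wpDl.
by rewrite (le_trans (H _ (enorm_nx x0)))// lerDl.
Qed.

(** The factor [|x|^2] compensates the singularity of the 0-homogeneous extension at the origin, so
    the extension is C^1 there as well. *)
Lemma isgrad_quad x : isgrad (fun z => dot z z * hextend c z) x
  ((2 * c (nx x)) *: x + enorm x *: G (nx x)).
Proof.
have [->|x0] := eqVneq x 0; last first.
  apply: (isgrad_eq (isgradM (isgrad_dotxx x) (sc.1 x x0))).
  rewrite addrC !scalerA -enorm_sqr expr2.
  by rewrite mulfK ?enorm_eq0// hextendE mulrC.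
have [M M0 HM] := sphere_bound (sgrad_scont sc).
have K0 : 0 < n.+1%:R * M by rewrite mulr_gt0.
rewrite scaler0 enorm0 scale0r addr0; apply/isgradP => e e0; near=> z.
rewrite addr0 dot0l mul0r dot0l !subr0 normrM -enorm_sqr ger0_norm ?sqr_ge0//.
have [->|z0] := eqVneq z 0; first by rewrite enorm0 expr0n/= mul0r normr0 mulr0.
have h1 : enorm z < e / (n.+1%:R * M) by near: z; apply: near0; exact: divr_gt0 e0 K0.
rewrite ltr_pdivlMr// in h1; have h2 := HM z z0; have e1 := enorm_ge0 z.
have h3 : enorm z <= n.+1%:R * `|z|.
  by rewrite (le_trans (enorm_le_norm z))// ler_wpM2r// ler_nat.
rewrite expr2; apply: (le_trans (ler_pM _ _ (ler_wpM2l e1 h3) h2)) => //; first exact: mulr_ge0.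
rewrite (_ : enorm z * (n.+1%:R * `|z|) * M = enorm z * (n.+1%:R * M) * `|z|); first by rewrite ler_wpM2r// ltW.
ring.
Unshelve. all: by end_near. Qed.

Lemma quad_C1 : C1 (fun z => dot z z * hextend c z).
Proof.
apply: (C1_of_isgrad isgrad_quad) => i x; have cc := sgrad_scont sc.
have E : (fun z => ((2 * c (nx z)) *: z + enorm z *: G (nx z)) 0 i) =
    (fun z => (2 * hextend c z) * z 0 i + enorm z * hextend (fun y => G y 0 i) z).
  by apply/funext => z; rewrite !mxE.
rewrite E; have [x0|x0] := eqVneq x 0; last first.
  have k := @cst_continuous _ _ (2 : R) x.
  exact: (continuous_add (continuous_mul (continuous_mul k (cc x x0)) (@continuous_coord _ _ i x))
    (continuous_mul (@continuous_enorm _ _ x) (sc.2 i x x0))).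
have [M M0 HM] := sphere_bound cc; have [N N0 HN] := sphere_bound (sc.2 i).
apply: (continuous0 x0 (K := 2 * M + N)); first by rewrite addr_gt0// mulr_gt0.
  by rewrite mxE mulr0 enorm0 mul0r addr0.
move=> z z0; rewrite mulrDr addrC [leRHS]addrC; apply: (le_trans (ler_normD _ _)).
have e1 := enorm_ge0 z; apply: lerD; rewrite !normrM.
  by rewrite ger0_norm// ler_wpM2l// HN.
by rewrite mulrC ler_pM ?coord_le_enorm// ?mulr_ge0// ger0_norm// ler_wpM2l// HM.
Qed.

End homogeneous_trial.

Section poincare.
Context {R : realType} {n : nat}.
Hypothesis n1 : (1 < n)%N.

Lemma dot_radial (k r : R) (y g : 'rV[R]_n) : unit_sphere y -> dot g y = 0 ->
  dot (k *: y + r *: g) (k *: y + r *: g) = k ^+ 2 + r ^+ 2 * dot g g.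
Proof.
move=> y1 gy; rewrite !(dotDl, dotDr, dotZl, dotZr) (dotC y g) gy -(enorm_sqr y) (y1 : enorm y = 1).
by ring.
Qed.

(* Steklov's inequality for the quadratic extension |x|^2 h(x / |x|). *)
Lemma poincare (d : R) (h : 'rV[R]_n -> R) : 0 <= d -> admissible d h -> 2 * n%:R * L2mass h <= gradmass h.
Proof.
move=> d0 ah; have sh := adm_sgrad ah; have S := steklov n1 (quad_C1 sh).
have [d4 a0] := @admissible5 R n.
have onS y : unit_sphere y -> dot y y * hextend h y = h y.
  by move=> y1; rewrite hextend_sphere// -enorm_sqr (y1 : enorm y = 1) expr1n mul1r.
pose q y := 4 * h y ^+ 2 + dot (tgrad h y) (tgrad h y).
have c := adm_scont ah; have sg := scont_grad2 ah; have s2 : scont (fun y => h y ^+ 2) by exact: scontX.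
have sq : scont q by apply: scontD => //; apply: scontM => //; exact: scont_cst.
rewrite (eq_sA onS) (adm_mean ah) big1 in S => [|i _]; last first.
  rewrite (@eq_sA _ _ _ (fun y => h y * y 0 i)) => [|y y1]; last by rewrite onS.
  by rewrite (adm_moment ah) expr0n.
(* Integrating [r^(n+1) (4 h^2 + |grad h|^2)] along rays gives the factor [1 / (n + 2)]; Steklov's
   inequality then reads [2 (n + 2) A <= 4 A + B] for the masses [A] of [h] and [B] of its
   gradient. *)
have E : \int[leb]_(x in eball 1) dot (grad (fun x => dot x x * hextend h x) x) (grad (fun x => dot x x * hextend h x) x) =
    n%:R * sA (fun y => q y / n.+2%:R * (1 + 0) ^+ n.+2).
  rewrite -[LHS]/(\int[leb]_(x in @unit_ball R n) _) -(starball0 n1).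
  apply: (Rintegral_starball_primitive n1 d4 a0 (K := fun y (r : R) => q y / n.+2%:R * r ^+ n.+2)).
  - exact: (continuous_dot_grad (quad_C1 sh) (quad_C1 sh)).
  - have Z : (0 : R) ^+ n.-1 = 0 by rewrite expr0n -subn1 subn_eq0 leqNgt n1.
    move=> y r y1 r0; apply: (is_derive_eq (is_deriveZ (q y / n.+2%:R) (is_deriveXn r n.+2))).
    rewrite /GRing.scale/= mulrA divfK ?pnatr_eq0// (isgrad_grad (isgrad_quad sh _)).
    have [->|rn] := eqVneq r 0; first by rewrite Z mul0r expr0n mulr0.
    have rp : 0 < r by rewrite lt0r rn.
    rewrite nxZ// nx_id// enorm_ray// scalerA dot_radial//; last exact: sgrad_tangent sh y1.
    rewrite (_ : r ^+ n.+2.-1 = r ^+ n.-1 * r ^+ 2); first by rewrite /q; ring.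
    by rewrite -exprD; congr (_ ^+ _); lia.
  - by move=> y; rewrite expr0n mulr0.
  - by apply: scontM; [apply: scontM => //; exact: scont_cst|exact: scont_cst].
rewrite E (@eq_sA _ _ (fun y => q y / n.+2%:R * (1 + 0) ^+ n.+2) (fun y => n.+2%:R^-1 * q y)) in S => [|y _]; last by rewrite addr0 expr1n mulr1 mulrC.
rewrite (@eq_sA _ _ (fun y => (dot y y * hextend h y) ^+ 2) (fun y => h y ^+ 2)) in S => [|y y1]; last by rewrite onS.
rewrite sAZ// sAD// ?sAZ// -/(L2mass h) -/(gradmass h) in S; last by scont.
have N0 : 0 < n%:R :> R by rewrite ltr0n ltnW.
move: S; rewrite expr0n/= !mulr0 !addr0 -mulrA mulrCA ler_pM2l// ler_pdivlMl ?ltr0n// => S.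
have E2 : n.+2%:R = n%:R + 2 :> R by rewrite -natrD addn2.
rewrite E2 in S; lra.
Qed.

End poincare.

(** * Remainders of prescribed order *)

Section vanishing_order.
Context {R : realType}.
Implicit Types (f g : R -> R).

Definition vanish k f := exists2 M : R, 0 <= M & forall t, `|t| <= 4^-1 -> `|f t| <= M * `|t| ^+ k.

Lemma vanishM j k f g : vanish j f -> vanish k g -> vanish (j + k) (fun t => f t * g t).
Proof.
move=> [M M0 fM] [N N0 gN]; exists (M * N) => [|t t4]; first exact: mulr_ge0.
by rewrite normrM exprD mulrACA ler_pM// ?fM ?gN.
Qed.

Lemma vanishD k f g : vanish k f -> vanish k g -> vanish k (fun t => f t + g t).
Proof.
move=> [M M0 fM] [N N0 gN]; exists (M + N) => [|t t4]; first exact: addr_ge0.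
by rewrite mulrDl (le_trans (ler_normD _ _))// lerD ?fM ?gN.
Qed.

Lemma vanish_cst (c : R) : vanish 0 (fun=> c).
Proof. by exists `|c| => // t _; rewrite mulr1. Qed.

Lemma vanish_id : vanish 1 id. Proof. by exists 1 => // t _; rewrite mul1r. Qed.

Lemma vanish_lip f : lip1 f -> vanish 0 (fun t => f (1 + t)).
Proof.
move=> [M M0 fM]; exists (`|f 1| + M) => [|t t4]; first exact: addr_ge0.
rewrite mulr1 -(subrK (f 1) (f (1 + t))) addrC (le_trans (ler_normD _ _))// lerD2l.
by rewrite (le_trans (fM t t4))// ler_piMr//; lra.
Qed.

Lemma vanish_lip1 f : lip1 f -> vanish 1 (fun t => f (1 + t) - f 1).
Proof. by []. Qed.

Lemma vanish_eq k f g : (forall t : R, `|t| <= 4^-1 -> f t = g t) -> vanish k f -> vanish k g.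
Proof. by move=> e [M M0 fM]; exists M => // t t4; rewrite -e// fM. Qed.

Lemma lip1_expV k : lip1 (fun r : R => r ^- k).
Proof.
have -> : (fun r : R => r ^- k) = (fun r => r^-1 ^+ k) by apply/funext => r; rewrite exprVn.
exact/lip1X/lip1_inv.
Qed.

End vanishing_order.

(** * Second-order expansion of the eigenvalue *)

Section eigenvalue_trial.
Context {R : realType} {n : nat}.
Hypothesis n1 : (1 < n)%N.
Let n0 : (0 < n)%N := ltnW n1.
Variable l : R.
Hypotheses (l0 : 0 < l) (Wl : bessel n 0 l = 0).
Local Notation W j r := (bessel n j (l * r ^+ 2)).
Local Notation N := (n%:R : R).
Local Notation v1 := (2 * l * bessel n 1 l).
Local Notation V := (sA (fun _ : 'rV[R]_n => 1)).
Local Notation E := (energy_primitive (n := n) l).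
Local Notation M := (mass_primitive (n := n) l).

(** The value of [c] for which the trial function [v(r) - c r^2] vanishes at the radius [r]. *)
Definition radial_coef (r : R) := W 0 r * r ^- 2.
Definition dradial_coef (r : R) := 2 * l * (r * W 1 r * r ^- 2) + (- 2) * (W 0 r * r ^- 3).
Local Notation u := radial_coef.
Local Notation u1 := dradial_coef.

Lemma is_derive_radial_coef (r : R) : r != 0 -> is_derive r 1 u (u1 r).
Proof.
move=> r0; apply: (is_derive_eq (is_deriveM (is_derive_radial n1 l 0 r) (is_deriveVX 2 r0))).
by rewrite /u1 /GRing.scale/=; field.
Qed.

Let at1 (f : R -> R) : f (l * 1 ^+ 2) = f l. Proof. by rewrite expr1n mulr1. Qed.
Let lW j := @lip1_radial R n n1 l j.

Let lip1_u : lip1 u. Proof. by apply: lip1M; [exact: lW|exact: lip1_expV]. Qed.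
Let lip1_u1 : lip1 u1.
Proof.
by apply: lip1D; apply: lip1Z; apply: lip1M; try exact: lip1_expV; [apply: lip1M; [exact: lip1_id|exact: lW]|exact: lW].
Qed.

Let u_1 : u 1 = 0. Proof. by rewrite /u at1 Wl mul0r. Qed.
Let u1_1 : u1 1 = v1. Proof. by rewrite /u1 !at1 Wl !expr1n; field. Qed.

Let radial_coef_linear : vanish 2 (fun t => u (1 + t) - v1 * t).
Proof.
have [C C0 H] := lip1_u1; exists C => // t t4.
have D (r : R) : `|r - 1| <= 4^-1 -> is_derive r 1 (fun s : R => u s - v1 * s ^+ 1) (u1 r - v1).
  rewrite ler_norml => /andP[r4 _]; have r0 : r != 0 by rewrite gt_eqF//; lra.
  by apply: (is_derive_eq (is_deriveB (is_derive_radial_coef r0) (is_derive_pow v1 1 r))); rewrite expr0 !mulr1.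
have := mvt_bound C0 (or_intror D) (k := 1) _ t4; rewrite u_1 !expr1 => /(_ _)h.
rewrite (_ : u (1 + t) - v1 * t = u (1 + t) - v1 * (1 + t) - (0 - v1 * 1)); last by ring.
by apply: h => s s4; have := H s s4; rewrite u1_1 expr1.
Qed.

(** The first term comes from the curvature of the flux, the other two from the energy and the mass
    of the correction [c r^2] with [c] close to [v1 t]. *)
Definition energy_coef : R := (N - 1) / 2 + 4 / (N + 2) - l / (N + 4).

Lemma energy_quadratic : exists2 C : R, 0 <= C & forall t p : R, `|t| <= 4^-1 -> 0 <= p ->
  E (u (1 + t)) (u1 (1 + t) ^+ 2 * p) (1 + t) <=
  - v1 ^+ 2 * t + v1 ^+ 2 * (energy_coef * t ^+ 2 + p / (N + 2)) + C * `|t| * (t ^+ 2 + p).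
Proof.
have N2 : N + 2 != 0 by rewrite gt_eqF// addr_gt0// ltr0n.
have N4 : N + 4 != 0 by rewrite gt_eqF// addr_gt0// ltr0n.
pose A (r : R) := 4 / (N + 2) * r ^+ n.+2 + (- (l / (N + 4))) * r ^+ n.+4.
pose B (r : R) := (N + 2)^-1 * (u1 r ^+ 2 * r ^+ n.+2).
have lp k := @lip1_pow R k.
have lA : lip1 A by apply: lip1D; exact: lip1Z.
have [CB CB0 HB] : lip1 B by apply: lip1Z; apply: lip1M => //; exact: lip1X.
have [CE CE0 HE] : vanish 3 (fun t => E (u (1 + t)) 0 (1 + t) - (- v1 ^+ 2 * t + v1 ^+ 2 * energy_coef * t ^+ 2)).
  (* For [c = u r] the term [- 4 l c r^(n+2) W 1] is minus twice the flux, so together with the flux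
     itself it leaves minus the flux. *)
  have [F F0 HF] := flux_quadratic n1 Wl.
  have v3 : vanish 3 (fun t => (-1) * (2 * l * ((1 + t) ^+ n * (W 0 (1 + t) * W 1 (1 + t))) -
      (v1 ^+ 2 * t - (N - 1) / 2 * v1 ^+ 2 * t ^+ 2))).
    by apply: (vanishM (vanish_cst (-1))); exists F.
  have w3 : vanish (2 + (1 + 0)) (fun t => (u (1 + t) - v1 * t) * ((u (1 + t) - u 1 + v1 * t) * A (1 + t))).
    exact: (vanishM radial_coef_linear (vanishM (vanishD (vanish_lip1 lip1_u) (vanishM (vanish_cst v1) vanish_id)) (vanish_lip lA))).
  have z3 : vanish (0 + (1 + (1 + 1))) (fun t => v1 ^+ 2 * (t * (t * (A (1 + t) - A 1)))).
    exact: (vanishM (vanish_cst _) (vanishM vanish_id (vanishM vanish_id (vanish_lip1 lA)))).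
  apply: vanish_eq (vanishD v3 (vanishD w3 z3)) => t; rewrite ler_norml => /andP[t4 _].
  have t0 : 1 + t != 0 by rewrite gt_eqF//; lra.
  rewrite u_1 /A /E /energy_coef !expr1n (_ : (1 + t) ^+ n.+2 = (1 + t) ^+ n * (1 + t) ^+ 2); last by rewrite -exprD addn2.
  by rewrite /u; field; rewrite t0 N2 N4.
exists (CE + CB) => [|t p t4 p0]; first exact: addr_ge0.
have -> : E (u (1 + t)) (u1 (1 + t) ^+ 2 * p) (1 + t) = E (u (1 + t)) 0 (1 + t) + B (1 + t) * p.
  by rewrite /E /B; field; rewrite N2 N4.
have := HE t t4; have := HB t t4; rewrite !ler_norml => /andP[_ h1] /andP[_ h2].
have B1 : B 1 = v1 ^+ 2 / (N + 2) by rewrite /B u1_1 expr1n mulr1 mulrC.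
have h3 := ler_wpM2r p0 h1; rewrite B1 in h3.
have t3 : `|t| ^+ 3 = `|t| * t ^+ 2 by rewrite exprS real_normK ?num_real.
have x1 : 0 <= CB * (`|t| * t ^+ 2) by rewrite mulr_ge0// mulr_ge0// sqr_ge0.
have x2 : 0 <= CE * (`|t| * p) by rewrite !mulr_ge0.
rewrite t3 in h2; lra.
Qed.

(** Rellich's identity for the radial eigenfunction: its mass along a ray is determined by the slope
    at the boundary. *)
Let mass1 : M 0 1 = v1 ^+ 2 / (2 * l).
Proof. by rewrite /M !at1 Wl !expr1n; field; rewrite !gt_eqF ?addr_gt0 ?ltr0n. Qed.

Lemma mass_linear : lip1 (fun r => M (u r) r) /\ M (u 1) 1 = v1 ^+ 2 / (2 * l).
Proof.
split; last by rewrite u_1 mass1.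
have lp k := @lip1_pow R k.
have d (c : R) f : lip1 f -> lip1 (fun r => c * u r * f r).
  by move=> lf; apply: lip1M => //; exact: lip1Z.
have -> : (fun r => M (u r) r) = (fun r => 2 * l * (r ^+ n.+2 * (W 1 r * W 1 r)) +
  2^-1 * (r ^+ n * (W 0 r * W 0 r)) + ((N - 2) * (r ^+ n * (W 0 r * W 1 r)) +
  4 * u r * (r ^+ n.+2 * W 1 r)) + ((- (4 / l)) * u r * (r ^+ n * W 0 r) +
  (- (8 * N / l)) * u r * (r ^+ n * W 1 r) + (N + 4)^-1 * u r * (u r * r ^+ n.+4))).
  by apply/funext => r; rewrite /M; field; rewrite gt_eqF// gt_eqF// addr_gt0// ltr0n.
by repeat (apply: lip1D); [apply: lip1Z|apply: lip1Z|apply: lip1Z|apply: d|apply: d|apply: d|apply: d];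
  repeat (apply: lip1M => //).
Qed.

Lemma primitive0 (c g : R) : M c 0 = 0 /\ E c g 0 = 0.
Proof. by rewrite /M /E !expr0n (gtn_eqF n0)/= !(mul0r, mulr0, addr0). Qed.

(* The mass of v is the integral of r^(n-1) v(r)^2 over (0, 1). *)
Lemma radial_slope_neq0 : (forall t : R, 0 <= t < l -> 0 < bessel n 0 t) -> 0 < v1 ^+ 2.
Proof.
move=> pos; have i0 : 0 < (2 * l)^-1 by rewrite invr_gt0 mulr_gt0.
rewrite -(pmulr_lgt0 _ i0) -mass1.
have D (r : R) : r \in `]0, 1[%R -> is_derive r 1 (M 0) (r ^+ n.-1 * (W 0 r - r ^+ 2 * 0) ^+ 2).
  by move=> _; exact: mass_derive.
have [|r] := MVT (@ltr01 R) D.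
  apply: derivable_within_continuous => r _; by have [] := mass_derive n1 l0 0 r.
rewrite in_itv/= => /andP[r0 r1]; rewrite subr0 mulr1 (primitive0 0 0).1 subr0.
move=> ->; rewrite mulr0 subr0 mulr_gt0 ?exprn_gt0//; apply: pos.
by rewrite mulr_ge0 ?sqr_ge0 ?(ltW l0)//= gtr_pMr// expr_lt1// ltW.
Qed.

Section trial_function.
Variables (d : R) (h : 'rV[R]_n -> R).
Hypotheses (d4 : 0 < d <= 4^-1) (ah : admissible d h).
Let c y := u (1 + h y).
Let G y := u1 (1 + h y) *: (0 + tgrad h y).
Let phi x := bessel n 0 (l * dot x x) - dot x x * hextend c x.

Let r_neq0 y : unit_sphere y -> 1 + h y != 0.
Proof. by move=> /(adm_radius d4 ah) r; rewrite gt_eqF//; lra. Qed.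

Let cW j (t : R) : {for t, continuous (bessel n j : R -> R)}.
Proof. exact: is_derive_continuous (is_derive_bessel n0 j t). Qed.

Let sW j : scont (fun y => W j (1 + h y)).
Proof.
apply: (scont_comp (u := bessel n j)) => [y _|]; first exact: cW.
by have s1 := adm_scont1 ah; scont.
Qed.

Let sV k : scont (fun y => (1 + h y) ^- k).
Proof.
apply: (scont_comp (u := fun s : R => s^-1)) => [y y1|]; last by apply: scontX; exact: adm_scont1 ah.
by apply: cvgV; [rewrite expf_neq0// r_neq0|exact: cvg_id].
Qed.

Let s1 := adm_scont1 ah.

Let su1 : scont (fun y => u1 (1 + h y)).
Proof. by rewrite /dradial_coef; scont. Qed.

Let sG : sgrad c G.
Proof.
apply: sgrad_comp (sgradD (sgrad_cst 1) (adm_sgrad ah)) _ su1 => y y1.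
exact: (is_derive_radial_coef (r_neq0 y1)).
Qed.

Let scc : scont c. Proof. exact: sgrad_scont sG. Qed.

Let gphi x : isgrad phi x ((2 * l * bessel n 1 (l * dot x x)) *: x - ((2 * c (nx x)) *: x + enorm x *: G (nx x))).
Proof.
apply: isgradB (isgrad_quad sG x); apply: isgrad_eq.
  exact: isgrad_comp1 (isgradZ l (isgrad_dotxx x)) (is_derive_bessel n0 0 _).
by rewrite !scalerA; congr (_ *: _); ring.
Qed.

Lemma trial_C1 : C1 phi.
Proof.
apply: C1B (quad_C1 sG).
apply: (@C1_of_isgrad _ _ _ (fun x => (2 * l * bessel n 1 (l * dot x x)) *: x)) => [x|i x].
  apply: (isgrad_eq (isgrad_comp1 (isgradZ l (isgrad_dotxx x)) (is_derive_bessel n0 0 _))).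
  by rewrite !scalerA; congr (_ *: _); ring.
rewrite (_ : (fun x => _) = (fun x : 'rV[R]_n => 2 * l * bessel n 1 (l * dot x x) * x 0 i)); last by apply/funext => z; rewrite mxE.
have k (a : R) := @cst_continuous 'rV[R]_n R a x.
exact: (continuous_mul (continuous_mul (k _) (continuous_comp (continuous_mul (k l) (@continuous_dotxx _ _ x)) (@cW 1 _))) (@continuous_coord _ _ i x)).
Qed.

Let ray y (r : R) : unit_sphere y -> 0 < r -> phi (r *: y) = W 0 r - r ^+ 2 * c y /\
  dot (grad phi (r *: y)) (grad phi (r *: y)) = (2 * l * r * W 1 r - 2 * c y * r) ^+ 2 + r ^+ 2 * dot (G y) (G y).
Proof.
move=> y1 r0; have e : dot (r *: y) (r *: y) = r ^+ 2.
  by rewrite -enorm_sqr enorm_ray.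
split; first by rewrite /phi e hextendZ// hextend_sphere.
rewrite (isgrad_grad (gphi _)) e nxZ// nx_id// enorm_ray//.
move: (G y) (sgrad_tangent sG y1) => g gy; rewrite !scalerA opprD addrA -scalerBl -[- (r *: g)]scaleNr dot_radial//; ring.
Qed.

Let zero_pow : (0 : R) ^+ n.-1 = 0. Proof. by rewrite expr0n -subn1 subn_eq0 leqNgt n1. Qed.

Lemma trial_boundary x : closure (starball h) x -> ~ starball h x -> phi x = 0.
Proof.
move=> cx nx'; have [x0 e] := starball_boundary n1 d4 ah cx nx'.
have y1 : unit_sphere (nx x) by exact: enorm_nx.
have r0 : 0 < 1 + h (nx x) by have := adm_radius d4 ah y1; lra.
rewrite -[x]enorm_nxE e (ray y1 r0).1 /c /radial_coef; field; exact: r_neq0.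
Qed.

Lemma scont_trial_mass : scont (fun y => M (u (1 + h y)) (1 + h y)).
Proof. by rewrite /mass_primitive; scont. Qed.

Lemma scont_trial_energy :
  scont (fun y => E (u (1 + h y)) (u1 (1 + h y) ^+ 2 * dot (tgrad h y) (tgrad h y)) (1 + h y)).
Proof. by have sg := scont_grad2 ah; rewrite /energy_primitive; scont. Qed.

Lemma trial_mass : \int[leb]_(x in starball h) phi x ^+ 2 = N * sA (fun y => M (c y) (1 + h y)).
Proof.
have cp := C1_continuous trial_C1.
apply: (Rintegral_starball_primitive n1 d4 ah (K := fun y r => M (c y) r)) => [|y r y1|y|].
- exact: continuous_sqr.
- rewrite le_eqVlt => /predU1P[<-|r0]; apply: (is_derive_eq (mass_derive n1 l0 (c y) _)).
    by rewrite zero_pow !mul0r.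
  by rewrite (ray y1 r0).1.
- by have [] := primitive0 (c y) 0.
exact: scont_trial_mass.
Qed.

Lemma trial_energy : \int[leb]_(x in starball h) enorm (grad phi x) ^+ 2 - l * \int[leb]_(x in starball h) phi x ^+ 2 =
  N * sA (fun y => E (c y) (u1 (1 + h y) ^+ 2 * dot (tgrad h y) (tgrad h y)) (1 + h y)).
Proof.
have cp := C1_continuous trial_C1; have cg := continuous_sqr_grad trial_C1.
have c2 := continuous_sqr cp.
have c3 : continuous (fun x => l * phi x ^+ 2) by move=> x; exact: (continuous_mul (@cst_continuous _ _ l x) (c2 x)).
have mS := open_measurable_rV (open_starball n1 d4 ah); have i := integrable_starball n1 d4 ah.
rewrite -(RintegralZl l mS (i _ c2)) -(RintegralB mS (i _ cg) (i _ c3)).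
have g2 y : dot (G y) (G y) = u1 (1 + h y) ^+ 2 * dot (tgrad h y) (tgrad h y).
  by rewrite /G add0r dotZl dotZr; ring.
apply: (Rintegral_starball_primitive n1 d4 ah (K := fun y r => E (c y) _ r)) => [x|y r y1|y|].
- exact: (continuous_sub (cg x) (c3 x)).
- rewrite le_eqVlt => /predU1P[<-|r0]; apply: (is_derive_eq (energy_derive n1 l (c y) _ _)).
    by rewrite zero_pow !mul0r.
  by rewrite enorm_sqr (ray y1 r0).1 (ray y1 r0).2 g2.
- by have [] := primitive0 (c y) (u1 (1 + h y) ^+ 2 * dot (tgrad h y) (tgrad h y)).
exact: scont_trial_energy.
Qed.

End trial_function.

Lemma mass_bounds (d : R) (h : 'rV[R]_n -> R) : 0 <= d -> admissible d h ->
  [/\ 0 <= L2mass h <= d ^+ 2 * V & 0 <= gradmass h <= d ^+ 2 * V].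
Proof.
move=> d0 ah; rewrite -sA_cst; have sh := adm_scont ah.
split; apply/andP; split; try by apply: sA_ge0 => y _; rewrite ?sqr_ge0 ?dotxx_ge0.
  apply: le_sA => [||y y1]; [exact: scontX|exact: scont_cst|].
  by apply: ler_sqr_norm; exact: adm_le ah _ y1.
apply: le_sA => [||y y1]; [exact: scont_grad2 ah|exact: scont_cst|].
by rewrite -enorm_sqr lerXn2r ?nnegrE ?enorm_ge0//; exact: adm_grad ah _ y1.
Qed.

(** The Rayleigh quotient is used as [(Lambda - l) mass <= energy - l mass]. The right side is of
    second order already, because its linear term is a multiple of the mean of [h]; hence the mass
    is needed only to order zero. *)
Lemma eigenvalue_quadratic : (forall t : R, 0 <= t < l -> 0 < bessel n 0 t) ->
  exists C d0 : R, [/\ 0 <= C, 0 < d0 <= 4^-1 & forall d (h : 'rV[R]_n -> R), 0 < d <= d0 -> admissible d h ->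
  eigenvalue1 (starball h) <= l + 2 * l / V * (energy_coef * L2mass h + gradmass h / (N + 2)) +
    C * d * (L2mass h + gradmass h)].
Proof.
move=> pos; have v0 := radial_slope_neq0 pos; have V0 : 0 < V := sA1_gt0 n1.
have [CE CE0 HE] := energy_quadratic; have [[CM CM0 HM] M1] := mass_linear.
pose k := energy_coef; pose m0 := v1 ^+ 2 / (2 * l); have m00 : 0 < m0 by rewrite divr_gt0// mulr_gt0.
pose Q := v1 ^+ 2 * (`|k| + 1).
have Q0 : 0 <= Q by rewrite mulr_ge0 ?sqr_ge0// addr_ge0.
have K0 : 0 <= CE + Q * CM / m0 by rewrite addr_ge0// divr_ge0 ?(ltW m00)// mulr_ge0.
pose C := 2 * (CE + Q * CM / m0) / (V * m0).
have C0 : 0 <= C by apply: divr_ge0; [exact: mulr_ge0|rewrite ltW// mulr_gt0].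
(* Keeps the mass of the trial function above half of its unperturbed value. *)
pose d0 := Num.min 4^-1 (m0 / (2 * (CM + 1))).
exists C, d0; split=> //.
  by rewrite ge_min lexx andbT lt_min invr_gt0 ltr0n divr_gt0// mulr_gt0// ltr_wpDl.
move=> d h /andP[dp]; rewrite le_min => /andP[d4' dm] ah.
have d4 : 0 < d <= 4^-1 by rewrite dp.
rewrite ler_pdivlMr in dm; last by rewrite mulr_gt0// ltr_wpDl.
have [/andP[a0 _] /andP[b0 _]] := mass_bounds (ltW dp) ah.
set a := L2mass h in a0 *; set b := gradmass h in b0 *.
have se := scont_trial_energy d4 ah; have sm := scont_trial_mass d4 ah.
have sh := adm_scont ah; have sg := scont_grad2 ah; have sh2 : scont (fun y => h y ^+ 2) by exact: scontX.
have hd y : unit_sphere y -> `|h y| <= d by exact: adm_le ah y.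
pose m := sA (fun y => M (u (1 + h y)) (1 + h y)).
have N2 : 0 < N + 2 by rewrite addr_gt0// ltr0n.
pose q := v1 ^+ 2 * (k * a + b / (N + 2)).
have eE : sA (fun y => E (u (1 + h y)) (u1 (1 + h y) ^+ 2 * dot (tgrad h y) (tgrad h y)) (1 + h y)) <= q + CE * d * (a + b).
  have -> : q + CE * d * (a + b) = sA (fun y => - v1 ^+ 2 * h y + ((v1 ^+ 2 * k + CE * d) * h y ^+ 2 +
      (v1 ^+ 2 / (N + 2) + CE * d) * dot (tgrad h y) (tgrad h y))).
    rewrite sAD; [|by scont|by scont].
    rewrite sAD ?sAZ// ?(adm_mean ah); [|by scont|by scont].
    by rewrite -[sA (fun y => h y ^+ 2)]/a -[sA (fun y => dot _ _)]/b /q; field; rewrite gt_eqF.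
  apply: le_sA => // [|y y1]; first by scont.
  have g0 := dotxx_ge0 (tgrad h y); have h4 := le_trans (hd y y1) d4'.
  apply: (le_trans (HE _ _ h4 g0)); rewrite -/k; move: (dot _ _) g0 => p p0.
  have := ler_wpM2l CE0 (ler_wpM2r (addr_ge0 (sqr_ge0 (h y)) p0) (hd y y1)); lra.
have mE : `|m - V * m0| <= CM * d * V.
  have -> : m - V * m0 = sA (fun y => M (u (1 + h y)) (1 + h y) - m0).
    by rewrite sAB//; [rewrite [sA (fun=> m0)]sA_cst mulrC|exact: scont_cst].
  apply: norm_sA_le => [|y y1]; first by apply: scontB => //; exact: scont_cst.
  have h4 := le_trans (hd y y1) d4'; rewrite /m0 -M1; apply: (le_trans (HM _ h4)).
  by rewrite ler_wpM2l// hd.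
have m2 : V * m0 / 2 <= m.
  move: mE; rewrite ler_norml => /andP[+ _]; have := ler_wpM2l (ltW V0) dm; have : 0 <= V * d by rewrite mulr_ge0// ltW.
  lra.
have mp : 0 < m by apply: lt_le_trans m2; rewrite divr_gt0// mulr_gt0.
have key : (eigenvalue1 (starball h) - l) * m <= q + CE * d * (a + b).
  apply: le_trans eE; have NR : 0 < N by rewrite ltr0n.
  have IM := trial_mass d4 ah; have IE := trial_energy d4 ah.
  have P : 0 < \int[leb]_(x in starball h) (bessel n 0 (l * dot x x) - dot x x * hextend (fun y => u (1 + h y)) x) ^+ 2.
    by rewrite IM mulr_gt0.
  have := eigenvalue1_ub n1 (open_starball n1 d4 ah) (ltr0Sn R 1) (starball_bounded n1 d4 ah) (trial_C1 d4 ah) (@trial_boundary d h d4 ah) P.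
  move=> Ke; rewrite -(ler_pM2l NR) -IE; rewrite IM -/m in Ke *; lra.
rewrite -addrA -lerBlDl -(ler_pM2r mp); apply: (le_trans key).
have qQ : `|q| <= Q * (a + b).
  rewrite /q /Q normrM (ger0_norm (sqr_ge0 _)) -[leRHS]mulrA ler_wpM2l ?sqr_ge0// (le_trans (ler_normD _ _))//.
  have b2 : b / (N + 2) <= b by rewrite ler_pdivrMr// ler_peMr//; have := ler0n R n; lra.
  rewrite normrM (ger0_norm a0) (ger0_norm (divr_ge0 b0 (ltW N2))); have := mulr_ge0 (normr_ge0 k) b0; lra.
have p0 : 0 < V * m0 by exact: mulr_gt0.
have vn : bessel n 1 l != 0 by apply: contraTneq v0 => ->; rewrite mulr0 expr0n ltxx.
have -> : 2 * l / V * (k * a + b / (N + 2)) = q / (V * m0).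
  by rewrite /q /m0; field; rewrite vn !gt_eqF.
have dev : q - Q * CM / m0 * (d * (a + b)) <= q / (V * m0) * m.
  have -> : q / (V * m0) * m = q + q * (m - V * m0) / (V * m0) by field; rewrite !gt_eqF.
  have : `|q * (m - V * m0)| <= Q * (a + b) * (CM * d * V) by rewrite normrM ler_pM.
  rewrite ler_norml => /andP[+ _]; rewrite -(ler_pM2r (_ : 0 < (V * m0)^-1)) ?invr_gt0// mulNr.
  rewrite (_ : Q * (a + b) * (CM * d * V) / (V * m0) = Q * CM / m0 * (d * (a + b))); first lra.
  by field; rewrite !gt_eqF.
have big : (CE + Q * CM / m0) * (d * (a + b)) <= C * d * (a + b) * m.
  have -> : (CE + Q * CM / m0) * (d * (a + b)) = C * d * (a + b) * (V * m0 / 2) by rewrite /C; field; rewrite !gt_eqF.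
  by rewrite ler_wpM2l// mulr_ge0 ?addr_ge0// mulr_ge0// ltW.
lra.
Qed.

End eigenvalue_trial.

(** * Signs of the coefficients and the product estimate *)

Section numeric.
Context {R : realType}.

(* Young's inequality for the pair (1 + x, 1) with exponents q and m. *)
Lemma bernoulli_powR m (x : R) (q := m%:R / (m%:R - 1) : R) : (1 < m)%N -> -1 <= x ->
  1 + q * x <= (1 + x) `^ q.
Proof.
move=> m1 x1; have m1R : 1 < m%:R :> R by rewrite ltr1n.
have q0 : 0 < q by rewrite divr_gt0//; lra.
have := @conjugate_powR R (1 + x) 1 q m%:R; rewrite powR1 mulr1 mul1r.
have -> : q^-1 + m%:R^-1 = 1 by rewrite /q; field; rewrite !gt_eqF//; lra.
have x0 : 0 <= 1 + x by lra.
have m0 : 0 < m%:R :> R by lra.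
move=> /(_ x0 ler01 q0 m0 erefl)/(ler_wpM2l (ltW q0)).
have qm : q * m%:R^-1 = q - 1 by rewrite /q; field; rewrite !gt_eqF//; lra.
rewrite [q * _ in X in _ <= X -> _]mulrDr qm mulrCA divff ?gt_eqF// mulr1; lra.
Qed.

(* The coefficients come from the torsion, the eigenvalue and the perimeter, in this order. *)
Lemma coefficients_negative (N l : R) (q := N / (N - 1))
  (a := (N + 2) * (N + 1) / 2 - 2 * (N + 2) + 2 * ((N - 1) / 2 + 4 / (N + 2) - l / (N + 4)) - q * ((N - 1) * (N - 2) / 2))
  (b := 2 / (N + 2) - q / 2) : 2 <= N -> N ^+ 2 / 4 + 2 * N <= l ->
  exists2 k : R, 0 < k & forall x y : R, 0 <= x -> 2 * N * x <= y -> a * x + b * y <= - k * (x + y).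
Proof.
move=> N2 hl; have [p2 p4 p1] : [/\ 0 < N + 2, 0 < N + 4 & 0 < N - 1] by split; lra.
(* For the gradient term, the loss [2 / (N + 2)] from the eigenvalue is smaller than the gain
   [q / 2] from the perimeter. *)
have b0 : b < 0.
  have -> : b = - ((N - 1) ^+ 2 + 3) / (2 * (N - 1) * (N + 2)) by rewrite /b /q; field; rewrite !gt_eqF.
  rewrite mulNr oppr_lt0 divr_gt0 ?mulr_gt0//; have := sqr_ge0 (N - 1); lra.
(* On the line [y = 2 N x], extremal in the Poincare inequality, the bound on [l] decides the
   sign. *)
have ab0 : a + 2 * N * b < 0.
  have -> : a + 2 * N * b = - ((3 * N ^+ 3 + 8 * N ^+ 2 + 4 * N) / ((N + 4) * (N - 1) * (N + 2)) +
      2 / (N + 4) * (l - (N ^+ 2 / 4 + 2 * N))) by rewrite /a /b /q; field; rewrite !gt_eqF.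
  have N0 : 0 < N by lra.
  rewrite oppr_lt0 ltr_wpDr//; first by rewrite mulr_ge0 ?subr_ge0// divr_ge0// ltW.
  by rewrite divr_gt0 ?mulr_gt0// !addr_gt0 ?mulr_gt0 ?exprn_gt0.
(* Both [b] and [a + 2 N b] stay nonpositive after [k] is added to the two coefficients. *)
pose k := Num.min (- b) (- (a + 2 * N * b) / (2 * N + 1)).
have N1 : 0 < 2 * N + 1 by lra.
exists k => [|x y x0 yx]; first by rewrite lt_min !oppr_gt0 b0/= divr_gt0// oppr_gt0.
have kb : b + k <= 0 by rewrite -lerBrDl sub0r ge_min lexx.
have ka : a + k + 2 * N * (b + k) <= 0.
  have : k <= - (a + 2 * N * b) / (2 * N + 1) by rewrite ge_min lexx orbT.
  rewrite ler_pdivlMr//; lra.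
have := mulr_ge0_le0 x0 ka; have : (b + k) * (y - 2 * N * x) <= 0 by rewrite mulr_le0_ge0// subr_ge0.
lra.
Qed.

(** Turns the additive estimate of the relative perturbations into a multiplicative one. The
    products of two perturbations are at most a constant times [d s]; they are absorbed by half of
    the gain [k s] once [d] is small, and [B] collects the constants. *)
Lemma product_bound (k C A q : R) : 0 < k -> 0 <= C -> 0 <= A -> 0 <= q -> exists2 d0 : R, 0 < d0 &
  forall d s tau sigma p : R, 0 < d <= d0 -> 0 <= s <= d -> `|tau| <= A * s -> `|sigma| <= A * s -> `|p| <= A * s ->
  tau + sigma - q * p <= (C * d - k) * s ->
  [/\ 0 <= 1 + tau, 0 <= 1 + sigma, 0 < 1 + q * p, k / 2 * s < 1 & (1 + tau) * (1 + sigma) <= (1 + q * p) * (1 - k / 2 * s)].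
Proof.
move=> k0 C0 A0 q0; pose B := C + A ^+ 2 + A + q * A + k + q * A * k + 1.
have qA : 0 <= q * A by rewrite mulr_ge0.
have qAk : 0 <= q * A * k by rewrite mulr_ge0// ltW.
have B0 : 0 < B by rewrite /B; have := sqr_ge0 A; lra.
exists (Num.min 1 k / (2 * B)) => [|d s tau sigma p /andP[d0 dd] /andP[s0 sd] ht hs hp H].
  by rewrite divr_gt0 ?mulr_gt0// lt_min ltr01.
rewrite ler_pdivlMr ?mulr_gt0// le_min in dd; case/andP: dd => dB1 dBk.
have sB : s * B <= d * B by rewrite ler_wpM2r// ltW.
have As : 0 <= A * s by rewrite mulr_ge0.
have qAs : 0 <= q * A * s by rewrite mulr_ge0.
have [Cs ks qks A2s] : [/\ 0 <= C * s, 0 <= k * s, 0 <= q * A * k * s & 0 <= A ^+ 2 * s].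
  by rewrite !mulr_ge0 ?sqr_ge0 ?(ltW k0).
have qp : `|q * p| <= q * A * s by rewrite normrM (ger0_norm q0) -mulrA ler_wpM2l.
have ts : tau * sigma <= A ^+ 2 * s * s.
  apply: (le_trans (ler_norm _)); rewrite normrM (_ : A ^+ 2 * s * s = A * s * (A * s)); last by ring.
  exact: ler_pM.
have s1 : B * s = C * s + A ^+ 2 * s + A * s + q * A * s + k * s + q * A * k * s + s by rewrite /B; ring.
move: ht hs qp; rewrite !ler_norml => /andP[t1 t2] /andP[g1 g2] /andP[p1 p2].
have small : [/\ 0 <= 1 + tau, 0 <= 1 + sigma, 0 < 1 + q * p & k / 2 * s < 1] by split; lra.
case: small => a1 a2 a3 a4; split=> //.
have x1 : q * p * (k / 2 * s) <= q * A * k * s * s.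
  have := ler_pM _ _ p2 (lexx (k / 2 * s)).
  have : q * p * (k / 2 * s) <= q * A * s * (k / 2 * s) by rewrite ler_wpM2r//; lra.
  have : 0 <= q * A * k * s * s by rewrite mulr_ge0.
  lra.
have x2 : (C * d + A ^+ 2 * d + q * A * k * d) * s <= k / 2 * s.
  rewrite ler_wpM2r//.
  have : 0 <= d * (A + q * A + k + 1) by rewrite mulr_ge0 ?(ltW d0)//; lra.
  rewrite /B in dBk; lra.
have x3 : (A ^+ 2 + q * A * k) * s * s <= (A ^+ 2 + q * A * k) * s * d.
  by rewrite ler_wpM2l// mulr_ge0// addr_ge0// sqr_ge0.
lra.
Qed.

End numeric.

(** * From the norms on the sphere to admissibility *)

Section sphere_norms.
Context {R : realType} {n : nat}.
Hypothesis n1 : (1 < n)%N.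
Implicit Types (f h : 'rV[R]_n -> R) (y : 'rV[R]_n).

Lemma sA_gt0 f y : scont f -> (forall z, unit_sphere z -> 0 <= f z) -> unit_sphere y -> 0 < f y -> 0 < sA f.
Proof.
move=> sf f0 y1 fy; pose x := 2^-1 *: y.
have x0 : x != 0 by rewrite scaler_eq0 negb_or unit_sphere_neq0// invr_eq0 pnatr_eq0.
have fx : hextend f x = f y by rewrite hextendZ ?hextend_sphere.
have xb : unit_ball x by rewrite /unit_ball/= enorm_ray//; lra.
have f2 : 0 < f y / 2 by rewrite divr_gt0.
have /cvgrPdist_lt/(_ _ f2) := sf x x0.
move=> /(filterI (filterI (near_neq0 x0) (open_nbhs_nbhs (conj (@open_unit_ball R n) xb)))).
move=> /nbhs_ballP[r /= r0 H].
have B z : enorm (z - x) < r -> pball z /\ f y / 2 <= hextend f z.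
  move=> zr; have [|[z0 z1]] := H z.
    by rewrite -ball_normE/= distrC; exact: le_lt_trans (norm_le_enorm _) zr.
  by rewrite fx ltr_norml => /andP[_ h]; split=> //; lra.
apply: (Rintegral_gt0 (@measurable_pball R n) (integrable_hextend sf) r0 f2) => z [].
- by move=> /B[].
- by move=> z0 _; apply: f0; exact: enorm_nx.
- by move=> /B[].
Qed.

Lemma sphere_integral_scont : exists2 k : R, 0 < k & forall f, scont f -> sphere_integral f = k * sA f.
Proof.
have [k k0 H] := @sphere_integral_sA R n n1; exists k => // f sf.
have e y : unit_sphere y -> hextend f y = f y by exact: hextend_sphere.
rewrite -(eq_sA e) -H; first by apply: eq_Rintegral => y; rewrite inE => /e.
by apply: continuous_in_subspaceT => y; rewrite inE => /unit_sphere_neq0; exact: sf.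
Qed.

Lemma C2gamma_norm_bounds (gamma D : R) h y : (C2gamma_norm gamma h <= D%:E)%E -> unit_sphere y ->
  `|h y| <= D /\ forall i, `|tpartial i h y| <= D.
Proof.
move=> hD y1; have up f : (`|f y|%:E <= sphere_sup f)%E by apply: ereal_sup_ubound; exists y.
have s0 f : (0 <= sphere_sup f)%E by apply: le_trans (up f); rewrite lee_fin.
(* The antipodal point provides a pair of distinct points, so the supremum is not that of the empty
   set. *)
have h0 f : (0 <= sphere_holder gamma f)%E.
  apply: (@le_trans _ _ (`|f y - f (- y)| / enorm (y - - y) `^ gamma)%:E).
    by rewrite lee_fin divr_ge0// powR_ge0.
  apply: ereal_sup_ubound; exists y, (- y); split => //; first by rewrite /unit_sphere/= enormN.
  by rewrite -subr_eq0 opprK -mulr2n -scaler_nat scaler_eq0 pnatr_eq0/= unit_sphere_neq0.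
have T i : (sphere_sup (tpartial i h) <= \sum_i sphere_sup (tpartial i h))%E.
  by rewrite (bigD1 i)//= leeDl// sume_ge0.
have S1 : (0 <= \sum_i sphere_sup (tpartial i h))%E by exact: sume_ge0.
have S2 : (sphere_sup h + \sum_i sphere_sup (tpartial i h) <= D%:E)%E.
  by apply: le_trans hD; rewrite leeDl// sume_ge0// => i _; rewrite sume_ge0// => j _; exact: adde_ge0.
split=> [|i]; rewrite -lee_fin; apply: le_trans S2; apply: (le_trans (up _)); first by rewrite leeDl.
by apply: (le_trans (T i)); rewrite leeDr.
Qed.

End sphere_norms.

Lemma torsion_ge0 {R : realType} {n : nat} (Om : set 'rV[R]_n) : 0 <= torsion Om.
Proof.
rewrite /torsion; set E := [set t | _]; have [[[t Et] bE]|nE] := pselect (has_sup E); last by rewrite sup_out.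
apply: le_trans (ub_le_sup bE Et); case: Et => phi [g [_ ->]].
by rewrite divr_ge0 ?sqr_ge0//; apply: Rintegral_ge0 => x _; exact: sqr_ge0.
Qed.

(** * Assembly of the three expansions *)

Section stability.
Context {R : realType} {n : nat}.
Hypothesis n1 : (1 < n)%N.
Local Notation N := (n%:R : R).
Local Notation V := (sA (fun _ : 'rV[R]_n => 1)).

Lemma mass0 : L2mass (fun _ : 'rV[R]_n => 0 : R) = 0 /\ gradmass (fun _ : 'rV[R]_n => 0 : R) = 0.
Proof.
have := mass_bounds (lexx 0) (@admissible0 R n _ (lexx 0)); rewrite expr0n/= mul0r.
by move=> [/le_anti <- /le_anti <-].
Qed.

Lemma stability : exists c0 d0 : R, [/\ 0 < c0, 0 < d0 & forall d (h : 'rV[R]_n -> R), 0 < d <= d0 -> admissible d h ->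
  Gfun (starball h) + c0 * (L2mass h + gradmass h) <= Gfun (@unit_ball R n)].
Proof.
have V0 : 0 < V := sA1_gt0 n1; have N2 : 2 <= N by rewrite ler_nat.
have N0 : 0 < N by lra.
have [l [l0 Wl pos lB]] := @bessel_first_zero R n n1.
have [CT [dT [CT0 /andP[dT0 dT4] HT]]] := @torsion_quadratic R n n1.
have [CL [dL [CL0 /andP[dL0 dL4] HL]]] := eigenvalue_quadratic n1 l0 Wl pos.
have [CP CP0 HP] := @perimeter_quadratic R n n1.
have [z1 z2] := mass0.
(* The eigenvalue expansion at [h = 0] bounds the eigenvalue of the ball by [l] from above, which
   transfers Barta's lower bound to [l]. *)
have hl : N ^+ 2 / 4 + 2 * N <= l.
  have dL1 : 0 < dL <= dL by rewrite dL0/=.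
  have := HL dL _ dL1 (admissible0 (ltW dL0)); rewrite starball0// z1 z2 !mulr0 mul0r !addr0 !mulr0 !addr0.
  exact: le_trans (ball_eigenvalue_lower n1).
(* The perimeter expansion at [h = 0] supplies the lower bound. *)
have PB : perimeter (@unit_ball R n) = (N * V)%:E.
  have d4 : 0 < (4^-1 : R) <= 4^-1 by rewrite invr_gt0 ltr0n/=.
  have := HP _ _ d4 (admissible0 (ltW (proj1 (andP d4)))); rewrite starball0// z1 z2 !mulr0 mul0r !addr0 !mulr0 subr0 => P.
  by apply/le_anti; rewrite perimeter_ball_le.
pose q := N / (N - 1); have q0 : 0 < q by rewrite divr_gt0//; lra.
have [k k0 HK] := coefficients_negative N2 hl.
have n_1 : n.-1%:R = N - 1 by rewrite -[in RHS](prednK (ltnW n1)) -natr1 addrK.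
have n_2 : n.-2%:R = N - 2 by rewrite -[in RHS](subnK n1) natrD addrK subn2.
pose CT' := N * (N + 2) * CT; pose CL' := CL * V / l.
have CT'0 : 0 <= CT' by rewrite !mulr_ge0// ?ler_wpDr// ltW.
have CL'0 : 0 <= CL' by rewrite divr_ge0 ?(ltW l0)// mulr_ge0// ltW.
pose cT := (N + 2) * (N + 1) / 2 - 2 * (N + 2); pose cL := 2 * energy_coef (n := n) l.
pose cP := (N - 1) * (N - 2) / 2; pose bL := 2 / (N + 2).
pose A := `|cT| + `|cL| + `|cP| + `|bL| + 1 + CT' + CL' + CP.
have A0 : 0 <= A by rewrite /A; do ?[apply: addr_ge0 => //].
pose C := CT' + CL' + q * CP.
have C0 : 0 <= C by rewrite !addr_ge0// mulr_ge0// ltW.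
have [d1 d10 HB] := product_bound k0 C0 A0 (ltW q0).
pose K := V / (N * n.+2%:R) * l / (N * V) `^ q.
have T10 : 0 < V / (N * n.+2%:R) by rewrite divr_gt0// mulr_gt0.
have NV : 0 < N * V by exact: mulr_gt0.
have K0 : 0 < K by rewrite divr_gt0 ?powR_gt0// mulr_gt0.
pose d0 := Num.min (Num.min dT dL) (Num.min d1 4^-1).
exists (K * (k / 2) / V), d0; split; first by rewrite divr_gt0// mulr_gt0// divr_gt0.
  by rewrite !lt_min dT0 dL0 d10 invr_gt0 ltr0n.
move=> d h /andP[dp]; rewrite !le_min => /andP[/andP[ddT ddL] /andP[dd1 dd4]] ah.
have [/andP[a0 aV] /andP[b0 bV]] := mass_bounds (ltW dp) ah.
have ab := poincare n1 (ltW dp) ah.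
have dB e : d <= e -> 0 < d <= e by rewrite dp.
have T := HT d h (dB _ ddT) ah; have L := HL d h (dB _ ddL) ah; have P := HP d h (dB _ dd4) ah.
set a := L2mass h in a0 aV ab P L T *; set b := gradmass h in b0 bV ab P L T *.
pose x := a / V; pose y := b / V; pose s := x + y.
have x0 : 0 <= x by rewrite divr_ge0// ltW.
have y0 : 0 <= y by rewrite divr_ge0// ltW.
have aE : a = x * V by rewrite divfK// gt_eqF.
have bE : b = y * V by rewrite divfK// gt_eqF.
have xy : 2 * N * x <= y by rewrite ler_pdivlMr//; apply: le_trans ab; apply: eq_ler; rewrite aE mulrA.
(* Both normalised masses are at most [d^2], and [2 d^2 <= d]. *)
have sd : 0 <= s <= d.
  have : x <= d ^+ 2 by rewrite ler_pdivrMr.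
  have : y <= d ^+ 2 by rewrite ler_pdivrMr.
  rewrite addr_ge0//= /s; clear -dp dd4; nra.
(* [tau], [sigma] and [p] are the relative perturbations allowed for torsion, eigenvalue and
   perimeter, in terms of the normalised masses of [h] and its gradient. *)
pose tau := (cT + CT' * d) * x.
pose sigma := cL * x + bL * y + CL' * d * s.
pose p := cP * x + y / 2 - CP * d * s.
have TE : torsion (starball h) <= V / (N * n.+2%:R) * (1 + tau).
  apply: (le_trans T); apply: eq_ler; rewrite /tau /cT /CT' aE -!natr1; field.
  by rewrite !gt_eqF//; lra.
have LE : eigenvalue1 (starball h) <= l * (1 + sigma).
  apply: (le_trans L); apply: eq_ler; rewrite /sigma /s /cL /bL /CL' aE bE; field.
  by rewrite !gt_eqF//; lra.
have PE : ((N * V * (1 + p))%:E <= perimeter (starball h))%E.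
  by apply: le_trans P; rewrite lee_fin; apply: eq_ler; rewrite n_1 n_2 /p /s /cP aE bE; field.
have d1' : d <= 1 by clear -dd4; lra.
have /andP[sp _] := sd.
have cb (c z : R) : 0 <= z <= s -> `|c * z| <= `|c| * s.
  by case/andP=> z0 zs; rewrite normrM (ger0_norm z0) ler_wpM2l.
have xs : 0 <= x <= s by rewrite x0 lerDl.
have ys : 0 <= y <= s by rewrite y0 lerDr.
have ds (c z : R) : 0 <= c -> 0 <= z <= s -> `|c * d * z| <= c * s.
  move=> c0 /andP[z0 zs]; rewrite ger0_norm ?mulr_ge0 ?(ltW dp)// -mulrA ler_wpM2l//.
  by apply: le_trans zs; rewrite ler_piMl.
have As : A * s = `|cT| * s + `|cL| * s + `|cP| * s + `|bL| * s + s + CT' * s + CL' * s + CP * s by rewrite /A; ring.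
have nn : [/\ 0 <= `|cT| * s, 0 <= `|cL| * s, 0 <= `|cP| * s & 0 <= `|bL| * s] by split; exact: mulr_ge0.
have nn' : [/\ 0 <= CT' * s, 0 <= CL' * s & 0 <= CP * s] by split; exact: mulr_ge0.
case: nn nn' => p1 p2 p3 p4 [p5 p6 p7].
have tauA : `|tau| <= A * s.
  rewrite /tau mulrDl (le_trans (ler_normD _ _))//.
  have := cb cT _ xs; have := ds _ _ CT'0 xs; rewrite As; clear -p1 p2 p3 p4 p5 p6 p7 sp; lra.
have sigA : `|sigma| <= A * s.
  rewrite /sigma (le_trans (ler_normD _ _))// (le_trans (lerD (ler_normD _ _) (lexx _)))//.
  have := cb cL _ xs; have := cb bL _ ys; have := ds _ s CL'0; rewrite sp lexx As => /(_ isT); clear -p1 p2 p3 p4 p5 p6 p7 sp; lra.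
have pA : `|p| <= A * s.
  rewrite /p (le_trans (ler_normB _ _))// (le_trans (lerD (ler_normD _ _) (lexx _)))//.
  have := cb cP _ xs; have := ds _ s CP0; rewrite sp lexx As => /(_ isT).
  rewrite (ger0_norm (_ : 0 <= y / 2)); last (by exact: divr_ge0 y0 (ler0n _ 2)); case/andP: ys; clear -p1 p2 p3 p4 p5 p6 p7 sp; lra.
have neg : tau + sigma - q * p <= (C * d - k) * s.
  have := HK x y x0 xy; rewrite -/q -/s.
  have : CT' * d * x <= CT' * d * s by rewrite ler_wpM2l ?mulr_ge0 ?(ltW dp)//; case/andP: xs.
  rewrite /tau /sigma /p /cT /cL /cP /bL /C /energy_coef; clear; lra.
have [t0 g0 qp0 ks1 PB1] := HB d s tau sigma p (dB _ dd1) sd tauA sigA pA neg.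
suff GE : Gfun (starball h) <= K * (1 - k / 2 * s).
  have KB : K <= Gfun (@unit_ball R n).
    rewrite /K /Gfun PB /= ler_wpM2r ?invr_ge0 ?powR_ge0//.
    by apply: ler_pM; [exact: ltW|exact: ltW|exact: torsion_ball_ge|].
  apply: (le_trans _ KB); apply: (le_trans (lerD GE (lexx _))); apply: eq_ler.
  by rewrite /s /x /y; field; rewrite gt_eqF.
have G0 : 0 <= K * (1 - k / 2 * s) by rewrite mulr_ge0 ?(ltW K0)// subr_ge0 ltW.
case PP : (perimeter (starball h)) PE => [r| |] PE.
- rewrite lee_fin in PE; have q1 : 1 <= q by rewrite ler_pdivlMr; clear -N2; lra.
  have p1' : -1 <= p by clear -q1 qp0; have [|] := lerP 0 p; [lra|nra].
  have p10 : 0 <= 1 + p by clear -p1'; lra.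
  (* Bernoulli's inequality bounds the power of the perimeter from below by its linearisation, the
     favourable direction for a denominator. *)
  have B : (N * V) `^ q * (1 + q * p) <= r `^ q.
    apply: (@le_trans _ _ ((N * V * (1 + p)) `^ q)).
      by rewrite (@powRM _ (N * V)) ?(ltW NV)// ler_wpM2l ?powR_ge0 ?bernoulli_powR.
    have P0 : 0 <= N * V * (1 + p) by rewrite mulr_ge0 ?(ltW NV).
    by apply: (ge0_ler_powR (ltW q0) _ _ PE); rewrite nnegrE// (le_trans P0).
  have rq : 0 < r `^ q by apply: lt_le_trans B; rewrite mulr_gt0 ?powR_gt0.
  rewrite /Gfun PP /= ler_pdivrMr//.
  have T0 : 0 <= torsion (starball h) by exact: torsion_ge0.
  have E0 : 0 <= eigenvalue1 (starball h) by exact: eigenvalue1_ge0.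
  apply: (le_trans (ler_pM T0 E0 TE LE)); apply: le_trans (ler_wpM2l G0 B).
  set T1 := V / (N * n.+2%:R) in K0 G0 T10 *.
  have -> : K * (1 - k / 2 * s) * ((N * V) `^ q * (1 + q * p)) = T1 * l * ((1 + q * p) * (1 - k / 2 * s)).
    have z0 : (N * V) `^ q != 0 by rewrite gt_eqF// powR_gt0.
    by rewrite /K -/T1; move: z0; move: (_ `^ _) (T1) (1 + q * p) (k / 2 * s); clear=> z T c u z0; field.
  by rewrite mulrACA ler_wpM2l// mulr_ge0 ?(ltW T10) ?(ltW l0).
(* An infinite perimeter is sent to 0 by [fine], and a quotient by 0 is 0, so the bound holds
   trivially. *)
- by rewrite /Gfun PP /= powR0 ?gt_eqF// invr0 mulr0.
- by move: PE; rewrite leeNy_eq.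
Qed.

End stability.

Theorem theorem1p5 (R : realType) (m : nat) :
  (2 <= m)%N ->
  exists C : R -> R, (forall delta : R, 0 < delta -> 0 < C delta) /\
  forall gamma : R, 0 < gamma < 1 ->
  exists delta : R, 0 < delta /\
  forall h : 'rV[R]_m -> R,
    nearly_spherical delta gamma h ->
    (exists y, unit_sphere y /\ h y <> 0) ->
    Gfun (@unit_ball R m) - Gfun (starball h) > C delta * H1_norm h ^+ 2.
Proof.
move=> m1; have [c0 [d0 [c00 d00 H]]] := @stability R m m1.
have [k k0 S] := @sphere_integral_scont R m m1.
(* The factor [k] between the Hausdorff integral and [sA] is divided out; half of [c0] is given up
   for the strict inequality. *)
exists (fun=> c0 / (2 * k)); split=> [_ _|gamma _]; first by rewrite divr_gt0// mulr_gt0.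
have m0 : 0 < m%:R :> R by rewrite ltr0n ltnW.
(* The tangential gradient is at most the sum of its [m] components, each bounded by the norm. *)
exists (d0 / m%:R); split=> [|h [[sh2 _] _ h0 h1 hD] [y [y1 hy]]]; first by rewrite divr_gt0.
have sg := sphere_C1_sgrad sh2.1; have sh := sgrad_scont sg.
have ah : admissible d0 h.
  split=> //.
  - move=> z /(C2gamma_norm_bounds hD)[/le_trans + _]; apply.
    by rewrite ler_pdivrMr// ler_peMr ?(ltW d00)// ler1n ltnW.
  - move=> z /(C2gamma_norm_bounds hD)[_ hz]; apply: (le_trans (enorm_le_sum _)).
    apply: (@le_trans _ _ (\sum_(i < m) d0 / m%:R)).
      by apply: ler_sum => i _; rewrite mxE.
    by rewrite sumr_const card_ord -[X in X <= _]mulr_natr divfK// gt_eqF.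
  - by move: h0; rewrite S// => /eqP; rewrite mulf_eq0 gt_eqF//= => /eqP.
  - move=> i; move: (h1 i); rewrite S; last by apply: scontM => //; exact: scont_coord.
    by move=> /eqP; rewrite mulf_eq0 gt_eqF//= => /eqP.
have sg2 := scont_grad2 ah; have s2 : scont (fun z => h z ^+ 2) by exact: scontX.
(* A continuous function that is nonzero at one point of the sphere has positive mass; this makes
   the final inequality strict. *)
have a0 : 0 < L2mass h.
  by apply: (sA_gt0 s2 _ y1) => [z _|]; rewrite ?sqr_ge0// exprn_even_gt0//=; apply/eqP.
have b0 : 0 <= gradmass h by apply: sA_ge0 => z _; exact: dotxx_ge0.
have -> : H1_norm h ^+ 2 = k * (L2mass h + gradmass h).
  rewrite /H1_norm (_ : (fun z => _) = (fun z => h z ^+ 2 + dot (tgrad h z) (tgrad h z))).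
    by rewrite S; [rewrite sAD// sqr_sqrtr// mulr_ge0 ?(ltW k0)// addr_ge0// ltW|exact: scontD].
  by apply/funext => z; rewrite enorm_sqr.
have dd : 0 < d0 <= d0 by rewrite d00/=.
rewrite ltrBrDl; apply: lt_le_trans (H d0 h dd ah).
rewrite ltrD2l mulrA (_ : c0 / (2 * k) * k = c0 / 2); last by field; rewrite gt_eqF.
by rewrite ltr_pM2r; [lra|rewrite ltr_wpDr].
Qed.
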